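(* Let $\Omega\subset\mathbb{R}^3$ be a domain and let $\mathcal{T}_h$ be a conforming, shape regular tetrahedrization of $\Omega$ with mesh parameter $h\in(0,h_0]$, such that every $T\in\mathcal{T}_h$ has at least three internal edges. Let $W_h$ be the nonconforming rotated $Q_1$ velocity space and $Q_h$ the space of continuous piecewise linear pressures with zero mean. Then there is a constant $C>0$, independent of the mesh parameter $h$, such that for all $q\in Q_h$ $$\|q\|_{L^2(\Omega)}+h\|\nabla q\|_{L^2(\Omega)}\le C\sup_{\boldsymbol v\in W_h\setminus\{\boldsymbol 0\}}\frac{b(\boldsymbol v,q)}{\|\boldsymbol v\|_{a_h}} .$$
   Context: Mesh: $\mathcal{T}_h$ is a conforming, shape regular tetrahedrization of $\Omega$ with mesh parameter $h\in(0,h_0]$. An edge is internal (interior) if it is not contained in $\partial\Omega$. Element: $\hat T$ is the reference tetrahedron inscribed in the cube $[-1,1]^3$ whose edges are diagonals of the faces of the cube (e.g. with vertices $(1,1,1),(1,-1,-1),(-1,1,-1),(-1,-1,1)$), so that its edge midpoints are the face midpoints $\pm\boldsymbol e_i$ of the cube. The local space is $V(\hat T)=\mathrm{span}(1,x_1,x_2,x_3,x_1^2-x_2^2,x_2^2-x_3^2)$; functions in it are uniquely determined by their values at the six edge midpoints. For $T\in\mathcal{T}_h$, $F_T:\hat T\to T$ is an affine bijection. Spaces: $V_h=\{v\in L^2(\Omega): v|_T\circ F_T\in V(\hat T)\ \forall T\in\mathcal{T}_h,\ v \text{ is continuous at the midpoints of all interior edges}\}$; $W_h=\{\boldsymbol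 v\in[V_h]^3:\boldsymbol v=\boldsymbol 0\text{ at the midpoints of all edges on }\partial\Omega\}$; $Q_h=\{q\in C^0(\Omega)\cap L^2(\Omega): \int_\Omega q=0,\ q|_T\text{ is linear (affine) for all }T\in\mathcal{T}_h\}$. Forms and norms: $a_h(\boldsymbol v,\boldsymbol w)=\sum_{T\in\mathcal{T}_h}(\nabla\boldsymbol v,\nabla\boldsymbol w)_T$, $\|\boldsymbol v\|_{a_h}=a_h(\boldsymbol v,\boldsymbol v)^{1/2}$, and $$b(\boldsymbol v,q)=\sum_{T\in\mathcal{T}_h}\big[(\nabla\cdot\boldsymbol v,q)_T-(\boldsymbol n\cdot\boldsymbol v,q)_{\partial T}\big]=-\sum_{T\in\mathcal{T}_h}(\boldsymbol v,\nabla q)_T,$$ with $(\cdot,\cdot)_T$, $(\cdot,\cdot)_{\partial T}$ the $L^2$ inner products and $\boldsymbol n$ the outward unit normal to $T$.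
   Formalization: The mesh parameter h is taken comparable to every element's diameter (diam T ≤ h ≤ κ diam T, C depending on κ): for h the maximal diameter of a graded mesh the bound fails for hat functions on small elements. Ω is the interior of the union of the elements. *)

(* Defs.v *)
From HB Require Import structures.
From mathcomp Require Import all_boot all_order all_algebra.
From mathcomp Require Import all_classical all_reals all_analysis.
Set Implicit Arguments.
Unset Strict Implicit.
Unset Printing Implicit Defensive.
Import Order.TTheory GRing.Theory Num.Theory.
Import numFieldNormedType.Exports.
Local Open Scope classical_set_scope.
Local Open Scope ring_scope.

(* The library norm on 'rV[R]_3 is the max norm; it is used only through the
   topology it induces.  All lengths below are Euclidean. *)
Definition dot (R : realType) (u v : 'rV[R]_3) : R := \sum_i u 0 i * v 0 i.
Definition enorm (R : realType) (u : 'rV[R]_3) : R := Num.sqrt (dot u u).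

Definition bd (T : topologicalType) (A : set T) : set T :=
  closure A `\` A°.

Definition domain (R : realType) (Omega : set 'rV[R]_3) : Prop :=
  [/\ open Omega, connected Omega & Omega !=set0].

(* Lebesgue measure on R^3 is available on R * R * R; vec3 transports it to
   row vectors. *)
Definition R3 (R : realType) :=
  (measurableTypeR R * measurableTypeR R * measurableTypeR R)%type.

Definition vec3 (R : realType) (p : R3 R) : 'rV[R]_3 :=
  \row_i [:: p.1.1; p.1.2; p.2]`_i.

Definition leb3 (R : realType) : {measure set (R3 R) -> \bar R} :=
  ((@lebesgue_measure R \x @lebesgue_measure R) \x @lebesgue_measure R)%E.

Definition int3 (R : realType) (D : set 'rV[R]_3) (f : 'rV[R]_3 -> R) : R :=
  \int[@leb3 R]_(p in @vec3 R @^-1` D) f (vec3 p).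

Definition L2 (R : realType) (D : set 'rV[R]_3) (f : 'rV[R]_3 -> R) : Prop :=
  measurable_fun (@vec3 R @^-1` D)
    (f \o @vec3 R : R3 R -> measurableTypeR R) /\
  (@leb3 R).-integrable (@vec3 R @^-1` D) (fun p => (f (vec3 p) ^+ 2)%:E).

Definition grad (R : realType) (f : 'rV[R]_3 -> R) (x : 'rV[R]_3) : 'rV[R]_3 :=
  \row_j 'D_(delta_mx 0 j) f x.

(* Vertices (1,1,1), (1,-1,-1), (-1,1,-1), (-1,-1,1). *)
Definition vhat (R : realType) (k : 'I_4) : 'rV[R]_3 :=
  \row_i (if (k == 0%N :> nat) || (k == i.+1 :> nat) then 1 else -1).

(* The face of the reference tetrahedron spanned by the vertices in s: the
   empty set for s empty, an edge for #|s| = 2, the tetrahedron for #|s| = 4. *)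
Definition hface (R : realType) (s : {set 'I_4}) : set 'rV[R]_3 :=
  [set x | exists l : 'I_4 -> R,
     [/\ forall k, 0 <= l k, forall k, k \notin s -> l k = 0,
         \sum_k l k = 1 & x = \sum_k l k *: @vhat R k]].

Definition That (R : realType) : set 'rV[R]_3 := @hface R [set: 'I_4]%SET.

Definition Vhat (R : realType) (p : 'rV[R]_3 -> R) : Prop :=
  exists c0 c1 c2 c3 c4 c5 : R, forall x : 'rV[R]_3,
    let x1 := x 0 (inord 0) in
    let x2 := x 0 (inord 1) in
    let x3 := x 0 (inord 2) in
    p x = c0 + c1 * x1 + c2 * x2 + c3 * x3
          + c4 * (x1 ^+ 2 - x2 ^+ 2) + c5 * (x2 ^+ 2 - x3 ^+ 2).

(* A tetrahedron T is given by its affine bijection F_T, so quantifying over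
   elements also quantifies over the choice of F_T. *)
Record elem (R : realType) := Elem {
  elem_lin : 'M[R]_3;
  elem_off : 'rV[R]_3;
  elem_unit : elem_lin \in unitmx }.

Definition Fmap (R : realType) (T : elem R) (x : 'rV[R]_3) : 'rV[R]_3 :=
  x *m elem_lin T + elem_off T.

Definition face (R : realType) (T : elem R) (s : {set 'I_4}) : set 'rV[R]_3 :=
  Fmap T @` @hface R s.

Definition cell (R : realType) (T : elem R) : set 'rV[R]_3 := Fmap T @` @That R.

Definition is_edge (e : {set 'I_4}) : bool := #|e| == 2.

Definition midpoint (R : realType) (T : elem R) (e : {set 'I_4}) : 'rV[R]_3 :=
  2^-1 *: \sum_(k in e) Fmap T (@vhat R k).

Definition boundary_edge (R : realType) (Omega : set 'rV[R]_3) (T : elem R)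
    (e : {set 'I_4}) : Prop := face T e `<=` bd Omega.

Definition internal_edges (R : realType) (Omega : set 'rV[R]_3) (T : elem R)
    : nat :=
  #|[pred e : {set 'I_4} | is_edge e && ~~ `[< boundary_edge Omega T e >]]|.

Definition mesh (R : realType) (N : nat) := 'I_N -> elem R.

(* Omega is the polyhedral domain filled by the mesh; as every element is the
   closure of its interior, closure Omega is then the union of the elements. *)
Definition tetrahedrization (R : realType) (N : nat) (Omega : set 'rV[R]_3)
    (K : mesh R N) : Prop :=
  Omega = (\bigcup_i cell (K i))°.

(* Two distinct elements meet in a common proper face (possibly empty). *)
Definition conforming (R : realType) (N : nat) (K : mesh R N) : Prop :=
  forall i j, i != j -> exists s s' : {set 'I_4},
    [/\ (#|s| < 4)%N, cell (K i) `&` cell (K j) = face (K i) s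
      & cell (K i) `&` cell (K j) = face (K j) s'].

Definition diam (R : realType) (A : set 'rV[R]_3) : R :=
  sup [set enorm (x - y) | x in A & y in A].

(* Diameter of the largest ball contained in A. *)
Definition indiam (R : realType) (A : set 'rV[R]_3) : R :=
  sup [set d | exists c, forall x, enorm (x - c) <= d / 2 -> A x].

Definition shape_regular (R : realType) (N : nat) (sigma : R) (K : mesh R N)
    : Prop :=
  forall i, diam (cell (K i)) <= sigma * indiam (cell (K i)).

(* The single number h measures the size of every element, up to kappa. *)
Definition mesh_parameter (R : realType) (N : nat) (kappa h : R) (K : mesh R N)
    : Prop :=
  forall i, diam (cell (K i)) <= h <= kappa * diam (cell (K i)).

Section spaces.
Context (R : realType) (N : nat) (Omega : set 'rV[R]_3) (K : mesh R N).

(* A member of V_h is a representative of an L^2 class: its values on the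
   faces, a null set, are constrained only by continuity at edge midpoints. *)
Definition Vh (v : 'rV[R]_3 -> R) : Prop :=
  [/\ L2 Omega v,
      forall i, exists2 p, Vhat p &
        forall x, (@That R)° x -> v (Fmap (K i) x) = p x
    & forall i e, is_edge e -> ~ boundary_edge Omega (K i) e ->
        {for midpoint (K i) e, continuous v}].

(* At a boundary edge, the value of v is its limit from inside Omega. *)
Definition Wh (v : 'rV[R]_3 -> 'rV[R]_3) : Prop :=
  (forall j, Vh (fun x => v x 0 j)) /\
  (forall i e, is_edge e -> boundary_edge Omega (K i) e ->
     v @ within Omega (nbhs (midpoint (K i) e)) --> (0 : 'rV[R]_3)).

Definition Qh (q : 'rV[R]_3 -> R) : Prop :=
  [/\ forall x, Omega x -> {for x, continuous q},
      L2 Omega q,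
      int3 Omega q = 0
    & forall i, exists (c : R) (g : 'rV[R]_3),
        forall x, (cell (K i))° x -> q x = c + dot g x].

Definition ah (v w : 'rV[R]_3 -> 'rV[R]_3) : R :=
  \sum_i int3 (cell (K i))° (fun x =>
    \sum_j dot (grad (fun y => v y 0 j) x) (grad (fun y => w y 0 j) x)).

Definition norm_ah (v : 'rV[R]_3 -> 'rV[R]_3) : R := Num.sqrt (ah v v).

(* Elementwise integration by parts turns this into
   sum_T [(div v, q)_T - (n . v, q)_(bd T)]. *)
Definition bh (v : 'rV[R]_3 -> 'rV[R]_3) (q : 'rV[R]_3 -> R) : R :=
  - \sum_i int3 (cell (K i))° (fun x => dot (v x) (grad q x)).

Definition normL2 (q : 'rV[R]_3 -> R) : R :=
  Num.sqrt (int3 Omega (fun x => q x ^+ 2)).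

Definition normL2v (v : 'rV[R]_3 -> 'rV[R]_3) : R :=
  Num.sqrt (int3 Omega (fun x => dot (v x) (v x))).

(* For q continuous and piecewise affine the weak gradient is the elementwise
   one, and the faces are null. *)
Definition normL2_grad (q : 'rV[R]_3 -> R) : R :=
  Num.sqrt (\sum_i int3 (cell (K i))° (fun x => dot (grad q x) (grad q x))).

(* v <> 0 as an element of L^2. *)
Definition Wh_nz (v : 'rV[R]_3 -> 'rV[R]_3) : Prop := Wh v /\ normL2v v != 0.

End spaces.

(* Main.v *)
Require Import Defs.
From HB Require Import structures.
From mathcomp Require Import all_boot all_order all_algebra.
From mathcomp Require Import ring lra zify.
Set Implicit Arguments.
Unset Strict Implicit.
Unset Printing Implicit Defensive.
Import Order.TTheory GRing.Theory Num.Theory.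
Local Open Scope ring_scope.

(* Let S be the supremum.  The nodal velocity whose value at the midpoint of an
   internal edge is minus the derivative of q along the edge times the edge
   vector shows that the derivatives of q along internal edges are bounded by S.
   They control the gradient of q on every element.  Indeed, either the internal
   edges of the element connect its vertices, or they form a triangle; the
   remaining vertex is then reached through a chain of face neighbours having
   this vertex, one of which has an internal edge there, for otherwise these
   elements would fill a neighbourhood of a boundary point.

   For q itself, fix one mesh of Omega and cover Omega by finitely many
   parallelepipeds depending only on this mesh.  On each of them, lattice
   functions of mesh width comparable to h define nodal velocities, and
   integration by parts bounds the lattice gradient of q in a negative norm by
   S, up to errors controlled by the gradient of q.  A discrete Necas inequality
   (lattice Dirichlet problem, weighted Caccioppoli estimate, Hardy inequality
   along the diagonal of the cube) then bounds q minus a constant on a corner of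
   the parallelepiped.  Since Omega is connected, the constants of all corners
   differ by at most a multiple of S, and the mean of q vanishes. *)

(** * Finite differences on a periodic lattice *)

(** [Omega] is only a connected polyhedron, not necessarily Lipschitz, and one constant must serve
    all its meshes. The bound for [q] is therefore built from pieces that are cut out of a single
    mesh and then used for every other one. The pieces must lie inside [Omega], yet their estimates
    must reach its boundary. This is why the discrete estimate is wanted on a corner of a cube, up
    to three of its faces: octants of small parallelepipeds then cover closed tetrahedra. Interior
    regularity of harmonic lattice functions controls the gradient only with the distance to the
    faces as a weight; Hardy's inequality along the diagonal removes this loss. The gradient bound
    has to come first, because every passage between lattice and mesh (quadrature, sampling of [q]
    at lattice points, oscillation on lattice cells) costs a multiple of [h] times the gradient, and
    these costs are of the order of [S]. The lattice is a torus, where summation by parts has no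
    boundary terms; boundary conditions are expressed by the supports of functions. *)

Section PeriodicLattice.
Context (R : realFieldType) (G : finZmodType) (e : 'I_3 -> G).
Implicit Types (f g u w : G -> R) (i j : 'I_3) (x : G).

Definition fdiff j f x := f (x + e j) - f x.
Definition bdiff j f x := f x - f (x - e j).
Definition lap f x := \sum_j bdiff j (fdiff j f) x.
Definition sqsum f := \sum_x f x ^+ 2.

Lemma sum_shift f a : \sum_x f (x + a) = \sum_x f x.
Proof. by rewrite [RHS](reindex_inj (addIr a)). Qed.

Lemma sqsum_ge0 f : 0 <= sqsum f.
Proof. by apply: sumr_ge0 => x _; exact: sqr_ge0. Qed.

(** A shift permutes the finite group, so no boundary terms arise. *)
Lemma sum_by_parts j f g :
  \sum_x f x * bdiff j g x = - \sum_x fdiff j f x * g x.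
Proof.
rewrite /bdiff /fdiff.
under eq_bigr do rewrite mulrBr.
rewrite sumrB -(sum_shift (fun x => f x * g (x - e j)) (e j)).
under [X in _ - X]eq_bigr do rewrite addrK.
by rewrite -sumrB -sumrN; apply: eq_bigr => x _; ring.
Qed.

Lemma sqsum_bdiff j f : sqsum (bdiff j f) = sqsum (fdiff j f).
Proof.
rewrite /sqsum -(sum_shift _ (e j)); apply: eq_bigr => x _.
by rewrite /bdiff /fdiff addrK.
Qed.

Lemma fdiffC i j f x : fdiff i (fdiff j f) x = fdiff j (fdiff i f) x.
Proof. by rewrite /fdiff (addrAC x (e i)); ring. Qed.

Lemma lap_bdiff i f x : lap (bdiff i f) x = lap f x - lap f (x - e i).
Proof.
rewrite /lap -sumrB; apply: eq_bigr => j _.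
by rewrite /bdiff /fdiff !(addrAC x (- e i)) !(addrAC _ (- e i)); ring.
Qed.

Lemma lap_fdiff i f x : lap (fdiff i f) x = lap f (x + e i) - lap f x.
Proof.
rewrite /lap -sumrB; apply: eq_bigr => j _.
rewrite /bdiff (fdiffC j i f x) (fdiffC j i f (x - e j)) (addrAC x (e i) (- e j)).
by rewrite /fdiff; ring.
Qed.

Lemma lapD f g x : lap (fun y => f y + g y) x = lap f x + lap g x.
Proof.
by rewrite /lap -big_split; apply: eq_bigr => j _; rewrite /bdiff /fdiff /=; ring.
Qed.

Lemma lap_sum (I : finType) (F : I -> G -> R) x :
  lap (fun y => \sum_i F i y) x = \sum_i lap (F i) x.
Proof.
rewrite /lap exchange_big; apply: eq_bigr => j _.
by rewrite /bdiff /fdiff -!sumrB.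
Qed.

Lemma dirichlet_form f g :
  \sum_x f x * lap g x = - \sum_j \sum_x fdiff j f x * fdiff j g x.
Proof.
under eq_bigr do rewrite mulr_sumr.
rewrite exchange_big -sumrN /=; apply: eq_bigr => j _.
by rewrite sum_by_parts.
Qed.

(** * The discrete Dirichlet problem *)

Section Solve.
Variable D : pred G.

Definition restr f x : R := if D x then f x else 0.

(** The Dirichlet problem as a square linear system: the rows outside [D] are those of the identity
    and prescribe the values there, so solvability reduces to the injectivity of one
    endomorphism. *)
Definition dirop (f : {ffun G -> R^o}) : {ffun G -> R^o} :=
  [ffun x => if D x then lap (restr f) x else f x].

Lemma dirop_is_linear : linear dirop.
Proof.
move=> c f g; apply/ffunP => x; rewrite !ffunE.
case: ifP => // _; rewrite /lap scaler_sumr -big_split; apply: eq_bigr => j _.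
rewrite /bdiff /fdiff /restr /= !ffunE.
by do ! case: ifP => _; rewrite /GRing.scale /=; ring.
Qed.

HB.instance Definition _ := GRing.isLinear.Build R _ _ _ dirop dirop_is_linear.

Hypothesis coercive : forall f, (forall x, ~~ D x -> f x = 0) ->
  (forall j x, fdiff j f x = 0) -> forall x, f x = 0.

(** In finite dimension an injective endomorphism is onto. A kernel element vanishes off [D] and has
    zero Dirichlet energy, hence zero differences, and [coercive] makes it zero. *)
Lemma poisson (F : G -> R) : exists w : G -> R,
  (forall x, ~~ D x -> w x = 0) /\ (forall x, D x -> lap w x = F x).
Proof.
pose L := linfun dirop.
have kerL : lker L == 0%VS.
  apply/eqP/vspaceP => f; rewrite memv_ker memv0 lfunE /=.
  apply/eqP/eqP => [f0|->]; last by rewrite linear0.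
  have fD x : ~~ D x -> f x = 0.
    by move=> nDx; have := congr1 (fun g : {ffun G -> R^o} => g x) f0; rewrite !ffunE (negbTE nDx).
  have rf x : restr f x = f x by rewrite /restr; case: ifP => // /negbT/fD.
  have lf x : D x -> lap f x = 0.
    move=> Dx; have := congr1 (fun g : {ffun G -> R^o} => g x) f0; rewrite !ffunE Dx => <-.
    by apply: eq_bigr => j _; rewrite /bdiff /fdiff !rf.
  have : \sum_j \sum_x fdiff j f x * fdiff j f x = 0.
    apply/eqP; rewrite -oppr_eq0 -dirichlet_form; apply/eqP/big1 => x _.
    by case: (boolP (D x)) => [/lf ->|/fD ->]; rewrite ?mulr0 ?mul0r.
  move=> s0; have d0 j x : fdiff j f x = 0.
    have H : \sum_x fdiff j f x * fdiff j f x = 0.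
      move/eqP: s0; rewrite psumr_eq0 => [|k _]; last first.
        by apply: sumr_ge0 => y _; rewrite -expr2 sqr_ge0.
      by move/allP => /(_ j (mem_index_enum j)) /eqP.
    move/eqP: H; rewrite psumr_eq0 => [|y _]; last by rewrite -expr2 sqr_ge0.
    by move/allP => /(_ x (mem_index_enum x)); rewrite -expr2 sqrf_eq0 => /eqP.
  by apply/ffunP => x; rewrite ffunE (coercive fD d0).
have /vspaceP fullL : limg L = fullv by apply/eqP; rewrite lker0_limgf.
have := fullL [ffun x => if D x then F x else 0]; rewrite memvf.
case/memv_imgP => f _ /ffunP fE; exists (restr f); split=> x Dx.
  by rewrite /restr (negbTE Dx).
by have := fE x; rewrite lfunE /= !ffunE Dx => ->.
Qed.

End Solve.
End PeriodicLattice.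

(** Since [b^4 - a^4 = (b - a)(b + a)(b^2 + a^2)], the difference is at most [15 (a^2 + 1)(b + 1)]
    in absolute value. The two terms of [a^2 + 1] undergo Young's inequality separately: the first
    goes into [a^4 D^2 / 2], the second leaves an unweighted multiple of [D^2]. *)
Lemma quartic_weight_diff (R : realFieldType) (a b F D : R) :
  0 <= a -> 0 <= b -> `|b - a| <= 1 ->
  `|F * (b ^+ 4 - a ^+ 4) * D| <=
    a ^+ 4 * D ^+ 2 / 2 + 120 * (b + 1) ^+ 2 * F ^+ 2 + 8 * D ^+ 2.
Proof.
move=> a0 b0 ab.
have H : `|b ^+ 4 - a ^+ 4| <= 15 * (a ^+ 2 + 1) * (b + 1).
  have -> : b ^+ 4 - a ^+ 4 = (b - a) * ((b + a) * (b ^+ 2 + a ^+ 2)) by ring.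
  rewrite normrM (ger0_norm (_ : 0 <= (b + a) * (b ^+ 2 + a ^+ 2))); last first.
    by rewrite mulr_ge0 ?addr_ge0 ?sqr_ge0.
  apply: le_trans (_ : 1 * ((b + a) * (b ^+ 2 + a ^+ 2)) <= _).
    by rewrite ler_wpM2r // mulr_ge0 ?addr_ge0 ?sqr_ge0.
  move: ab; rewrite ler_norml => /andP[ab1 ab2]; rewrite mul1r.
  have h1 : b ^+ 2 + a ^+ 2 <= 5 * (a ^+ 2 + 1).
    have : b ^+ 2 <= (a + 1) ^+ 2 by rewrite lerXn2r ?nnegrE //; lra.
    have := sqr_ge0 (a - 1); nra.
  have h2 : b + a <= 3 * (b + 1) by lra.
  apply: le_trans (_ : 3 * (b + 1) * (5 * (a ^+ 2 + 1)) <= _); last first.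
    by rewrite le_eqVlt; apply/orP; left; apply/eqP; ring.
  by apply: ler_pM => //; rewrite ?addr_ge0 ?sqr_ge0.
rewrite -mulrA (mulrC _ D) mulrA normrM.
apply: le_trans (ler_wpM2l (normr_ge0 _) H) _.
rewrite normrM.
have FF : F ^+ 2 = `|F| ^+ 2 by rewrite -normrX ger0_norm ?sqr_ge0.
have DD : D ^+ 2 = `|D| ^+ 2 by rewrite -normrX ger0_norm ?sqr_ge0.
rewrite FF DD; move: `|F| `|D| (normr_ge0 F) (normr_ge0 D) => f d f0 d0.
have := sqr_ge0 (a ^+ 2 * d - 15 * (b + 1) * f).
have := sqr_ge0 (d - (b + 1) * f).
have := sqr_ge0 ((b + 1) * f).
rewrite !sqrrB !exprMn; nra.
Qed.

(** * Weighted estimates for harmonic lattice functions *)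

Section WeightedEstimate.
Context (R : realFieldType) (G : finZmodType) (e : 'I_3 -> G).
Implicit Types (i j : 'I_3) (x : G).
Local Notation fdiff := (@fdiff R G e).
Local Notation bdiff := (@bdiff R G e).
Local Notation lap := (@lap R G e).

Variables (D : pred G) (N : pred G) (delta : G -> R).
Hypothesis delta_ge0 : forall x, 0 <= delta x.
Hypothesis delta_lip : forall j x, `|delta (x + e j) - delta x| <= 1.
Hypothesis deltaN : forall j x, (delta x != 0) || (delta (x + e j) != 0) ->
  N x && N (x + e j).

(** Testing harmonicity with [delta^4 f] leaves the differences of the weight, and half of the left
    side is absorbed. The weight may jump from 0 to 1 between neighbours, so unweighted terms
    survive; they live on [N]. *)
Lemma caccioppoli (f : G -> R) :
  (forall x, delta x != 0 -> lap f x = 0) ->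
  \sum_j \sum_x delta x ^+ 4 * fdiff j f x ^+ 2 <=
    1440 * (\sum_x delta x ^+ 2 * f x ^+ 2) + 2100 * \sum_(x | N x) f x ^+ 2.
Proof.
move=> fharm; set X := (X in X <= _); set Y := \sum_x _; set B := \sum_(x | N x) _.
have E : X = - \sum_j \sum_x f (x + e j) * (delta (x + e j) ^+ 4 - delta x ^+ 4) * fdiff j f x.
  apply/eqP; rewrite -subr_eq0 opprK; apply/eqP.
  transitivity (- \sum_x delta x ^+ 4 * f x * lap f x); last first.
    rewrite big1 ?oppr0 // => x _; case: (eqVneq (delta x) 0) => [->|/fharm ->].
      by rewrite expr0n /= !mul0r.
    by rewrite mulr0.
  under [X in _ = - X]eq_bigr do rewrite mulr_sumr.
  rewrite /X [in RHS]exchange_big /= -big_split -[RHS]sumrN /=; apply: eq_bigr => j _.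
  rewrite (@sum_by_parts _ _ _ j (fun x => delta x ^+ 4 * f x)) opprK -big_split /=.
  by apply: eq_bigr => x _; rewrite /fdiff; ring.
have pt j x : `|f (x + e j) * (delta (x + e j) ^+ 4 - delta x ^+ 4) * fdiff j f x| <=
   delta x ^+ 4 * fdiff j f x ^+ 2 / 2 + 240 * (delta (x + e j) ^+ 2 * f (x + e j) ^+ 2)
   + 256 * (if N (x + e j) then f (x + e j) ^+ 2 else 0) + 16 * (if N x then f x ^+ 2 else 0).
  case: (boolP ((delta x != 0) || (delta (x + e j) != 0))) => [h|]; last first.
    rewrite negb_or !negbK => /andP[/eqP -> /eqP ->].
    rewrite subrr mulr0 mul0r normr0 !expr0n /= !mul0r !mulr0 !add0r.
    by apply: addr_ge0; apply: mulr_ge0 => //; case: ifP => // _; exact: sqr_ge0.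
  have /andP[-> ->] := deltaN h.
  apply: le_trans (quartic_weight_diff _ _ (delta_ge0 x) (delta_ge0 _) (delta_lip j x)) _.
  rewrite /fdiff; move: (f (x + e j)) (f x) => F F0; move: (delta (x + e j)) (delta x) => b a.
  rewrite -!addrA lerD2l -subr_ge0.
  (* These squares are the defects in [(b + 1)^2 <= 2 b^2 + 2] and [(F - F0)^2 <= 2 F^2 + 2 F0^2];
     hence 240 and 256 = 240 + 16. *)
  apply: le_trans (_ : 0 <= 120 * ((b - 1) * F) ^+ 2 + 8 * (F + F0) ^+ 2) _.
    by rewrite addr_ge0 // mulr_ge0 // sqr_ge0.
  by rewrite le_eqVlt; apply/orP; left; apply/eqP; ring.
have le1 : X <= X / 2 + 720 * Y + 768 * B + 48 * B.
  rewrite {1}E -sumrN.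
  apply: le_trans (_ : \sum_j ((\sum_x delta x ^+ 4 * fdiff j f x ^+ 2) / 2 + 240 * Y + 256 * B + 16 * B) <= _).
    apply: ler_sum => j _; rewrite -sumrN.
    apply: le_trans (_ : \sum_x (delta x ^+ 4 * fdiff j f x ^+ 2 / 2 + 240 * (delta (x + e j) ^+ 2 * f (x + e j) ^+ 2)
   + 256 * (if N (x + e j) then f (x + e j) ^+ 2 else 0) + 16 * (if N x then f x ^+ 2 else 0)) <= _).
      by apply: ler_sum => x _; apply: le_trans (pt j x); rewrite -normrN ler_norm.
    rewrite !big_split /= -!mulr_sumr -mulr_suml.
    rewrite (sum_shift (fun x => delta x ^+ 2 * f x ^+ 2)).
    by rewrite (sum_shift (fun x => if N x then f x ^+ 2 else 0)) /= -big_mkcond.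
  rewrite !big_split /= !sumr_const !card_ord -mulr_suml -/X.
  by rewrite le_eqVlt; apply/orP; left; apply/eqP; ring.
have B0 : 0 <= B by apply: sumr_ge0 => x _; exact: sqr_ge0.
lra.
Qed.

Variables (u : G -> R) (W : 'I_3 -> G -> R).
Hypothesis WE : forall i x, D x -> lap (W i) x = - fdiff i u x.

(** [u = harm - divW] splits [u] into a part that is harmonic inside and a divergence bounded by the
    energy of [W]. *)
Definition divW x := \sum_i bdiff i (W i) x.
Definition harm x := u x + divW x.

(** [lap] commutes with [bdiff], and [bdiff i (fdiff i u)] summed over [i] is [lap u], so everything
    cancels. The equation for [W i] is used at [x] and at [x - e i]. *)
Lemma lap_harm x : D x -> (forall j, D (x - e j)) -> lap harm x = 0.
Proof.
move=> Dx Dxj; rewrite /harm lapD /divW lap_sum {1}/lap -big_split big1 // => i _.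
by rewrite /= lap_bdiff !WE // /bdiff; ring.
Qed.

Hypothesis deltaD : forall x, delta x != 0 ->
  [/\ D x, forall j, D (x - e j), forall i, D (x + e i) & forall i j, D (x + e i - e j)].

Definition energyW := \sum_i \sum_j sqsum (fdiff j (W i)).

Lemma sqsum_divW : sqsum divW <= 3 * energyW.
Proof.
apply: le_trans (_ : \sum_i 3 * sqsum (fdiff i (W i)) <= _).
  rewrite -mulr_sumr.
  under eq_bigr do rewrite -sqsum_bdiff.
  rewrite /sqsum exchange_big /= mulr_sumr; apply: ler_sum => x _.
  rewrite /divW !big_ord_recl !big_ord0 !addr0; move: (bdiff _ _ _) (bdiff _ _ _) (bdiff _ _ _) => a b c.
  have := sqr_ge0 (a - b); have := sqr_ge0 (a - c); have := sqr_ge0 (b - c); nra.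
rewrite -mulr_sumr ler_wpM2l //; apply: ler_sum => i _.
by rewrite (bigD1 i) //= lerDl sumr_ge0 // => j _; exact: sqsum_ge0.
Qed.

Lemma young (I : finType) (F H : I -> R) (t : R) : 0 < t ->
  \sum_x F x * H x <= t / 2 * (\sum_x F x ^+ 2) + t^-1 / 2 * \sum_x H x ^+ 2.
Proof.
move=> t0; rewrite !mulr_sumr -big_split /=; apply: ler_sum => x _.
rewrite -subr_ge0.
have -> : t / 2 * F x ^+ 2 + t^-1 / 2 * H x ^+ 2 - F x * H x =
    t / 2 * (F x - t^-1 * H x) ^+ 2 by field; lra.
by rewrite mulr_ge0 ?sqr_ge0 // divr_ge0 // ltW.
Qed.

(** With [f = fdiff i harm], the equation for [W i] gives [f = - lap (W i) + fdiff i divW]. Testing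
    with [delta^2 f] and summing by parts pairs first differences of [delta^2 f] with quantities
    bounded by the energy. As [f] is harmonic too, [caccioppoli] controls these differences, and a
    small Young parameter absorbs them. *)
Lemma weighted_gradient i :
  \sum_x delta x ^+ 2 * fdiff i harm x ^+ 2 <=
    4 * (\sum_(x | N x) fdiff i harm x ^+ 2) + (600 * 100) * energyW.
Proof.
pose f := fdiff i harm.
have fharm x : delta x != 0 -> lap f x = 0.
  move=> /deltaD[D1 D2 D3 D4]; rewrite lap_fdiff !lap_harm ?subrr //.
have := caccioppoli fharm; set X := (X in X <= _); set Y := \sum_x _; set B := \sum_(x | N x) _ => XYB.
rewrite -/f -/Y -/B.
pose g x := delta x ^+ 2 * f x.
have Yg : Y = \sum_j (\sum_x fdiff j g x * fdiff j (W i) x) - \sum_x bdiff i g x * divW x.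
  have -> : Y = \sum_x g x * (- lap (W i) x + fdiff i divW x).
    apply: eq_bigr => x _; rewrite /g; case: (eqVneq (delta x) 0) => [->|/deltaD[Dx _ _ _]].
      by rewrite expr0n /= !mul0r.
    have fE : f x = fdiff i u x + fdiff i divW x by rewrite /f /harm /fdiff; ring.
    by rewrite WE // opprK -fE expr2 mulrA.
  under eq_bigr do rewrite mulrDr mulrN.
  rewrite big_split /= sumrN dirichlet_form opprK; congr (_ + _).
  under eq_bigr do rewrite mulrC.
  under [in RHS]eq_bigr do rewrite mulrC.
  by rewrite sum_by_parts opprK.
have gB j : sqsum (fdiff j g) <= 2 * (\sum_x delta x ^+ 4 * fdiff j f x ^+ 2) + 16 * Y + 4 * B.
  rewrite /sqsum /Y /B -(sum_shift (fun x => delta x ^+ 2 * f x ^+ 2) (e j)).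
  rewrite [X in _ <= _ + 4 * X]big_mkcond /= -(sum_shift (fun x => if N x then f x ^+ 2 else 0) (e j)).
  rewrite !mulr_sumr -!big_split /=; apply: ler_sum => x _; rewrite /g /fdiff.
  case: (boolP ((delta x != 0) || (delta (x + e j) != 0))) => [h|]; last first.
    rewrite negb_or !negbK => /andP[/eqP -> /eqP ->].
    rewrite !expr0n /= !mul0r subr0 expr0n /= !mulr0 !add0r mulr_ge0 //.
    by case: ifP => // _; exact: sqr_ge0.
  have /andP[_ ->] := deltaN h.
  have := delta_lip j x; have := delta_ge0 x; have := delta_ge0 (x + e j).
  move: (f (x + e j)) (f x) => F F0; move: (delta (x + e j)) (delta x) => b a b0 a0.
  rewrite ler_norml => /andP[l1 l2].
  have -> : b ^+ 2 * F - a ^+ 2 * F0 = a ^+ 2 * (F - F0) + (b - a) * (b + a) * F by ring.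
  apply: le_trans (_ : 2 * (a ^+ 2 * (F - F0)) ^+ 2 + 2 * ((b - a) * (b + a) * F) ^+ 2 <= _).
    have := sqr_ge0 (a ^+ 2 * (F - F0) - (b - a) * (b + a) * F); nra.
  rewrite [(a ^+ 2 * _) ^+ 2]exprMn -exprM -addrA lerD2l.
  rewrite !exprMn.
  have h1 : (b - a) ^+ 2 <= 1 by rewrite -real_normK ?num_real // expr_le1 // ler_norml l1.
  have h2 : (b + a) ^+ 2 <= 8 * b ^+ 2 + 2.
    have : (b + a) ^+ 2 <= (2 * b + 1) ^+ 2 by rewrite lerXn2r ?nnegrE; lra.
    have := sqr_ge0 (2 * b - 1); nra.
  have h3 : (b - a) ^+ 2 * (b + a) ^+ 2 <= 1 * (8 * b ^+ 2 + 2) by apply: ler_pM => //; exact: sqr_ge0.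
  have := ler_wpM2r (sqr_ge0 F) h3; nra.
(* The parameter must beat the factor 1440 of [caccioppoli]: the share of [Y] to be absorbed is
   [(4 * 1440 + 64) / 12000], less than one half. *)
have t0 : 0 < (60 * 100)^-1 :> R by lra.
have Y1 : \sum_j (\sum_x fdiff j g x * fdiff j (W i) x) <=
   (60 * 100)^-1 / 2 * (2 * X + 48 * Y + 12 * B) + (30 * 100) * energyW.
  apply: le_trans (_ : \sum_j ((60 * 100)^-1 / 2 * (2 * (\sum_x delta x ^+ 4 * fdiff j f x ^+ 2) + 16 * Y + 4 * B) + (30 * 100) * sqsum (fdiff j (W i))) <= _).
    apply: ler_sum => j _; apply: le_trans (young _ _ t0) _; rewrite invrK.
    apply: lerD; last by rewrite le_eqVlt; apply/orP; left; apply/eqP; rewrite /sqsum; field.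
    by apply: ler_wpM2l; [lra|exact: gB].
  rewrite big_split /= -!mulr_sumr; apply: lerD.
    rewrite !big_split /= -mulr_sumr !sumr_const !card_ord.
    by rewrite le_eqVlt; apply/orP; left; apply/eqP; rewrite /X; field.
  apply: ler_wpM2l; first lra.
  rewrite /energyW [leRHS](bigD1 i) //= lerDl.
  by apply: sumr_ge0 => k _; apply: sumr_ge0 => j _; exact: sqsum_ge0.
have Y2 : - \sum_x bdiff i g x * divW x <= (60 * 100)^-1 / 2 * (2 * X + 16 * Y + 4 * B) + (90 * 100) * energyW.
  rewrite -sumrN; under eq_bigr do rewrite -mulrN.
  apply: le_trans (young _ _ t0) _; rewrite invrK; apply: lerD.
    apply: ler_wpM2l; first lra.
    rewrite -/(sqsum (bdiff i g)) sqsum_bdiff.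
    apply: le_trans (gB i) _; rewrite lerD2r lerD2r ler_wpM2l // /X [leRHS](bigD1 i) //= lerDl.
    by apply: sumr_ge0 => k _; apply: sumr_ge0 => x _; rewrite mulr_ge0 ?sqr_ge0 // exprn_ge0.
  have -> : \sum_x (- divW x) ^+ 2 = sqsum divW by apply: eq_bigr => x _; rewrite sqrrN.
  have := sqsum_divW; lra.
have B0 : 0 <= B by apply: sumr_ge0 => x _; exact: sqr_ge0.
have E0 : 0 <= energyW by apply: sumr_ge0 => k _; apply: sumr_ge0 => j _; exact: sqsum_ge0.
have Y0 : 0 <= Y by apply: sumr_ge0 => x _; rewrite mulr_ge0 ?sqr_ge0.
lra.
Qed.

End WeightedEstimate.

(** * Poincare and Hardy inequalities on lattice cubes *)

Section Corner.
Context (R : realFieldType).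
Implicit Types (F : nat -> nat -> nat -> R) (f : nat -> R) (g : nat -> nat -> nat -> R).

Definition sum3 n g : R := \sum_(a < n) \sum_(b < n) \sum_(c < n) g a b c.

Lemma sum3_le n g g' :
  (forall a b c, (a < n)%N -> (b < n)%N -> (c < n)%N -> g a b c <= g' a b c) ->
  sum3 n g <= sum3 n g'.
Proof. by move=> H; do 3! (apply: ler_sum => ? _); exact: H. Qed.

Lemma eq_sum3 n g g' :
  (forall a b c, (a < n)%N -> (b < n)%N -> (c < n)%N -> g a b c = g' a b c) ->
  sum3 n g = sum3 n g'.
Proof. by move=> H; do 3! (apply: eq_bigr => ? _); exact: H. Qed.

Lemma sum3_ge0 n g : (forall a b c, 0 <= g a b c) -> 0 <= sum3 n g.
Proof. by move=> H; do 3! (apply: sumr_ge0 => ? _). Qed.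

Lemma sum3D n g g' : sum3 n (fun a b c => g a b c + g' a b c) = sum3 n g + sum3 n g'.
Proof.
rewrite /sum3 -big_split; apply: eq_bigr => a _ /=.
by rewrite -big_split; apply: eq_bigr => b _ /=; rewrite -big_split.
Qed.

Lemma sum3Z n k g : sum3 n (fun a b c => k * g a b c) = k * sum3 n g.
Proof.
rewrite /sum3 mulr_sumr; apply: eq_bigr => a _.
by rewrite mulr_sumr; apply: eq_bigr => b _; rewrite mulr_sumr.
Qed.

Lemma sum1_sub m n J f : (forall a, 0 <= f a) -> (m + J <= n)%N ->
  \sum_(a < m) f (a + J)%N <= \sum_(a < n) f a.
Proof.
move=> f0 mJn; rewrite -(subnKC mJn) big_split_ord /= addnC.
rewrite big_split_ord /=.
under eq_bigr do rewrite addnC.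
rewrite -[leLHS]addr0 -[leLHS]add0r addrA.
by rewrite lerD // ?lerD // sumr_ge0.
Qed.

Lemma sum3_sub m n J g : (forall a b c, 0 <= g a b c) -> (m + J <= n)%N ->
  sum3 m (fun a b c => g (a + J)%N (b + J)%N (c + J)%N) <= sum3 n g.
Proof.
move=> g0 mJn.
pose h2 a := \sum_(b < n) \sum_(c < n) g a b c.
apply: le_trans (_ : \sum_(a < m) h2 (a + J)%N <= _); last first.
  by apply: sum1_sub => // a; do 2! apply: sumr_ge0 => ? _.
apply: ler_sum => a _; pose h1 b := \sum_(c < n) g (a + J)%N b c.
apply: le_trans (_ : \sum_(b < m) h1 (b + J)%N <= _); last first.
  by apply: sum1_sub => // b; apply: sumr_ge0 => ? _.
by apply: ler_sum => b _; apply: sum1_sub.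
Qed.

Lemma sum3_shift1 n g :
  (forall a b c, (a == 0)%N || (b == 0)%N || (c == 0)%N -> g a b c = 0) ->
  sum3 n.+1 g = sum3 n (fun a b c => g a.+1 b.+1 c.+1).
Proof.
move=> g0; rewrite /sum3 big_ord_recl big1 ?add0r; last first.
  by move=> b _; apply: big1 => c _; rewrite g0.
apply: eq_bigr => a _; rewrite big_ord_recl big1 ?add0r; last first.
  by move=> b _; rewrite g0 // orbT.
by apply: eq_bigr => b _; rewrite big_ord_recl g0 ?orbT // add0r.
Qed.

Lemma sum3_recr n g :
  (forall a b c, (a <= n)%N -> (b <= n)%N -> (c <= n)%N ->
     (a == n)%N || (b == n)%N || (c == n)%N -> g a b c = 0) ->
  sum3 n.+1 g = sum3 n g.
Proof.
move=> g0; rewrite /sum3 big_ord_recr /= [X in _ + X]big1 ?addr0; last first.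
  by move=> b _; apply: big1 => c _; rewrite g0 ?leq_ord ?eqxx.
apply: eq_bigr => a _; have la : (a <= n)%N by rewrite ltnW.
rewrite big_ord_recr /= [X in _ + X]big1 ?addr0; last first.
  by move=> b _; rewrite g0 ?leq_ord ?eqxx ?orbT.
apply: eq_bigr => b _; have lb : (b <= n)%N by rewrite ltnW.
by rewrite big_ord_recr /= [X in _ + X]g0 ?addr0 ?eqxx ?orbT.
Qed.

Lemma poincare1 (M : nat) f a a' : (a <= M)%N -> (a' <= M)%N ->
  (f a - f a') ^+ 2 <= M%:R * \sum_(t < M) (f t.+1 - f t) ^+ 2.
Proof.
wlog le : a a' / (a <= a')%N => [H aM a'M|aM a'M].
  have [/H ->//|/ltnW /H h] := leqP a a'.
  by rewrite -sqrrN opprB h.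
have -> : f a - f a' = - \sum_(a <= t < a') (f t.+1 - f t).
  by rewrite telescope_sumr // opprB.
rewrite sqrrN.
have cs (s : seq nat) (d : nat -> R) :
    (\sum_(t <- s) d t) ^+ 2 <= (size s)%:R * \sum_(t <- s) d t ^+ 2.
  elim: s => [|t s IH]; first by rewrite !big_nil expr0n mul0r.
  rewrite !big_cons /= -natr1.
  set A := \sum_(_ <- _) d _ in IH *; set B := \sum_(_ <- _) _ in IH *.
  case: (posnP (size s)) => [s0|sp].
    have /size0nil sn := s0; rewrite s0 /A /B sn !big_nil; lra.
  set k := (size s)%:R in IH *; have k0 : 0 < k by rewrite ltr0n.
  have : 2 * d t * A <= k * d t ^+ 2 + B.
    rewrite -(ler_pM2l k0).
    have := sqr_ge0 (k * d t - A); nra.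
  nra.
apply: le_trans (cs _ _) _; rewrite size_iota.
apply: ler_pM.
- exact: ler0n.
- by apply: sumr_ge0 => t _; exact: sqr_ge0.
- by rewrite ler_nat; lia.
rewrite -(big_mkord xpredT (fun t => (f t.+1 - f t) ^+ 2)).
rewrite (big_cat_nat_idem _ (leq0n a) aM) /=; last by rewrite addr0.
rewrite (big_cat_nat_idem _ le a'M) /=; last by rewrite addr0.
rewrite -[leLHS]addr0 -[leLHS]add0r lerD ?lerD // sumr_ge0 // => t _; exact: sqr_ge0.
Qed.

Definition stepsq F a b c : R :=
  (F a.+1 b c - F a b c) ^+ 2 + (F a b.+1 c - F a b c) ^+ 2
  + (F a b c.+1 - F a b c) ^+ 2.

Lemma stepsq_ge0 F a b c : 0 <= stepsq F a b c.
Proof. by rewrite /stepsq !addr_ge0 ?sqr_ge0. Qed.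

Lemma sum_const3 n (k : R) : sum3 n (fun _ _ _ => k) = n%:R ^+ 3 * k.
Proof.
by rewrite /sum3 !sumr_const !card_ord; ring.
Qed.

(** The constant is the value of [F] at a suitable lattice point. Joining any two points by three
    axis-parallel segments bounds the double sum over pairs, and some point does not exceed the
    average. *)
Lemma poincare3 (M : nat) F :
  exists c, sum3 M.+1 (fun x y z => (F x y z - c) ^+ 2) <=
    9 * M.+1%:R ^+ 2 * sum3 M.+1 (stepsq F).
Proof.
set n := M.+1; set E := sum3 n _.
pose Q x y z := sum3 n (fun x' y' z' => (F x' y' z' - F x y z) ^+ 2).
pose P1 y z := \sum_(t < n) (F t.+1 y z - F t y z) ^+ 2.
pose P2 x z := \sum_(t < n) (F x t.+1 z - F x t z) ^+ 2.
pose P3 x y := \sum_(t < n) (F x y t.+1 - F x y t) ^+ 2.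
have ext f a a' : (a < n)%N -> (a' < n)%N ->
    (f a - f a') ^+ 2 <= n%:R * \sum_(t < n) (f t.+1 - f t) ^+ 2.
  by move=> la la'; apply: poincare1; exact: ltnW.
have pt x y z x' y' z' : (x < n)%N -> (y < n)%N -> (z < n)%N ->
    (x' < n)%N -> (y' < n)%N -> (z' < n)%N ->
    (F x' y' z' - F x y z) ^+ 2 <= 3 * n%:R * (P1 y' z' + (P2 x z' + P3 x y)).
  move=> h1 h2 h3 h1' h2' h3'.
  have e1 := ext (fun t => F t y' z') _ _ h1' h1.
  have e2 := ext (fun t => F x t z') _ _ h2' h2.
  have e3 := ext (fun t => F x y t) _ _ h3' h3.
  apply: le_trans (_ : 3 * ((F x' y' z' - F x y' z') ^+ 2 + (F x y' z' - F x y z') ^+ 2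
       + (F x y z' - F x y z) ^+ 2) <= _).
    have -> : F x' y' z' - F x y z = (F x' y' z' - F x y' z') + (F x y' z' - F x y z')
       + (F x y z' - F x y z) by ring.
    move: (F x' y' z' - _) (F x y' z' - _) (F x y z' - _) => p q r.
    have := sqr_ge0 (p - q); have := sqr_ge0 (p - r); have := sqr_ge0 (q - r); nra.
  rewrite -mulrA ler_wpM2l // !mulrDr addrA; do ! apply: lerD => //.
have total : sum3 n Q <= 9 * n%:R ^+ 5 * E.
  apply: le_trans (_ : sum3 n (fun x y z => sum3 n (fun x' y' z' =>
     3 * n%:R * (P1 y' z' + (P2 x z' + P3 x y)))) <= _).
    by apply: sum3_le => *; apply: sum3_le => *; exact: pt.
  have S1 : sum3 n (fun _ y z => P1 y z) = n%:R * \sum_(y < n) \sum_(z < n) P1 y z.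
    by rewrite /sum3 sumr_const card_ord mulr_natl.
  have E1 : \sum_(y < n) \sum_(z < n) P1 y z = sum3 n (fun a b c => (F a.+1 b c - F a b c) ^+ 2).
    rewrite /sum3 [RHS]exchange_big /=; apply: eq_bigr => y _.
    by rewrite [RHS]exchange_big.
  have E2 : \sum_(x < n) \sum_(z < n) P2 x z = sum3 n (fun a b c => (F a b.+1 c - F a b c) ^+ 2).
    by rewrite /sum3; apply: eq_bigr => x _; rewrite [RHS]exchange_big.
  have E3 : \sum_(x < n) \sum_(y < n) P3 x y = sum3 n (fun a b c => (F a b c.+1 - F a b c) ^+ 2).
    by [].
  have EE : E = \sum_(y < n) \sum_(z < n) P1 y z + \sum_(x < n) \sum_(z < n) P2 x z
     + \sum_(x < n) \sum_(y < n) P3 x y.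
    by rewrite E1 E2 E3 /E -!sum3D.
  have [p1 p2 p3] : [/\ 0 <= \sum_(y < n) \sum_(z < n) P1 y z,
     0 <= \sum_(x < n) \sum_(z < n) P2 x z & 0 <= \sum_(x < n) \sum_(y < n) P3 x y].
    by split; do 3! apply: sumr_ge0 => ? _; exact: sqr_ge0.
  have -> : sum3 n (fun x y z => sum3 n (fun x' y' z' =>
     3 * n%:R * (P1 y' z' + (P2 x z' + P3 x y)))) =
     3 * n%:R * (n%:R ^+ 4 * (\sum_(y < n) \sum_(z < n) P1 y z)
       + (n%:R ^+ 4 * (\sum_(x < n) \sum_(z < n) P2 x z)
       + n%:R ^+ 4 * \sum_(x < n) \sum_(y < n) P3 x y)).
    transitivity (sum3 n (fun x y z => 3 * n%:R * (n%:R * (\sum_(y < n) \sum_(z < n) P1 y z) +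
        (n%:R ^+ 2 * (\sum_(z < n) P2 x z) + n%:R ^+ 3 * P3 x y)))).
      apply: eq_sum3 => x y z _ _ _; rewrite sum3Z !sum3D S1 sum_const3.
      by rewrite /sum3 !sumr_const !card_ord; ring.
    rewrite sum3Z !sum3D !sum3Z sum_const3; congr (_ * (_ + (_ + _))); first ring.
      rewrite /sum3.
      under eq_bigr do rewrite !sumr_const !card_ord -mulrnA -mulr_natr.
      by rewrite -mulr_suml natrM; ring.
    rewrite /sum3.
    under eq_bigr do under eq_bigr do rewrite sumr_const card_ord -mulr_natr.
    under eq_bigr do rewrite -mulr_suml.
    by rewrite -mulr_suml; ring.
  rewrite EE; have n0 : 0 <= n%:R ^+ 5 :> R by rewrite exprn_ge0.
  rewrite -!mulrDr.
  have -> : 3 * n%:R * (n%:R ^+ 4 * (\sum_(y < n) \sum_(z < n) P1 y z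
       + (\sum_(x < n) \sum_(z < n) P2 x z + \sum_(x < n) \sum_(y < n) P3 x y))) =
     3 * (n%:R ^+ 5 * (\sum_(y < n) \sum_(z < n) P1 y z
       + \sum_(x < n) \sum_(z < n) P2 x z + \sum_(x < n) \sum_(y < n) P3 x y)) :> R by ring.
  rewrite -mulrA; apply: ler_wpM2r; last lra.
  by rewrite mulr_ge0 // !addr_ge0.
have n0 : 0 < n%:R :> R by rewrite ltr0n.
case: (boolP [exists x : 'I_n, exists y : 'I_n, exists z : 'I_n,
    Q x y z <= 9 * n%:R ^+ 2 * E]) => [/existsP[x /existsP[y /existsP[z h]]]|no].
  by exists (F x y z).
have : sum3 n (fun _ _ _ => 9 * n%:R ^+ 2 * E) < sum3 n Q.
  have lt (x y z : 'I_n) : 9 * n%:R ^+ 2 * E < Q x y z.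
    rewrite ltNge; apply: contra no => h.
    by apply/existsP; exists x; apply/existsP; exists y; apply/existsP; exists z.
  by do 3! (apply: ltr_sum => [|? _]; first by apply/hasP; exists ord0; rewrite ?mem_index_enum).
by rewrite sum_const3 ltNge => /negP; case; apply: le_trans total _;
  rewrite le_eqVlt; apply/orP; left; apply/eqP; ring.
Qed.

Definition min3 (a b c : nat) := minn a (minn b c).

(** Along a diagonal [min3] counts the steps from the near faces, and [bf] vanishes on the far ones.
    Summation by parts turns the sum of squares into that of [(min3 + 1)] times the decrease of
    [bf^2] in one step; completing a square gives the factor 4. *)
Lemma hardy_diagonal (K : nat) (bf : nat -> nat -> nat -> R) :
  (forall a b c, (a <= K)%N -> (b <= K)%N -> (c <= K)%N ->
     (a == K)%N || (b == K)%N || (c == K)%N -> bf a b c = 0) ->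
  sum3 K.+1 (fun a b c => bf a b c ^+ 2) <=
  4 * sum3 K (fun a b c => (min3 a b c).+1%:R ^+ 2 * (bf a b c - bf a.+1 b.+1 c.+1) ^+ 2).
Proof.
move=> b0; set S := sum3 _ _; set E := sum3 K _.
have e1 : sum3 K.+1 (fun a b c => (min3 a b c).+1%:R * bf a b c ^+ 2) =
    sum3 K (fun a b c => (min3 a b c).+1%:R * bf a b c ^+ 2).
  by apply: sum3_recr => a b c ha hb hc h; rewrite b0 // expr0n mulr0.
have e2 : sum3 K.+1 (fun a b c => (min3 a b c)%:R * bf a b c ^+ 2) =
    sum3 K (fun a b c => (min3 a b c).+1%:R * bf a.+1 b.+1 c.+1 ^+ 2).
  rewrite sum3_shift1; first by apply: eq_sum3 => a b c _ _ _; rewrite /min3 !minnSS.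
  by move=> a b c h; rewrite (_ : min3 a b c = 0%N) ?mul0r //; move: h; rewrite /min3; lia.
have e3 : S = sum3 K.+1 (fun a b c => (min3 a b c).+1%:R * bf a b c ^+ 2)
    + -1 * sum3 K.+1 (fun a b c => (min3 a b c)%:R * bf a b c ^+ 2).
  rewrite -sum3Z -sum3D; apply: eq_sum3 => a b c _ _ _.
  by rewrite -natr1; ring.
have e4 : S <= sum3 K (fun a b c => 2^-1 * bf a b c ^+ 2 +
     2 * ((min3 a b c).+1%:R ^+ 2 * (bf a b c - bf a.+1 b.+1 c.+1) ^+ 2)).
  rewrite e3 e1 e2 -sum3Z -sum3D; apply: sum3_le => a b c _ _ _.
  have : 0 <= (min3 a b c).+1%:R :> R by [].
  move: (min3 a b c).+1%:R (bf a b c) (bf a.+1 b.+1 c.+1) => m b1 b2 m0.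
  rewrite -subr_ge0.
  have -> : 2^-1 * b1 ^+ 2 + 2 * (m ^+ 2 * (b1 - b2) ^+ 2) - (m * b1 ^+ 2 + -1 * (m * b2 ^+ 2)) =
     2 * (2^-1 * b1 - m * (b1 - b2)) ^+ 2 + m * (b1 - b2) ^+ 2 by field.
  by apply: addr_ge0; apply: mulr_ge0 => //; exact: sqr_ge0.
rewrite sum3D !sum3Z -/E in e4.
have : sum3 K (fun a b c => bf a b c ^+ 2) <= S.
  have := @sum3_sub K K.+1 0 (fun a b c => bf a b c ^+ 2).
  rewrite addn0 leqnSn => /(_ _ isT) H; apply: le_trans (H _); last by move=> *; exact: sqr_ge0.
  by apply: sum3_le => a b c _ _ _; rewrite !addn0.
lra.
Qed.

(** The weight is small at the three near faces only. A shift by [J] along the diagonal moves the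
    corner to where the weight exceeds [J], and [poincare3] applies there. The shift itself costs a
    difference of two values of [bf], estimated by [hardy_diagonal]. *)
Lemma corner_poincare (J : nat) F :
  exists c, sum3 (2 * J).+1 (fun x y z => (F x y z - c) ^+ 2) <=
    400 * sum3 (3 * J).+1 (fun x y z => (min3 x y z).+1%:R ^+ 2 * stepsq F x y z).
Proof.
set E := sum3 (3 * J).+1 _; pose K := (3 * J)%N.
pose FJ a b c := F (a + J)%N (b + J)%N (c + J)%N.
(* The number of diagonal steps left before a far face; [bf] is the deviation of [F] from the value
   reached there, and so is constant under subtraction of that value along a diagonal. *)
pose en a b c := (K - maxn a (maxn b c))%N.
pose bf a b c := F a b c - F (a + en a b c)%N (b + en a b c)%N (c + en a b c)%N.
have bf0 a b c : (a <= K)%N -> (b <= K)%N -> (c <= K)%N ->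
     (a == K)%N || (b == K)%N || (c == K)%N -> bf a b c = 0.
  move=> ha hb hc h; rewrite /bf (_ : en a b c = 0%N) ?addn0 ?subrr //.
  by move: h; rewrite /en; lia.
have H1 := hardy_diagonal bf0.
have gE0 a b c : 0 <= (min3 a b c).+1%:R ^+ 2 * stepsq F a b c.
  by rewrite mulr_ge0 ?stepsq_ge0 // sqr_ge0.
have shiftle (i j k : nat) (g : nat -> nat -> nat -> R) : (i <= 1)%N -> (j <= 1)%N -> (k <= 1)%N ->
    (forall a b c, 0 <= g a b c) ->
    sum3 K (fun a b c => g (a + i)%N (b + j)%N (c + k)%N) <= sum3 K.+1 g.
  move=> hi hj hk g0.
  pose h2 a := \sum_(b < K.+1) \sum_(c < K.+1) g a b c.
  apply: le_trans (_ : \sum_(a < K) h2 (a + i)%N <= _); last first.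
    by apply: sum1_sub => [a|]; [do 2! apply: sumr_ge0 => ? _|lia].
  apply: ler_sum => a _; pose h1 b := \sum_(c < K.+1) g (a + i)%N b c.
  apply: le_trans (_ : \sum_(b < K) h1 (b + j)%N <= _); last first.
    by apply: sum1_sub => [b|]; [apply: sumr_ge0 => ? _|lia].
  by apply: ler_sum => b _; apply: sum1_sub => //; lia.
have H2 : sum3 K (fun a b c => (min3 a b c).+1%:R ^+ 2 * (bf a b c - bf a.+1 b.+1 c.+1) ^+ 2)
    <= 3 * (E + (E + E)).
  (* A diagonal step consists of three axis steps, starting at these three points, and the weight
     does not decrease on the way. *)
  apply: le_trans (_ : sum3 K (fun a b c => 3 * (
     (min3 (a + 0) (b + 0) (c + 0)).+1%:R ^+ 2 * stepsq F (a + 0) (b + 0) (c + 0) +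
     ((min3 (a + 1) (b + 0) (c + 0)).+1%:R ^+ 2 * stepsq F (a + 1) (b + 0) (c + 0) +
     (min3 (a + 1) (b + 1) (c + 0)).+1%:R ^+ 2 * stepsq F (a + 1) (b + 1) (c + 0)))) <= _).
    apply: sum3_le => a b c ha hb hc; rewrite !addn0 !addn1.
    have -> : bf a b c - bf a.+1 b.+1 c.+1 = - (F a.+1 b.+1 c.+1 - F a b c).
      rewrite /bf (_ : (a.+1 + en a.+1 b.+1 c.+1 = a + en a b c)%N); last by rewrite /en /K; lia.
      rewrite (_ : (b.+1 + en a.+1 b.+1 c.+1 = b + en a b c)%N); last by rewrite /en /K; lia.
      rewrite (_ : (c.+1 + en a.+1 b.+1 c.+1 = c + en a b c)%N); last by rewrite /en /K; lia.
      by ring.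
    rewrite sqrrN.
    set m := (min3 a b c).+1%:R.
    have m0 : 0 <= m by [].
    have m1 : m ^+ 2 <= (min3 a.+1 b c).+1%:R ^+ 2.
      by rewrite lerXn2r ?nnegrE ?ler_nat // /min3; lia.
    have m2 : m ^+ 2 <= (min3 a.+1 b.+1 c).+1%:R ^+ 2.
      by rewrite lerXn2r ?nnegrE ?ler_nat // /min3; lia.
    apply: le_trans (_ : 3 * (m ^+ 2 * stepsq F a b c + (m ^+ 2 * stepsq F a.+1 b c +
       m ^+ 2 * stepsq F a.+1 b.+1 c)) <= _); last first.
      by rewrite ler_wpM2l // lerD2l lerD // ler_wpM2r ?stepsq_ge0.
    rewrite -!mulrDr [leRHS]mulrCA; apply: ler_wpM2l; [exact: sqr_ge0|rewrite /stepsq].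
    have -> : F a.+1 b.+1 c.+1 - F a b c = (F a.+1 b c - F a b c) +
       (F a.+1 b.+1 c - F a.+1 b c) + (F a.+1 b.+1 c.+1 - F a.+1 b.+1 c) by ring.
    apply: le_trans (_ : 3 * ((F a.+1 b c - F a b c) ^+ 2 +
       ((F a.+1 b.+1 c - F a.+1 b c) ^+ 2 + (F a.+1 b.+1 c.+1 - F a.+1 b.+1 c) ^+ 2)) <= _).
      move: (F a.+1 b c - _) (F a.+1 b.+1 c - _) (F a.+1 b.+1 c.+1 - _) => p q r.
      have := sqr_ge0 (p - q); have := sqr_ge0 (p - r); have := sqr_ge0 (q - r); nra.
    rewrite ler_wpM2l //; apply: lerD; last apply: lerD.
    - by rewrite -addrA lerDl addr_ge0 ?sqr_ge0.
    - by rewrite addrAC lerDr addr_ge0 ?sqr_ge0.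
    - by rewrite lerDr addr_ge0 ?sqr_ge0.
  rewrite sum3Z !sum3D ler_wpM2l //.
  pose g a b c := (min3 a b c).+1%:R ^+ 2 * stepsq F a b c.
  by apply: lerD; last apply: lerD; apply: (shiftle _ _ _ g).
have H3 : sum3 (2 * J).+1 (fun a b c => (F a b c - FJ a b c) ^+ 2)
    <= 4 * sum3 K.+1 (fun a b c => bf a b c ^+ 2).
  have q0 a b c : 0 <= bf a b c ^+ 2 by exact: sqr_ge0.
  have s1 := @sum3_sub (2 * J).+1 K.+1 0 _ q0.
  have s2 := @sum3_sub (2 * J).+1 K.+1 J _ q0.
  apply: le_trans (_ : sum3 (2 * J).+1 (fun a b c => 2 * bf (a + 0)%N (b + 0)%N (c + 0)%N ^+ 2 +
     2 * bf (a + J)%N (b + J)%N (c + J)%N ^+ 2) <= _).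
    apply: sum3_le => a b c ha hb hc; rewrite !addn0.
    have -> : F a b c - FJ a b c = bf a b c - bf (a + J)%N (b + J)%N (c + J)%N.
      have eJ : (en a b c = J + en (a + J) (b + J) (c + J))%N by rewrite /en /K; lia.
      by rewrite /bf /FJ eJ !addnA; ring.
    move: (bf a b c) (bf (a + J) (b + J) (c + J))%N => p q; have := sqr_ge0 (p + q); nra.
  rewrite sum3D !sum3Z.
  have := s1 _; have := s2 _; rewrite /K => /(_ ltac:(lia)) h2 /(_ ltac:(lia)) h1.
  by move: h1 h2; move: (sum3 _ _) (sum3 _ _) (sum3 _ _) => x y z; lra.
have [c Hc] := poincare3 (2 * J) FJ.
exists c.
have H4 : 9 * (2 * J).+1%:R ^+ 2 * sum3 (2 * J).+1 (stepsq FJ)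
   <= 36 * E.
  apply: le_trans (_ : 36 * sum3 (2 * J).+1 (fun a b c =>
     (min3 (a + J) (b + J) (c + J)).+1%:R ^+ 2 * stepsq F (a + J) (b + J) (c + J)) <= _); last first.
    by rewrite ler_wpM2l //; apply: (@sum3_sub _ _ J _ gE0); lia.
  rewrite -!sum3Z; apply: sum3_le => x y z hx hy hz.
  have -> : stepsq FJ x y z = stepsq F (x + J) (y + J) (z + J) by [].
  rewrite [leRHS]mulrA ler_wpM2r ?stepsq_ge0 //.
  have h : (2 * J).+1%:R <= 2 * (min3 (x + J) (y + J) (z + J)).+1%:R :> R.
    by rewrite -natrM ler_nat /min3; lia.
  have : (2 * J).+1%:R ^+ 2 <= (2 * (min3 (x + J) (y + J) (z + J)).+1%:R) ^+ 2 :> R.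
    by rewrite lerXn2r ?nnegrE // mulr_ge0.
  rewrite exprMn; lra.
apply: le_trans (_ : sum3 (2 * J).+1 (fun a b d => 2 * (F a b d - FJ a b d) ^+ 2
    + 2 * (FJ a b d - c) ^+ 2) <= _).
  apply: sum3_le => x y z _ _ _; move: (F x y z) (FJ x y z) => p q.
  have := sqr_ge0 (p - q - (q - c)); nra.
rewrite sum3D !sum3Z.
have E0 : 0 <= E by exact: sum3_ge0.
by have := le_trans Hc H4; lra.
Qed.

End Corner.

(** * A discrete Necas inequality on a cube *)

Section LatticeNecas.
Context (R : rcfType) (m : nat).
Local Notation n := m.+2.
Local Notation G := 'rV['I_n]_3.
Implicit Types (x : G) (l i j : 'I_3).

Definition unitv l : G := delta_mx 0 l.

Local Notation fd := (fdiff unitv).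
Local Notation bk := (bdiff unitv).

Lemma unitv_addE x l j : ((x + unitv l)%R 0%R j : nat) =
  (if j == l then (x 0%R j).+1 %% n else x 0%R j)%N.
Proof.
rewrite !mxE eqxx eq_sym /=; case: eqP => _ /=; first by rewrite modnDmr addn1.
by rewrite addn0 modn_small.
Qed.

Lemma unitv_addS x l : (x 0%R l < m.+1)%N ->
  forall j, ((x + unitv l)%R 0%R j : nat) = (if j == l then (x 0%R j).+1 else x 0%R j)%N.
Proof.
move=> h j; rewrite unitv_addE; case: eqP => // ->.
by rewrite modn_small.
Qed.

Lemma unitv_sub x l : (0 < x 0%R l)%N ->
  forall j, ((x - unitv l)%R 0%R j : nat) = (if j == l then (x 0%R j).-1 else x 0%R j)%N.
Proof.
move=> h j; have := unitv_addE (x - unitv l) l j; rewrite subrK.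
case: eqP => [->|_ ->//] H.
move: h; rewrite H; have := ltn_ord ((x - unitv l) 0 l).
set z := nat_of_ord _; rewrite ltnS leq_eqVlt => /orP[/eqP ->|lt]; first by rewrite modnn.
by rewrite modn_small.
Qed.

Definition latpt (a b c : nat) : G :=
  \row_l inord (nth 0%N [:: a; b; c] l).

Lemma latptE a b c l : (a < n)%N -> (b < n)%N -> (c < n)%N ->
  (latpt a b c 0%R l : nat) = nth 0%N [:: a; b; c] l.
Proof.
move=> ha hb hc; rewrite mxE inordK //.
by case: l => -[|[|[|]]].
Qed.

Lemma sum_lattice (f : G -> R) :
  \sum_x f x = sum3 n (fun a b c => f (latpt a b c)).
Proof.
rewrite /sum3; under [RHS]eq_bigr do rewrite pair_big /=.
rewrite pair_big /=.
pose h (t : 'I_n * ('I_n * 'I_n)) := latpt t.1 t.2.1 t.2.2.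
pose k x : 'I_n * ('I_n * 'I_n) := (x 0 0, (x 0 1, x 0 2%:R)).
rewrite (reindex h) //; exists k => [t _|x _].
  case: t => a [b c]; rewrite /k /h; congr (_, (_, _)); apply: val_inj;
  by rewrite /= latptE.
apply/rowP => l; apply: val_inj; rewrite /= latptE //.
by case: l => -[|[|[|//]]] p /=; congr (val (x 0 _)); apply: val_inj.
Qed.

(** [inner] carries the Dirichlet condition. At [nowrap] points all forward steps are genuine steps
    in the cube rather than jumps across the torus. *)
Definition inner x := [forall l, (0 < x 0%R l)%N && (x 0%R l < m.+1)%N].
Definition nowrap x := [forall l, (x 0%R l < m.+1)%N].

(** The truncated subtraction of 2 makes [depth] vanish near the faces: where it is positive, the
    point and all its shifts in [depth_inner] are [inner]. *)
Definition wall (a : nat) := (minn a (m.+1 - a) - 2)%N.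
Definition depth x : nat := min3 (wall (x 0 0)) (wall (x 0 1)) (wall (x 0 2)).

Lemma depth_le x l : (depth x <= wall (x 0%R l))%N.
Proof.
rewrite /depth /min3.
have : l \in [:: 0; 1; 2].
  by case: l => -[|[|[|//]]] p; rewrite !inE -!val_eqE /= ?orbT.
by rewrite !inE => /or3P[] /eqP ->; rewrite !geq_min leqnn ?orbT.
Qed.

Lemma depth_glb x d : (forall l, d <= wall (x 0%R l))%N -> (d <= depth x)%N.
Proof. by move=> h; rewrite /depth /min3 !leq_min !h. Qed.

Lemma wall_step x l j :
  (wall ((x + unitv l)%R 0%R j) <= (wall (x 0%R j)).+1)%N /\
  (wall (x 0%R j) <= (wall ((x + unitv l)%R 0%R j)).+1)%N.
Proof.
rewrite unitv_addE; case: eqP => [->|_]; last by lia.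
have := ltn_ord (x 0 l); rewrite /wall ltnS leq_eqVlt => /orP[/eqP ->|lt].
  by rewrite modnn; lia.
by rewrite modn_small //; lia.
Qed.

Lemma depth_lip x l : `|(depth (x + unitv l))%:R - (depth x)%:R| <= 1 :> R.
Proof.
have h1 : (depth (x + unitv l) <= (depth x).+1)%N.
  have [j ->] : exists j, depth x = wall (x 0%R j).
    rewrite /depth /min3 /minn.
    by case: ltnP => _; [exists 0|case: ltnP => _; [exists 1|exists 2]].
  by apply: leq_trans (depth_le _ j) _; case: (wall_step x l j).
have h2 : (depth x <= (depth (x + unitv l)).+1)%N.
  have [j ->] : exists j, depth (x + unitv l) = wall ((x + unitv l)%R 0%R j).
    rewrite /depth /min3 /minn.
    by case: ltnP => _; [exists 0|case: ltnP => _; [exists 1|exists 2]].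
  by apply: leq_trans (depth_le _ j) _; case: (wall_step x l j).
move: h1 h2; rewrite -!(ler_nat R) -!natr1 => h1 h2.
by rewrite ler_norml; apply/andP; split; lra.
Qed.

Lemma depth_gt0 x : (0 < depth x)%N -> forall l, (2 < x 0%R l)%N && (x 0%R l < m.-1)%N.
Proof. by move=> h l; have := leq_trans h (depth_le x l); rewrite /wall; lia. Qed.

Lemma depth_nowrap j x :
  ((depth x)%:R != 0 :> R) || ((depth (x + unitv j))%:R != 0 :> R) ->
  nowrap x && nowrap (x + unitv j).
Proof.
rewrite !pnatr_eq0 -!lt0n => /orP[] /depth_gt0 h.
  have hx l : (x 0%R l < m)%N by have := h l; lia.
  apply/andP; split; apply/forallP => l; first by have := hx l; lia.
  by rewrite unitv_addS; [case: eqP => _; have := hx l; lia|have := hx j; lia].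
have hx l : (x 0%R l < m)%N.
  have := h l; rewrite unitv_addE; case: eqP => [->|]; last by lia.
  have := ltn_ord (x 0 j); rewrite ltnS leq_eqVlt => /orP[/eqP ->|lt]; first by rewrite modnn.
  by rewrite modn_small //; lia.
apply/andP; split; apply/forallP => l; first by have := hx l; lia.
by rewrite unitv_addS; [case: eqP => _; have := hx l; lia|have := hx j; lia].
Qed.

Lemma depth_inner x : (depth x)%:R != 0 :> R ->
  [/\ inner x, forall j, inner (x - unitv j), forall i, inner (x + unitv i)
     & forall i j, inner (x + unitv i - unitv j)].
Proof.
rewrite pnatr_eq0 -lt0n => /depth_gt0 h.
have hp i l : ((x + unitv i)%R 0%R l : nat) = (if l == i then (x 0%R l).+1 else x 0%R l)%N.
  by apply: unitv_addS; have := h i; lia.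
split=> [|j|i|i j]; apply/forallP => l.
- by have := h l; lia.
- rewrite unitv_sub; last by have := h j; lia.
  by case: eqP => _; have := h l; lia.
- by rewrite hp; case: eqP => _; have := h l; lia.
- rewrite unitv_sub hp; last by case: eqP => _; have := h j; lia.
  by case: eqP => _; case: eqP => _; have := h l; lia.
Qed.

(** Walking round the torus in direction 0 one reaches a point whose first coordinate is 0, and such
    a point is not [inner]. *)
Lemma inner_coercive (f : G -> R) : (forall x, ~~ inner x -> f x = 0) ->
  (forall j x, fd j f x = 0) -> forall x, f x = 0.
Proof.
move=> f0 df x.
have sh k : f (x + unitv 0 *+ k) = f x.
  elim: k => [|k <-]; first by rewrite mulr0n addr0.
  by rewrite mulrSr addrA; apply/eqP; rewrite -subr_eq0; apply/eqP/(df 0).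
rewrite -(sh (- (x 0 0) : nat)%R); apply: f0.
apply/negP => /forallP /(_ 0) /andP[]; rewrite lt0n => /negP[].
suff -> : (x + unitv 0 *+ (- x 0 0)) 0 0 = 0 by [].
by rewrite mxE mulmxnE mxE !eqxx (_ : (true && true)%:R = 1) // natr_Zp subrr.
Qed.

(** [W] represents the gradient of [u] in the Dirichlet inner product: testing with [- W] gives
    [en <= s * sqrt en], so its energy is at most [s^2]. What remains is the harmonic part, for
    [weighted_gradient] and [corner_poincare]. The term [B] pays for the layer where [depth] is zero
    while the weight of [corner_poincare] is positive. *)
Lemma lattice_necas (J : nat) (u : G -> R) (s B : R) :
  n = (4 * J)%N -> (2 <= J)%N -> 0 <= s ->
  (forall V : 'I_3 -> G -> R, (forall l x, ~~ inner x -> V l x = 0) ->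
     \sum_l \sum_x u x * bk l (V l) x <=
       s * Num.sqrt (\sum_l \sum_j sqsum (fd j (V l)))) ->
  \sum_l \sum_(x | nowrap x) fd l u x ^+ 2 <= B ->
  exists c, \sum_(x : G | [forall l, (x 0%R l <= 2 * J)%N]) (u x - c) ^+ 2 <=
    10 ^+ 11 * (s ^+ 2 + B).
Proof.
move=> nJ J2 s0 test dB.
pose W_ i := poisson inner_coercive (fun x => - fd i u x).
have [W WP] : exists W : 'I_3 -> G -> R, forall i,
   (forall x, ~~ inner x -> W i x = 0) /\
   (forall x, inner x -> lap unitv (W i) x = - fd i u x).
  have [w0 h0] := W_ 0; have [w1 h1] := W_ 1; have [w2 h2] := W_ 2.
  exists (fun i => if i == 0 then w0 else if i == 1 then w1 else w2) => i.
  case: eqP => [->//|/eqP i0]; case: eqP => [->//|/eqP i1].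
  suff -> : i = 2 by [].
  by move: i i0 i1 => [[|[|[|//]]] p] //= _ _; apply: val_inj.
have WE i x : inner x -> lap unitv (W i) x = - fd i u x by case: (WP i) => _; apply.
have W0 i x : ~~ inner x -> W i x = 0 by case: (WP i) => + _; apply.
pose en := energyW unitv W.
have en0 : 0 <= en by apply: sumr_ge0 => k _; apply: sumr_ge0 => j _; exact: sqsum_ge0.
have en_s : en <= s ^+ 2.
  have E : en = \sum_l \sum_x u x * bk l (fun x => - W l x) x.
    apply: eq_bigr => l _; rewrite sum_by_parts -sumrN.
    transitivity (- \sum_x W l x * lap unitv (W l) x).
      by rewrite dirichlet_form opprK; do 2! apply: eq_bigr => ? _; rewrite expr2.
    rewrite -sumrN; apply: eq_bigr => x _.
    by case: (boolP (inner x)) => [/WE ->|/W0 ->]; ring.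
  have en_le : en <= s * Num.sqrt en.
    rewrite {1}E; apply: le_trans (test _ _) _ => [l x /W0 ->|]; first by rewrite oppr0.
    rewrite ler_wpM2l // ler_sqrt // le_eqVlt; apply/orP; left; apply/eqP.
    by do 3! apply: eq_bigr => ? _; rewrite /fdiff; ring.
  have := sqr_sqrtr en0; have := sqrtr_ge0 en; move: (Num.sqrt en) en_le => r h r0 rE.
  move: h; rewrite -rE expr2; case: (ltgtP 0 r) r0 => // [rp _|<- _]; last by rewrite !mulr0 mulr_ge0.
  by rewrite ler_pM2r // => rs; rewrite expr2 ler_pM // ltW.
pose p := harm unitv u W.
pose dlt x : R := (depth x)%:R.
have B_p i : \sum_(x | nowrap x) fd i p x ^+ 2 <= 2 * (\sum_(x | nowrap x) fd i u x ^+ 2) + 24 * en.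
  apply: le_trans (_ : \sum_(x | nowrap x) (2 * fd i u x ^+ 2 + 2 * fd i (divW unitv W) x ^+ 2) <= _).
    apply: ler_sum => x _.
    have -> : fd i p x = fd i u x + fd i (divW unitv W) x by rewrite /p /harm /fdiff; ring.
    by move: (fd i u x) (fd i (divW unitv W) x) => a b; have := sqr_ge0 (a - b); nra.
  rewrite big_split /= -!mulr_sumr lerD2l.
  have h1 : \sum_(x | nowrap x) fd i (divW unitv W) x ^+ 2 <= sqsum (fd i (divW unitv W)).
    by rewrite /sqsum big_mkcond; apply: ler_sum => x _; case: ifP => // _; exact: sqr_ge0.
  have h2 : sqsum (fd i (divW unitv W)) <= 4 * sqsum (divW unitv W).
    rewrite /sqsum.
    apply: le_trans (_ : \sum_x (2 * divW unitv W (x + unitv i) ^+ 2 + 2 * divW unitv W x ^+ 2) <= _).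
      apply: ler_sum => x _; rewrite /fdiff; move: (divW _ _ (x + _)) (divW _ _ x) => a b.
      by have := sqr_ge0 (a + b); nra.
    rewrite big_split /= -!mulr_sumr (sum_shift (fun x => divW unitv W x ^+ 2)).
    by lra.
  have := sqsum_divW unitv W; rewrite -/en; lra.
have Y_p i : \sum_x dlt x ^+ 2 * fd i p x ^+ 2 <=
     4 * (\sum_(x | nowrap x) fd i p x ^+ 2) + (600 * 100) * en.
  apply: (@weighted_gradient R G unitv inner nowrap dlt) => //.
  - by move=> j x; exact: depth_lip.
  - by move=> j x; exact: depth_nowrap.
  - by move=> x; exact: depth_inner.
pose Q x := \sum_i (dlt x ^+ 2 * fd i p x ^+ 2 + (if nowrap x then fd i p x ^+ 2 else 0)).
have QB : \sum_x Q x <= 10 * B + (3 * 600 * 101) * en.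
  rewrite /Q exchange_big /=.
  apply: le_trans (_ : \sum_i (10 * (\sum_(x | nowrap x) fd i u x ^+ 2) + (600 * 101) * en) <= _).
    apply: ler_sum => i _; rewrite big_split /= -big_mkcond /=.
    have := Y_p i; have := B_p i; lra.
  rewrite big_split /= -mulr_sumr sumr_const card_ord; lra.
have [c Hc] := corner_poincare J (fun a b c => p (latpt a b c)).
exists c.
have Q0 x : 0 <= Q x.
  by apply: sumr_ge0 => i _; apply: addr_ge0; [rewrite mulr_ge0 ?sqr_ge0|case: ifP => // _; exact: sqr_ge0].
have EQ : sum3 (3 * J).+1 (fun a b d => (min3 a b d).+1%:R ^+ 2 *
    stepsq (fun a b c => p (latpt a b c)) a b d) <= 400 * \sum_x Q x.
  rewrite sum_lattice -sum3Z.
  have := @sum3_sub R (3 * J).+1 n 0 (fun a b c => 400 * Q (latpt a b c)).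
  move=> /(_ (fun a b c => mulr_ge0 (ler0n _ _) (Q0 _)) ltac:(clear -nJ J2; lia)); apply: le_trans.
  apply: sum3_le => a b d ha hb hc; rewrite !addn0.
  have na : (a < n)%N by clear -nJ J2 ha; lia.
  have nb : (b < n)%N by clear -nJ J2 hb; lia.
  have nc : (d < n)%N by clear -nJ J2 hc; lia.
  have co l : (latpt a b d 0%R l : nat) = nth 0%N [:: a; b; d] l by exact: latptE.
  have cl l : (latpt a b d 0%R l < m.+1)%N.
    by rewrite co; clear -nJ J2 ha hb hc; case: l => -[|[|[|//]]] ? /=; lia.
  have nw : nowrap (latpt a b d) by apply/forallP.
  have st l : latpt (a + (l == 0)) (b + (l == 1)) (d + (l == 2)) = latpt a b d + unitv l.
    apply/rowP => k; apply: val_inj; rewrite /= unitv_addS // latptE ?latptE //;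
      [|by case: eqP => _; clear -nJ J2 ha hb hc; lia..].
    have k3 : k \in [:: 0; 1; 2] by case: k => -[|[|[|//]]] ?; rewrite !inE -!val_eqE /= ?orbT.
    have l3 : l \in [:: 0; 1; 2] by case: l => -[|[|[|//]]] ?; rewrite !inE -!val_eqE /= ?orbT.
    by move: k3 l3; rewrite !inE => /or3P[] /eqP -> /or3P[] /eqP -> /=; rewrite ?addn1 ?addn0.
  have ss : stepsq (fun a b c => p (latpt a b c)) a b d = \sum_i fd i p (latpt a b d) ^+ 2.
    have i2 : lift ord0 (lift ord0 ord0) = 2 :> 'I_3 by apply: val_inj.
    have i1 : lift ord0 ord0 = 1 :> 'I_3 by apply: val_inj.
    rewrite !big_ord_recl big_ord0 addr0 i2 i1 /stepsq /fdiff -!st /= !addn0 !addn1.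
    by rewrite addrA.
  rewrite ss /Q nw big_split /= -mulr_sumr.
  set S := \sum_i _; have S0 : 0 <= S by apply: sumr_ge0 => ? _; exact: sqr_ge0.
  (* The coordinates are at most [3 J] in a cube of [4 J] points, so the far walls stay at distance
     about [J] and [depth] is comparable to the distance from the near faces. The factor 13 also
     covers small [J], where [depth] may be zero. *)
  have mm : ((min3 a b d).+1 <= 13 * (depth (latpt a b d)).+1)%N.
    suff : ((min3 a b d).+1 - 13 <= 4 * depth (latpt a b d))%N by clear; lia.
    have : (((min3 a b d).+1 - 13 + 3) %/ 4 <= depth (latpt a b d))%N.
      apply: depth_glb => l; rewrite co /wall /min3.
      by clear -nJ J2 ha hb hc; case: l => -[|[|[|//]]] ? /=; lia.
    by clear; lia.
  have mR : (min3 a b d).+1%:R <= 13 * (dlt (latpt a b d) + 1).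
    by rewrite /dlt natr1 -natrM ler_nat.
  have mR2 : (min3 a b d).+1%:R ^+ 2 <= 338 * (dlt (latpt a b d) ^+ 2 + 1).
    have : (min3 a b d).+1%:R ^+ 2 <= (13 * (dlt (latpt a b d) + 1)) ^+ 2.
      by rewrite lerXn2r ?nnegrE // mulr_ge0 // addr_ge0 // ler0n.
    have := sqr_ge0 (dlt (latpt a b d) - 1); nra.
  have := ler_wpM2r S0 mR2; have := mulr_ge0 (sqr_ge0 (dlt (latpt a b d))) S0; nra.
rewrite big_mkcond sum_lattice /=.
have -> : sum3 n (fun a b c0 => if [forall l, (latpt a b c0 0%R l <= 2 * J)%N]
     then (u (latpt a b c0) - c) ^+ 2 else 0) =
   sum3 (2 * J).+1 (fun a b c0 => (u (latpt a b c0) - c) ^+ 2).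
  have le : ((2 * J).+1 <= n)%N by clear -nJ J2; lia.
  have fa a b d : (a < n)%N -> (b < n)%N -> (d < n)%N ->
     [forall l, (latpt a b d 0%R l <= 2 * J)%N] = [&& a < (2 * J).+1, b < (2 * J).+1 & d < (2 * J).+1]%N.
    move=> ha hb hd; rewrite !ltnS; apply/forallP/and3P => [h|[h1 h2 h3] l].
      by split; [have := h 0|have := h 1|have := h 2]; rewrite latptE.
    by rewrite latptE //; case: l => -[|[|[|//]]] ?.
  rewrite /sum3.
  rewrite (big_ord_widen n (fun a => \sum_(b < (2 * J).+1) \sum_(d < (2 * J).+1) (u (latpt a b d) - c) ^+ 2) le).
  rewrite [RHS]big_mkcond; apply: eq_bigr => a _; case: ifP => la; last first.
    by rewrite big1 // => b _; rewrite big1 // => d _; rewrite fa // la.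
  rewrite (big_ord_widen n (fun b => \sum_(d < (2 * J).+1) (u (latpt a b d) - c) ^+ 2) le).
  rewrite [RHS]big_mkcond; apply: eq_bigr => b _; case: ifP => lb; last first.
    by rewrite big1 // => d _; rewrite fa // la lb.
  rewrite (big_ord_widen n (fun d => (u (latpt a b d) - c) ^+ 2) le).
  rewrite [RHS]big_mkcond; apply: eq_bigr => d _.
  by rewrite fa // la lb.
apply: le_trans (_ : sum3 (2 * J).+1 (fun a b d => 2 * (p (latpt a b d) - c) ^+ 2 +
   2 * divW unitv W (latpt a b d) ^+ 2) <= _).
  apply: sum3_le => a b d _ _ _; rewrite /p /harm.
  move: (u _) (divW _ _ _) => y z; have := sqr_ge0 (y + z + z - c); nra.
rewrite sum3D !sum3Z.
have d1 : sum3 (2 * J).+1 (fun a b d => divW unitv W (latpt a b d) ^+ 2) <= 3 * en.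
  apply: le_trans (sqsum_divW _ _); rewrite /sqsum sum_lattice.
  have := @sum3_sub R (2 * J).+1 n 0 (fun a b d => divW unitv W (latpt a b d) ^+ 2).
  move=> /(_ (fun a b c => sqr_ge0 _) ltac:(clear -nJ J2; lia)); apply: le_trans.
  by apply: sum3_le => a b d _ _ _; rewrite !addn0.
have B0 : 0 <= B.
  apply: le_trans dB; apply: sumr_ge0 => l _; apply: sumr_ge0 => x _; exact: sqr_ge0.
set T := sum3 (2 * J).+1 _ in Hc *.
have HT : T <= 400 * (400 * (10 * B + (3 * 600 * 101) * en)).
  apply: le_trans Hc _; rewrite ler_wpM2l //; apply: le_trans EQ _.
  by rewrite ler_wpM2l.
have p8 : 10 ^+ 11 = 100 * 100 * 100 * 100 * 100 * 10 :> R by ring.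
rewrite p8; lra.
Qed.

End LatticeNecas.

From mathcomp Require Import all_classical all_reals all_analysis.
From mathcomp Require Import measurable_realfun.
Import numFieldNormedType.Exports.
Local Open Scope classical_set_scope.
Local Open Scope ring_scope.

(** * Lebesgue measure on row vectors *)

Section LebesgueInvariance.
Context (R : realType).
Local Notation lam := (@lebesgue_measure R).
Local Notation T1 := (measurableTypeR R).

Lemma measurable_affine (s u : R) : measurable_fun setT ((fun z => s * z + u) : T1 -> T1).
Proof. exact: measurable_funD. Qed.

(** The pushforward agrees with Lebesgue measure on half-open intervals. Translations and
    reflections of the line generate the maps of determinant 1 and -1 used below. *)
Lemma lebesgue_affine (s u : R) (A : set T1) : s = 1 \/ s = -1 -> measurable A ->
  lam ((fun z => s * z + u) @^-1` A) = lam A.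
Proof.
move=> s1 mA.
have mphi : measurable_fun setT ((fun z => s * z + u) : T1 -> T1) := measurable_affine s u.
have := @lebesgue_measure_unique R (pushforward lam (fun z : T1 => s * z + u : T1)).
move=> /(_ mphi) H; apply/esym; apply: (H _ A mA) => X oX.
change (lam X = lam ((fun z : T1 => s * z + u : T1) @^-1` X)).
move/ocitvP: oX => [->|[[a b] /= ab ->]]; first by rewrite preimage_set0 !measure0.
case: s1 => ->.
- have -> : (fun z : R => 1 * z + u) @^-1` `]a, b] = `]a - u, b - u]%classic.
    by apply/seteqP; split=> z /=; rewrite !in_itv /= mul1r ltrBlDr lerBrDr.
  by rewrite !lebesgue_measure_itv /= !lte_fin ltrD2r; case: ifP => // _; congr (_%:E); ring.
- have -> : (fun z : R => -1 * z + u) @^-1` `]a, b] = `[u - b, u - a[%classic.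
    apply/seteqP; split=> z /=; rewrite !in_itv /= mulN1r => /andP[h1 h2]; apply/andP; split; lra.
  by rewrite !lebesgue_measure_itv /= !lte_fin ltrD2l ltrN2; case: ifP => // _; congr (_%:E); ring.
Qed.

Local Notation R3 := (R3 R).
Local Notation leb3 := (@leb3 R).

Lemma leb3E (A : set R3) :
  leb3 A = (\int[(lam \x lam)%E]_p lam (xsection A p))%E.
Proof. by []. Qed.

Definition mpres (phi : R3 -> R3) : Prop :=
  measurable_fun setT phi /\ forall A, measurable A -> leb3 (phi @^-1` A) = leb3 A.

Lemma mpres_comp f g : mpres f -> mpres g -> mpres (f \o g).
Proof.
move=> [mf Hf] [mg Hg]; split; first exact: measurableT_comp.
move=> A mA; rewrite comp_preimage Hg ?Hf // -[X in measurable X]setTI.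
exact: mf.
Qed.

Lemma mpres_ext f g : f =1 g -> mpres f -> mpres g.
Proof. by move=> /funext ->. Qed.

(** On each vertical line the map is a translation or a reflection; integrate [lebesgue_affine] over
    the base. *)
Lemma mpres_z (s : R) (u : T1 * T1 -> T1) : s = 1 \/ s = -1 -> measurable_fun setT u ->
  mpres (fun p => (p.1, s * p.2 + u p.1)).
Proof.
move=> s1 mu; split.
  apply: measurable_fun_pair => //=.
  apply: measurable_funD; last by apply: measurableT_comp => //.
  by apply: measurable_funM => //.
move=> A mA; rewrite !leb3E; apply: eq_integral => p _.
have mS : measurable (xsection A p) by exact: measurable_xsection.
rewrite -(lebesgue_affine (u p) s1 mS).
by congr (lam _); apply/seteqP; split=> z; rewrite /xsection /= !inE.
Qed.

Lemma measurable_swap : measurable_fun setT (fun p : T1 * T1 => (p.2, p.1)).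
Proof. exact: measurable_fun_pair. Qed.

Lemma lebesgue2_swap (X : set (T1 * T1)) : measurable X ->
  (lam \x lam)%E ((fun p => (p.2, p.1)) @^-1` X) = (lam \x lam)%E X.
Proof.
move=> mX.
have := @product_measure_unique _ _ T1 T1 R lam lam
  (pushforward (lam \x lam)%E (fun p : T1 * T1 => (p.2, p.1))).
move=> /(_ measurable_swap) H; apply/esym; apply: (H _ X mX) => A' B mA' mB.
change ((lam \x lam)%E ((fun p : T1 * T1 => (p.2, p.1)) @^-1` (A' `*` B)) = (lam A' * lam B)%E).
have -> : (fun p : T1 * T1 => (p.2, p.1)) @^-1` (A' `*` B) = B `*` A'.
  by apply/seteqP; split=> -[x y] /= [].
by rewrite product_measure1E // muleC.
Qed.

Lemma mpres_s12 : mpres (fun p => ((p.1.2, p.1.1), p.2)).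
Proof.
have mphi : measurable_fun setT (fun p : R3 => ((p.1.2, p.1.1), p.2) : R3).
  apply: measurable_fun_pair => //=; apply: measurable_fun_pair; exact: measurableT_comp.
split=> // A mA; rewrite !leb3E.
have mF : measurable_fun setT (fun p : T1 * T1 => lam (xsection A p)) by exact: measurable_fun_xsection.
transitivity (\int[pushforward (lam \x lam)%E (fun p : T1 * T1 => (p.2, p.1))]_p lam (xsection A p))%E.
  by rewrite (ge0_integral_pushforward measurable_swap).
apply: eq_measure_integral; first exact: measurable_swap.
by move=> ? X mX _; exact: (lebesgue2_swap mX).
Qed.

(** Tonelli isolates the first coordinate; for fixed first coordinate the claim is
    [lebesgue2_swap]. *)
Lemma mpres_s23 : mpres (fun p => ((p.1.1, p.2), p.1.2)).
Proof.
have mphi : measurable_fun setT (fun p : R3 => ((p.1.1, p.2), p.1.2) : R3).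
  apply: measurable_fun_pair => //=; last exact: measurableT_comp.
  by apply: measurable_fun_pair => //; exact: measurableT_comp.
split=> // A mA; rewrite !leb3E.
have mphiA : measurable ((fun p : R3 => ((p.1.1, p.2), p.1.2) : R3) @^-1` A).
  by rewrite -[X in measurable X]setTI; exact: mphi.
have mA' (x : T1) : measurable [set yz : T1 * T1 | A ((x, yz.1), yz.2)].
  have mx : measurable_fun setT (fun yz : T1 * T1 => ((x, yz.1), yz.2) : R3).
    by apply: measurable_fun_pair => //; apply: measurable_fun_pair.
  by rewrite -[X in measurable X]setTI; exact: mx.
have E X : measurable X -> (\int[(lam \x lam)%E]_p lam (xsection X p) =
    \int[lam]_x \int[lam]_y lam (xsection X (x, y)))%E.
  move=> mX; rewrite (fubini_tonelli1 (fun p : T1 * T1 => lam (xsection X p))) //.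
  exact: measurable_fun_xsection.
rewrite (E _ mA) (E _ mphiA).
apply: eq_integral => x _.
transitivity ((lam \x lam)%E ((fun p => (p.2, p.1)) @^-1` [set yz : T1 * T1 | A ((x, yz.1), yz.2)])).
  by apply: eq_integral => y _; congr (lam _); apply/seteqP; split=> z; rewrite /xsection /= !inE.
by rewrite lebesgue2_swap.
Qed.

End LebesgueInvariance.

Lemma ord3P (P : 'I_3 -> Prop) : P 0 -> P 1 -> P 2 -> forall i, P i.
Proof.
move=> p0 p1 p2 [[|[|[|//]]] p].
- by rewrite (_ : Ordinal p = 0) //; apply: val_inj.
- by rewrite (_ : Ordinal p = 1) //; apply: val_inj.
- by rewrite (_ : Ordinal p = 2) //; apply: val_inj.
Qed.

Lemma sum_ord3 (V : nmodType) (f : 'I_3 -> V) : \sum_i f i = f 0 + f 1 + f 2.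
Proof.
rewrite !big_ord_recl big_ord0 addr0 addrA; congr (_ + f _ + f _); exact: val_inj.
Qed.

(** * Row vectors: norms, measurable sets and functions *)

Section Vec3.
Context (R : realType).
Local Notation E3 := 'rV[R]_3.
Local Notation R3 := (R3 R).
Local Notation leb3 := (@leb3 R).
Local Notation vec3 := (@vec3 R).
Local Notation T1 := (measurableTypeR R).
Local Notation lam := (@lebesgue_measure R).
Implicit Types (x y u v w : E3) (A B D : set E3) (f g : E3 -> R).

Lemma vec3E (p : R3) : [/\ vec3 p 0 0 = p.1.1, vec3 p 0 1 = p.1.2 & vec3 p 0 2 = p.2].
Proof. by rewrite /vec3 !mxE. Qed.

Definition unvec x : R3 := ((x 0 0, x 0 1), x 0 2).

Lemma unvecK x : vec3 (unvec x) = x.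
Proof. by apply/rowP; apply: ord3P; rewrite /vec3 mxE. Qed.

Lemma vec3K (p : R3) : unvec (vec3 p) = p.
Proof. by case: p => [[a b] c]; rewrite /unvec; case: (vec3E (a, b, c)) => -> -> ->. Qed.

Lemma dotE v w : dot v w = v 0 0 * w 0 0 + v 0 1 * w 0 1 + v 0 2 * w 0 2.
Proof. by rewrite /dot sum_ord3. Qed.

Lemma dotC v w : dot v w = dot w v.
Proof. by apply: eq_bigr => i _; rewrite mulrC. Qed.

Lemma dotDr u v w : dot u (v + w) = dot u v + dot u w.
Proof. by rewrite -big_split; apply: eq_bigr => i _; rewrite mxE mulrDr. Qed.

Lemma dotZr u (c : R) v : dot u (c *: v) = c * dot u v.
Proof. by rewrite mulr_sumr; apply: eq_bigr => i _; rewrite mxE mulrCA. Qed.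

Lemma dotNr u v : dot u (- v) = - dot u v.
Proof. by rewrite -scaleN1r dotZr mulN1r. Qed.

Lemma dotBr u v w : dot u (v - w) = dot u v - dot u w.
Proof. by rewrite dotDr dotNr. Qed.

Lemma dot0r u : dot u 0 = 0.
Proof. by rewrite -(scale0r 0) dotZr mul0r. Qed.

Lemma dotDl u v w : dot (u + v) w = dot u w + dot v w.
Proof. by rewrite !(dotC _ w) dotDr. Qed.

Lemma dotZl (c : R) u v : dot (c *: u) v = c * dot u v.
Proof. by rewrite !(dotC _ v) dotZr. Qed.

Lemma dotBl u v w : dot (u - v) w = dot u w - dot v w.
Proof. by rewrite !(dotC _ w) dotBr. Qed.

Lemma dot0l u : dot 0 u = 0.
Proof. by rewrite dotC dot0r. Qed.

Lemma dot_sumr (I : finType) (P : pred I) u (F : I -> E3) :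
  dot u (\sum_(i | P i) F i) = \sum_(i | P i) dot u (F i).
Proof. by elim/big_rec2: _ => [|i a b _ <-]; rewrite ?dot0r ?dotDr. Qed.

Lemma dot_ge0 u : 0 <= dot u u.
Proof. by apply: sumr_ge0 => i _; rewrite -expr2 sqr_ge0. Qed.

Lemma dot_delta v j : dot v (delta_mx 0 j) = v 0 j.
Proof.
rewrite /dot (bigD1 j) //= mxE !eqxx mulr1 big1 ?addr0 // => i ij.
by rewrite mxE (negbTE ij) andbF mulr0.
Qed.

Lemma norm_coord x j : `|x 0 j| <= `|x|.
Proof.
by rewrite [leRHS]/Num.norm /= mx_normrE; apply/bigmax_geP; right => /=; exists (0, j).
Qed.

Lemma norm_le x (M : R) : 0 <= M -> (forall j, `|x 0 j| <= M) -> `|x| <= M.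
Proof.
move=> M0 h; rewrite [leLHS]/Num.norm /= mx_normrE; apply/bigmax_leP; split => // -[i j] _ /=.
by rewrite (ord1 i).
Qed.

Lemma norm_lt x (M : R) : 0 < M -> (forall j, `|x 0 j| < M) -> `|x| < M.
Proof.
move=> M0 h; rewrite [ltLHS]/Num.norm /= mx_normrE; apply/bigmax_ltP; split => // -[i j] _ /=.
by rewrite (ord1 i).
Qed.

Lemma dot_le v w : `|dot v w| <= 3 * `|v| * `|w|.
Proof.
apply: le_trans (ler_norm_sum _ _ _) _.
apply: le_trans (_ : \sum_(i < 3) `|v| * `|w| <= _).
  by apply: ler_sum => i _; rewrite normrM ler_pM ?norm_coord.
by rewrite sumr_const card_ord -[leLHS]mulr_natl mulrA.
Qed.

Lemma enorm_ge x : `|x| <= enorm x.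
Proof.
apply: norm_le => [|j]; first exact: sqrtr_ge0.
rewrite -sqrtr_sqr ler_sqrt ?dot_ge0 // /dot (bigD1 j) //= -expr2 lerDl.
by apply: sumr_ge0 => i _; rewrite -expr2 sqr_ge0.
Qed.

Lemma enorm_le x : enorm x <= 2 * `|x|.
Proof.
have h : dot x x <= (2 * `|x|) ^+ 2.
  rewrite dotE exprMn.
  have s j : x 0 j * x 0 j <= `|x| ^+ 2.
    by rewrite -expr2 -[leLHS]ger0_norm ?sqr_ge0 // normrX lerXn2r ?nnegrE ?norm_coord.
  have := s 0; have := s 1; have := s 2; have := sqr_ge0 `|x|; lra.
by rewrite -[leRHS]ger0_norm ?mulr_ge0 // -sqrtr_sqr ler_sqrt // sqr_ge0.
Qed.

Definition mset A : Prop := measurable (vec3 @^-1` A : set R3).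
Definition mfn f : Prop := measurable_fun setT (f \o vec3 : R3 -> T1).
Definition bdd D f : Prop := exists M, forall x, D x -> `|f x| <= M.
Definition finv A : Prop := (leb3 (vec3 @^-1` A) < +oo)%E.
Definition vol A : R := fine (leb3 (vec3 @^-1` A)).

Lemma mfn_coord j : mfn (fun x => x 0 j).
Proof.
rewrite /mfn; move: j; apply: ord3P.
- rewrite (_ : _ \o _ = (fun p : R3 => p.1.1)); first exact: measurableT_comp.
  by apply/funext => p; case: (vec3E p).
- rewrite (_ : _ \o _ = (fun p : R3 => p.1.2)); first exact: measurableT_comp.
  by apply/funext => p; case: (vec3E p).
- rewrite (_ : _ \o _ = (fun p : R3 => p.2)); first exact: measurable_snd.
  by apply/funext => p; case: (vec3E p).
Qed.

Lemma mfn_ext f g : f =1 g -> mfn f -> mfn g.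
Proof. by move=> /funext ->. Qed.

Lemma mfn_cst c : mfn (fun=> c).
Proof. exact: measurable_cst. Qed.

Lemma mfnD f g : mfn f -> mfn g -> mfn (fun x => f x + g x).
Proof. exact: measurable_funD. Qed.

Lemma mfnM f g : mfn f -> mfn g -> mfn (fun x => f x * g x).
Proof. exact: measurable_funM. Qed.

Lemma mfn_sum (I : Type) (s : seq I) (F : I -> E3 -> R) :
  (forall i, mfn (F i)) -> mfn (fun x => \sum_(i <- s) F i x).
Proof.
move=> h; elim: s => [|i s IH].
  by apply: mfn_ext (mfn_cst 0) => x; rewrite big_nil.
by apply: mfn_ext (mfnD (h i) IH) => x; rewrite big_cons.
Qed.

Lemma mfn_dot v : mfn (dot v).
Proof. by apply: mfn_sum => i; apply: mfnM; [exact: mfn_cst|exact: mfn_coord]. Qed.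

Lemma mset_ge f (c : R) : mfn f -> mset [set x | c <= f x].
Proof.
move=> mf; have := mf measurableT `[c, +oo[%classic (measurable_itv _); rewrite setTI.
congr measurable; apply/seteqP; split=> p /=; rewrite in_itv /= andbT //.
Qed.

Lemma mset_gt f (c : R) : mfn f -> mset [set x | c < f x].
Proof.
move=> mf; have := mf measurableT `]c, +oo[%classic (measurable_itv _); rewrite setTI.
congr measurable; apply/seteqP; split=> p /=; rewrite in_itv /= andbT //.
Qed.

Lemma msetI A B : mset A -> mset B -> mset (A `&` B).
Proof. exact: measurableI. Qed.

Lemma msetU A B : mset A -> mset B -> mset (A `|` B).
Proof. exact: measurableU. Qed.

Lemma msetD A B : mset A -> mset B -> mset (A `\` B).
Proof. exact: measurableD. Qed.

Lemma msetC A : mset A -> mset (~` A).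
Proof. exact: measurableC. Qed.

Lemma mset_forall (I : finType) (F : I -> set E3) :
  (forall i, mset (F i)) -> mset [set x | forall i, F i x].
Proof.
move=> h; rewrite /mset (_ : _ @^-1` _ = \bigcap_(i in [set: I]) (vec3 @^-1` (F i))).
  by apply: fin_bigcap_measurable => [|i _]; [exact: finite_finset|exact: h].
by apply/seteqP; split=> p /= H i; [move=> _; exact: H|exact: (H i Logic.I)].
Qed.

Lemma mset_exists (I : finType) (F : I -> set E3) :
  (forall i, mset (F i)) -> mset [set x | exists i, F i x].
Proof.
move=> h; rewrite /mset (_ : _ @^-1` _ = \bigcup_(i in [set: I]) (vec3 @^-1` (F i))).
  by apply: fin_bigcup_measurable => [|i _]; [exact: finite_finset|exact: h].
by apply/seteqP; split=> p /= -[i]; [move=> H|move=> _ H]; exists i.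
Qed.

Lemma ballE3 x (e : R) y : ball x e y <-> `|x - y| < e.
Proof. by rewrite mx_norm_ball. Qed.

Lemma openE3 A x : open A -> A x -> exists2 e, 0 < e & forall y, `|x - y| < e -> A y.
Proof.
rewrite openE => oA /oA; rewrite /interior => /nbhs_ballP[e /= e0 he].
by exists e => // y /ballE3 /he.
Qed.

(** An open set is the union of the countably many rational cubes that it contains. *)
Lemma mset_open A : open A -> mset A.
Proof.
move=> oA.
pose I := (rat * rat * rat * rat)%type.
pose ctr (i : I) : E3 := vec3 (ratr i.1.1.1, ratr i.1.1.2, ratr i.1.2).
pose B (i : I) : set E3 := [set y | forall j, `|y 0 j - ctr i 0 j| < ratr i.2].
pose F (i : I) : set E3 := [set y | B i y /\ B i `<=` A].
have mB i : mset (B i).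
  apply: mset_forall => j.
  have E : [set x : E3 | `|x 0 j - ctr i 0 j| < ratr i.2] =
     [set x | - ratr i.2 < x 0 j - ctr i 0 j] `&` [set x | - ratr i.2 < - (x 0 j) + ctr i 0 j].
    by apply/seteqP; split=> x /=; rewrite ltr_norml; [move=> /andP[]|move=> []] => *;
      [split|apply/andP; split]; lra.
  suff: mset ([set x | - ratr i.2 < x 0 j - ctr i 0 j] `&` [set x | - ratr i.2 < - (x 0 j) + ctr i 0 j]).
    by rewrite -E.
  apply: msetI; apply: mset_gt; apply: mfnD; try exact: mfn_cst; first exact: mfn_coord.
  apply: (@mfn_ext (fun x => -1 * x 0 j)); first by move=> x; rewrite mulN1r.
  by apply: mfnM; [exact: mfn_cst|exact: mfn_coord].
have mF i : mset (F i).
  rewrite /F; have [BA|nBA] := pselect (B i `<=` A).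
    by rewrite (_ : [set y | _] = B i) //; apply/seteqP; split=> y //= [].
  rewrite (_ : [set y | _] = set0); first exact: measurable0.
  by apply/seteqP; split=> y //= [].
have -> : A = [set y | exists i, F i y].
  apply/seteqP; split=> x /=; last by case=> i [Bx BA]; exact: BA.
  move=> Ax; have [e e0 he] := openE3 oA Ax.
  have [r /andP[r0 re]] : exists r : rat, 0 < (ratr r : R) < e / 2.
    have e2 : 0 < e / 2 by rewrite divr_gt0.
    by have [r] := rat_in_itvoo e2; rewrite in_itv /= => h; exists r.
  have cl j : exists s : rat, `|x 0 j - ratr s| < ratr r.
    have : x 0 j - ratr r < x 0 j + ratr r by lra.
    move=> /rat_in_itvoo[s]; rewrite in_itv /= => h; exists s.
    by rewrite ltr_norml; lra.
  have [s0 h0] := cl 0; have [s1 h1] := cl 1; have [s2 h2] := cl 2.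
  have [c0 c1 c2] := vec3E (ratr s0, ratr s1, ratr s2 : R).
  exists (s0, s1, s2, r); split.
    by apply: ord3P; rewrite /ctr /= ?c0 ?c1 ?c2.
  move=> y By; apply: he.
  apply: norm_lt => // j; rewrite !mxE.
  have := By j; have : `|x 0 j - ctr (s0, s1, s2, r) 0 j| < ratr r.
    by move: j {By}; apply: ord3P; rewrite /ctr /= ?c0 ?c1 ?c2.
  rewrite /= !ltr_norml; lra.
rewrite /mset (_ : _ @^-1` _ = \bigcup_i (vec3 @^-1` (F i))); last first.
  by apply/seteqP; split=> p /= [i]; [move=> h; exists i|move=> _ h; exists i].
by apply: countable_bigcupT_measurable => //; exact: countableP.
Qed.

End Vec3.

(** * Integrals of bounded functions and measure-preserving maps *)

Section Integral3.
Context (R : realType).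
Local Notation E3 := 'rV[R]_3.
Local Notation R3 := (R3 R).
Local Notation leb3 := (@leb3 R).
Local Notation vec3 := (@vec3 R).
Local Notation unvec := (@unvec R).
Local Notation T1 := (measurableTypeR R).
Local Notation lam := (@lebesgue_measure R).
Implicit Types (x y u v w : E3) (A B D : set E3) (f g : E3 -> R).

(** A class of integrands, stable under sums, products and restriction, in which integrability is
    automatic. Measurability is asked on the whole space, so that restricting [D] or composing with
    a map leaves it intact. *)
Definition nice D f : Prop := [/\ mset D, finv D, mfn f & bdd D f].

Lemma nice_integrable D f : nice D f ->
  leb3.-integrable (vec3 @^-1` D) (EFin \o (f \o vec3)).
Proof.
move=> [mD fD mf [M bf]]; apply: measurable_bounded_integrable => //.
  exact: measurable_funTS.
exists `|M|; split; first exact: num_real.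
move=> c Mc p Dp; apply: le_trans (bf _ Dp) _.
exact: le_trans (ler_norm M) (ltW Mc).
Qed.

Lemma nice_cst D c : mset D -> finv D -> nice D (fun=> c).
Proof. by move=> mD fD; split => //; [exact: mfn_cst|exists `|c|]. Qed.

Lemma niceD D f g : nice D f -> nice D g -> nice D (fun x => f x + g x).
Proof.
move=> [mD fD mf [M bf]] [_ _ mg [M' bg]]; split => //; first exact: mfnD.
exists (M + M') => x Dx; apply: le_trans (ler_normD _ _) _.
by rewrite lerD ?bf ?bg.
Qed.

Lemma niceM D f g : nice D f -> nice D g -> nice D (fun x => f x * g x).
Proof.
move=> [mD fD mf [M bf]] [_ _ mg [M' bg]]; split => //; first exact: mfnM.
by exists (M * M') => x Dx; rewrite normrM ler_pM ?bf ?bg.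
Qed.

Lemma niceZ D c f : nice D f -> nice D (fun x => c * f x).
Proof. by move=> nf; case: (nf) => mD fD _ _; apply: niceM => //; exact: nice_cst. Qed.

Lemma niceB D f g : nice D f -> nice D g -> nice D (fun x => f x - g x).
Proof.
move=> nf /(niceZ (-1)) ng; have := niceD nf ng.
by rewrite (_ : (fun x => f x + _) = fun x => f x - g x) //; apply/funext => x; rewrite mulN1r.
Qed.

Lemma nice_sq D f : nice D f -> nice D (fun x => f x ^+ 2).
Proof. by move=> nf; exact: niceM. Qed.

Lemma finvS A B : mset A -> mset B -> A `<=` B -> finv B -> finv A.
Proof.
move=> mA mB AB; apply: le_lt_trans; apply: le_measure; rewrite ?inE //.
by move=> p; exact: AB.
Qed.

Lemma niceS A B f : mset A -> A `<=` B -> nice B f -> nice A f.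
Proof.
move=> mA AB [mB fB mf [M bf]]; split => //; first exact: finvS AB fB.
by exists M => x /AB; exact: bf.
Qed.

Lemma nice_sum (I : Type) (s : seq I) D (F : I -> E3 -> R) : mset D -> finv D ->
  (forall i, nice D (F i)) -> nice D (fun x => \sum_(i <- s) F i x).
Proof.
move=> mD fD nF; elim: s => [|i s IH].
  by have := nice_cst 0 mD fD; congr nice; apply/funext => x; rewrite big_nil.
by have := niceD (nF i) IH; congr nice; apply/funext => x; rewrite big_cons.
Qed.

Lemma eq_int3 D f g : (forall x, D x -> f x = g x) -> int3 D f = int3 D g.
Proof. by move=> fg; apply: eq_Rintegral => p; rewrite inE => /fg. Qed.

Lemma int3D D f g : nice D f -> nice D g ->
  int3 D (fun x => f x + g x) = int3 D f + int3 D g.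
Proof.
move=> nf ng; case: (nf) => mD _ _ _.
by rewrite /int3 RintegralD //; exact: nice_integrable.
Qed.

Lemma int3Z D c f : nice D f -> int3 D (fun x => c * f x) = c * int3 D f.
Proof.
by move=> nf; case: (nf) => mD _ _ _; rewrite /int3 RintegralZl //; exact: nice_integrable.
Qed.

Lemma int3B D f g : nice D f -> nice D g ->
  int3 D (fun x => f x - g x) = int3 D f - int3 D g.
Proof.
move=> nf ng; case: (nf) => mD _ _ _.
by rewrite /int3 RintegralB //; exact: nice_integrable.
Qed.

Lemma int3_cst D c : mset D -> int3 D (fun=> c) = c * vol D.
Proof. by move=> mD; rewrite /int3 Rintegral_cst. Qed.

Lemma int3_sum (I : Type) (s : seq I) D (F : I -> E3 -> R) : mset D -> finv D ->
  (forall i, nice D (F i)) ->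
  int3 D (fun x => \sum_(i <- s) F i x) = \sum_(i <- s) int3 D (F i).
Proof.
move=> mD fD nF; elim: s => [|i s IH].
  rewrite big_nil (@eq_int3 D _ (fun=> 0)) ?int3_cst ?mul0r // => x _.
  by rewrite big_nil.
rewrite big_cons -IH -int3D //; last exact: nice_sum.
by apply: eq_int3 => x _; rewrite big_cons.
Qed.

Lemma int3_le D f g : nice D f -> nice D g -> (forall x, D x -> f x <= g x) ->
  int3 D f <= int3 D g.
Proof.
move=> nf ng fg; case: (nf) => mD _ _ _.
apply: le_Rintegral => //; try exact: nice_integrable.
by move=> p; exact: fg.
Qed.

Lemma int3_ge0 D f : (forall x, D x -> 0 <= f x) -> 0 <= int3 D f.
Proof. by move=> f0; apply: Rintegral_ge0 => p; exact: f0. Qed.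

Lemma int3_le_cst D f c : nice D f -> (forall x, D x -> f x <= c) ->
  int3 D f <= c * vol D.
Proof.
move=> nf fc; case: (nf) => mD fD _ _; rewrite -int3_cst //.
by apply: int3_le => //; exact: nice_cst.
Qed.

Lemma int3_norm_le D f c : nice D f -> (forall x, D x -> `|f x| <= c) ->
  `|int3 D f| <= c * vol D.
Proof.
move=> nf fc; rewrite ler_norml; apply/andP; split; last first.
  by apply: int3_le_cst => // x /fc; exact: le_trans (ler_norm _).
rewrite lerNl -[- int3 D f]mulN1r -int3Z //; apply: int3_le_cst; first exact: niceZ.
by move=> x /fc; rewrite mulN1r; apply: le_trans; rewrite -normrN ler_norm.
Qed.

Lemma int3U A B f : mset A -> mset B -> A `&` B = set0 -> nice (A `|` B) f ->
  int3 (A `|` B) f = int3 A f + int3 B f.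
Proof.
move=> mA mB AB nf; rewrite /int3 preimage_setU Rintegral_setU //.
  by have := nice_integrable nf.
by apply/disj_setPS; rewrite -preimage_setI AB preimage_set0.
Qed.

Lemma int3_null D N f : mset N -> vol N = 0 -> finv N -> nice D f ->
  int3 D f = int3 (D `\` N) f.
Proof.
move=> mN vN fN nf; case: (nf) => mD fD _ _.
rewrite /int3 /Rintegral (@negligible_integral _ _ _ _ _ (vec3 @^-1` N)) //.
  by have := nice_integrable nf.
by rewrite -[LHS]fineK ?ge0_fin_numE // -/(vol N) vN.
Qed.

Lemma vol_ge0 A : 0 <= vol A.
Proof. exact: fine_ge0. Qed.

Lemma volS A B : mset A -> mset B -> A `<=` B -> finv B -> vol A <= vol B.
Proof.
move=> mA mB AB fB; apply: fine_le.
- by rewrite ge0_fin_numE //; exact: finvS AB fB.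
- by rewrite ge0_fin_numE.
- by apply: le_measure; rewrite ?inE // => p; exact: AB.
Qed.

Lemma int3S A B f : mset A -> A `<=` B -> nice B f -> (forall x, B x -> 0 <= f x) ->
  int3 A f <= int3 B f.
Proof.
move=> mA AB nf f0; case: (nf) => mB _ _ _.
have -> : B = A `|` (B `\` A) by rewrite setDUK.
rewrite int3U //; first by rewrite lerDl int3_ge0 // => x [/f0].
- exact: msetD.
- by apply/seteqP; split=> x // -[h []].
- by rewrite setDUK.
Qed.

(** Induction on the list: split off the part of [D] in the first set, the rest is covered by the
    others. *)
Lemma int3_cover (I : Type) (s : seq I) (P : I -> set E3) D f :
  mset D -> (forall i, mset (P i)) -> nice D f -> (forall x, D x -> 0 <= f x) ->
  (forall x, D x -> exists2 i, List.In i s & P i x) ->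
  int3 D f <= \sum_(i <- s) int3 (D `&` P i) f.
Proof.
move=> mD mP; elim: s D mD => [|i s IH] D mD nf f0 cov.
  rewrite big_nil (_ : D = set0).
    by rewrite /int3 preimage_set0 Rintegral_set0.
  by apply/seteqP; split=> x // /cov[].
rewrite big_cons (_ : D = (D `&` P i) `|` (D `\` P i)); last first.
  by rewrite setUIDK.
have mDP : mset (D `&` P i) by exact: msetI.
have mDD : mset (D `\` P i) by exact: msetD.
rewrite int3U //; last 2 first.
- by apply/seteqP; split=> x // -[[_ h] []].
- by rewrite setUIDK.
rewrite setUIDK lerD2l.
apply: le_trans (IH (D `\` P i) mDD _ _ _) _.
- by apply: niceS nf => // x [].
- by move=> x [/f0].
- by move=> x [Dx nP]; case: (cov x Dx) => j [<-//|js Pj]; exists j.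
apply: ler_sum => j _; apply: int3S.
- exact: msetI.
- by move=> x [[]].
- by apply: niceS nf => [|x []//]; exact: msetI.
- by move=> x [/f0].
Qed.

Definition mp3 (psi : E3 -> E3) : Prop := mpres (unvec \o psi \o vec3).

Lemma mp3_comp (f g : E3 -> E3) : mp3 f -> mp3 g -> mp3 (f \o g).
Proof.
move=> mf mg; apply: mpres_ext (mpres_comp mf mg) => p /=.
by rewrite unvecK.
Qed.

Lemma mp3_ext (f g : E3 -> E3) : f =1 g -> mp3 f -> mp3 g.
Proof. by move=> /funext ->. Qed.

Lemma mp3_pre psi A : vec3 @^-1` (psi @^-1` A) =
  (unvec \o psi \o vec3) @^-1` (vec3 @^-1` A).
Proof. by apply/seteqP; split=> p /=; rewrite unvecK. Qed.

Lemma mset_mp3 psi A : mp3 psi -> mset A -> mset (psi @^-1` A).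
Proof.
by move=> [mpsi _] mA; rewrite /mset mp3_pre -[X in measurable X]setTI; exact: mpsi.
Qed.

Lemma leb3_mp3 psi A : mp3 psi -> mset A ->
  leb3 (vec3 @^-1` (psi @^-1` A)) = leb3 (vec3 @^-1` A).
Proof. by move=> [_ h] mA; rewrite mp3_pre h. Qed.

Lemma vol_mp3 psi A : mp3 psi -> mset A -> vol (psi @^-1` A) = vol A.
Proof. by move=> mp mA; rewrite /vol leb3_mp3. Qed.

Lemma nice_mp3 psi D f : mp3 psi -> nice D f -> nice (psi @^-1` D) (f \o psi).
Proof.
move=> mp [mD fD mf [M bf]]; split; first exact: mset_mp3.
- by rewrite /finv leb3_mp3.
- rewrite /mfn (_ : _ \o vec3 = (f \o vec3) \o (unvec \o psi \o vec3)).
    by case: mp => mpsi _; exact: measurableT_comp.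
  by apply/funext => p /=; rewrite unvecK.
- by exists M => x /= /bf.
Qed.

Lemma int3_mp3 psi D f : mp3 psi -> nice D f ->
  int3 (psi @^-1` D) (f \o psi) = int3 D f.
Proof.
move=> mp nf; case: (nf) => mD fD mf bf; case: (mp) => mpsi hpsi.
have ni := nice_integrable (nice_mp3 mp nf).
rewrite /int3 /Rintegral; congr fine.
transitivity (\int[pushforward leb3 (unvec \o psi \o vec3)]_(y in vec3 @^-1` D) (f (vec3 y))%:E)%E.
  have E : (fun y : R3 => (f (vec3 y))%:E) \o (unvec \o psi \o vec3) = EFin \o ((f \o psi) \o vec3).
    by apply/funext => p /=; rewrite unvecK.
  rewrite (integral_pushforward mpsi); first by rewrite -mp3_pre E.
  - exact/measurable_EFinP.
  - by rewrite -mp3_pre E.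
  - exact: mD.
by apply: eq_measure_integral => X mX _; exact: hpsi.
Qed.

(** The determinant of the linear part is [1 + a 0 j]. For the last coordinate the claim is
    [mpres_z]; exchanges of coordinates conjugate the other two cases to it. *)
Lemma mp3_affine j (a : E3) (b : R) : 1 + a 0 j = 1 \/ 1 + a 0 j = -1 ->
  mp3 (fun x => x + (dot a x + b) *: delta_mx 0 j).
Proof.
have mz (a' : E3) b' : 1 + a' 0 2 = 1 \/ 1 + a' 0 2 = -1 ->
    mp3 (fun x => x + (dot a' x + b') *: delta_mx 0 2).
  move=> h.
  have mu : measurable_fun setT (fun p : T1 * T1 => a' 0 0 * p.1 + a' 0 1 * p.2 + b').
    apply: measurable_funD => //; apply: measurable_funD; exact: measurable_funM.
  apply: mpres_ext (mpres_z h mu) => p /=.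
  rewrite /unvec !mxE dotE; case: (vec3E p) => -> -> ->; rewrite !eqxx /=.
  by case: p => [[p1 p2] p3] /=; congr (_, _, _); ring.
pose S12 x : E3 := vec3 (x 0 1, x 0 0, x 0 2).
pose S23 x : E3 := vec3 (x 0 0, x 0 2, x 0 1).
have mS12 : mp3 S12.
  apply: mpres_ext (mpres_s12 R) => p /=; rewrite vec3K.
  by case: (vec3E p) => -> -> ->.
have mS23 : mp3 S23.
  apply: mpres_ext (mpres_s23 R) => p /=; rewrite vec3K.
  by case: (vec3E p) => -> -> ->.
have my (a' : E3) b' : 1 + a' 0 1 = 1 \/ 1 + a' 0 1 = -1 ->
    mp3 (fun x => x + (dot a' x + b') *: delta_mx 0 1).
  move=> h; have h' : 1 + S23 a' 0 2 = 1 \/ 1 + S23 a' 0 2 = -1.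
    by rewrite /S23; case: (vec3E (a' 0 0, a' 0 2, a' 0 1)) => _ _ ->.
  apply: mp3_ext (mp3_comp mS23 (mp3_comp (mz _ b' h') mS23)) => x /=.
  apply/rowP; apply: ord3P; rewrite /S23 !dotE !mxE /=; ring.
move: j; apply: ord3P => h; [|exact: my|exact: mz].
have h' : 1 + S12 a 0 1 = 1 \/ 1 + S12 a 0 1 = -1.
  by rewrite /S12; case: (vec3E (a 0 1, a 0 0, a 0 2)) => _ -> _.
apply: mp3_ext (mp3_comp mS12 (mp3_comp (my _ b h') mS12)) => x /=.
apply/rowP; apply: ord3P; rewrite /S12 !dotE !mxE /=; ring.
Qed.

Lemma mp3_translate v : mp3 (fun x => x + v).
Proof.
have t j (b : R) : mp3 (fun x => x + (dot 0 x + b) *: delta_mx 0 j).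
  by apply: mp3_affine; rewrite mxE addr0; left.
apply: mp3_ext (mp3_comp (t 0 (v 0 0)) (mp3_comp (t 1 (v 0 1)) (t 2 (v 0 2)))) => x /=.
rewrite !dot0l !add0r; apply/rowP; apply: ord3P; rewrite !mxE /=; ring.
Qed.

End Integral3.

(** * Cubes, null planes, oblique reflections *)

Section Volumes.
Context (R : realType).
Local Notation E3 := 'rV[R]_3.
Local Notation R3 := (R3 R).
Local Notation leb3 := (@leb3 R).
Local Notation vec3 := (@vec3 R).
Local Notation T1 := (measurableTypeR R).
Local Notation lam := (@lebesgue_measure R).
Implicit Types (x y u v w : E3) (A B D : set E3) (f g : E3 -> R).

Definition cbox (c : E3) (r : R) : set E3 := [set x | `|x - c| <= r].

Lemma cboxE c r : 0 <= r -> vec3 @^-1` (cbox c r) =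
  (`[c 0 0 - r, c 0 0 + r] `*` `[c 0 1 - r, c 0 1 + r]) `*` `[c 0 2 - r, c 0 2 + r].
Proof.
move=> r0; apply/seteqP; split=> p /=; have [v0 v1 v2] := vec3E p.
  move=> h; have hj j : `|vec3 p 0 j - c 0 j| <= r.
    by apply: le_trans h; have := norm_coord (vec3 p - c) j; rewrite !mxE.
  move: (hj 0) (hj 1) (hj 2); rewrite v0 v1 v2 !ler_norml !in_itv /=.
  by move=> /andP[? ?] /andP[? ?] /andP[? ?]; do ! split; apply/andP; split; lra.
rewrite !in_itv /= => -[[/andP[? ?] /andP[? ?]] /andP[? ?]].
apply: norm_le => //; apply: ord3P; rewrite !mxE ler_norml /=; apply/andP; split; lra.
Qed.

Lemma leb3_cbox c r : 0 <= r -> leb3 (vec3 @^-1` (cbox c r)) = ((2 * r) ^+ 3)%:E.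
Proof.
move=> r0; rewrite cboxE //; rewrite -[LHS]/(((lam \x lam)%E \x lam)%E _).
rewrite product_measure1E //; last exact: measurableX.
have itv (a : R) : lam (`[a - r, a + r]%classic : set T1) = (2 * r)%:E.
  rewrite lebesgue_measure_itv /= lte_fin; case: ifP => [_|].
    by rewrite -EFinD; congr (_%:E); ring.
  move/negbT; rewrite -leNgt => h; congr (_%:E); lra.
transitivity (((2 * r)%:E * (2 * r)%:E) * (2 * r)%:E)%E; last first.
  by rewrite -!EFinM; congr (_%:E); ring.
congr (_ * _)%E; last exact: itv.
rewrite -[LHS]/((lam \x lam)%E (_ `*` _)).
rewrite product_measure1E //; congr (_ * _)%E; exact: itv.
Qed.

Lemma mset_cbox c r : 0 <= r -> mset (cbox c r).
Proof.
by move=> r0; rewrite /mset cboxE //; apply: measurableX => //; exact: measurableX.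
Qed.

Lemma finv_cbox c r : 0 <= r -> finv (cbox c r).
Proof. by move=> r0; rewrite /finv leb3_cbox // ltry. Qed.

Lemma vol_cbox c r : 0 <= r -> vol (cbox c r) = (2 * r) ^+ 3.
Proof. by move=> r0; rewrite /vol leb3_cbox. Qed.

Lemma finv_bounded A (M : R) : mset A -> (forall x, A x -> `|x| <= M) -> finv A.
Proof.
move=> mA h; apply: (@finvS _ _ (cbox 0 `|M|)) => //.
- exact: mset_cbox.
- by move=> x /h; rewrite /cbox /= subr0 => h1; exact: le_trans h1 (ler_norm _).
- exact: finv_cbox.
Qed.

Lemma vol_gt0 A c r : mset A -> finv A -> 0 < r -> (forall x, `|x - c| <= r -> A x) ->
  (2 * r) ^+ 3 <= vol A.
Proof.
move=> mA fA r0 h; rewrite -(@vol_cbox c r (ltW r0)).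
by apply: volS => //; apply: mset_cbox; exact: ltW.
Qed.

Lemma vol_small A c r : mset A -> 0 <= r -> (forall x, A x -> `|x - c| <= r) ->
  vol A <= (2 * r) ^+ 3.
Proof.
move=> mA r0 h; rewrite -(@vol_cbox c r r0).
by apply: volS => //; [exact: mset_cbox|exact: finv_cbox].
Qed.

Definition plane (a : E3) (b : R) : set E3 := [set x | dot a x = b].

Lemma mset_plane a b : mset (plane a b).
Proof.
have -> : plane a b = [set x | b <= dot a x] `\` [set x | b < dot a x].
  apply/seteqP; split=> x; rewrite /plane /=.
    by move=> ->; split => //; rewrite ltxx.
  by move=> [h /negP]; rewrite -leNgt => h'; apply/eqP; rewrite eq_le h'.
by apply: msetD; [apply: mset_ge|apply: mset_gt]; exact: mfn_dot.
Qed.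

(** If the last coefficient is nonzero, each vertical line meets the plane in one point. Otherwise a
    measure-preserving shear makes it nonzero. *)
Lemma leb3_plane a b : a != 0 -> leb3 (vec3 @^-1` (plane a b)) = 0%E.
Proof.
have H2 (c : E3) : c 0 2 != 0 -> leb3 (vec3 @^-1` (plane c b)) = 0%E.
  move=> c2; rewrite leb3E; apply: integral0_eq => p _.
  rewrite (_ : xsection _ _ = [set (b - c 0 0 * p.1 - c 0 1 * p.2) / c 0 2]).
    exact: lebesgue_measure_set1.
  apply/seteqP; split=> z; rewrite /xsection /= inE /plane /= dotE;
    have [-> -> ->] := vec3E (p, z) => /=.
    by move=> <-; field.
  by move=> ->; field.
move=> a0; have [a2|/negPn/eqP a2] := boolP (a 0 2 != 0); first exact: H2.
have [j aj] : exists j, a 0 j != 0.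
  apply: contrapT => h; move/eqP: a0; apply; apply/rowP => j; rewrite mxE.
  by apply/eqP/negPn/negP => h'; apply: h; exists j.
have j2 : j != 2 by apply: contra_neq aj => ->.
pose e2 : E3 := delta_mx 0 2.
have mp : mp3 (fun x => x + (dot e2 x + 0) *: delta_mx 0 j).
  by apply: mp3_affine; left; rewrite mxE (negbTE j2) andbF addr0.
rewrite -(leb3_mp3 mp (mset_plane a b)).
rewrite (_ : _ @^-1` plane a b = plane (a + a 0 j *: e2) b).
  by apply: H2; rewrite !mxE !eqxx a2 add0r mulr1.
apply/seteqP; split=> x; rewrite /plane /= dotDr dotZr dot_delta addr0 dotDl dotZl => <-; ring.
Qed.

Lemma vol_null_union (I : finType) (F : I -> set E3) : (forall i, mset (F i)) ->
  (forall i, leb3 (vec3 @^-1` (F i)) = 0%E) ->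
  leb3 (vec3 @^-1` [set x | exists i, F i x]) = 0%E.
Proof.
move=> mF F0; rewrite (_ : _ @^-1` _ = \bigcup_(i in [set: I]) (vec3 @^-1` (F i))); last first.
  by apply/seteqP; split=> p /= -[i]; [move=> H|move=> _ H]; exists i.
apply/eqP; rewrite eq_le measure_ge0 andbT.
have -> : [set: I] = [set` index_enum I].
  by apply/seteqP; split=> i //= _; exact: mem_index_enum.
rewrite bigcup_seq.
apply: le_trans (_ : \sum_(i <- index_enum I) leb3 (vec3 @^-1` (F i)) <= _)%E; last by rewrite big1.
elim: (index_enum I) => [|i s IH]; first by rewrite !big_nil measure0.
rewrite !big_cons; apply: le_trans (measureU2 _ _ _) _ => //; first exact: mF.
  elim: s {IH} => [|j s IHs]; first by rewrite big_nil.
  by rewrite big_cons; apply: measurableU => //; exact: mF.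
by rewrite leeD2l.
Qed.

(** The determinant of the linear part is [1 + dot a w = -1]. A shear taking [w] to a multiple of a
    unit vector conjugates the map to one of [mp3_affine]. Reflections of this kind exchange two
    vertices of a tetrahedron. *)
Lemma mp3_oblique (a w : E3) (b : R) : dot a w = -2 ->
  mp3 (fun x => x + (dot a x + b) *: w).
Proof.
move=> aw.
have [j wj] : exists j, w 0 j != 0.
  apply: contrapT => h; have w0 : w = 0.
    apply/rowP => j; rewrite mxE; apply/eqP/negPn/negP => h'; by apply: h; exists j.
  by move: aw; rewrite w0 dot0r => /eqP; rewrite eq_sym oppr_eq0 pnatr_eq0.
have shear (c : E3) : c 0 j = 0 -> mp3 (fun x => x + x 0 j *: c).
  move=> cj.
  have el k : mp3 (fun x => x + (dot (c 0 k *: delta_mx 0 j) x + 0) *: delta_mx 0 k).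
    apply: mp3_affine; left; rewrite !mxE eqxx /=; case: eqP => [->|_]; last by rewrite mulr0 addr0.
    by rewrite cj mul0r addr0.
  apply: mp3_ext (mp3_comp (el 0) (mp3_comp (el 1) (el 2))) => x /=.
  have xj k (y : E3) : (y + (dot (c 0 k *: delta_mx 0 j) y + 0) *: delta_mx 0 k) 0 j = y 0 j.
    rewrite !mxE eqxx /=; case: eqP => [<-|_]; last by rewrite mulr0 addr0.
    by rewrite dotZl cj mul0r !addr0 mul0r addr0.
  set y2 := x + _; set y1 := y2 + _.
  have y2j : y2 0 j = x 0 j by exact: xj.
  have y1j : y1 0 j = x 0 j by rewrite xj y2j.
  have dd k (y : E3) : dot (c 0 k *: delta_mx 0 j) y = c 0 k * y 0 j.
    by rewrite dotZl dotC dot_delta.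
  rewrite dd y1j /y1 dd y2j /y2 dd.
  by apply/rowP; apply: ord3P; rewrite !mxE /=; ring.
pose ej : E3 := delta_mx 0 j.
pose c : E3 := - (w 0 j)^-1 *: (w - w 0 j *: ej).
have cj : c 0 j = 0 by rewrite !mxE !eqxx mulr1 subrr mulr0.
have cj' : (- c) 0 j = 0 by rewrite mxE cj oppr0.
pose a' : E3 := a - dot a c *: ej.
have h : 1 + (w 0 j *: a') 0 j = 1 \/ 1 + (w 0 j *: a') 0 j = -1.
  right; rewrite /a' !mxE !eqxx /= mulr1 /c dotZr dotBr dotZr dot_delta aw.
  by field.
apply: mp3_ext (mp3_comp (shear _ cj') (mp3_comp (mp3_affine (b * w 0 j) h) (shear _ cj))) => x /=.
set y := x + x 0 j *: c.
have yj : y 0 j = x 0 j by rewrite /y 2!mxE cj mulr0 addr0.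
have -> : dot (w 0 j *: a') y + b * w 0 j = w 0 j * (dot a x + b).
  rewrite dotZl /a' dotBl dotZl (dotC ej) dot_delta yj /y dotDr dotZr; ring.
set L := dot a x + b; have ejj : ej 0 j = 1 by rewrite /ej mxE !eqxx.
have wE : w = w 0 j *: (ej - c).
  by rewrite /c scaleNr opprK scalerDr scalerA mulfV // scale1r addrC subrK.
have -> : (y + (w 0 j * L) *: ej) 0 j = x 0 j + w 0 j * L.
  by rewrite mxE yj [in X in _ + X]mxE ejj mulr1.
rewrite [in RHS]wE /y -/ej; clearbody c ej; apply/rowP => i; rewrite !mxE; ring.
Qed.

End Volumes.

(** * Tetrahedra and meshes *)

Lemma ord4P (P : 'I_4 -> Prop) : P 0 -> P 1 -> P 2 -> P 3 -> forall i, P i.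
Proof.
move=> p0 p1 p2 p3 [[|[|[|[|//]]]] p].
- by rewrite (_ : Ordinal p = 0) //; apply: val_inj.
- by rewrite (_ : Ordinal p = 1) //; apply: val_inj.
- by rewrite (_ : Ordinal p = 2) //; apply: val_inj.
- by rewrite (_ : Ordinal p = 3) //; apply: val_inj.
Qed.

Lemma sum_ord4 (V : nmodType) (f : 'I_4 -> V) : \sum_i f i = f 0 + f 1 + f 2 + f 3.
Proof.
rewrite !big_ord_recl big_ord0 addr0 !addrA; congr (_ + f _ + f _ + f _); exact: val_inj.
Qed.

Section Element.
Context (R : realType).
Local Notation E3 := 'rV[R]_3.
Local Notation vhat := (@vhat R).
Implicit Types (x y u v w : E3) (T : elem R) (k l : 'I_4).

(** Barycentric coordinates of the reference tetrahedron, whose vertices have squared length 3 and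
    mutual products -1. *)
Definition hbary k x : R := (1 + dot x (vhat k)) / 4.

Lemma vhat_dot k l : dot (vhat k) (vhat l) = if k == l then 3 else -1.
Proof.
by move: k l; apply: ord4P; apply: ord4P; rewrite dotE !mxE /=; ring.
Qed.

Lemma hbary_sum x : \sum_k hbary k x = 1.
Proof. by rewrite sum_ord4 /hbary !dotE !mxE /=; field. Qed.

Lemma hbary_rec x : x = \sum_k hbary k x *: vhat k.
Proof.
by rewrite sum_ord4; apply/rowP; apply: ord3P; rewrite /hbary !dotE !mxE /=; field.
Qed.

Lemma hbary_comb k (I : finType) (c : I -> R) (X : I -> E3) :
  \sum_i c i = 1 -> hbary k (\sum_i c i *: X i) = \sum_i c i * hbary k (X i).
Proof.
move=> c1; rewrite /hbary dotC dot_sumr.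
under eq_bigr do rewrite dotZr dotC.
under [RHS]eq_bigr do rewrite mulrA mulrDr mulr1.
by rewrite -mulr_suml big_split /= c1.
Qed.

Lemma hbary_vhat k l : hbary k (vhat l) = (k == l)%:R.
Proof. by rewrite /hbary vhat_dot eq_sym; case: eqP => _ /=; field. Qed.

Lemma hfaceP (s : {set 'I_4}) x : @hface R s x <->
  (forall k, 0 <= hbary k x) /\ (forall k, k \notin s -> hbary k x = 0).
Proof.
split=> [[l [l0 ls l1 ->]]|[h0 hs]].
  have E k : hbary k (\sum_k l k *: vhat k) = l k.
    rewrite hbary_comb // (bigD1 k) //= hbary_vhat eqxx mulr1 big1 ?addr0 // => j jk.
    by rewrite hbary_vhat eq_sym (negbTE jk) mulr0.
  by split=> k; rewrite E //; exact: ls.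
exists (hbary^~ x); split => //; [exact: hbary_sum|exact: hbary_rec].
Qed.

Definition Finv T x : E3 := (x - elem_off T) *m invmx (elem_lin T).

Lemma FinvK T x : Fmap T (Finv T x) = x.
Proof. by rewrite /Fmap /Finv mulmxKV ?elem_unit // subrK. Qed.

Lemma FmapK T x : Finv T (Fmap T x) = x.
Proof. by rewrite /Fmap /Finv addrK mulmxK ?elem_unit. Qed.

Definition vert T k : E3 := Fmap T (vhat k).
Definition bary T k x : R := hbary k (Finv T x).
(** The linear part of the affine function [bary T k]. *)
Definition lbary T k v : R := dot (v *m invmx (elem_lin T)) (vhat k) / 4.

Lemma baryD T k x v : bary T k (x + v) = bary T k x + lbary T k v.
Proof.
rewrite /bary /lbary /hbary /Finv addrAC mulmxDl dotDl.
by rewrite mulrDl mulrDl mulrDl addrA.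
Qed.

Lemma lbaryZ T k c v : lbary T k (c *: v) = c * lbary T k v.
Proof. by rewrite /lbary -scalemxAl dotZl mulrA. Qed.

Lemma lbaryD T k u v : lbary T k (u + v) = lbary T k u + lbary T k v.
Proof. by rewrite /lbary mulmxDl dotDl mulrDl. Qed.

Lemma lbaryB T k x y : lbary T k (x - y) = bary T k x - bary T k y.
Proof. by have := baryD T k y (x - y); rewrite addrC subrK => ->; ring. Qed.

Lemma bary_sum T x : \sum_k bary T k x = 1.
Proof. exact: hbary_sum. Qed.

Lemma lbary_sum T v : \sum_k lbary T k v = 0.
Proof.
have := bary_sum T (0 + v); under eq_bigr do rewrite baryD.
by rewrite big_split /= bary_sum => h; lra.
Qed.

Lemma Fmap_comb T (I : finType) (c : I -> R) (X : I -> E3) :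
  \sum_i c i = 1 -> Fmap T (\sum_i c i *: X i) = \sum_i c i *: Fmap T (X i).
Proof.
move=> c1; rewrite /Fmap mulmx_suml.
under [RHS]eq_bigr do rewrite scalerDr.
rewrite big_split /= -scaler_suml c1 scale1r; congr (_ + _).
by apply: eq_bigr => i _; rewrite scalemxAl.
Qed.

Lemma bary_rec T x : x = \sum_k bary T k x *: vert T k.
Proof. by rewrite -Fmap_comb ?hbary_sum // -hbary_rec FinvK. Qed.

Lemma bary_comb T k (I : finType) (c : I -> R) (X : I -> E3) :
  \sum_i c i = 1 -> bary T k (\sum_i c i *: X i) = \sum_i c i * bary T k (X i).
Proof.
move=> c1; rewrite /bary -hbary_comb //; congr hbary.
apply: (can_inj (FmapK T)); rewrite FinvK Fmap_comb //.
by apply: eq_bigr => i _; rewrite FinvK.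
Qed.

Lemma bary_vert T k l : bary T k (vert T l) = (k == l)%:R.
Proof. by rewrite /bary /vert FmapK hbary_vhat. Qed.

Lemma bary_eq T x y : (forall k, bary T k x = bary T k y) -> x = y.
Proof. by move=> h; rewrite (bary_rec T x) (bary_rec T y); apply: eq_bigr => k _; rewrite h. Qed.

Lemma bary_conv T k x y (t : R) : bary T k (x + t *: (y - x)) =
  (1 - t) * bary T k x + t * bary T k y.
Proof. by rewrite baryD lbaryZ lbaryB; ring. Qed.

Lemma lbary_rec T v : v = \sum_k lbary T k v *: vert T k.
Proof.
have e0 := bary_rec T 0; have ev := bary_rec T (0 + v).
rewrite add0r in ev; rewrite {1}ev.
under eq_bigr do rewrite -[v in bary _ _ v]add0r baryD scalerDl.
by rewrite big_split /= -e0 add0r.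
Qed.

Lemma faceP T (s : {set 'I_4}) x : face T s x <->
  (forall k, 0 <= bary T k x) /\ (forall k, k \notin s -> bary T k x = 0).
Proof.
split=> [[y /hfaceP hy <-]|h].
  by rewrite /bary FmapK.
by exists (Finv T x); rewrite ?FinvK //; apply/hfaceP.
Qed.

Lemma cellP T x : cell T x <-> forall k, 0 <= bary T k x.
Proof.
split=> [/(@faceP T [set: 'I_4]%SET)[]//|h].
by apply/(@faceP T [set: 'I_4]%SET); split=> // k; rewrite finset.in_setT.
Qed.

Lemma bary_le1 T k x : cell T x -> bary T k x <= 1.
Proof.
move=> /cellP h; rewrite -(bary_sum T x) (bigD1 k) //= lerDl.
by apply: sumr_ge0 => j _.
Qed.

Lemma vert_cell T k : cell T (vert T k).
Proof. by apply/cellP => j; rewrite bary_vert ler0n. Qed.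

Lemma lbary_lip T : exists2 C, 0 < C & forall k v, `|lbary T k v| <= C * `|v|.
Proof.
have lin k v : lbary T k v = \sum_j v 0 j * lbary T k (delta_mx 0 j).
  rewrite {1}(row_sum_delta v); elim/big_rec2: _ => [|j a b _ <-].
    by rewrite -(scale0r 0) lbaryZ mul0r.
  by rewrite lbaryD lbaryZ.
exists (1 + \sum_k \sum_j `|lbary T k (delta_mx 0 j)|).
  by apply: ltr_pwDl => //; do 2! apply: sumr_ge0 => ? _.
move=> k v; rewrite lin; apply: le_trans (ler_norm_sum _ _ _) _.
apply: le_trans (_ : \sum_j `|lbary T k (delta_mx 0 j)| * `|v| <= _).
  by apply: ler_sum => j _; rewrite normrM mulrC ler_wpM2l ?norm_coord.
rewrite -mulr_suml ler_wpM2r // [leRHS]addrC -[leLHS]addr0 lerD //.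
by rewrite [leRHS](bigD1 k) //= lerDl; do 2! apply: sumr_ge0 => ? _.
Qed.

Lemma norm_sub_bary T x (c : R) : (forall k, c < bary T k x) ->
  exists2 e, 0 < e & forall y, `|x - y| < e -> forall k, c < bary T k y.
Proof.
move=> h; have [C C0 lip] := lbary_lip T.
pose d := \big[Num.min/1]_k (bary T k x - c).
have d0 : 0 < d by apply: lt_bigmin => // k _; rewrite subr_gt0.
exists (d / C) => [|y]; first exact: divr_gt0.
rewrite ltr_pdivlMr // => hy k.
have dk : d <= bary T k x - c by apply: bigmin_le_cond.
have : lbary T k (x - y) <= C * `|x - y| by apply: le_trans (ler_norm _) (lip _ _).
rewrite lbaryB mulrC; lra.
Qed.

Lemma interior_cell T x : (cell T)° x <-> forall k, 0 < bary T k x.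
Proof.
split=> [|h]; last first.
  have [e e0 he] := norm_sub_bary h; apply/nbhs_ballP; exists e => //= y /ballE3 /he hy.
  by apply/cellP => k; exact: ltW.
move=> /nbhs_ballP[e /= e0 he] k.
have cx : cell T x by apply: he; exact: ballxx.
rewrite lt_neqAle; move/cellP/(_ k): (cx) => ->; rewrite andbT eq_sym; apply/eqP => b0.
pose z := x - vert T k; pose t := e / (2 * (`|z| + 1)).
have z0 : 0 < `|z| + 1 by rewrite ltr_wpDl.
have t0 : 0 < t by rewrite divr_gt0 // mulr_gt0.
have : cell T (x + t *: z).
  apply: he; apply/ballE3; rewrite opprD addNKr normrN normrZ gtr0_norm //.
  have tE : t * (2 * (`|z| + 1)) = e by rewrite /t divfK // gt_eqF // mulr_gt0.
  by have := mulr_ge0 (ltW t0) (normr_ge0 z); nra.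
by move/cellP/(_ k); rewrite baryD lbaryZ lbaryB bary_vert eqxx b0 (_ : true%:R = 1) //; lra.
Qed.

Lemma cell_closedP T x : ~ cell T x -> exists2 e, 0 < e & forall y, `|x - y| < e -> ~ cell T y.
Proof.
move=> nx; have [k bk] : exists k, bary T k x < 0.
  apply: contrapT => h; apply: nx; apply/cellP => k; rewrite leNgt; apply/negP => ?.
  by apply: h; exists k.
have [C C0 lip] := lbary_lip T.
exists (- bary T k x / C) => [|y]; first by rewrite divr_gt0 // oppr_gt0.
rewrite ltr_pdivlMr // => hy /cellP/(_ k).
have : - lbary T k (x - y) <= C * `|x - y|.
  by apply: le_trans (lip k (x - y)); rewrite -normrN ler_norm.
rewrite lbaryB mulrC; lra.
Qed.

Lemma vert_inj T : injective (vert T).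
Proof.
by move=> k l h; have := bary_vert T k l; rewrite -h bary_vert eqxx; case: eqP => // _ /eqP; rewrite oner_eq0.
Qed.

Lemma vertex_of_bary1 T k x : cell T x -> bary T k x = 1 -> x = vert T k.
Proof.
move=> cx bk; apply: (@bary_eq T) => l; rewrite bary_vert.
case: eqP => [->//|/eqP lk] /=; apply/eqP; rewrite eq_le (cellP T x).1 // andbT.
have := bary_sum T x; rewrite (bigD1 k) //= bk => h.
rewrite (_ : _%:R = \sum_(i | i != k) bary T i x); last by rewrite /=; lra.
rewrite (bigD1 l) //= lerDl; apply: sumr_ge0 => j _; exact: (cellP T x).1.
Qed.

(** Vertices are extreme points: [bary T k] is at most 1 on the face and equals 1 only at
    [vert T k], so a convex combination of the vertices of [s'] can give that point only if it is
    one of them. *)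
Lemma face_vertex T T' (s s' : {set 'I_4}) k : face T s = face T' s' -> k \in s ->
  exists2 k', k' \in s' & vert T' k' = vert T k.
Proof.
move=> ff ks.
have fs : face T s (vert T k).
  apply/faceP; split=> j; rewrite bary_vert ?ler0n //.
  by case: eqP => // -> /negP; rewrite ks.
have /faceP[f0 f1] : face T' s' (vert T k) by rewrite -ff.
have fv' k' : k' \in s' -> face T s (vert T' k').
  move=> ks'; rewrite ff; apply/faceP; split=> j; rewrite bary_vert ?ler0n //.
  by case: eqP => // -> /negP; rewrite ks'.
have cf x : face T s x -> cell T x by move=> /faceP[h _]; apply/cellP.
apply: contrapT => no.
have lt k' : k' \in s' -> bary T k (vert T' k') < 1.
  move=> ks'; rewrite lt_neqAle bary_le1 ?andbT; last exact/cf/fv'.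
  apply/eqP => b1; apply: no; exists k' => //.
  by apply: vertex_of_bary1 => //; exact/cf/fv'.
have e1 : \sum_k' bary T' k' (vert T k) * bary T k (vert T' k') = 1.
  by rewrite -bary_comb ?bary_sum // -bary_rec bary_vert eqxx.
have e2 : \sum_k' bary T' k' (vert T k) * (1 - bary T k (vert T' k')) = 0.
  under eq_bigr do rewrite mulrBr mulr1.
  by rewrite sumrB bary_sum e1 subrr.
have nn k' : 0 <= bary T' k' (vert T k) * (1 - bary T k (vert T' k')).
  case: (boolP (k' \in s')) => [/lt h|/f1 ->]; last by rewrite mul0r.
  by rewrite mulr_ge0 // subr_ge0 ltW.
have z k' : bary T' k' (vert T k) = 0.
  case: (boolP (k' \in s')) => [/lt h|/f1//].
  move/eqP: e2; rewrite psumr_eq0 // => /allP /(_ k' (mem_index_enum _)).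
  by rewrite mulf_eq0 subr_eq0 (gt_eqF h) orbF => /eqP.
have := bary_sum T' (vert T k); rewrite big1 // => /eqP.
by rewrite eq_sym oner_eq0.
Qed.

Lemma midpoint_bary T (e : {set 'I_4}) k : is_edge e ->
  bary T k (midpoint T e) = if k \in e then 2^-1 else 0.
Proof.
move=> /eqP ce.
have -> : midpoint T e = \sum_l (if l \in e then 2^-1 else 0) *: vert T l.
  rewrite /midpoint scaler_sumr big_mkcond; apply: eq_bigr => l _.
  by case: ifP => //; rewrite scale0r.
rewrite bary_comb; last by rewrite -big_mkcond sumr_const ce; field.
rewrite (bigD1 k) //= bary_vert eqxx mulr1 big1 ?addr0 // => l lk.
by rewrite bary_vert eq_sym (negbTE lk) mulr0.
Qed.

End Element.

Lemma finite_min_pos (R : realType) (I : finType) (F : I -> R) :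
  (forall i, 0 < F i) -> exists2 e, 0 < e & forall i, e <= F i.
Proof.
move=> F0; exists (\big[Num.min/1]_i F i); first by apply: lt_bigmin.
by move=> i; apply: bigmin_le_cond.
Qed.

Section CellSize.
Context (R : realType).
Local Notation E3 := 'rV[R]_3.
Implicit Types (x y : E3) (T : elem R).

Lemma cell_norm T x : cell T x -> `|x| <= \sum_k `|vert T k|.
Proof.
move=> cx; rewrite {1}(bary_rec T x); apply: le_trans (ler_norm_sum _ _ _) _.
apply: ler_sum => k _; rewrite normrZ ger0_norm; last exact: (cellP T x).1.
by rewrite ler_piMl // bary_le1.
Qed.

Lemma cell_diam T x y : cell T x -> cell T y -> `|x - y| <= diam (cell T).
Proof.
move=> cx cy; apply: le_trans (enorm_ge _) _.
apply: ub_le_sup; last by exists x => //; exists y.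
exists (4 * \sum_k `|vert T k|) => _ [a ca [b cb <-]].
apply: le_trans (enorm_le _) _.
have := ler_normB a b; have := cell_norm ca; have := cell_norm cb; lra.
Qed.

(** Some admissible diameter exceeds [r / 2], so a Euclidean radius [r / 4] is available, and the
    Euclidean norm is at most twice the max norm. *)
Lemma indiam_ball T (r : R) : 0 < r -> r <= indiam (cell T) ->
  exists c, forall x, `|x - c| <= r / 8 -> cell T x.
Proof.
move=> r0 rI; set S := [set d | exists c : E3, forall x, enorm (x - c) <= d / 2 -> cell T x].
have hS : has_sup S.
  apply: contrapT => h; move: rI; rewrite /indiam -/S sup_out // => r1.
  by move: (lt_le_trans r0 r1); rewrite ltxx.
have r2 : 0 < r / 2 by rewrite divr_gt0.
have [d [c dc] dr] := sup_adherent r2 hS.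
exists c => x xc; apply: dc; apply: le_trans (enorm_le _) _.
move: rI dr; rewrite /indiam -/S; lra.
Qed.

End CellSize.

(** * Consequences of conformity *)

Section Mesh.
Context (R : realType) (N : nat) (Omega : set 'rV[R]_3) (K : mesh R N).
Local Notation E3 := 'rV[R]_3.
Implicit Types (x y : E3) (i j : 'I_N) (k l : 'I_4).

(** As [h] is positive, the presence of an element forces [kappa] and [sigma] to be positive. *)
Lemma mesh_size (sigma kappa h : R) : 0 < h -> shape_regular sigma K ->
  mesh_parameter kappa h K -> forall i,
  [/\ 0 < kappa * sigma,
      forall x y, cell (K i) x -> cell (K i) y -> `|x - y| <= h
    & exists c, forall x, `|x - c| <= h / (8 * (kappa * sigma)) -> cell (K i) x].
Proof.
move=> h0 sr mp i; have /andP[dh hd] := mp i; have di := sr i.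
set d := diam _ in dh hd di; set I := indiam _ in di.
have I0 : 0 <= I.
  rewrite /I /indiam; set S := [set _ | _].
  have [hS|hS] := pselect (has_sup S); last by rewrite sup_out.
  (* A negative number belongs to the set defining [indiam] because its condition is vacuous; hence
     the supremum is at least [- e] for every [e]. *)
  apply/ler_addgt0Pl => e e0; rewrite -lerBlDl sub0r.
  apply: ub_le_sup; first by case: hS.
  exists 0 => x hx; exfalso; have := sqrtr_ge0 (dot (x - 0) (x - 0)).
  move: hx; rewrite /enorm; lra.
have d0 : 0 <= d.
  apply: le_trans (normr_ge0 (vert (K i) 0 - vert (K i) 0)) _.
  by apply: cell_diam; exact: vert_cell.
have k0 : 0 < kappa by rewrite ltNge; apply/negP => k0; nra.
have dp : 0 < d by rewrite lt_neqAle d0 andbT; apply/eqP => d_0; move: hd; rewrite -d_0; nra.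
have s0 : 0 < sigma by rewrite ltNge; apply/negP => k1; nra.
have ks : 0 < kappa * sigma by exact: mulr_gt0.
split => // [x y cx cy|]; first exact: le_trans (cell_diam cx cy) dh.
have r0 : 0 < h / (kappa * sigma) by exact: divr_gt0.
have rI : h / (kappa * sigma) <= I.
  rewrite ler_pdivrMr //; apply: le_trans hd _.
  have : kappa * d <= kappa * (sigma * I) by rewrite ler_pM2l.
  by move=> h1; apply: le_trans h1 _; rewrite mulrA mulrC.
have [c hc] := indiam_ball r0 rI; exists c => x xc; apply: hc.
apply: le_trans xc _; rewrite le_eqVlt; apply/orP; left; apply/eqP; field.
by rewrite !gt_eqF.
Qed.

Lemma near_cells x : exists2 e, 0 < e &
  forall y, `|x - y| < e -> forall i, cell (K i) y -> cell (K i) x.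
Proof.
have /choice[F FP] i : exists e, 0 < e /\ forall y, `|x - y| < e -> cell (K i) y -> cell (K i) x.
  have [cx|ncx] := pselect (cell (K i) x); first by exists 1.
  by have [e e0 he] := cell_closedP ncx; exists e; split => // y /he.
have [e e0 he] := finite_min_pos (fun i => (FP i).1).
by exists e => // y ye i; apply: (FP i).2; exact: lt_le_trans (he i).
Qed.

Hypothesis tet : tetrahedrization Omega K.

Lemma omega_open : open Omega.
Proof. by rewrite tet; exact: open_interior. Qed.

Lemma omega_near x : Omega x -> exists2 e, 0 < e & forall y, `|x - y| < e -> Omega y.
Proof. exact: openE3 omega_open. Qed.

Lemma omega_cell x : Omega x -> exists i, cell (K i) x.
Proof. by rewrite tet => /interior_subset[i _ ci]; exists i. Qed.

Lemma in_omega x (e : R) : 0 < e ->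
  (forall y, `|x - y| < e -> exists i, cell (K i) y) -> Omega x.
Proof.
move=> e0 h; rewrite tet; apply/nbhs_ballP; exists e => //= y /ballE3 /h[i ci].
by exists i.
Qed.

Lemma int_cell_omega i x : (forall k, 0 < bary (K i) k x) -> Omega x.
Proof.
move=> /interior_cell h; rewrite tet; move: h; apply: interiorS.
by move=> y cy; exists i.
Qed.

Lemma cell_approx T x (e : R) : cell T x -> 0 < e ->
  exists2 y, `|x - y| < e & forall k, 0 < bary T k y.
Proof.
move=> /cellP cx e0; pose b := \sum_k 4^-1 *: vert T k : E3.
have b0 k : bary T k b = 4^-1.
  rewrite bary_comb; last by rewrite sumr_const card_ord; field.
  rewrite (bigD1 k) //= bary_vert eqxx mulr1 big1 ?addr0 // => l lk.
  by rewrite bary_vert eq_sym (negbTE lk) mulr0.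
pose t := Num.min 1 (e / (2 * (`|b - x| + 1))).
have z0 : 0 < `|b - x| + 1 by rewrite ltr_wpDl.
have t0 : 0 < t by rewrite lt_min ltr01 divr_gt0 // mulr_gt0.
have t1 : t <= 1 by rewrite ge_min lexx.
exists (x + t *: (b - x)) => [|k].
  rewrite opprD addNKr normrN normrZ gtr0_norm //.
  have tE : t * (2 * (`|b - x| + 1)) <= e by rewrite -ler_pdivlMr ?mulr_gt0 // ge_min lexx orbT.
  by have := mulr_ge0 (ltW t0) (normr_ge0 (b - x)); nra.
by rewrite bary_conv b0; have := cx k; nra.
Qed.

Lemma cell_closure i x : cell (K i) x -> closure Omega x.
Proof.
move=> cx B /nbhs_ballP[e /= e0 he].
have [y ye hy] := cell_approx cx e0.
by exists y; split; [exact: int_cell_omega hy|apply: he; apply/ballE3].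
Qed.

Lemma bd_cell i x : cell (K i) x -> bd Omega x <-> ~ Omega x.
Proof.
move=> cx; have oi : Omega° = Omega by apply/interior_id/omega_open.
split=> [[_]|nO]; first by rewrite oi.
by split; [exact: cell_closure cx|rewrite oi].
Qed.

Hypothesis conf : conforming K.

Lemma common_face i j x : i != j -> cell (K i) x -> cell (K j) x -> exists k, bary (K i) k x = 0.
Proof.
move=> ij ci cj; have [s [s' [s4 fE _]]] := conf ij.
have : face (K i) s x by rewrite -fE.
move=> /faceP[_ h].
have [k ks] : exists k, k \notin s.
  apply/existsP; rewrite -negb_forall; apply/negP => /forallP all.
  have /eqP : s = [set: 'I_4]%SET by apply/setP => k; rewrite all finset.in_setT.
  by move=> /eqP sE; move: s4; rewrite sE cardsT card_ord.
by exists k; exact: h.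
Qed.

Lemma int_cell_inj i j x : (forall k, 0 < bary (K i) k x) -> cell (K j) x -> i = j.
Proof.
move=> h cj; apply: contrapT => /eqP ij.
have ci : cell (K i) x by apply/cellP => k; exact: ltW.
by have [k bk] := common_face ij ci cj; have := h k; rewrite bk ltxx.
Qed.

(** The point lies in the common face, which must contain every vertex with a positive coordinate
    there; [face_vertex] finds this vertex in the other cell. *)
Lemma common_vertex i j x k : cell (K i) x -> cell (K j) x -> 0 < bary (K i) k x ->
  exists k', vert (K j) k' = vert (K i) k.
Proof.
move=> ci cj bk; have [<-|/eqP ij] := pselect (i = j); first by exists k.
have [s [s' [_ fE fE']]] := conf ij.
have ks : k \in s.
  have /faceP[_ h] : face (K i) s x by rewrite -fE.
  by apply/negPn/negP => /h b0; move: bk; rewrite b0 ltxx.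
have [k' _ h] := face_vertex (etrans (esym fE) fE') ks.
by exists k'.
Qed.

End Mesh.

(** * Nodal functions *)

Lemma edgeP (e : {set 'I_4}) : is_edge e -> exists a b, a != b /\ e = [set a; b]%SET.
Proof. by move=> /cards2P. Qed.

Lemma is_edge2 (a b : 'I_4) : a != b -> is_edge [set a; b]%SET.
Proof. by move=> ab; rewrite /is_edge cards2 ab. Qed.

Lemma sum_edge (V : nmodType) (f : 'I_4 -> V) a b : a != b ->
  \sum_(k in [set a; b]%SET) f k = f a + f b.
Proof. by move=> ab; rewrite big_setU1 ?big_set1 // finset.in_set1. Qed.

Lemma set2_eq (a b c d : 'I_4) : a != b ->
  ([set a; b] == [set c; d])%SET = ((a == c) && (b == d)) || ((a == d) && (b == c)).
Proof.
move=> ab; apply/eqP/idP => [/setP h|/orP[] /andP[/eqP -> /eqP ->]//]; last by rewrite finset.setUC.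
have := h a; have := h b; rewrite !finset.inE !eqxx orbT /= => /esym/orP[] /eqP eb /esym/orP[] /eqP ea.
- by move: ab; rewrite ea eb eqxx.
- by rewrite ea eb !eqxx orbT.
- by rewrite ea eb !eqxx.
- by move: ab; rewrite ea eb eqxx.
Qed.

Lemma sum_edges (V : nmodType) (f : {set 'I_4} -> V) :
  \sum_(e | is_edge e) f e =
  f [set 0; 1]%SET + f [set 0; 2]%SET + f [set 0; 3]%SET + f [set 1; 2]%SET
  + f [set 1; 3]%SET + f [set 2; 3]%SET.
Proof.
rewrite -big_filter (perm_big [:: [set 0; 1]; [set 0; 2]; [set 0; 3]; [set 1; 2];
  [set 1; 3]; [set 2; 3]]%SET).
  by rewrite !big_cons big_nil /= addr0 !addrA.
apply: uniq_perm; first by rewrite filter_uniq // index_enum_uniq.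
  by rewrite /= !finset.inE !set2_eq.
move=> e; rewrite mem_filter mem_index_enum andbT; apply/idP/idP.
  move=> /edgeP[a [b [ab ->]]]; rewrite !finset.inE !set2_eq //.
  by move: a b ab; apply: ord4P; apply: ord4P.
by rewrite !finset.inE => /or4P[/eqP ->|/eqP ->|/eqP ->|/or3P[]/eqP ->]; apply: is_edge2.
Qed.

(** * The midpoint basis of the local space *)

Section Shape.
Context (R : realType).
Local Notation E3 := 'rV[R]_3.
Implicit Types (x y u v w : E3) (T : elem R) (k l a b : 'I_4) (e : {set 'I_4}).

(* In barycentric coordinates the space V(That) is spanned by these six
   functions, dual to the point values at the edge midpoints. *)
Definition hshape e x : R :=
  let s := \sum_(k in e) hbary k x in
  2 * s ^+ 2 - s + 3^-1 - 2 / 3 * \sum_k hbary k x ^+ 2.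

Definition shape T e x : R := hshape e (Finv T x).

Lemma shapeE T e x : shape T e x =
  2 * (\sum_(k in e) bary T k x) ^+ 2 - \sum_(k in e) bary T k x + 3^-1
  - 2 / 3 * \sum_k bary T k x ^+ 2.
Proof. by []. Qed.

Lemma VhatD (p q : E3 -> R) (c : R) : Vhat p -> Vhat q -> Vhat (fun x => p x + c * q x).
Proof.
move=> [a0 [a1 [a2 [a3 [a4 [a5 hp]]]]]] [b0 [b1 [b2 [b3 [b4 [b5 hq]]]]]].
exists (a0 + c * b0), (a1 + c * b1), (a2 + c * b2), (a3 + c * b3), (a4 + c * b4), (a5 + c * b5).
by move=> x /=; rewrite hp hq /=; ring.
Qed.

Lemma Vhat_ext (p q : E3 -> R) : p =1 q -> Vhat p -> Vhat q.
Proof. by move=> /funext ->. Qed.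

Lemma Vhat_sum (I : Type) (r : seq I) (P : pred I) (c : I -> R) (p : I -> E3 -> R) :
  (forall i, P i -> Vhat (p i)) -> Vhat (fun x => \sum_(i <- r | P i) c i * p i x).
Proof.
move=> hp; elim: r => [|i r IH].
  by exists 0, 0, 0, 0, 0, 0 => x; rewrite big_nil /=; ring.
case Pi : (P i).
  by apply: Vhat_ext (VhatD (c i) IH (hp i Pi)) => x; rewrite big_cons Pi addrC.
by apply: Vhat_ext IH => x; rewrite big_cons Pi.
Qed.

Lemma Vhat_hshape e : is_edge e -> Vhat (hshape e).
Proof.
move=> /edgeP[a [b [ab ->]]].
pose m : E3 := 2^-1 *: (@vhat R a + @vhat R b).
pose al j : R := m 0 j ^+ 2 / 2 - 6^-1.
exists 6^-1, (m 0 0 / 2), (m 0 1 / 2), (m 0 2 / 2), (al 0), (al 0 + al 1) => x.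
have -> : inord 0 = 0 :> 'I_3 by apply: val_inj; rewrite /= inordK.
have -> : inord 1 = 1 :> 'I_3 by apply: val_inj; rewrite /= inordK.
have -> : inord 2 = 2 :> 'I_3 by apply: val_inj; rewrite /= inordK.
rewrite /hshape sum_edge // sum_ord4 /al /m /hbary !dotE !mxE.
by move: a b ab {m al}; apply: ord4P; apply: ord4P => //= _; field.
Qed.

Lemma shape_sum T x : \sum_(e | is_edge e) shape T e x = 1.
Proof.
have := bary_sum T x; rewrite sum_edges !shapeE !sum_edge // !sum_ord4 => h.
have -> : bary T 0 x = 1 - bary T 1 x - bary T 2 x - bary T 3 x by lra.
by field.
Qed.

Lemma shape_midpoint T e e' : is_edge e -> is_edge e' ->
  shape T e (midpoint T e') = (e == e')%:R.
Proof.
move=> ee ee'; rewrite shapeE sum_ord4 !midpoint_bary //.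
under eq_bigr do rewrite midpoint_bary //.
move/edgeP: ee => [a [b [ab ->]]]; move/edgeP: ee' => [c [d [cd ->]]].
rewrite sum_edge // set2_eq // !finset.inE.
by move: c d cd; apply: ord4P; apply: ord4P => //= _;
  move: a b ab; apply: ord4P; apply: ord4P => //= _; field.
Qed.

Lemma shape_le2 T e x : is_edge e -> cell T x -> `|shape T e x| <= 2.
Proof.
move=> /edgeP[a [b [ab ->]]] cx; rewrite shapeE sum_edge //.
have b0 k : 0 <= bary T k x by exact: (cellP T x).1.
have b1 k : bary T k x <= 1 by exact: bary_le1.
have Q0 : 0 <= \sum_k bary T k x ^+ 2 by apply: sumr_ge0 => k _; exact: sqr_ge0.
have Q1 : \sum_k bary T k x ^+ 2 <= 1.
  rewrite -[leRHS](bary_sum T x); apply: ler_sum => k _; rewrite expr2 ler_piMl //.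
have s1 : bary T a x + bary T b x <= 1.
  rewrite -(bary_sum T x) (bigD1 a) //= lerD2l (bigD1 b) ?(eq_sym b) //= lerDl.
  by apply: sumr_ge0.
set s := bary T a x + bary T b x in s1 *; have s0 : 0 <= s by rewrite addr_ge0.
move: Q0 Q1; set Q := \sum_k _ => Q0 Q1.
rewrite ler_norml; apply/andP; split; nra.
Qed.

Lemma mfn_bary T k : mfn (bary T k).
Proof.
apply: (@mfn_ext _ (fun x => 4^-1 + \sum_j x 0 j * lbary T k (delta_mx 0 j) + (bary T k 0 - 4^-1))).
  move=> x; rewrite -[in RHS](add0r x) baryD.
  suff -> : lbary T k x = \sum_j x 0 j * lbary T k (delta_mx 0 j) by ring.
  rewrite {1}(row_sum_delta x); elim/big_rec2: _ => [|j c d _ <-].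
    by rewrite -(scale0r 0) lbaryZ mul0r.
  by rewrite lbaryD lbaryZ.
apply: mfnD; last exact: mfn_cst.
apply: mfnD; first exact: mfn_cst.
by apply: mfn_sum => j; apply: mfnM; [exact: mfn_coord|exact: mfn_cst].
Qed.

Lemma mfn_shape T e : is_edge e -> mfn (shape T e).
Proof.
move=> /edgeP[a [b [ab ->]]].
have mb k := mfn_bary T k.
apply: (@mfn_ext _ (fun x => (2 * ((bary T a x + bary T b x) * (bary T a x + bary T b x))
   + -1 * (bary T a x + bary T b x)) + (3^-1 + - (2 / 3) * \sum_k bary T k x * bary T k x))).
  by move=> x; rewrite shapeE sum_edge //; under [X in _ = _ - _ * X]eq_bigr do rewrite expr2; ring.
have ms : mfn (fun x => bary T a x + bary T b x) by exact: mfnD.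
apply: mfnD; apply: mfnD.
- by apply: mfnM; [exact: mfn_cst|exact: mfnM].
- by apply: mfnM; [exact: mfn_cst|].
- exact: mfn_cst.
- by apply: mfnM; [exact: mfn_cst|apply: mfn_sum => k; exact: mfnM].
Qed.

Lemma mset_cell T : mset (cell T).
Proof.
have -> : cell T = [set x | forall k, 0 <= bary T k x].
  by apply/seteqP; split=> x /=; [move/cellP|move=> ?; apply/cellP].
by apply: mset_forall => k; apply: mset_ge; exact: mfn_bary.
Qed.

Lemma icellE T : (cell T)° = [set x | forall k, 0 < bary T k x].
Proof. by apply/seteqP; split=> x /= /interior_cell. Qed.

Lemma mset_icell T : mset (cell T)°.
Proof. by apply: mset_open; exact: open_interior. Qed.

Lemma finv_cell T : finv (cell T).
Proof. by apply: finv_bounded (@cell_norm _ T); exact: mset_cell. Qed.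

Lemma finv_icell T : finv (cell T)°.
Proof. by apply: finvS (finv_cell T); [exact: mset_icell|exact: mset_cell|exact: interior_subset]. Qed.

Lemma nice_shape T e : is_edge e -> nice (cell T)° (shape T e).
Proof.
move=> ee; split; [exact: mset_icell|exact: finv_icell|exact: mfn_shape|].
by exists 2 => x /interior_subset; exact: shape_le2.
Qed.

(** The affine reflection that exchanges the vertices [a] and [b] and fixes the other two. *)
Definition vswap T a b x : E3 := x + (bary T a x - bary T b x) *: (vert T b - vert T a).

Lemma mp3_vswap T a b : a != b -> mp3 (vswap T a b).
Proof.
move=> ab.
pose al : E3 := \row_j (lbary T a (delta_mx 0 j) - lbary T b (delta_mx 0 j)).
have lin v : dot al v = lbary T a v - lbary T b v.
  have l k : lbary T k v = \sum_j v 0 j * lbary T k (delta_mx 0 j).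
    rewrite {1}(row_sum_delta v); elim/big_rec2: _ => [|j c d _ <-].
      by rewrite -(scale0r 0) lbaryZ mul0r.
    by rewrite lbaryD lbaryZ.
  by rewrite !l -sumrB; apply: eq_bigr => j _; rewrite mxE; ring.
apply: (@mp3_ext _ (fun x => x + (dot al x + (bary T a 0 - bary T b 0)) *: (vert T b - vert T a))).
  move=> x; have E k : bary T k x = bary T k 0 + lbary T k x by rewrite -baryD add0r.
  by rewrite /vswap lin (E a) (E b); congr (_ + _ *: _); ring.
apply: mp3_oblique; rewrite lin !lbaryB !bary_vert !eqxx (negbTE ab) eq_sym (negbTE ab) /=; ring.
Qed.

Lemma bary_vswap T a b k x : a != b -> bary T k (vswap T a b x) =
  bary T (if k == a then b else if k == b then a else k) x.
Proof.
move=> ab; rewrite baryD lbaryZ lbaryB !bary_vert.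
case: (eqVneq k a) => [->|ka]; first by rewrite (negbTE ab) /=; ring.
by case: (eqVneq k b) => [->|kb] /=; ring.
Qed.

Lemma int_shape_swap T a b c : a != b -> a != c -> b != c ->
  int3 (cell T)° (shape T [set a; c]%SET) = int3 (cell T)° (shape T [set b; c]%SET).
Proof.
move=> ab ac bc; rewrite -(int3_mp3 (mp3_vswap T ab)); last by apply: nice_shape; exact: is_edge2.
have -> : vswap T a b @^-1` (cell T)° = (cell T)°.
  rewrite icellE; apply/seteqP; split=> x /= h k.
    have := h (if k == a then b else if k == b then a else k); rewrite bary_vswap //.
    case: (eqVneq k a) => [->|ka]; first by rewrite eqxx eq_sym (negbTE ab).
    case: (eqVneq k b) => [->|kb]; first by rewrite eqxx.
    by rewrite (negbTE ka) (negbTE kb).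
  by rewrite bary_vswap.
apply: eq_int3 => x _; rewrite /= !shapeE !sum_edge // !bary_vswap // eqxx.
rewrite (eq_sym c a) (negbTE ac) (eq_sym c b) (negbTE bc).
have -> : \sum_k bary T k (vswap T a b x) ^+ 2 = \sum_k bary T k x ^+ 2.
  pose s k := if k == a then b else if k == b then a else k.
  have si : involutive s.
    move=> k; rewrite /s; case: (eqVneq k a) => [->|ka]; first by rewrite eq_sym (negbTE ab) eqxx.
    case: (eqVneq k b) => [->|kb]; first by rewrite eqxx.
    by rewrite (negbTE ka) (negbTE kb).
  by rewrite [RHS](reindex_inj (inv_inj si)); apply: eq_bigr => k _; rewrite bary_vswap.
by [].
Qed.

Lemma edge_constant (A : Type) (I : 'I_4 -> 'I_4 -> A) : (forall a b, I a b = I b a) ->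
  I 0 2 = I 0 1 -> I 0 3 = I 0 1 -> I 1 2 = I 0 2 -> I 1 3 = I 0 3 -> I 2 3 = I 0 3 ->
  forall a b, a != b -> I a b = I 0 1.
Proof.
move=> sy e1 e2 e3 e4 e5; do 2! apply: ord4P => //; move=> _;
  rewrite ?(sy 1 0) ?(sy 2 0) ?(sy 3 0) ?(sy 2 1) ?(sy 3 1) ?(sy 3 2);
  by rewrite ?e3 ?e4 ?e5 ?e1 ?e2.
Qed.

(** Vertex exchanges preserve volume and permute the shape functions, so their six integrals agree,
    and they add up to the volume. Hence the midpoint rule over the edges is exact on the local
    space. *)
Lemma int_shape T e : is_edge e -> int3 (cell T)° (shape T e) = vol (cell T)° / 6.
Proof.
pose I a b := int3 (cell T)° (shape T [set a; b]%SET).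
have sw a b c : a != b -> a != c -> b != c -> I a c = I b c by exact: int_shape_swap.
have sy a b : I a b = I b a by rewrite /I finset.setUC.
have tot : \sum_(e | is_edge e) int3 (cell T)° (shape T e) = vol (cell T)°.
  rewrite -[RHS]mul1r -int3_cst; last exact: mset_icell.
  pose F e := fun x => if is_edge e then shape T e x else 0.
  have := @int3_sum R _ (index_enum _) (cell T)° F (mset_icell T) (finv_icell T).
  move=> H; rewrite big_mkcond.
  transitivity (\sum_(e <- index_enum _) int3 (cell T)° (F e)).
    apply: eq_bigr => e' _; rewrite /F; case: ifP => // _.
    by rewrite int3_cst ?mul0r //; exact: mset_icell.
  rewrite -H; last first.
    move=> e'; rewrite /F; case: (boolP (is_edge e')) => ee; first exact: nice_shape.
    by apply: nice_cst; [exact: mset_icell|exact: finv_icell].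
  apply: eq_int3 => x _; rewrite -(shape_sum T x) [RHS]big_mkcond.
  by apply: eq_bigr.
rewrite sum_edges -!/(I _ _) in tot.
have e1 : I 0 2 = I 0 1 by rewrite !(sy 0); apply: sw.
have e2 : I 0 3 = I 0 1 by rewrite !(sy 0); apply: sw.
have e3 : I 1 2 = I 0 2 by apply: sw.
have e4 : I 1 3 = I 0 3 by apply: sw.
have e5 : I 2 3 = I 0 3 by apply: sw.
move=> /edgeP[a [b [ab ->]]]; rewrite -/(I a b) (edge_constant sy e1 e2 e3 e4 e5 ab).
by move: tot; rewrite e5 e4 e3 e2 e1; move: (I 0 1) (vol _) => x v; lra.
Qed.

End Shape.

(** * Continuity and local interpolation *)

Section Continuity.
Context (R : realType).
Local Notation E3 := 'rV[R]_3.
Implicit Types (x y : E3) (T : elem R) (f : E3 -> R).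

Lemma continuousP3 f x : {for x, continuous f} <->
  forall e, 0 < e -> exists2 d, 0 < d & forall y, `|x - y| < d -> `|f x - f y| < e.
Proof.
split=> [h e e0|h].
  have /cvgrPdist_lt/(_ e e0)/nbhs_ballP[d /= d0 hd] : f @ x --> f x by exact: h.
  by exists d => // y /ballE3; exact: hd.
apply: (proj2 (@cvgrPdist_lt R _ _ (nbhs x) _ f (f x))) => e /h[d d0 hd]; apply/nbhs_ballP; exists d => //= y /ballE3.
exact: hd.
Qed.

Lemma continuousD3 f g x : {for x, continuous f} -> {for x, continuous g} ->
  {for x, continuous (fun y => f y + g y)}.
Proof. by move=> cf cg; apply: (@cvgD R R^o E3 (nbhs x) _ f g (f x) (g x)). Qed.

Lemma continuousM3 f g x : {for x, continuous f} -> {for x, continuous g} ->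
  {for x, continuous (fun y => f y * g y)}.
Proof. by move=> cf cg; apply: (@cvgM R E3 (nbhs x) _ f g (f x) (g x)). Qed.

Lemma continuousZ3 (c : R) f x : {for x, continuous f} -> {for x, continuous (fun y => c * f y)}.
Proof. by move=> cf; apply: continuousM3 => //; exact: cst_continuous. Qed.

Lemma continuous_sum3 (I : Type) (s : seq I) (P : pred I) (F : I -> E3 -> R) x :
  (forall i, P i -> {for x, continuous (F i)}) ->
  {for x, continuous (fun y => \sum_(i <- s | P i) F i y)}.
Proof.
move=> cF; elim: s => [|i s IH].
  rewrite (_ : (fun y => _) = fun=> 0); first exact: cst_continuous.
  by apply/funext => y; rewrite big_nil.
case: (boolP (P i)) => Pi; last first.
  rewrite (_ : (fun y => _) = fun y => \sum_(i <- s | P i) F i y) //.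
  by apply/funext => y; rewrite big_cons (negbTE Pi).
rewrite (_ : (fun y => _) = fun y => F i y + \sum_(i <- s | P i) F i y).
  by apply: continuousD3 => //; exact: cF.
by apply/funext => y; rewrite big_cons Pi.
Qed.

Lemma continuous_bary T k : continuous (bary T k).
Proof.
move=> x; apply/continuousP3 => e e0; have [C C0 lip] := lbary_lip T.
exists (e / C) => [|y]; first exact: divr_gt0.
rewrite ltr_pdivlMr // mulrC -lbaryB; exact: le_lt_trans (lip _ _).
Qed.

Lemma continuous_shape T e : is_edge e -> continuous (shape T e).
Proof.
move=> /edgeP[a [b [ab ->]]] x.
have cb k : {for x, continuous (bary T k)} by exact: continuous_bary.
have -> : shape T [set a; b]%SET = fun y => 2 * ((bary T a y + bary T b y) * (bary T a y + bary T b y)) +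
    -1 * (bary T a y + bary T b y) + 1 / 3 + (- 2 / 3) * (bary T 0 y * bary T 0 y + bary T 1 y * bary T 1 y +
    bary T 2 y * bary T 2 y + bary T 3 y * bary T 3 y).
  by apply/funext => y; rewrite shapeE sum_edge // sum_ord4; field.
apply: continuousD3; last by apply: continuousZ3; do ! apply: continuousD3; exact: continuousM3.
apply: continuousD3; last exact: cst_continuous.
apply: continuousD3; last by apply: continuousZ3; exact: continuousD3.
by apply: continuousZ3; apply: continuousM3; exact: continuousD3.
Qed.

Definition loc T (nu : E3 -> R) x : R :=
  \sum_(e | is_edge e) nu (midpoint T e) * shape T e x.

Lemma continuous_loc T nu : continuous (loc T nu).
Proof.
move=> x; apply: continuous_sum3 => e ee.
by apply: continuousZ3; exact: continuous_shape.
Qed.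

Lemma loc_midpoint T nu e : is_edge e -> loc T nu (midpoint T e) = nu (midpoint T e).
Proof.
move=> ee; rewrite /loc (bigD1 e) //= shape_midpoint // eqxx mulr1 big1 ?addr0 // => e' /andP[ee' ne].
by rewrite shape_midpoint // (negbTE ne) mulr0.
Qed.

Lemma midpoint2 T a b : a != b -> midpoint T [set a; b]%SET = 2^-1 *: (vert T a + vert T b).
Proof. by move=> ab; rewrite /midpoint sum_edge. Qed.

Lemma midpoint_cell T e : is_edge e -> cell T (midpoint T e).
Proof. by move=> ee; apply/cellP => k; rewrite midpoint_bary //; case: ifP. Qed.

Lemma loc_le T nu x : cell T x ->
  `|loc T nu x| <= 2 * \sum_(e | is_edge e) `|nu (midpoint T e)|.
Proof.
move=> cx; apply: le_trans (ler_norm_sum _ _ _) _; rewrite mulr_sumr.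
by apply: ler_sum => e ee; rewrite normrM mulrC ler_wpM2r // shape_le2.
Qed.

Lemma mfn_loc T nu : mfn (loc T nu).
Proof.
apply: (@mfn_ext _ (fun x => \sum_(e <- index_enum _) (if is_edge e then nu (midpoint T e) * shape T e x else 0))).
  by move=> x; rewrite /loc [RHS]big_mkcond.
apply: mfn_sum => e; case: (boolP (is_edge e)) => ee; last exact: mfn_cst.
by apply: mfnM; [exact: mfn_cst|exact: mfn_shape].
Qed.

Lemma mfn_if (A : set E3) f : mset A -> mfn f -> mfn (fun x => if `[< A x >] then f x else 0).
Proof.
move=> mA mf; apply: (@mfn_ext _ (fun x => \1_A x * f x)).
  by move=> x; rewrite indicE; case: asboolP => Ax; [rewrite mem_set // mul1r|rewrite memNset // mul0r].
apply: mfnM => //; rewrite /mfn (_ : _ \o _ = \1_(@vec3 R @^-1` A)).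
  exact: measurable_indic.
by apply/funext => p /=; rewrite !indicE; congr (_%:R); apply/idP/idP; rewrite !inE.
Qed.

End Continuity.

(** * Global nodal functions and membership in [Wh] *)

Section Nodal.
Context (R : realType) (N : nat) (Omega : set 'rV[R]_3) (K : mesh R N).
Local Notation E3 := 'rV[R]_3.
Implicit Types (x y : E3) (i j : 'I_N) (k l : 'I_4) (nu : E3 -> R).

(* Points of a common face are attributed to the cell of least index. *)
Definition own i : set E3 :=
  [set x | cell (K i) x /\ forall j, ((j < i)%N -> ~ cell (K j) x)].

Definition nod nu x : R := \sum_i (if `[< own i x >] then loc (K i) nu x else 0).

Lemma own_uniq i j x : own i x -> own j x -> i = j.
Proof.
move=> [ci hi] [cj hj]; apply: val_inj; case: (ltngtP i j) => // h.
- by case: (hj i h).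
- by case: (hi j h).
Qed.

Lemma own_ex x i : cell (K i) x -> exists j, own j x.
Proof.
move=> ci; have [j /asboolP cj hj] := @arg_minnP _ i (fun j => `[< cell (K j) x >]) (@nat_of_ord N) (asboolT ci).
exists j; split => // l lj cl; have := hj l (asboolT cl); rewrite leqNgt lj //.
Qed.

Lemma nod_own nu i x : own i x -> nod nu x = loc (K i) nu x.
Proof.
move=> oi; rewrite /nod (bigD1 i) //= asboolT // big1 ?addr0 // => j ji.
by case: asboolP => // oj; move: ji; rewrite (own_uniq oi oj) eqxx.
Qed.

Lemma nod_cell nu i x : cell (K i) x -> exists2 j, cell (K j) x & nod nu x = loc (K j) nu x.
Proof. by move=> /own_ex[j oj]; exists j; [case: oj|exact: nod_own]. Qed.

Lemma mset_own i : mset (own i).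
Proof.
apply: msetI; first exact: mset_cell.
apply: mset_forall => j; have [ji|nji] := boolP (j < i)%N.
  rewrite (_ : (fun x => _) = ~` cell (K j)); first by apply: msetC; exact: mset_cell.
  by apply/seteqP; split=> x /=; [apply|move=> ? _].
rewrite (_ : (fun x => _) = setT); first exact: measurableT.
by apply/seteqP; split.
Qed.

Lemma mfn_nod nu : mfn (nod nu).
Proof. by apply: mfn_sum => i; apply: mfn_if; [exact: mset_own|exact: mfn_loc]. Qed.

Lemma nod_le nu x : `|nod nu x| <= \sum_i 2 * \sum_(e | is_edge e) `|nu (midpoint (K i) e)|.
Proof.
apply: le_trans (ler_norm_sum _ _ _) _; apply: ler_sum => i _.
case: asboolP => [[ci _]|_]; first exact: loc_le.
by rewrite normr0 mulr_ge0 // sumr_ge0.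
Qed.

Hypothesis tet : tetrahedrization Omega K.
Hypothesis conf : conforming K.

Lemma mset_omega : mset Omega.
Proof. by apply: mset_open; exact: omega_open tet. Qed.

Lemma finv_omega : finv Omega.
Proof.
apply: (@finv_bounded _ _ (\sum_i \sum_k `|vert (K i) k|)) mset_omega _ => x /(omega_cell tet)[i ci].
apply: le_trans (cell_norm ci) _; rewrite (bigD1 i) //= lerDl.
by do 2! apply: sumr_ge0 => ? _.
Qed.

Lemma L2_nice f : nice Omega f -> L2 Omega f.
Proof.
move=> nf; case: (nf) => _ _ mf _; split; first exact: measurable_funTS.
exact: nice_integrable (nice_sq nf).
Qed.

Lemma nice_nod nu : nice Omega (nod nu).
Proof.
split; [exact: mset_omega|exact: finv_omega|exact: mfn_nod|].
by exists (\sum_i 2 * \sum_(e | is_edge e) `|nu (midpoint (K i) e)|) => x _; exact: nod_le.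
Qed.

Lemma nod_int nu i x : (forall k, 0 < bary (K i) k x) -> nod nu x = loc (K i) nu x.
Proof.
move=> h; have ci : cell (K i) x by apply/cellP => k; exact: ltW.
by have [j cj ->] := nod_cell nu ci; rewrite (int_cell_inj conf h cj).
Qed.

Lemma common_edge i j e : is_edge e -> cell (K j) (midpoint (K i) e) ->
  exists2 e', is_edge e' & midpoint (K j) e' = midpoint (K i) e.
Proof.
move=> /edgeP[a [b [ab eE]]] cj; have ee : is_edge e by rewrite eE is_edge2.
have ci := midpoint_cell (K i) ee.
have pos k : k \in e -> 0 < bary (K i) k (midpoint (K i) e).
  by move=> ke; rewrite midpoint_bary // ke invr_gt0.
have [a' ha] := common_vertex conf ci cj (pos a ltac:(by rewrite eE !finset.inE eqxx)).
have [b' hb] := common_vertex conf ci cj (pos b ltac:(by rewrite eE !finset.inE eqxx orbT)).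
have ab' : a' != b'.
  by apply: contra ab => /eqP h; move: ha; rewrite h hb => /vert_inj ->.
by exists [set a'; b']%SET; [exact: is_edge2|rewrite eE !midpoint2 // ha hb].
Qed.

(** Close to an edge midpoint only cells containing it occur; it is an edge midpoint of each of
    them, where the local functions take the nodal value. This yields continuity at internal
    midpoints and the zero limit at boundary ones. *)
Lemma nod_near nu i e (eps : R) : is_edge e -> 0 < eps ->
  exists2 d, 0 < d & forall x, `|midpoint (K i) e - x| < d -> (exists j, cell (K j) x) ->
    `|nu (midpoint (K i) e) - nod nu x| < eps.
Proof.
move=> ee e0; set m := midpoint (K i) e.
have [d1 d10 near] := near_cells K m.
have /choice[F FP] j : exists d, 0 < d /\ forall x, `|m - x| < d ->
    `|loc (K j) nu m - loc (K j) nu x| < eps.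
  have /continuousP3 /(_ eps e0)[d d0 hd] := @continuous_loc R (K j) nu m.
  by exists d.
have [d2 d20 le2] := finite_min_pos (fun j => (FP j).1).
exists (Num.min d1 d2) => [|x]; first by rewrite lt_min d10.
rewrite lt_min => /andP[x1 x2] [j0 cj0].
have [j cj ->] := nod_cell nu cj0.
have cm : cell (K j) m by exact: near cj.
have [e' ee' mE] := common_edge ee cm.
have <- : loc (K j) nu m = nu m by rewrite /m -mE loc_midpoint.
by apply: (FP j).2; exact: lt_le_trans (le2 j).
Qed.

(** Membership in [Omega] depends only on the open face containing the point. The cells at [y]
    contain all vertices of this face, and they cut out the same cones near [y] and near [m]; so
    they cover a neighbourhood of [m] because they cover one of [y]. *)
Lemma omega_support i y m : cell (K i) y -> cell (K i) m ->
  (forall k, (0 < bary (K i) k y) = (0 < bary (K i) k m)) -> Omega y -> Omega m.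
Proof.
move=> cy cm supp oy.
have [e1 e10 he1] := omega_near tet oy.
have [e2 e20 he2] := near_cells K y.
have vj j k : cell (K j) y -> 0 < bary (K i) k m -> cell (K j) (vert (K i) k).
  move=> cj; rewrite -supp => bk; have [k' <-] := common_vertex conf cy cj bk.
  exact: vert_cell.
have comb j l z : cell (K i) z -> bary (K j) l z = \sum_k bary (K i) k z * bary (K j) l (vert (K i) k).
  by move=> cz; rewrite {1}(bary_rec (K i) z) bary_comb ?bary_sum.
have nz z k : cell (K i) z -> bary (K i) k z = 0 \/ 0 < bary (K i) k z.
  move=> /cellP/(_ k); rewrite le_eqVlt => /orP[/eqP <-|]; by [left|right].
have mj j : cell (K j) y -> cell (K j) m.
  move=> cj; apply/cellP => l; rewrite comb //; apply: sumr_ge0 => k _.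
  case: (nz m k cm) => [->|bk]; first by rewrite mul0r.
  by rewrite mulr_ge0 ?(ltW bk) //; apply: (cellP _ _).1; exact: vj.
have zero j l : cell (K j) y -> bary (K j) l m = 0 -> bary (K j) l y = 0.
  move=> cj; rewrite comb // => /eqP; rewrite psumr_eq0; last first.
    move=> k _; case: (nz m k cm) => [->|bk]; first by rewrite mul0r.
    by rewrite mulr_ge0 ?(ltW bk) //; apply: (cellP _ _).1; exact: vj.
  move=> /allP h; rewrite comb //; apply: big1 => k _.
  have /eqP := h k (mem_index_enum _).
  case: (nz y k cy) => [->|]; first by rewrite mul0r.
  by rewrite supp => bk /eqP; rewrite mulf_eq0 gt_eqF //= => /eqP ->; rewrite mulr0.
have /choice[F FP] j : exists d, 0 < d /\ (cell (K j) y -> forall z, `|m - z| < d ->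
    forall l, 0 < bary (K j) l m -> 0 <= bary (K j) l z).
  have [cj|ncj] := pselect (cell (K j) y); last by exists 1; split.
  have [C C0 lip] := lbary_lip (K j).
  have [d d0 hd] : exists2 d, 0 < d & forall l, 0 < bary (K j) l m -> d <= bary (K j) l m.
    pose G l := if 0 < bary (K j) l m then bary (K j) l m else 1.
    have G0 l : 0 < G l by rewrite /G; case: ifP.
    have [d d0 hd] := finite_min_pos G0.
    by exists d => // l bl; have := hd l; rewrite /G bl.
  exists (d / C); split; first exact: divr_gt0.
  move=> _ z; rewrite ltr_pdivlMr // => hz l /hd dl.
  have : lbary (K j) l (m - z) <= C * `|m - z| by apply: le_trans (ler_norm _) (lip _ _).
  rewrite lbaryB mulrC; lra.
have [d d0 hd] := finite_min_pos (fun j => (FP j).1).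
apply: (in_omega tet d0) => z mz.
pose s := Num.min 1 (Num.min e1 e2 / (2 * (`|z - m| + 1))).
have zm0 : 0 < `|z - m| + 1 by rewrite ltr_wpDl.
have e12 : 0 < Num.min e1 e2 by rewrite lt_min e10.
have s0 : 0 < s by rewrite lt_min ltr01 divr_gt0 // mulr_gt0.
(* A cell containing [w] contains [z]: the coordinates that vanish at [m] vanish at [y], so their
   values at [w] are [s] times those at [z], and the others stay nonnegative near [m]. *)
pose w := y + s *: (z - m).
have yw : `|y - w| < Num.min e1 e2.
  rewrite opprD addNKr normrN normrZ gtr0_norm //.
  have sE : s * (2 * (`|z - m| + 1)) <= Num.min e1 e2.
    by rewrite -ler_pdivlMr ?mulr_gt0 // ge_min lexx orbT.
  by have := mulr_ge0 (ltW s0) (normr_ge0 (z - m)); nra.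
move: yw; rewrite lt_min => /andP[yw1 yw2].
have [j cjw] := omega_cell tet (he1 w yw1).
have cj : cell (K j) y := he2 w yw2 j cjw.
exists j; apply/cellP => l.
have /cellP/(_ l) := mj j cj; rewrite le_eqVlt => /orP[/eqP bl|bl]; last first.
  by apply: (FP j).2 bl => //; exact: lt_le_trans (hd j).
have ly := zero j l cj (esym bl).
have /cellP/(_ l) := cjw; rewrite baryD lbaryZ lbaryB ly -bl subr0 add0r.
by rewrite pmulr_rge0.
Qed.

(** The edge has a point in [Omega], possibly an endpoint. Moved slightly towards the midpoint it is
    in the open edge, and [omega_support] applies. *)
Lemma internal_mid i e : is_edge e -> ~ boundary_edge Omega (K i) e -> Omega (midpoint (K i) e).
Proof.
move=> ee nb; set m := midpoint _ _; have cm : cell (K i) m := midpoint_cell (K i) ee.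
have [y [fy oy]] : exists y, face (K i) e y /\ Omega y.
  apply: contrapT => no; apply: nb => y fy.
  have cy : cell (K i) y by apply/cellP; case/faceP: fy.
  by apply/(bd_cell tet cy) => oy; apply: no; exists y.
case/faceP: fy => fy0 fy1.
have [d d0 hd] := omega_near tet oy.
pose t := Num.min 1 (d / (2 * (`|m - y| + 1))).
have z0 : 0 < `|m - y| + 1 by rewrite ltr_wpDl.
have t0 : 0 < t by rewrite lt_min ltr01 divr_gt0 // mulr_gt0.
have t1 : t <= 1 by rewrite ge_min lexx.
pose y' := y + t *: (m - y).
have oy' : Omega y'.
  apply: hd; rewrite opprD addNKr normrN normrZ gtr0_norm //.
  have tE : t * (2 * (`|m - y| + 1)) <= d by rewrite -ler_pdivlMr ?mulr_gt0 // ge_min lexx orbT.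
  by have := mulr_ge0 (ltW t0) (normr_ge0 (m - y)); nra.
have by' k : bary (K i) k y' = (1 - t) * bary (K i) k y + t * (if k \in e then 2^-1 else 0).
  by rewrite bary_conv midpoint_bary.
apply: (@omega_support i y' m) => //.
- by apply/cellP => k; rewrite by' addr_ge0 // mulr_ge0 ?subr_ge0 ?(ltW t0) //; case: ifP.
- move=> k; rewrite by' midpoint_bary //; case: ifPn => ke.
    by rewrite invr_gt0 ltr0n ltr_wpDl // ?mulr_gt0 ?invr_gt0 // mulr_ge0 ?subr_ge0.
  by rewrite fy1 // !mulr0 addr0.
Qed.

Definition nodv (nu : E3 -> E3) x : E3 := \row_j nod (fun m => nu m 0 j) x.

Lemma Wh_nodv (nu : E3 -> E3) :
  (forall i e, is_edge e -> boundary_edge Omega (K i) e -> nu (midpoint (K i) e) = 0) ->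
  Wh Omega K (nodv nu).
Proof.
move=> bnu.
have compE (j : 'I_3) : (fun x => nodv nu x 0 j) = nod (fun m => nu m 0 j).
  by apply/funext => x; rewrite mxE.
split=> [j|i e ee be].
  rewrite compE; split.
  - exact: L2_nice (nice_nod _).
  - move=> i; exists (fun y => \sum_(e | is_edge e) nu (midpoint (K i) e) 0 j * hshape e y).
      by apply: Vhat_sum => e; exact: Vhat_hshape.
    move=> y iy; have hy k : 0 < bary (K i) k (Fmap (K i) y).
      rewrite /bary FmapK.
      (* The reference tetrahedron is itself an element, so [interior_cell] describes its
         interior. *)
      pose I := @Elem R 1%:M 0 (unitmx1 _ _).
      have FI z : Finv I z = z by rewrite /Finv /= invmx1 mulmx1 subr0.
      suff : (cell I)° y by move=> /interior_cell/(_ k); rewrite /bary FI.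
      rewrite (_ : cell I = @That R) //; apply/seteqP; split=> z.
        by case=> w Tw <-; rewrite /Fmap /= mulmx1 addr0.
      by move=> Tz; exists z => //; rewrite /Fmap /= mulmx1 addr0.
    rewrite (nod_int _ hy) /loc; apply: eq_bigr => e _.
    by rewrite /shape FmapK.
  - move=> i e ee nb; apply/continuousP3 => eps e0; set m := midpoint _ _.
    have om : Omega m by exact: internal_mid.
    have [d1 d10 h1] := omega_near tet om.
    have [d2 d20 h2] := nod_near (fun m => nu m 0 j) i ee e0.
    have [j0 cj0] := omega_cell tet om.
    have -> : nod (fun m => nu m 0 j) m = nu m 0 j.
      have [j1 cj1 ->] := nod_cell (fun m => nu m 0 j) cj0.
      have [e' ee' mE] := common_edge ee cj1.
      by rewrite /m -mE loc_midpoint.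
    exists (Num.min d1 d2) => [|x]; first by rewrite lt_min d10.
    rewrite lt_min => /andP[x1 x2]; apply: h2 => //.
    by apply: (omega_cell tet); exact: h1.
apply/cvgrPdist_lt => eps e0.
have /choice[F FP] (j : 'I_3) : exists d, 0 < d /\ forall x, `|midpoint (K i) e - x| < d -> (exists j, cell (K j) x) ->
    `|nu (midpoint (K i) e) 0 j - nod (fun m => nu m 0 j) x| < eps.
  by have [d d0 hd] := nod_near (fun m => nu m 0 j) i ee e0; exists d.
have [d d0 hd] := finite_min_pos (fun j : 'I_3 => (FP j).1).
apply/nbhs_ballP; exists d => //= x /ballE3 xd ox.
apply: norm_lt => // j; rewrite !mxE.
have := (FP j).2 x (lt_le_trans xd (hd j)) (omega_cell tet ox).
by rewrite bnu // mxE.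
Qed.

End Nodal.

(** * Gradients of nodal functions *)

Section Gradients.
Context (R : realType).
Local Notation E3 := 'rV[R]_3.
Implicit Types (x y v : E3) (T : elem R) (f : E3 -> R).

Lemma derive_quad f x v (B C d : R) : 0 < d ->
  (forall t, `|t| < d -> f (x + t *: v) = f x + t * B + t ^+ 2 * C) -> 'D_v f x = B.
Proof.
move=> d0 h; rewrite /derive; apply: cvg_lim => //; apply/cvgrPdist_lt => e e0.
have C1 : 0 < `|C| + 1 by rewrite ltr_wpDl.
rewrite /dnbhs near_withinE; apply/nbhs_ballP; exists (Num.min d (e / (`|C| + 1))) => /=.
  by rewrite lt_min d0 divr_gt0.
move=> t; rewrite /ball /= sub0r normrN lt_min => /andP[td te] t0.
rewrite /= (addrC (t *: v)) (h t td).
have -> : t^-1 *: (f x + t * B + t ^+ 2 * C - f x) = B + t * C.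
  by rewrite -[LHS]/(t^-1 * _); field.
rewrite opprD addrA subrr add0r normrN normrM.
move: te; rewrite ltr_pdivlMr //; apply: le_lt_trans.
by rewrite ler_wpM2l // lerDl.
Qed.

Lemma gradE f x (b : E3) : (forall j, exists C d, 0 < d /\
   forall t, `|t| < d -> f (x + t *: delta_mx 0 j) = f x + t * b 0 j + t ^+ 2 * C) ->
  grad f x = b.
Proof.
move=> h; apply/rowP => j; rewrite mxE; have [C [d [d0 hd]]] := h j.
exact: derive_quad hd.
Qed.

Lemma norm_delta j : `|delta_mx 0 j : E3| = 1.
Proof.
apply/eqP; rewrite eq_le; apply/andP; split.
  by apply: norm_le => // i; rewrite mxE /= normr_nat lern1 leq_b1.
by apply: le_trans (norm_coord _ j); rewrite mxE !eqxx normr1.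
Qed.

Lemma icell_near T x : (forall k, 0 < bary T k x) ->
  exists2 d, 0 < d & forall y, `|x - y| < d -> forall k, 0 < bary T k y.
Proof.
move=> /interior_cell ix.
have [d d0 hd] := openE3 (@open_interior _ (cell T)) ix.
by exists d => // y /hd/interior_cell.
Qed.

Lemma grad_cell f p T x (b : E3) : (forall k, 0 < bary T k x) ->
  (forall y, (forall k, 0 < bary T k y) -> f y = p y) ->
  (forall j, exists C, forall t, p (x + t *: delta_mx 0 j) = p x + t * b 0 j + t ^+ 2 * C) ->
  grad f x = b.
Proof.
move=> hx fp hp; apply: gradE => j; have [C hC] := hp j.
have [d d0 hd] := icell_near hx.
exists C, d; split=> // t td; rewrite !fp //; apply: hd.
by rewrite opprD addNKr normrN normrZ norm_delta mulr1.
Qed.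

Definition dshape T (e : {set 'I_4}) x v : R :=
  (4 * \sum_(k in e) bary T k x - 1) * \sum_(k in e) lbary T k v
  - 4 / 3 * \sum_k bary T k x * lbary T k v.

Definition d2shape T (e : {set 'I_4}) v : R :=
  2 * (\sum_(k in e) lbary T k v) ^+ 2 - 2 / 3 * \sum_k lbary T k v ^+ 2.

Lemma shape_taylor T e x v (t : R) : is_edge e ->
  shape T e (x + t *: v) = shape T e x + t * dshape T e x v + t ^+ 2 * d2shape T e v.
Proof.
move=> /edgeP[a [b [ab ->]]].
rewrite !shapeE /dshape /d2shape !sum_edge // !sum_ord4 !baryD !lbaryZ.
by field.
Qed.

Lemma dshapeD T e x v w : is_edge e ->
  dshape T e (x + v) w = dshape T e x w + (4 * (\sum_(k in e) lbary T k v) * (\sum_(k in e) lbary T k w)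
    - 4 / 3 * \sum_k lbary T k v * lbary T k w).
Proof.
move=> /edgeP[a [b [ab ->]]].
rewrite /dshape !sum_edge // !sum_ord4 !baryD.
by field.
Qed.

Lemma dshape_sum T x v : \sum_(e | is_edge e) dshape T e x v = 0.
Proof.
have l3 : lbary T 3 v = - (lbary T 0 v + lbary T 1 v + lbary T 2 v).
  by have := lbary_sum T v; rewrite sum_ord4 => h; lra.
have b3 : bary T 3 x = 1 - (bary T 0 x + bary T 1 x + bary T 2 x).
  by have := bary_sum T x; rewrite sum_ord4 => h; lra.
rewrite sum_edges /dshape !sum_edge // !sum_ord4 l3 b3.
by field.
Qed.

Lemma dshape_lin T e x v : is_edge e ->
  dshape T e x v = \sum_j v 0 j * dshape T e x (delta_mx 0 j).
Proof.
move=> /edgeP[a [b [ab ->]]].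
have dZ c w : dshape T [set a; b]%SET x (c *: w) = c * dshape T [set a; b]%SET x w.
  by rewrite /dshape !sum_edge // !sum_ord4 !lbaryZ; field.
have dD : {morph dshape T [set a; b]%SET x : u w / u + w}.
  by move=> u w; rewrite /dshape !sum_edge // !sum_ord4 !lbaryD; field.
rewrite {1}(row_sum_delta v) (big_morph _ dD (_ : _ = 0)).
  by apply: eq_bigr => j _; rewrite dZ.
by rewrite -(scale0r (0 : E3)) dZ mul0r.
Qed.

(** [bary] has values in [0, 1] on the ball, so it changes by at most 1 over a distance [r]. *)
Lemma lbary_ball T c (r : R) k v : 0 < r -> (forall x, `|x - c| <= r -> cell T x) ->
  `|lbary T k v| <= `|v| / r.
Proof.
move=> r0 h; have [->|v0] := eqVneq v 0.
  by rewrite -(scale0r (0 : E3)) lbaryZ mul0r normr0 divr_ge0 // ltW.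
have nv : 0 < `|v| by rewrite normr_gt0.
pose w := (r / `|v|) *: v.
have vE : v = (`|v| / r) *: w.
  by rewrite scalerA mulrA divfK ?gt_eqF // divff ?gt_eqF // scale1r.
have nw : `|w| = r.
  by rewrite normrZ ger0_norm ?divr_ge0 ?(ltW r0) // divfK // gt_eqF.
rewrite {1}vE lbaryZ normrM ger0_norm ?divr_ge0 ?(ltW r0) // ler_piMr ?divr_ge0 ?(ltW r0) //.
have c1 : cell T (c + w) by apply: h; rewrite addrAC subrr add0r nw.
have c0 : cell T c by apply: h; rewrite subrr normr0 ltW.
have -> : lbary T k w = bary T k (c + w) - bary T k c by rewrite baryD; ring.
have /cellP/(_ k) p1 := c1; have /cellP/(_ k) p0 := c0.
have q1 := bary_le1 k c1; have q0 := bary_le1 k c0.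
by rewrite ler_norml; apply/andP; split; lra.
Qed.

Lemma dshape_le T e x v (L : R) : is_edge e -> cell T x -> (forall k, `|lbary T k v| <= L) ->
  `|dshape T e x v| <= 8 * L.
Proof.
move=> /edgeP[a [b [ab ->]]] cx hl; rewrite /dshape !sum_edge //.
have b0 k : 0 <= bary T k x by move/cellP: cx.
have L0 : 0 <= L by apply: le_trans (hl 0).
have s1 : bary T a x + bary T b x <= 1.
  rewrite -(bary_sum T x) (bigD1 a) //= lerD2l (bigD1 b) 1?eq_sym //= lerDl.
  by apply: sumr_ge0.
have h1 : `|(4 * (bary T a x + bary T b x) - 1) * (lbary T a v + lbary T b v)| <= 3 * (2 * L).
  rewrite normrM ler_pM //.
    by rewrite ler_norml; apply/andP; split; have := b0 a; have := b0 b; lra.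
  by apply: le_trans (ler_normD _ _) _; have := hl a; have := hl b; lra.
have h2 : `|\sum_k bary T k x * lbary T k v| <= L.
  apply: le_trans (ler_norm_sum _ _ _) _.
  apply: le_trans (_ : \sum_k bary T k x * L <= _); last by rewrite -mulr_suml bary_sum mul1r.
  by apply: ler_sum => k _; rewrite normrM ger0_norm // ler_wpM2l.
apply: le_trans (ler_normB _ _) _; rewrite [X in _ + X]normrM ger0_norm //; lra.
Qed.

Lemma continuous_dshape T e v : is_edge e -> continuous (fun x => dshape T e x v).
Proof.
move=> /edgeP[a [b [ab ->]]] x.
have -> : (fun x => dshape T [set a; b]%SET x v) = fun y =>
   (\sum_(k <- [:: a; b]) (4 * (lbary T a v + lbary T b v)) * bary T k y + - (lbary T a v + lbary T b v)) +
   \sum_k (- 4 / 3 * lbary T k v) * bary T k y.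
  by apply/funext => y; rewrite /dshape !sum_edge // !sum_ord4 !big_cons big_nil; field.
have cb k : {for x, continuous (bary T k)} by exact: continuous_bary.
apply: continuousD3; last by apply: continuous_sum3 => k _; exact: continuousZ3.
by apply: continuousD3; [apply: continuous_sum3 => k _; exact: continuousZ3|exact: cst_continuous].
Qed.

Lemma mfn_dshape T e v : is_edge e -> mfn (fun x => dshape T e x v).
Proof.
move=> /edgeP[a [b [ab ->]]].
apply: (@mfn_ext _ (fun y =>
   (\sum_(k <- [:: a; b]) (4 * (lbary T a v + lbary T b v)) * bary T k y + - (lbary T a v + lbary T b v)) +
   \sum_(k <- index_enum _) (- 4 / 3 * lbary T k v) * bary T k y)).
  by move=> y; rewrite /dshape !sum_edge // !sum_ord4 !big_cons big_nil; field.
have mM (c : R) k : mfn (fun y => c * bary T k y) by apply: mfnM; [exact: mfn_cst|exact: mfn_bary].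
apply: mfnD; last exact: mfn_sum.
by apply: mfnD; [exact: mfn_sum|exact: mfn_cst].
Qed.

Definition dloc T (nu : E3 -> R) x v : R :=
  \sum_(e | is_edge e) nu (midpoint T e) * dshape T e x v.

Lemma loc_taylor T nu x v (t : R) : loc T nu (x + t *: v) = loc T nu x + t * dloc T nu x v +
  t ^+ 2 * \sum_(e | is_edge e) nu (midpoint T e) * d2shape T e v.
Proof.
rewrite /loc /dloc !mulr_sumr -!big_split; apply: eq_bigr => e ee /=.
by rewrite shape_taylor //; ring.
Qed.

Lemma dloc_lin T nu x v : dloc T nu x v = \sum_j v 0 j * dloc T nu x (delta_mx 0 j).
Proof.
rewrite /dloc; rewrite (eq_bigr _ (fun e ee => congr1 ( *%R _) (dshape_lin T x v ee))).
under eq_bigr do rewrite mulr_sumr.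
rewrite exchange_big; apply: eq_bigr => j _; rewrite mulr_sumr.
by apply: eq_bigr => e _; rewrite mulrCA.
Qed.

Lemma dloc_step T nu x v : dloc T nu (x + v) v = dloc T nu x v +
  2 * \sum_(e | is_edge e) nu (midpoint T e) * d2shape T e v.
Proof.
rewrite /dloc mulr_sumr -big_split; apply: eq_bigr => e ee /=.
rewrite dshapeD // /d2shape; under [X in _ - _ * X]eq_bigr do rewrite -expr2.
by field.
Qed.

(** The shape functions add up to 1, so one nodal value may be subtracted from all. The 48 is six
    edges times the 8 of [dshape_le]. *)
Lemma dloc_le T nu x v (L d : R) : cell T x -> (forall k, `|lbary T k v| <= L) ->
  (forall e e', is_edge e -> is_edge e' -> `|nu (midpoint T e) - nu (midpoint T e')| <= d) ->
  `|dloc T nu x v| <= 48 * L * d.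
Proof.
move=> cx hL hd; pose e0 : {set 'I_4} := [set 0; 1]%SET.
have ee0 : is_edge e0 by exact: is_edge2.
have d0 : 0 <= d by apply: le_trans (hd e0 e0 ee0 ee0).
have L0 : 0 <= L by apply: le_trans (hL 0).
have -> : dloc T nu x v = \sum_(e | is_edge e) (nu (midpoint T e) - nu (midpoint T e0)) * dshape T e x v.
  rewrite (eq_bigr (fun e => nu (midpoint T e) * dshape T e x v - nu (midpoint T e0) * dshape T e x v)).
    by rewrite sumrB -mulr_sumr dshape_sum mulr0 subr0.
  by move=> e _; rewrite mulrBl.
apply: le_trans (ler_norm_sum _ _ _) _.
apply: le_trans (_ : \sum_(e : {set 'I_4} | is_edge e) d * (8 * L) <= _); last first.
  by rewrite sum_edges; lra.
by apply: ler_sum => e ee; rewrite normrM ler_pM // ?hd // dshape_le.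
Qed.

Lemma continuous_dloc T nu v : continuous (fun x => dloc T nu x v).
Proof.
by move=> x; apply: continuous_sum3 => e ee; apply: continuousZ3; exact: continuous_dshape.
Qed.

Lemma mfn_dloc T nu v : mfn (fun x => dloc T nu x v).
Proof.
apply: (@mfn_ext _ (fun x => \sum_(e <- index_enum _) (if is_edge e then nu (midpoint T e) * dshape T e x v else 0))).
  by move=> x; rewrite /dloc [RHS]big_mkcond.
apply: mfn_sum => e; case: (boolP (is_edge e)) => ee; last exact: mfn_cst.
by apply: mfnM; [exact: mfn_cst|exact: mfn_dshape].
Qed.

(** The quadratic expansion makes [loc] constant in the interior; continuity extends this to the
    midpoints. *)
Lemma loc_cst T nu : (forall x j, (forall k, 0 < bary T k x) -> dloc T nu x (delta_mx 0 j) = 0) ->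
  forall e e', is_edge e -> is_edge e' -> nu (midpoint T e) = nu (midpoint T e').
Proof.
move=> h0.
have h1 x v : (forall k, 0 < bary T k x) -> dloc T nu x v = 0.
  by move=> hx; rewrite dloc_lin big1 // => j _; rewrite h0 // mulr0.
have h2 x y : (forall k, 0 < bary T k x) -> (forall k, 0 < bary T k y) -> loc T nu x = loc T nu y.
  move=> hx hy; have := loc_taylor T nu x (y - x) 1; rewrite scale1r addrC subrK => ->.
  have := dloc_step T nu x (y - x); rewrite addrC subrK !h1 // add0r => h.
  rewrite mulr0 addr0 expr1n mul1r; lra.
have h3 x y : cell T x -> cell T y -> loc T nu x = loc T nu y.
  move=> cx cy; apply/eqP; rewrite -subr_eq0 -normr_le0; apply/ler_addgt0Pl => eps e0.
  have e2 : 0 < eps / 2 by rewrite divr_gt0.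
  have /continuousP3/(_ _ e2)[d d0 hd] := @continuous_loc R T nu x.
  have /continuousP3/(_ _ e2)[d' d0' hd'] := @continuous_loc R T nu y.
  have [x' xx hx] := cell_approx cx d0; have [y' yy hy] := cell_approx cy d0'.
  have := hd _ xx; have := hd' _ yy; rewrite -(h2 _ _ hx hy) (distrC (loc T nu y)) => A B.
  rewrite addr0; apply: ltW; apply: le_lt_trans (ler_distD (loc T nu x') _ _) _; lra.
move=> e e' ee ee'; have := h3 _ _ (midpoint_cell T ee) (midpoint_cell T ee').
by rewrite !loc_midpoint.
Qed.

Lemma int3_gt0 D f x0 : nice D f -> (forall x, D x -> 0 <= f x) ->
  (exists2 d, 0 < d & forall x, `|x0 - x| < d -> D x) ->
  {for x0, continuous f} -> 0 < f x0 -> 0 < int3 D f.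
Proof.
move=> nf f0 [d d0 hd] /continuousP3 cf fx; have e0 : 0 < f x0 / 2 by rewrite divr_gt0.
have [d' d'0 hd'] := cf _ e0.
pose r := Num.min d d' / 2; have m0 : 0 < Num.min d d' by rewrite lt_min d0.
have r0 : 0 < r by rewrite divr_gt0.
have sub x : cbox x0 r x -> `|x0 - x| < Num.min d d'.
  by rewrite /cbox /= distrC /r; lra.
have subD : cbox x0 r `<=` D by move=> x /sub; rewrite lt_min => /andP[/hd].
have mB := mset_cbox x0 (ltW r0).
apply: lt_le_trans (int3S mB subD nf f0).
have vB : 0 < vol (cbox x0 r) by rewrite vol_cbox ?(ltW r0) // exprn_gt0 // mulr_gt0.
apply: lt_le_trans (_ : f x0 / 2 * vol (cbox x0 r) <= _); first by rewrite mulr_gt0.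
rewrite -int3_cst //; apply: int3_le.
- by apply: nice_cst => //; apply: finv_cbox; exact: ltW.
- exact: niceS subD nf.
- move=> x /sub; rewrite lt_min => /andP[_ /hd']; rewrite ltr_norml => /andP[_]; lra.
Qed.

End Gradients.

(** The parameters [kappa] and [sigma] survive only in [rho], and sizes are measured in the max
    norm. *)
Record regular_mesh (R : realType) (Omega : set 'rV[R]_3) (rho h : R) (N : nat) (K : mesh R N) : Prop :=
  RegularMesh {
    rm_tet : tetrahedrization Omega K;
    rm_conf : conforming K;
    rm_h : 0 < h;
    rm_rho : 0 < rho;
    rm_diam : forall i x y, cell (K i) x -> cell (K i) y -> `|x - y| <= h;
    rm_ball : forall i, exists c, forall x, `|x - c| <= rho * h -> cell (K i) x;
    rm_edges : forall i, (3 <= internal_edges Omega (K i))%N }.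

(** * Bounding [bh] by the supremum *)

Section Test.
Context (R : realType) (N : nat) (Omega : set 'rV[R]_3) (K : mesh R N) (rho h : R).
Local Notation E3 := 'rV[R]_3.
Hypothesis rm : regular_mesh Omega rho h K.
Let tet := rm_tet rm.
Let conf := rm_conf rm.
Let h0 := rm_h rm.
Let r0 := rm_rho rm.
Implicit Types (x y : E3) (i j : 'I_N) (k l : 'I_4) (nu : E3 -> E3) (d : 'I_N -> R).

Definition co nu (j : 'I_3) : E3 -> R := fun m => nu m 0 j.

Definition vanishing nu : Prop := forall i e, is_edge e -> boundary_edge Omega (K i) e ->
  nu (midpoint (K i) e) = 0.

(** The bound on the energy sees nodal values only through their oscillation on each cell. *)
Definition spread nu d : Prop := forall i e e', is_edge e -> is_edge e' ->
  `|nu (midpoint (K i) e) - nu (midpoint (K i) e')| <= d i.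

Lemma nodvE nu (j : 'I_3) : (fun y => nodv K nu y 0 j) = nod K (co nu j).
Proof. by apply/funext => y; rewrite mxE. Qed.

Lemma grad_nod (f : E3 -> R) i x : (forall k, 0 < bary (K i) k x) ->
  grad (nod K f) x = \row_j dloc (K i) f x (delta_mx 0 j).
Proof.
move=> hx; apply: (grad_cell (p := loc (K i) f) hx) => [y hy|j].
  exact: nod_int conf _ _ _ hy.
by eexists => t; rewrite loc_taylor mxE.
Qed.

Definition energy_density i nu x : R :=
  \sum_(j < 3) \sum_(l < 3) dloc (K i) (co nu j) x (delta_mx 0 l) ^+ 2.

Lemma ahE nu : ah K (nodv K nu) (nodv K nu) = \sum_i int3 (cell (K i))° (energy_density i nu).
Proof.
apply: eq_bigr => i _; apply: eq_int3 => x /interior_cell hx.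
apply: eq_bigr => j _; rewrite nodvE (grad_nod _ hx) /dot.
by apply: eq_bigr => l _; rewrite mxE expr2.
Qed.

Lemma lbary_mesh i k (v : E3) : `|lbary (K i) k v| <= `|v| / (rho * h).
Proof. by have [c hc] := rm_ball rm i; apply: lbary_ball hc; rewrite mulr_gt0. Qed.

Lemma dloc_mesh i nu (dd : R) (j l : 'I_3) x : cell (K i) x ->
  (forall e e', is_edge e -> is_edge e' -> `|nu (midpoint (K i) e) - nu (midpoint (K i) e')| <= dd) ->
  `|dloc (K i) (co nu j) x (delta_mx 0 l)| <= 48 * (rho * h)^-1 * dd.
Proof.
move=> cx hd; apply: dloc_le => // [k|e e' ee ee'].
  by apply: le_trans (lbary_mesh i k _) _; rewrite norm_delta mul1r.
apply: le_trans (hd e e' ee ee'); have := norm_coord (nu (midpoint (K i) e) - nu (midpoint (K i) e')) j.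
by rewrite !mxE.
Qed.

Lemma spread_ex nu : exists d, spread nu d.
Proof.
exists (fun i => \sum_(e | is_edge e) \sum_(e' | is_edge e') `|nu (midpoint (K i) e) - nu (midpoint (K i) e')|).
move=> i e e' ee ee'; rewrite (bigD1 e) //= (bigD1 e') //= -addrA lerDl addr_ge0 //; apply: sumr_ge0 => // *.
exact: sumr_ge0.
Qed.

Lemma nice_density i nu : nice (cell (K i))° (energy_density i nu).
Proof.
have mc := mset_icell (K i); have fc := finv_icell (K i).
apply: nice_sum => // j; apply: nice_sum => // l; apply: nice_sq.
have [d hd] := spread_ex nu; split => //; first exact: mfn_dloc.
by exists (48 * (rho * h)^-1 * d i) => x /interior_subset cx; apply: dloc_mesh => //; exact: hd.
Qed.

Lemma vol_icell_le i : vol (cell (K i))° <= 8 * h ^+ 3.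
Proof.
have -> : 8 * h ^+ 3 = (2 * h) ^+ 3 by ring.
apply: (@vol_small _ _ (vert (K i) 0)) => //; [exact: mset_icell|exact: ltW|].
move=> x /interior_subset cx; apply: rm_diam rm _ _ _ cx (vert_cell _ _).
Qed.

Lemma vol_icell_ge i : rho ^+ 3 * h ^+ 3 <= vol (cell (K i))°.
Proof.
have [x hx] := rm_ball rm i; have rh : 0 < rho * h by rewrite mulr_gt0.
have -> : rho ^+ 3 * h ^+ 3 = (2 * (rho * h / 2)) ^+ 3 by field.
apply: (@vol_gt0 _ _ x); [exact: mset_icell|exact: finv_icell|exact: divr_gt0|].
move=> y yx; apply/nbhs_ballP; exists (rho * h / 2) => /=; first exact: divr_gt0.
move=> z /ballE3 yz; apply: hx; apply: le_trans (ler_distD y _ _) _.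
by rewrite distrC; lra.
Qed.

(** Nine partial derivatives, each at most [48 d / (rho h)], squared and integrated over a volume of
    at most [8 h^3]. *)
Definition Ca : R := 72 * (48 / rho) ^+ 2.

Lemma Ca_gt0 : 0 < Ca.
Proof. by rewrite mulr_gt0 // exprn_gt0 // divr_gt0. Qed.

Lemma ah_le nu d : spread nu d ->
  ah K (nodv K nu) (nodv K nu) <= Ca * (h * \sum_i d i ^+ 2).
Proof.
move=> hd; rewrite ahE !mulr_sumr; apply: ler_sum => i _.
set B := 48 * (rho * h)^-1 * d i.
have d0 : 0 <= d i by apply: le_trans (hd i _ _ (is_edge2 (erefl : 0 != 1 :> 'I_4)) (is_edge2 (erefl : 0 != 1 :> 'I_4))).
have B0 : 0 <= B by rewrite !mulr_ge0 // invr_ge0 ltW // mulr_gt0.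
apply: le_trans (int3_le_cst (c := 9 * B ^+ 2) (nice_density i nu) _) _.
  move=> x /interior_subset cx; rewrite /energy_density.
  apply: le_trans (_ : \sum_(j < 3) \sum_(l < 3) B ^+ 2 <= _).
    apply: ler_sum => j _; apply: ler_sum => l _.
    rewrite -real_normK ?num_real // lerXn2r ?nnegrE //.
    by apply: dloc_mesh => //; exact: hd.
  by rewrite !sum_ord3; lra.
apply: le_trans (_ : 9 * B ^+ 2 * (8 * h ^+ 3) <= _).
  by rewrite ler_wpM2l ?vol_icell_le // mulr_ge0 // sqr_ge0.
rewrite le_eqVlt; apply/orP; left; apply/eqP; rewrite /B /Ca.
by field; rewrite !gt_eqF.
Qed.

Lemma nonconstant_dloc nu i e e' : is_edge e -> is_edge e' ->
  nu (midpoint (K i) e) <> nu (midpoint (K i) e') ->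
  exists x (j l : 'I_3), (forall k, 0 < bary (K i) k x) /\
    dloc (K i) (co nu j) x (delta_mx 0 l) != 0.
Proof.
move=> ee ee' ne; apply: contrapT => no; apply: ne; apply/rowP => j.
apply: (loc_cst (nu := co nu j) _ ee ee') => x l hx; apply/eqP; apply: contrapT => /negP nz.
by apply: no; exists x, j, l.
Qed.

Lemma ah_gt0 nu i e e' : is_edge e -> is_edge e' ->
  nu (midpoint (K i) e) <> nu (midpoint (K i) e') -> 0 < ah K (nodv K nu) (nodv K nu).
Proof.
move=> ee ee' /(nonconstant_dloc ee ee')[x [j [l [hx nz]]]].
have pos i' y : 0 <= energy_density i' nu y.
  by do 2! apply: sumr_ge0 => ? _; exact: sqr_ge0.
rewrite ahE (bigD1 i) //= ltr_pwDl //; last by apply: sumr_ge0 => i' _; apply: int3_ge0.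
apply: (int3_gt0 (x0 := x) (nice_density i nu)) => //.
- by have [d d0 hd] := icell_near hx; exists d => // y /hd hy; apply/interior_cell.
- apply: continuous_sum3 => j' _; apply: continuous_sum3 => l' _.
  have -> : (fun y => dloc (K i) (co nu j') y (delta_mx 0 l') ^+ 2) =
    (fun y => dloc (K i) (co nu j') y (delta_mx 0 l') * dloc (K i) (co nu j') y (delta_mx 0 l')).
    by apply/funext => y; rewrite expr2.
  by apply: continuousM3; exact: continuous_dloc.
- rewrite /energy_density (bigD1 j) //= ltr_pwDl //.
    rewrite (bigD1 l) //= ltr_pwDl ?exprn_even_gt0 //.
    by apply: sumr_ge0 => ? _; exact: sqr_ge0.
  by do 2! apply: sumr_ge0 => ? _; exact: sqr_ge0.
Qed.

Lemma nodv_neq0 nu i e e' : is_edge e -> is_edge e' ->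
  nu (midpoint (K i) e) <> nu (midpoint (K i) e') -> normL2v Omega (nodv K nu) != 0.
Proof.
move=> ee ee' /(nonconstant_dloc ee ee')[x [j [l [hx nz]]]].
have [y hy ly] : exists2 y, (forall k, 0 < bary (K i) k y) & loc (K i) (co nu j) y != 0.
  apply: contrapT => no; move/eqP: nz; apply.
  have -> : dloc (K i) (co nu j) x (delta_mx 0 l) = grad (nod K (co nu j)) x 0 l by rewrite (grad_nod _ hx) mxE.
  rewrite (grad_cell (p := fun=> 0) (b := 0) hx) ?mxE // => [y hy|j'].
    rewrite (nod_int conf _ hy); apply/eqP; apply: contrapT => /negP ny.
    by apply: no; exists y.
  by exists 0 => t; rewrite mxE !mulr0 !addr0.
have nf : nice Omega (fun x => dot (nodv K nu x) (nodv K nu x)).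
  apply: nice_sum => [||j']; [exact: mset_omega tet|exact: finv_omega tet|].
  have -> : (fun x0 => nodv K nu x0 0 j' * nodv K nu x0 0 j') = (fun x0 => nod K (co nu j') x0 * nod K (co nu j') x0).
    by apply/funext => z; rewrite -nodvE.
  by apply: niceM; exact: nice_nod.
rewrite gt_eqF // sqrtr_gt0.
have mc := mset_icell (K i).
have sub : (cell (K i))° `<=` Omega by move=> z /interior_cell; exact: int_cell_omega.
apply: lt_le_trans (int3S mc sub nf _) => [|z _]; last exact: dot_ge0.
pose f z := \sum_(j < 3) loc (K i) (co nu j) z * loc (K i) (co nu j) z.
rewrite (@eq_int3 _ _ _ f); last first.
  by move=> z /interior_cell hz; apply: eq_bigr => j' _; rewrite !mxE (nod_int conf _ hz).
apply: (int3_gt0 (x0 := y)).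
- apply: nice_sum => [||j'] //; first exact: finv_icell.
  have nl : nice (cell (K i))° (loc (K i) (co nu j')).
    split => //; [exact: finv_icell|exact: mfn_loc|].
    by exists (2 * \sum_(e | is_edge e) `|co nu j' (midpoint (K i) e)|) => z /interior_subset; exact: loc_le.
  exact: niceM.
- by move=> z _; apply: sumr_ge0 => ? _; rewrite -expr2 sqr_ge0.
- by have [d d0 hd] := icell_near hy; exists d => // z /hd hz; apply/interior_cell.
- by apply: continuous_sum3 => j' _; apply: continuousM3; exact: continuous_loc.
- rewrite /f (bigD1 j) //= ltr_pwDl //; first by rewrite -expr2 exprn_even_gt0.
  by apply: sumr_ge0 => ? _; rewrite -expr2 sqr_ge0.
Qed.

Context (q : E3 -> R) (c : 'I_N -> R) (g : 'I_N -> E3).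
Hypothesis qE : forall i x, (cell (K i))° x -> q x = c i + dot (g i) x.

Lemma grad_q i x : (cell (K i))° x -> grad q x = g i.
Proof.
move=> /interior_cell hx; apply: (grad_cell (p := fun x => c i + dot (g i) x) hx) => [y hy|j].
  by apply: qE; apply/interior_cell.
by exists 0 => t; rewrite dotDr dotZr dot_delta; ring.
Qed.

(** The gradient of [q] is constant on each cell and [int_shape] makes the midpoint rule exact, so
    only nodal values remain. *)
Lemma bhE nu : bh K (nodv K nu) q =
  - \sum_i vol (cell (K i))° / 6 * \sum_(e | is_edge e) dot (nu (midpoint (K i) e)) (g i).
Proof.
congr (- _); apply: eq_bigr => i _.
pose F e x := if is_edge e then dot (nu (midpoint (K i) e)) (g i) * shape (K i) e x else 0.
rewrite (@eq_int3 _ _ _ (fun x => \sum_(e <- index_enum _) F e x)); last first.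
  move=> x ix; rewrite (grad_q ix); move: ix => /interior_cell hx.
  rewrite -big_mkcond /=; under eq_bigr do rewrite /dot mulr_suml.
  rewrite exchange_big; apply: eq_bigr => j _; rewrite mxE (nod_int conf _ hx) /loc mulr_suml.
  by apply: eq_bigr => e _; rewrite /= mulrAC.
have mc := mset_icell (K i); have fc := finv_icell (K i).
rewrite int3_sum //; last first.
  move=> e; rewrite /F; case: (boolP (is_edge e)) => ee; last exact: nice_cst.
  by apply: niceZ; exact: nice_shape.
rewrite [in RHS]big_mkcond mulr_sumr; apply: eq_bigr => e _; rewrite /F.
case: (boolP (is_edge e)) => ee; last by rewrite mulr0 int3_cst // mul0r.
by rewrite int3Z ?int_shape //; [rewrite mulrC|exact: nice_shape].
Qed.

Lemma bhD nu nu' (t : R) : bh K (nodv K (fun m => nu m + t *: nu' m)) q =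
  bh K (nodv K nu) q + t * bh K (nodv K nu') q.
Proof.
rewrite !bhE mulrN -opprD mulr_sumr -big_split; congr (- _); apply: eq_bigr => i _ /=.
rewrite mulrCA -mulrDr; congr (_ * _); rewrite mulr_sumr -big_split; apply: eq_bigr => e _ /=.
by rewrite dotDl dotZl.
Qed.

Lemma internal_edge_ex i : exists2 e, is_edge e & ~ boundary_edge Omega (K i) e.
Proof.
have /card_gt0P[e] : (0 < internal_edges Omega (K i))%N by apply: leq_trans (rm_edges rm i).
by rewrite inE => /andP[ee /asboolPn nb]; exists e.
Qed.

Hypothesis ne : Omega !=set0.

(** One nonzero value, at an internal midpoint. It shows that the supremum is over a nonempty set,
    and it is the perturbation in [test_bound]. *)
Lemma bump_ex : exists nu, [/\ vanishing nu, spread nu (fun=> 1) &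
  exists i e e', [/\ is_edge e, is_edge e' & nu (midpoint (K i) e) <> nu (midpoint (K i) e')]].
Proof.
have [x ox] := ne; have [i _] := omega_cell tet ox.
have [e0 ee0 ne0] := internal_edge_ex i.
set m0 := midpoint (K i) e0; pose dl : E3 := delta_mx 0 0.
have om : Omega m0 := internal_mid tet conf ee0 ne0.
exists (fun m => if m == m0 then dl else 0); split.
- move=> i' e ee be; case: eqP => // mE; exfalso.
  have fm : face (K i') e (midpoint (K i') e).
    apply/faceP; split=> k; rewrite midpoint_bary //; first by case: ifP.
    by move/negbTE => ->.
  have : bd Omega (midpoint (K i') e) by exact: be.
  by move/(bd_cell tet (midpoint_cell (K i') ee)); rewrite mE.
- move=> i' e e' ee ee'; case: eqP => _; case: eqP => _.
  + by rewrite subrr normr0.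
  + by rewrite subr0 norm_delta.
  + by rewrite sub0r normrN norm_delta.
  + by rewrite subrr normr0.
- have /edgeP[a [b [ab eE]]] := ee0.
  have [e' ee' ne'] : exists2 e', is_edge e' & e' != e0.
    have [c' ca] : exists c', (c' != a) && (c' != b).
      by move: a b {ab eE}; apply: ord4P; apply: ord4P; do ? [by exists 0|by exists 1|by exists 2|by exists 3].
    exists [set a; c']%SET; first by apply: is_edge2; rewrite eq_sym; case/andP: ca.
    rewrite eE set2_eq; last by rewrite eq_sym; case/andP: ca.
    by case/andP: ca => /negbTE ca /negbTE cb; rewrite eqxx cb ca /= andbF.
  exists i, e0, e'; split => //.
  rewrite eqxx; case: eqP => [mE|_].
    have := midpoint_bary (K i) ; move=> mb.
    exfalso; move/eqP: ne'; apply; apply/setP => k.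
    have := mb e' k ee'; rewrite mE mb //.
    by case: (k \in e'); case: (k \in e0) => // /eqP; rewrite ?[0 == _]eq_sym invr_eq0 pnatr_eq0.
  by move=> /rowP/(_ 0); rewrite !mxE /= => /eqP; rewrite oner_eq0.
Qed.

Context (S : R).
Hypothesis HS : forall v, Wh_nz Omega K v -> bh K v q / norm_ah K v <= S.

Lemma Wh_nz_nodv nu i e e' : vanishing nu -> is_edge e -> is_edge e' ->
  nu (midpoint (K i) e) <> nu (midpoint (K i) e') -> Wh_nz Omega K (nodv K nu).
Proof.
by move=> vn ee ee' ne'; split; [exact: Wh_nodv tet conf nu vn|exact: nodv_neq0 ne'].
Qed.

Lemma test_nonconst nu d i e e' : 0 <= S -> vanishing nu -> spread nu d -> is_edge e -> is_edge e' ->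
  nu (midpoint (K i) e) <> nu (midpoint (K i) e') ->
  bh K (nodv K nu) q <= S * Num.sqrt (Ca * (h * \sum_i d i ^+ 2)).
Proof.
move=> S0 vn sp ee ee' ne'.
have a0 : 0 < norm_ah K (nodv K nu) by rewrite sqrtr_gt0; exact: ah_gt0 ne'.
have := HS (Wh_nz_nodv vn ee ee' ne'); rewrite ler_pdivrMr // => /le_trans; apply.
rewrite ler_wpM2l // ler_sqrt; first exact: ah_le.
by rewrite mulr_ge0 ?(ltW Ca_gt0) // mulr_ge0 ?(ltW h0) // sumr_ge0 // => *; exact: sqr_ge0.
Qed.

(** The bump and its negative are both admissible. *)
Lemma S_ge0 : 0 <= S.
Proof.
have [nu [vn sp [i [e [e' [ee ee' ne']]]]]] := bump_ex.
have bN : bh K (nodv K (fun m => 0 + (-1) *: nu m)) q = - bh K (nodv K nu) q.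
  rewrite bhD mulN1r [X in X + _](_ : _ = 0) ?add0r // bhE big1 ?oppr0 // => i' _.
  by rewrite big1 ?mulr0 // => *; rewrite dot0l.
have vn' : vanishing (fun m => 0 + (-1) *: nu m).
  by move=> i' e1 ee1 be; rewrite vn // scaler0 addr0.
have ne'' : 0 + (-1) *: nu (midpoint (K i) e) <> 0 + (-1) *: nu (midpoint (K i) e').
  by rewrite !add0r !scaleN1r => /oppr_inj.
have := HS (Wh_nz_nodv vn ee ee' ne'); have := HS (Wh_nz_nodv vn' ee ee' ne'').
rewrite bN; have [b0|b0] := leP 0 (bh K (nodv K nu) q) => h1 h2.
- by apply: le_trans h2; rewrite divr_ge0 // sqrtr_ge0.
- by apply: le_trans h1; rewrite divr_ge0 ?sqrtr_ge0 // oppr_ge0 ltW.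
Qed.

(** Nodal values constant on every cell have zero energy and escape the quotient. Adding [t] times a
    bump makes them admissible, with a bound proportional to [t]; as [t] tends to 0 this shows that
    [bh] is at most 0. *)
Lemma test_bound nu d : vanishing nu -> spread nu d ->
  bh K (nodv K nu) q <= S * Num.sqrt (Ca * (h * \sum_i d i ^+ 2)).
Proof.
move=> vn sp; have S0 := S_ge0.
have [[i [e [e' [ee ee' ne']]]]|no] := pselect (exists i e e',
  [/\ is_edge e, is_edge e' & nu (midpoint (K i) e) <> nu (midpoint (K i) e')]).
  exact: test_nonconst ne'.
have cst i e e' : is_edge e -> is_edge e' -> nu (midpoint (K i) e) = nu (midpoint (K i) e').
  by move=> ee ee'; apply: contrapT => ne'; apply: no; exists i, e, e'.
have [nu0 [vn0 sp0 [i [e [e' [ee ee' ne']]]]]] := bump_ex.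
apply: le_trans (_ : 0 <= _); last by rewrite mulr_ge0 // sqrtr_ge0.
set X := bh K (nodv K nu) q; pose Y := bh K (nodv K nu0) q.
pose Z := S * Num.sqrt (Ca * (h * \sum_(i < N) 1 ^+ 2)).
have key t : 0 < t -> X <= t * (Z - Y).
  move=> t0; have vnt : vanishing (fun m => nu m + t *: nu0 m).
    by move=> i' e1 ee1 be; rewrite vn // vn0 // scaler0 addr0.
  have dif i' e1 e1' : is_edge e1 -> is_edge e1' ->
     nu (midpoint (K i') e1) + t *: nu0 (midpoint (K i') e1) -
     (nu (midpoint (K i') e1') + t *: nu0 (midpoint (K i') e1')) =
     t *: (nu0 (midpoint (K i') e1) - nu0 (midpoint (K i') e1')).
    by move=> h1 h2; rewrite (cst _ _ _ h1 h2) opprD addrACA subrr add0r scalerBr.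
  have spt : spread (fun m => nu m + t *: nu0 m) (fun=> t).
    move=> i' e1 e1' h1 h2; rewrite dif // normrZ gtr0_norm // ler_piMr ?(ltW t0) //.
    exact: sp0.
  have net : nu (midpoint (K i) e) + t *: nu0 (midpoint (K i) e) <>
             nu (midpoint (K i) e') + t *: nu0 (midpoint (K i) e').
    move=> /eqP; rewrite -subr_eq0 dif // scaler_eq0 gt_eqF //= subr_eq0 => /eqP.
    exact: ne'.
  have := test_nonconst S0 vnt spt ee ee' net; rewrite bhD -/X -/Y => hh.
  have -> : t * (Z - Y) = t * Z - t * Y by ring.
  rewrite lerBrDr; apply: le_trans hh _.
  have -> : Ca * (h * \sum_(i < N) t ^+ 2) = t ^+ 2 * (Ca * (h * \sum_(i < N) 1 ^+ 2)).
    rewrite !mulr_sumr; apply: eq_bigr => *; ring.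
  by rewrite sqrtrM ?sqr_ge0 // sqrtr_sqr gtr0_norm // /Z mulrCA.
rewrite leNgt; apply/negP => X0.
have W0 : 0 < `|Z - Y| + 1 by rewrite ltr_wpDl.
have t0 : 0 < X / (2 * (`|Z - Y| + 1)) by rewrite divr_gt0 // mulr_gt0.
have := key _ t0; rewrite leNgt => /negP; apply.
rewrite mulrAC ltr_pdivrMr ?mulr_gt0 // ltr_pM2l //.
by apply: le_lt_trans (ler_norm _) _; rewrite -subr_gt0; have := normr_ge0 (Z - Y); lra.
Qed.

End Test.

(** * The gradient of the pressure *)

(* [c i + dot (g i) x] extends the restriction of the pressure to the cell [i]; [ts_test] is
   the bound of [bh] by the supremum, restricted to nodal velocities. *)
Record tested (R : realType) (Omega : set 'rV[R]_3) (rho h : R) (N : nat) (K : mesh R N)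
    (q : 'rV[R]_3 -> R) (c : 'I_N -> R) (g : 'I_N -> 'rV[R]_3) (S : R) : Prop := Tested {
  ts_rm : regular_mesh Omega rho h K;
  ts_aff : forall i x, Omega x -> cell (K i) x -> q x = c i + dot (g i) x;
  ts_S : 0 <= S;
  ts_test : forall nu d, vanishing Omega K nu -> spread K nu d ->
    - \sum_i vol (cell (K i))° / 6 * \sum_(e | is_edge e) dot (nu (midpoint (K i) e)) (g i) <=
    S * Num.sqrt (h * \sum_i d i ^+ 2) }.

Lemma cauchy_sum (R : realFieldType) (I : finType) (P : pred I) (F : I -> R) :
  (\sum_(i | P i) F i) ^+ 2 <= #|P|%:R * \sum_(i | P i) F i ^+ 2.
Proof.
have : 0 <= \sum_(i | P i) \sum_(j | P j) (F i - F j) ^+ 2.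
  by do 2! apply: sumr_ge0 => ? _; exact: sqr_ge0.
have -> : \sum_(i | P i) \sum_(j | P j) (F i - F j) ^+ 2 =
    2 * (#|P|%:R * \sum_(i | P i) F i ^+ 2) - 2 * (\sum_(i | P i) F i) ^+ 2.
  transitivity (\sum_(i | P i) (#|P|%:R * F i ^+ 2 + \sum_(j | P j) F j ^+ 2 - 2 * F i * \sum_(j | P j) F j)).
    apply: eq_bigr => i _; rewrite mulr_sumr mulr_natl -sumr_const -big_split -sumrB.
    by apply: eq_bigr => j _ /=; ring.
  rewrite sumrB big_split /= -mulr_sumr sumr_const -mulr_suml -mulr_sumr -[_ *+ #|P|]mulr_natl.
  by ring.
by move=> h; lra.
Qed.

(** * Derivatives along internal edges *)

Section TangentialTest.
Context (R : realType) (N : nat) (Omega : set 'rV[R]_3) (K : mesh R N) (rho h : R).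
Local Notation E3 := 'rV[R]_3.
Context (q : E3 -> R) (c : 'I_N -> R) (g : 'I_N -> E3) (S : R).
Hypothesis ts : tested Omega rho h K q c g S.
Let rm := ts_rm ts.
Let tet := rm_tet rm.
Let conf := rm_conf rm.
Let h0 := rm_h rm.
Let r0 := rm_rho rm.
Implicit Types (x y z : E3) (i j : 'I_N) (a b k l : 'I_4).

(** A short step from [z] along the edge stays in both cells, since every vertex of [i] active at
    [z] belongs to [j] too; both affine formulas then compute the same increment of [q]. *)
Lemma shared_dir i j z a b : Omega z -> cell (K i) z -> cell (K j) z ->
  0 < bary (K i) a z -> 0 < bary (K i) b z ->
  dot (g i) (vert (K i) a - vert (K i) b) = dot (g j) (vert (K i) a - vert (K i) b).
Proof.
move=> oz ci cj pa pb; have [->|ab] := eqVneq a b; first by rewrite subrr !dot0r.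
set w := vert _ _ - vert _ _.
have [d d0 hd] := omega_near tet oz.
have w1 : 0 < `|w| + 1 by rewrite ltr_wpDl.
pose s := Num.min (bary (K i) b z) (d / (`|w| + 1)) / 2.
have m0 : 0 < Num.min (bary (K i) b z) (d / (`|w| + 1)) by rewrite lt_min pb divr_gt0.
have s0 : 0 < s by rewrite divr_gt0.
have sb : s < bary (K i) b z.
  apply: lt_le_trans (_ : Num.min (bary (K i) b z) (d / (`|w| + 1)) <= _); last by rewrite ge_min lexx.
  by rewrite /s; lra.
have sd : s * (`|w| + 1) < d.
  rewrite -ltr_pdivlMr //.
  apply: lt_le_trans (_ : Num.min (bary (K i) b z) (d / (`|w| + 1)) <= _); last by rewrite ge_min lexx orbT.
  by rewrite /s; lra.
have oz' : Omega (z + s *: w).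
  apply: hd; rewrite opprD addNKr normrN normrZ gtr0_norm //.
  by apply: le_lt_trans sd; rewrite ler_pM2l // lerDl.
have bz k : bary (K i) k (z + s *: w) = bary (K i) k z + s * ((k == a)%:R - (k == b)%:R).
  by rewrite baryD lbaryZ lbaryB !bary_vert.
have ci' : cell (K i) (z + s *: w).
  apply/cellP => k; rewrite bz; have /cellP/(_ k) := ci.
  have [->|ka] := eqVneq k a; first by rewrite (negbTE ab) /= => ?; lra.
  by have [->|kb] /= := eqVneq k b => ?; lra.
have cj' : cell (K j) (z + s *: w).
  apply/cellP => l; rewrite (bary_rec (K i) (z + s *: w)) bary_comb ?bary_sum //.
  apply: sumr_ge0 => k _; have /cellP/(_ k) := ci'; rewrite le_eqVlt => /orP[/eqP <-|pk].
    by rewrite mul0r.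
  have pk' : 0 < bary (K i) k z.
    move: pk; rewrite bz; have [->//|ka] := eqVneq k a.
    by have [->//|kb] := eqVneq k b; rewrite subrr mulr0 addr0.
  have [k' <-] := common_vertex conf ci cj pk'.
  by rewrite bary_vert mulr_ge0 // ltW.
have e1 : s * dot (g i) w = q (z + s *: w) - q z.
  by rewrite !(ts_aff ts (i := i)) // dotDr dotZr; ring.
have e2 : s * dot (g j) w = q (z + s *: w) - q z.
  by rewrite !(ts_aff ts (i := j)) // dotDr dotZr; ring.
by apply: (mulfI (lt0r_neq0 s0)); rewrite e1 e2.
Qed.

Definition mid T a b : E3 := 2^-1 *: (@vert R T a + vert T b).
Definition edge_inside i a b : bool := `[< Omega (mid (K i) a b) >].

Lemma mid_bary T a b k : bary T k (mid T a b) = 2^-1 * ((k == a)%:R + (k == b)%:R).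
Proof.
have -> : mid T a b = vert T a + 2^-1 *: (vert T b - vert T a).
  by apply/rowP => j; rewrite !mxE; field.
by rewrite baryD lbaryZ lbaryB !bary_vert; field.
Qed.

Lemma mid_cell T a b : cell T (mid T a b).
Proof. by apply/cellP => k; rewrite mid_bary mulr_ge0 // addr_ge0. Qed.

(** The endpoints are recovered as the vertices with a positive coordinate at the midpoint. *)
Lemma mid_ends i j a b a' b' : a != b -> a' != b' -> mid (K j) a' b' = mid (K i) a b ->
  (vert (K j) a' = vert (K i) a /\ vert (K j) b' = vert (K i) b) \/
  (vert (K j) a' = vert (K i) b /\ vert (K j) b' = vert (K i) a).
Proof.
move=> ab ab' mE; set m := mid (K i) a b.
have ci : cell (K i) m by exact: mid_cell.
have cj : cell (K j) m by rewrite /m -mE; exact: mid_cell.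
have pa : 0 < bary (K i) a m by rewrite mid_bary eqxx mulr_gt0 ?invr_gt0 // ltr_pwDl.
have pb : 0 < bary (K i) b m by rewrite mid_bary eqxx mulr_gt0 ?invr_gt0 // ltr_wpDl.
have [a2 ha] := common_vertex conf ci cj pa; have [b2 hb] := common_vertex conf ci cj pb.
have ab2 : a2 != b2.
  by apply: contra ab => /eqP e; move: ha; rewrite e hb => /vert_inj ->.
have mE2 : mid (K j) a2 b2 = mid (K j) a' b' by rewrite mE /mid ha hb.
have hk k : ((k == a2) || (k == b2)) = ((k == a') || (k == b')).
  have := congr1 (bary (K j) k) mE2; rewrite !mid_bary => /(mulfI (_ : 2^-1 != 0)) => /(_ ltac:(by rewrite invr_eq0 pnatr_eq0)).
  case: (k == a2); case: (k == b2); case: (k == a'); case: (k == b') => //= /eqP;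
    by rewrite ?add0r ?addr0 ?[0 == _]eq_sym -?natrD ?pnatr_eq0.
have [e|na] := eqVneq a' a2.
- left; rewrite e ha; split=> //; have := hk b'; rewrite eqxx orbT => /orP[/eqP eb|/eqP eb].
    by move: ab'; rewrite e eb eqxx.
  by rewrite eb.
- right; have := hk a'; rewrite eqxx (negbTE na) /= => /eqP ea; rewrite ea hb; split=> //.
  have := hk b'; rewrite eqxx orbT => /orP[/eqP eb|/eqP eb]; first by rewrite eb.
  by move: ab'; rewrite ea eb eqxx.
Qed.

Definition tangential i a b : R := if edge_inside i a b then dot (g i) (vert (K i) b - vert (K i) a) else 0.

(** Nodal values are functions of the point, so some edge with midpoint [m] is picked. By
    [shared_dir] and [mid_ends] the choice is immaterial; reversing the edge changes two signs. *)
Definition tnu (m : E3) : E3 :=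
  if [pick p : 'I_N * ('I_4 * 'I_4) | (p.2.1 != p.2.2) && `[< mid (K p.1) p.2.1 p.2.2 = m >] && `[< Omega m >]]
  is Some (i, (a, b)) then - dot (g i) (vert (K i) b - vert (K i) a) *: (vert (K i) b - vert (K i) a) else 0.

Lemma tnuE i a b : a != b -> tnu (mid (K i) a b) = - tangential i a b *: (vert (K i) b - vert (K i) a).
Proof.
move=> ab; rewrite /tnu /tangential /edge_inside; case: pickP => [[j [a' b']] /= /andP[/andP[ab' /asboolP mE] /asboolP om]|no].
  rewrite asboolT //.
  have cj : cell (K j) (mid (K i) a b) by rewrite -mE; exact: mid_cell.
  have pa : 0 < bary (K i) a (mid (K i) a b) by rewrite mid_bary eqxx mulr_gt0 ?invr_gt0 // ltr_pwDl.
  have pb : 0 < bary (K i) b (mid (K i) a b) by rewrite mid_bary eqxx mulr_gt0 ?invr_gt0 // ltr_wpDl.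
  rewrite (shared_dir om (mid_cell _ _ _) cj pb pa).
  case: (mid_ends ab ab' mE) => -[-> ->] //.
  by rewrite -opprB dotNr scalerN scaleNr opprK scaleNr.
case: asboolP => om; last by rewrite oppr0 scale0r.
by have := no (i, (a, b)); rewrite /= ab !asboolT.
Qed.

Lemma midpointE T a b : a != b -> midpoint T [set a; b]%SET = mid T a b.
Proof. by move=> ab; rewrite /midpoint sum_edge. Qed.

Lemma tnu_vanishing : vanishing Omega K tnu.
Proof.
move=> i e ee; have /edgeP[a [b [ab ->]]] := ee => be.
rewrite midpointE // tnuE // /tangential /edge_inside asboolF ?oppr0 ?scale0r //; rewrite -midpointE // => om.
have ee' : is_edge [set a; b]%SET := is_edge2 ab.
have fm : face (K i) [set a; b]%SET (midpoint (K i) [set a; b]%SET).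
  apply/faceP; split=> k; rewrite midpoint_bary //; first by case: ifP.
  by move/negbTE => ->.
by move/(bd_cell tet (midpoint_cell (K i) ee')): (be _ fm).
Qed.

Definition tsum i : R := \sum_a \sum_b `|tangential i a b|.

Lemma tang_le i a b : `|tangential i a b| <= tsum i.
Proof.
rewrite /tsum (bigD1 a) //= (bigD1 b) //= -addrA lerDl addr_ge0 //; first exact: sumr_ge0.
by apply: sumr_ge0 => *; exact: sumr_ge0.
Qed.

Lemma tsum_ge0 i : 0 <= tsum i.
Proof. by apply: sumr_ge0 => *; exact: sumr_ge0. Qed.

Lemma tnu_le i a b : a != b -> `|tnu (mid (K i) a b)| <= h * tsum i.
Proof.
move=> ab; rewrite tnuE // normrZ normrN mulrC ler_pM ?tang_le //.
by apply: (rm_diam rm); exact: vert_cell.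
Qed.

Lemma tnu_spread : spread K tnu (fun i => 2 * h * tsum i).
Proof.
move=> i e e' /edgeP[a [b [ab ->]]] /edgeP[a' [b' [ab' ->]]].
rewrite !midpointE //; apply: le_trans (ler_normB _ _) _.
by have := tnu_le i ab; have := tnu_le i ab'; lra.
Qed.

Lemma tang_sym i a b : `|tangential i b a| = `|tangential i a b|.
Proof.
rewrite /tangential /edge_inside /mid addrC; case: ifP => // _.
by rewrite -opprB dotNr normrN.
Qed.

(** [tsum] counts each edge twice, and Cauchy-Schwarz over six edges gives [24 = 2^2 * 6]. *)
Lemma tsum_sq i : tsum i ^+ 2 <= 24 * - \sum_(e | is_edge e) dot (tnu (midpoint (K i) e)) (g i).
Proof.
have dE a b : a != b -> dot (tnu (midpoint (K i) [set a; b]%SET)) (g i) = - `|tangential i a b| ^+ 2.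
  move=> ab; rewrite midpointE // tnuE // dotZl real_normK ?num_real // dotC /tangential.
  by case: ifP => _; [rewrite expr2 mulNr|rewrite oppr0 mul0r expr0n oppr0].
have t0 a : tangential i a a = 0 by rewrite /tangential subrr dot0r; case: ifP.
rewrite sum_edges !dE // /tsum !sum_ord4 !t0 !normr0 (tang_sym i 0 1) (tang_sym i 0 2) (tang_sym i 0 3)
  (tang_sym i 1 2) (tang_sym i 1 3) (tang_sym i 2 3).
move: `|tangential i 0 1| `|tangential i 0 2| `|tangential i 0 3| `|tangential i 1 2| `|tangential i 1 3| `|tangential i 2 3| => x1 x2 x3 x4 x5 x6.
have := cauchy_sum predT (fun k : 'I_6 => [:: x1; x2; x3; x4; x5; x6]`_k).
rewrite !big_ord_recl !big_ord0 /= card_ord; lra.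
Qed.

(** For [tnu] the left side of [ts_test] dominates a multiple of [h^3] times the sum of [tsum^2],
    while the right side has its square root. *)
Lemma tang_bound : h ^+ 3 * \sum_i tsum i ^+ 2 <= (288 / rho ^+ 3) ^+ 2 * S ^+ 2.
Proof.
have := ts_test ts tnu_vanishing tnu_spread.
set X := \sum_i tsum i ^+ 2; have X0 : 0 <= X by apply: sumr_ge0 => *; exact: sqr_ge0.
have -> : h * \sum_i (2 * h * tsum i) ^+ 2 = 2 ^+ 2 * (h ^+ 3 * X).
  by rewrite /X !mulr_sumr; apply: eq_bigr => i _; ring.
rewrite sqrtrM ?sqr_ge0 // sqrtr_sqr ger0_norm //.
set Y := h ^+ 3 * X; have Y0 : 0 <= Y by rewrite mulr_ge0 // exprn_ge0 // ltW.
have r3 : 0 < rho ^+ 3 by exact: exprn_gt0.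
have h3 : 0 < h ^+ 3 by exact: exprn_gt0.
have low : rho ^+ 3 / 144 * Y <=
    - \sum_i vol (cell (K i))° / 6 * \sum_(e | is_edge e) dot (tnu (midpoint (K i) e)) (g i).
  rewrite /Y /X -sumrN !mulr_sumr; apply: ler_sum => i _; rewrite -mulrN.
  apply: le_trans (_ : (rho ^+ 3 * h ^+ 3) / 6 * (tsum i ^+ 2 / 24) <= _).
    by rewrite le_eqVlt; apply/orP; left; apply/eqP; field.
  have rh3 := mulr_gt0 r3 h3.
  apply: ler_pM.
  - by rewrite divr_ge0 // ltW.
  - by rewrite divr_ge0 // sqr_ge0.
  - by rewrite ler_pM2r ?invr_gt0 // (vol_icell_ge rm).
  - by rewrite ler_pdivrMr // mulrC tsum_sq.
move=> /(le_trans low); rewrite -{1 3}(sqr_sqrtr Y0); set y := Num.sqrt Y.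
have y0 : 0 <= y by exact: sqrtr_ge0.
have S0 := ts_S ts.
move=> hy; rewrite -exprMn lerXn2r ?nnegrE ?mulr_ge0 ?invr_ge0 ?(ltW r3) //.
move: y0; rewrite le_eqVlt => /orP[/eqP <-|y0]; first by rewrite !mulr_ge0 // invr_ge0 ltW.
rewrite mulrAC ler_pdivlMr // -(ler_pM2l y0).
have -> : y * (y * rho ^+ 3) = 144 * (rho ^+ 3 / 144 * y ^+ 2) by field.
have -> : y * (288 * S) = 144 * (S * (2 * y)) by ring.
by rewrite ler_pM2l.
Qed.

End TangentialTest.

(** * Generic points and small graphs *)

Section Avoid.
Context (R : realType).
Local Notation E3 := 'rV[R]_3.

(** A cube has positive volume, finitely many planes have none. *)
Lemma avoid_planes (I : finType) (a : I -> E3) (b : I -> R) (y0 : E3) (r : R) : 0 < r ->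
  exists2 y, `|y - y0| <= r & forall i, a i != 0 -> dot (a i) y != b i.
Proof.
move=> r0; pose a' i := if a i == 0 then delta_mx 0 0 else a i.
have a'0 i : a' i != 0.
  rewrite /a'; case: ifPn => // _; rewrite -normr_gt0 norm_delta; exact: ltr01.
apply: contrapT => no.
have sub : cbox y0 r `<=` [set x | exists i, plane (a' i) (b i) x].
  move=> y yr; apply: contrapT => ny; apply: no; exists y => // i ai.
  apply/eqP => e; apply: ny; exists i; rewrite /plane /= /a' (negbTE ai); exact: e.
have mU : mset [set x | exists i, plane (a' i) (b i) x].
  by apply: mset_exists => i; exact: mset_plane.
have zU : @leb3 R (@vec3 R @^-1` [set x | exists i, plane (a' i) (b i) x]) = 0%E.
  by apply: vol_null_union => i; [exact: mset_plane|exact: leb3_plane].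
have := volS (mset_cbox y0 (ltW r0)) mU sub; rewrite /finv zU => /(_ (ltry _)).
rewrite vol_cbox ?(ltW r0) // {1}/vol zU /= leNgt => /negP; apply.
by rewrite exprn_gt0 // mulr_gt0.
Qed.

Definition gb (T : elem R) k : E3 := \row_j lbary T k (delta_mx 0 j).

Lemma lbary_dot T k v : lbary T k v = dot (gb T k) v.
Proof.
have l0 : lbary T k (0 : E3) = 0 by rewrite -(scale0r (0 : E3)) lbaryZ mul0r.
rewrite {1}(row_sum_delta v) (big_morph _ (@lbaryD _ T k) l0).
by apply: eq_bigr => j _; rewrite lbaryZ mxE mulrC.
Qed.

Lemma bary_dot T k x : bary T k x = bary T k 0 + dot (gb T k) x.
Proof. by rewrite -{1}(add0r x) baryD lbary_dot. Qed.

Lemma gb_neq0 (T : elem R) k : gb T k != 0.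
Proof.
apply/eqP => g0; have := lbary_dot T k (vert T k - vert T (if k == 0 then 1 else 0)).
rewrite g0 dot0l lbaryB !bary_vert eqxx.
by case: (eqVneq k 0) => [->|/negbTE ->] /eqP; rewrite ?subr0 oner_eq0.
Qed.

End Avoid.

(** A graph on four vertices with three edges and no isolated vertex is connected; the disjuncts are
    the five simple paths from the first vertex to the second. *)
Lemma path_bool (eab eac ead ebc ebd ecd : bool) :
  (3 <= eab + eac + ead + ebc + ebd + ecd)%N -> eab || eac || ead -> eab || ebc || ebd ->
  eac || ebc || ecd -> ead || ebd || ecd ->
  [|| eab, eac && ebc, ead && ebd, [&& eac, ecd & ebd] | [&& ead, ecd & ebc]].
Proof. by move: eab eac ead ebc ebd ecd => [] [] [] [] [] []. Qed.

Definition edge_count (I : 'I_4 -> 'I_4 -> bool) : nat :=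
  addn (addn (addn (addn (addn (I 0 1) (I 0 2)) (I 0 3)) (I 1 2)) (I 1 3)) (I 2 3).

(** Three edges that avoid a vertex form the triangle on the other three. *)
Lemma isolated_bool (I : 'I_4 -> 'I_4 -> bool) a b d : (forall x y, I x y = I y x) ->
  (3 <= edge_count I)%N ->
  (forall x, (x != a) ==> ~~ I a x) -> b != a -> d != a -> b != d -> I b d.
Proof.
move=> sym cnt H; move: (H 0) (H 1) (H 2) (H 3) cnt => {H}; rewrite /edge_count.
move: a b d; do 3! apply: ord4P; rewrite //= ?(sym 1 0) ?(sym 2 0) ?(sym 3 0) ?(sym 2 1) ?(sym 3 1) ?(sym 3 2);
  by move: (I 0 1) (I 0 2) (I 0 3) (I 1 2) (I 1 3) (I 2 3) => [] [] [] [] [] [].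
Qed.

Lemma connected_bool (I : 'I_4 -> 'I_4 -> bool) a b : (forall x y, I x y = I y x) ->
  (3 <= edge_count I)%N ->
  (forall x, exists2 y, y != x & I x y) -> a != b ->
  exists x y, I a b \/ (I a x /\ I x b) \/ [/\ I a x, I x y & I y b].
Proof.
move=> sym cnt H.
have N4 (x y z w : 'I_4) : (forall u : 'I_4, [|| u == x, u == y, u == z | u == w]) -> I x y || I x z || I x w.
  move=> all4; have [u ux Iu] := H x; have := all4 u; rewrite (negbTE ux) /=.
  by move=> /or3P[/eqP<-|/eqP<-|/eqP<-]; rewrite Iu ?orbT.
have main x y z w : (forall u : 'I_4, [|| u == x, u == y, u == z | u == w]) ->
  (3 <= I x y + I x z + I x w + I y z + I y w + I z w)%N ->
  exists u v, I x y \/ (I x u /\ I u y) \/ [/\ I x u, I u v & I v y].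
  move=> all4 cn.
  have n1 := N4 x y z w all4.
  have n2 : I x y || I y z || I y w.
    by rewrite (sym x y); apply: N4 => u; have := all4 u; case: (u == x); case: (u == y); rewrite ?orbT.
  have n3 : I x z || I y z || I z w.
    rewrite (sym x z) (sym y z); apply: N4 => u; have := all4 u.
    by case: (u == x); case: (u == y); case: (u == z); rewrite ?orbT.
  have n4 : I x w || I y w || I z w.
    rewrite (sym x w) (sym y w) (sym z w); apply: N4 => u; have := all4 u.
    by case: (u == x); case: (u == y); case: (u == z); case: (u == w); rewrite ?orbT.
  have /orP[A|/orP[/andP[A B]|/orP[/andP[A B]|/orP[/and3P[A B C]|/and3P[A B C]]]]] := path_bool cn n1 n2 n3 n4.
  - by exists x, y; left.
  - by exists z, z; right; left; rewrite (sym z y).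
  - by exists w, w; right; left; rewrite (sym w y).
  - by exists z, w; right; right; rewrite (sym w y).
  - by exists w, z; right; right; rewrite (sym w z) (sym z y).
have fin x y z w : [forall u : 'I_4, [|| u == x, u == y, u == z | u == w]] ->
  (edge_count I = I x y + I x z + I x w + I y z + I y w + I z w)%N ->
  exists u v, I x y \/ (I x u /\ I u y) \/ [/\ I x u, I u v & I v y].
  by move=> /forallP all4 e; apply: (main x y z w) => //; rewrite -e.
move: a b; do 2! apply: ord4P => //; move=> _;
  [apply: (fin 0 1 2 3)|apply: (fin 0 2 1 3)|apply: (fin 0 3 1 2)|apply: (fin 1 0 2 3)
  |apply: (fin 1 2 0 3)|apply: (fin 1 3 0 2)|apply: (fin 2 0 1 3)|apply: (fin 2 1 0 3)
  |apply: (fin 2 3 0 1)|apply: (fin 3 0 1 2)|apply: (fin 3 1 0 2)|apply: (fin 3 2 0 1)];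
  do ? (by apply/forallP; apply: ord4P); rewrite /edge_count
   ?(sym 1 0) ?(sym 2 0) ?(sym 3 0) ?(sym 2 1) ?(sym 3 1) ?(sym 3 2);
   by move: (I 0 1) (I 0 2) (I 0 3) (I 1 2) (I 1 3) (I 2 3) => [] [] [] [] [] [].
Qed.

(** * Internal edges around a vertex *)

Section Star.
Context (R : realType) (N : nat) (Omega : set 'rV[R]_3) (K : mesh R N) (rho h : R).
Local Notation E3 := 'rV[R]_3.
Context (q : E3 -> R) (c : 'I_N -> R) (g : 'I_N -> E3) (S : R).
Hypothesis ts : tested Omega rho h K q c g S.
Let rm := ts_rm ts.
Let tet := rm_tet rm.
Let conf := rm_conf rm.
Let h0 := rm_h rm.
Let r0 := rm_rho rm.
Implicit Types (x y z p : E3) (i j : 'I_N) (a b k l : 'I_4).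
Local Notation inn := (edge_inside Omega K).
Local Notation tang := (tangential Omega K g).
Local Notation tsum := (tsum Omega K g).

Lemma inn_sym i a b : inn i a b = inn i b a.
Proof. by rewrite /edge_inside /mid addrC. Qed.

Lemma inn_count i : (3 <= edge_count (inn i))%N.
Proof.
apply: leq_trans (rm_edges rm i) _; rewrite /internal_edges -sum1_card.
rewrite (eq_bigl (fun e => is_edge e && ~~ `[< boundary_edge Omega (K i) e >])) //.
rewrite big_mkcondr /=.
have := @sum_edges nat (fun e => if ~~ `[< boundary_edge Omega (K i) e >] then 1%N else 0%N) => ->.
rewrite -[X in (X <= _)%N]/(_ + _ + _ + _ + _ + _)%N.
have le a b : a != b -> ((if ~~ `[< boundary_edge Omega (K i) [set a; b]%SET >] then 1 else 0) <= inn i a b)%N.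
  move=> ab; case: asboolP => //= nb; rewrite /edge_inside asboolT // -midpointE //.
  exact: internal_mid tet conf _ _ (is_edge2 ab) nb.
by rewrite !leq_add // le.
Qed.

Definition isolated i a : bool := [forall b, (b != a) ==> ~~ inn i a b].

Lemma isolatedPn i a : ~~ isolated i a -> exists2 b, b != a & inn i a b.
Proof. by move=> /forallPn[b]; rewrite negb_imply negbK => /andP[ba ib]; exists b. Qed.

Lemma isolated_others i a b d : isolated i a -> b != a -> d != a -> b != d -> inn i b d.
Proof. by move=> /forallP; apply: isolated_bool; [exact: inn_sym|exact: inn_count]. Qed.

Lemma tang_inn i a b : inn i a b -> `|dot (g i) (vert (K i) b - vert (K i) a)| <= tsum i.
Proof. by move=> ab; have := tang_le Omega K g i a b; rewrite /tangential ab. Qed.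

(** If the cell has an isolated vertex, the other three are joined directly; otherwise a path of at
    most three internal edges joins [a] to [b]. *)
Lemma pair_bound i a b : ~~ isolated i a -> ~~ isolated i b ->
  `|dot (g i) (vert (K i) b - vert (K i) a)| <= 3 * tsum i.
Proof.
move=> na nb; have t0 := tsum_ge0 Omega K g i.
have [->|ab] := eqVneq a b; first by rewrite subrr dot0r normr0 mulr_ge0.
have [[k ik]|no] := pselect (exists k, isolated i k).
  have iab : inn i a b.
    by apply: (isolated_others ik _ _ ab); apply/eqP => e; [move: na|move: nb]; rewrite e ik.
  by have := tang_inn iab; lra.
have [x [y]] := connected_bool (inn_sym i) (inn_count i)
  (fun k => isolatedPn (introT negP (fun ik => no (ex_intro _ k ik)))) ab.
set v := vert (K i); have dec u w o : dot (g i) (v w - v u) = dot (g i) (v o - v u) + dot (g i) (v w - v o).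
  by rewrite -dotDr [in RHS]addrC addrA subrK.
case=> [iab|[[ax xb]|[ax xy yb]]].
- by have := tang_inn iab; rewrite -/v; lra.
- rewrite (dec a b x); apply: le_trans (ler_normD _ _) _.
  by have := tang_inn ax; have := tang_inn xb; rewrite -/v; lra.
- rewrite (dec a b x) (dec x b y); apply: le_trans (ler_normD _ _) _.
  have := ler_normD (dot (g i) (v y - v x)) (dot (g i) (v b - v y)).
  by have := tang_inn ax; have := tang_inn xy; have := tang_inn yb; rewrite -/v; lra.
Qed.

(* [i] and [j] share a two-dimensional face through [p] meeting [Omega]. *)
Definition adj p i j : Prop := exists z k0, [/\ Omega z, cell (K i) z, cell (K j) z,
  forall k, k != k0 -> 0 < bary (K i) k z & vert (K i) k0 <> p].

(** Points close to the edge midpoint in the direction of [z] are in [Omega] and in the open face of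
    [z]; [omega_support] carries this to [z]. *)
Lemma omega_face i b d k0 z : inn i b d -> b != k0 -> d != k0 -> bary (K i) k0 z = 0 ->
  (forall k, k != k0 -> 0 < bary (K i) k z) -> Omega z.
Proof.
move=> /asboolP; set m := mid _ _ _ => om bk dk z0 zp.
have [e e0 he] := omega_near tet om.
have w1 : 0 < `|z - m| + 1 by rewrite ltr_wpDl.
pose s := Num.min 1 (e / (2 * (`|z - m| + 1))).
have s0 : 0 < s by rewrite lt_min ltr01 divr_gt0 // mulr_gt0.
have s1 : s <= 1 by rewrite ge_min lexx.
have oms : Omega (m + s *: (z - m)).
  apply: he; rewrite opprD addNKr normrN normrZ gtr0_norm //.
  have sE : s * (2 * (`|z - m| + 1)) <= e by rewrite -ler_pdivlMr ?mulr_gt0 // ge_min lexx orbT.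
  by have := mulr_ge0 (ltW s0) (normr_ge0 (z - m)); nra.
have bs k : bary (K i) k (m + s *: (z - m)) = (1 - s) * bary (K i) k m + s * bary (K i) k z.
  exact: bary_conv.
have m0 : bary (K i) k0 m = 0.
  by rewrite mid_bary [k0 == _]eq_sym (negbTE bk) [k0 == _]eq_sym (negbTE dk) addr0 mulr0.
have mp k : 0 <= bary (K i) k m by have /cellP := mid_cell (K i) b d; apply.
have sp k : k != k0 -> 0 < bary (K i) k (m + s *: (z - m)).
  by move=> kk; rewrite bs; apply: ltr_wpDl; [rewrite mulr_ge0 ?subr_ge0|rewrite mulr_gt0 ?zp].
have cz : cell (K i) z.
  by apply/cellP => k; have [->|/zp/ltW//] := eqVneq k k0; rewrite z0.
have cs : cell (K i) (m + s *: (z - m)).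
  by apply/cellP => k; have [->|/sp/ltW//] := eqVneq k k0; rewrite bs z0 m0 !mulr0 addr0.
apply: (omega_support tet conf cs cz) oms => k.
have [->|kk] := eqVneq k k0; first by rewrite bs z0 m0 !mulr0 addr0.
by rewrite zp // sp.
Qed.

Lemma other_two (a b : 'I_4) : exists x y : 'I_4, [/\ x != a, x != b, y != a, y != b & x != y].
Proof.
move: a b; do 2! apply: ord4P; do ? [by exists 0, 1 | by exists 0, 2 | by exists 0, 3
 | by exists 1, 2 | by exists 1, 3 | by exists 2, 3].
Qed.

(* Walking along a generic segment near [p] one only leaves a cell of [A] through the interior
   of a face, hence into another cell of [A]. *)
Lemma star_neighbourhood (A : pred 'I_N) p i0 : A i0 ->
  (forall i, A i -> exists2 k, vert (K i) k = p & isolated i k) ->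
  (forall i j, A i -> adj p i j -> A j) -> Omega p.
Proof.
move=> A0 bad clo.
have /choice[kk kkP] i : exists k, A i -> vert (K i) k = p /\ isolated i k.
  have [/bad[k]|nA] := boolP (A i); first by exists k.
  by exists 0.
have rh : 0 < rho * h by rewrite mulr_gt0.
have pos i x : A i -> `|p - x| < rho * h -> 0 < bary (K i) (kk i) x.
  move=> /kkP[vp _] px.
  have -> : bary (K i) (kk i) x = 1 - lbary (K i) (kk i) (p - x).
    by rewrite lbaryB -vp bary_vert eqxx /=; ring.
  rewrite subr_gt0; apply: le_lt_trans (ler_norm _) _.
  by apply: le_lt_trans (lbary_mesh rm _ _ _) _; rewrite ltr_pdivrMr // mul1r.
apply: (in_omega tet rh) => y0 py0; apply: contrapT => ny0.
have [r rr0 hr] : exists2 r, 0 < r & forall y, `|y0 - y| < r -> forall i, ~ cell (K i) y.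
  have [r rr hr] := near_cells K y0; exists r => // y /hr yy i /yy ci.
  by apply: ny0; exists i.
have cp : cell (K i0) p by have [<- _] := kkP _ A0; exact: vert_cell.
have [x1 px1 ix1] := cell_approx cp rh.
have [r1 r10 hr1] := icell_near ix1.
have ball c' s y : `|p - c'| < s -> 0 < Num.min r1 (s - `|p - c'|).
  by move=> ps; rewrite lt_min r10 subr_gt0.
have [x0 [px0 ix0 gx0]] : exists x0, [/\ `|p - x0| < rho * h, forall k, 0 < bary (K i0) k x0
    & forall i k, bary (K i) k x0 != 0].
  have e0 : 0 < Num.min r1 (rho * h - `|p - x1|) / 2 by rewrite divr_gt0 // ball.
  have [x0 x01 gen] := avoid_planes (fun ik : 'I_N * 'I_4 => gb (K ik.1) ik.2)
    (fun ik => - bary (K ik.1) ik.2 0) x1 e0.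
  have : `|x0 - x1| < Num.min r1 (rho * h - `|p - x1|) by lra.
  rewrite lt_min => /andP[xr xp]; exists x0; split.
  - by apply: le_lt_trans (ler_distD x1 _ _) _; rewrite (distrC x1); lra.
  - by apply: hr1; rewrite distrC.
  - move=> i k; rewrite bary_dot addrC addr_eq0; apply: (gen (i, k)); exact: gb_neq0.
(* These determinants being nonzero, no two barycentric coordinates of a cell vanish at the same
   point of the segment from [x0] to [y]: it meets no edge. *)
have [y [py yr gy]] : exists y, [/\ `|p - y| < rho * h, `|y0 - y| < r &
    forall i k k', k != k' -> bary (K i) k x0 * bary (K i) k' y - bary (K i) k' x0 * bary (K i) k y != 0].
  have e0 : 0 < Num.min r (rho * h - `|p - y0|) / 2 by rewrite divr_gt0 // lt_min rr0 subr_gt0.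
  pose a (t : 'I_N * ('I_4 * 'I_4)) := bary (K t.1) t.2.1 x0 *: gb (K t.1) t.2.2 -
     bary (K t.1) t.2.2 x0 *: gb (K t.1) t.2.1.
  pose b (t : 'I_N * ('I_4 * 'I_4)) := - (bary (K t.1) t.2.1 x0 * bary (K t.1) t.2.2 0 -
     bary (K t.1) t.2.2 x0 * bary (K t.1) t.2.1 0).
  have [y yy0 gen] := avoid_planes a b y0 e0.
  have : `|y - y0| < Num.min r (rho * h - `|p - y0|) by lra.
  rewrite lt_min => /andP[xr xp]; exists y; split.
  - by apply: le_lt_trans (ler_distD y0 _ _) _; rewrite (distrC y0); lra.
  - by rewrite distrC.
  - move=> i k k' nk; have := gen (i, (k, k')); rewrite /a /b /= => gen'.
    have a0 : bary (K i) k x0 *: gb (K i) k' - bary (K i) k' x0 *: gb (K i) k != 0.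
      have [x [y' [xk xk' _ _ _]]] := other_two k k'.
      apply/eqP => /(congr1 (fun u => dot u (vert (K i) k - vert (K i) x))).
      rewrite dot0l dotBl !dotZl -!lbary_dot !lbaryB !bary_vert eqxx.
      rewrite eq_sym (negbTE nk) eq_sym (negbTE xk') eq_sym (negbTE xk) => /eqP.
      by rewrite /= !subr0 mulr0 sub0r mulr1 oppr_eq0 (negbTE (gx0 _ _)).
    apply: contra (gen' a0) => /eqP; rewrite (bary_dot (K i) k' y) (bary_dot (K i) k y) => E.
    by rewrite dotBl !dotZl; apply/eqP; lra.
pose z (t : R) := x0 + t *: (y - x0).
have zp t : 0 <= t <= 1 -> `|p - z t| < rho * h.
  move=> /andP[t0 t1]; have -> : p - z t = (1 - t) *: (p - x0) + t *: (p - y).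
    by apply/rowP => j; rewrite !mxE; ring.
  apply: le_lt_trans (ler_normD _ _) _; rewrite !normrZ (ger0_norm t0) ger0_norm ?subr_ge0 //.
  have [t1'|t1'] := ltP t 1.
    have p1 : 0 < (1 - t) * (rho * h - `|p - x0|) by rewrite mulr_gt0 ?subr_gt0.
    have p2 : 0 <= t * (rho * h - `|p - y|) by rewrite mulr_ge0 // subr_ge0 ltW.
    by lra.
  have -> : t = 1 by apply/eqP; rewrite eq_le t1.
  by rewrite subrr mul0r add0r mul1r.
have zd s t : `|z s - z t| = `|s - t| * `|y - x0|.
  by rewrite /z opprD addrACA subrr add0r -scalerBl normrZ.
have w1 : 0 < `|y - x0| + 1 by rewrite ltr_wpDl.
(* The supremum of [T] is the last parameter in a cell of [A]. It is attained because cells are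
   closed, and it is below 1 because [y] is in no cell. *)
pose T := [set t : R | 0 <= t <= 1 /\ exists2 i, A i & cell (K i) (z t)].
have T0 : T 0.
  split; first by rewrite lexx ler01.
  by exists i0 => //; rewrite /z scale0r addr0; apply/cellP => k; exact: ltW.
have ubT : ubound T 1 by move=> t [/andP[]].
have hsT : has_sup T by split; [exists 0|exists 1].
set t := sup T.
have t0 : 0 <= t by apply: ub_le_sup T0; case: hsT.
have t1 : t <= 1 by apply: ge_sup ubT; case: hsT.
have step (e : R) : 0 < e -> 0 < e / (2 * (`|y - x0| + 1)) /\ (e / (2 * (`|y - x0| + 1))) * `|y - x0| < e.
  move=> e0; have pe : 0 < e / (2 * (`|y - x0| + 1)) by rewrite divr_gt0 // mulr_gt0.
  split=> //; rewrite mulrAC ltr_pdivrMr ?mulr_gt0 // ltr_pM2l //.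
  by have := normr_ge0 (y - x0); lra.
have [i Ai ci] : exists2 i, A i & cell (K i) (z t).
  have [e e0 he] := near_cells K (z t).
  have [d0 hd] := step e e0.
  have [s [/andP[s0 s1] [i Ai ci]] st] := sup_adherent d0 hsT.
  exists i => //; apply: (he (z s) _ i ci); rewrite zd.
  apply: le_lt_trans hd; rewrite ler_wpM2r //.
  have sle : s <= t.
    apply: ub_le_sup; first by case: hsT.
    by split; [apply/andP|exists i].
  by rewrite ger0_norm ?subr_ge0 //; rewrite -/t in st; lra.
have tlt : t < 1.
  rewrite lt_neqAle t1 andbT; apply/eqP => tE; apply: (hr y yr i).
  by move: ci; rewrite tE /z scale1r addrC subrK.
have beyond (e : R) : 0 < e -> (forall x, `|z t - x| < e -> exists2 j, A j & cell (K j) x) -> False.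
  move=> e0 he; have [d0 hd] := step e e0; set d := e / _ in d0 hd.
  pose s := t + Num.min d (1 - t).
  have m0 : 0 < Num.min d (1 - t) by rewrite lt_min d0 subr_gt0.
  have md : Num.min d (1 - t) <= d by rewrite ge_min lexx.
  have m1 : Num.min d (1 - t) <= 1 - t by rewrite ge_min lexx orbT.
  have [j Aj cj] : exists2 j, A j & cell (K j) (z s).
    apply: he; rewrite zd /s opprD addNKr normrN gtr0_norm //.
    by apply: le_lt_trans hd; rewrite ler_wpM2r.
  have : s <= t.
    apply: ub_le_sup; first by case: hsT.
    by split; [rewrite /s; apply/andP; split; lra|exists j].
  by rewrite /s; lra.
have bz k : bary (K i) k (z t) = (1 - t) * bary (K i) k x0 + t * bary (K i) k y by exact: bary_conv.
have [allpos|] := pselect (forall k, 0 < bary (K i) k (z t)).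
  have [e e0 he] := icell_near allpos.
  apply: (beyond e e0) => x /he hx; exists i => //; apply/cellP => k; exact: ltW.
move=> /existsNP[k0 /negP]; rewrite -leNgt => zk0.
have z0 : bary (K i) k0 (z t) = 0 by apply/eqP; rewrite eq_le zk0; have /cellP := ci; apply.
have [vp iso] := kkP _ Ai.
have kk0 : kk i != k0.
  have t01 : 0 <= t <= 1 by rewrite t0.
  by apply/eqP => e; have := pos i (z t) Ai (zp t t01); rewrite e z0 ltxx.
have zpos k : k != k0 -> 0 < bary (K i) k (z t).
  move=> nk; rewrite lt_neqAle; apply/andP; split; last by have /cellP := ci; apply.
  apply/eqP => zk; have := gy i k k0 nk; move: zk z0; rewrite !bz => e1 e2 /eqP; apply.
  have tn0 : t != 0.
    by apply/eqP => tE; move: e2; rewrite tE mul0r addr0 subr0 mul1r => /eqP; rewrite (negbTE (gx0 _ _)).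
  apply: (mulfI tn0); rewrite mulr0 mulrBr [X in X - _]mulrCA [X in _ - X]mulrCA.
  have -> : t * bary (K i) k0 y = - ((1 - t) * bary (K i) k0 x0) by lra.
  have -> : t * bary (K i) k y = - ((1 - t) * bary (K i) k x0) by lra.
  by ring.
(* The face opposite [k0] contains [p]. Its edge not through [p] is internal since [p] is isolated,
   so the crossing point is in [Omega]. *)
have [b [d [bk bk0 dk dk0 bd]]] := other_two (kk i) k0.
have oz : Omega (z t) by apply: omega_face (isolated_others iso bk dk bd) bk0 dk0 z0 zpos.
have [e1 e10 he1] := omega_near tet oz; have [e2 e20 he2] := near_cells K (z t).
have e12 : 0 < Num.min e1 e2 by rewrite lt_min e10.
apply: (beyond _ e12) => x; rewrite lt_min => /andP[x1' x2].
have [j cj] := omega_cell tet (he1 x x1').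
exists j => //; apply: clo Ai _; exists (z t), k0; split=> //; first exact: he2 cj.
by rewrite -vp => /vert_inj e; move: kk0; rewrite e eqxx.
Qed.

End Star.

(** * Packing by disjoint sets *)

Section Packing.
Context (R : realType).
Local Notation E3 := 'rV[R]_3.
Implicit Types (A D : set E3).

Definition ind A (x : E3) : R := if `[< A x >] then 1 else 0.

Lemma nice_ind D A : mset D -> finv D -> mset A -> nice D (ind A).
Proof.
move=> mD fD mA; split => //; first exact: mfn_if mA (mfn_cst 1).
by exists 1 => x _; rewrite /ind; case: ifP => _; rewrite ?normr0 ?normr1.
Qed.

Lemma int3_ind D A : mset D -> finv D -> mset A -> A `<=` D -> int3 D (ind A) = vol A.
Proof.
move=> mD fD mA AD; have nI := nice_ind mD fD mA.
have e : D = A `|` (D `\` A) by rewrite setDUK.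
rewrite [in LHS]e int3U //; [|exact: msetD|by apply/seteqP; split=> x // -[Ax [_ /(_ Ax)]]|by rewrite -e].
rewrite (@eq_int3 _ A _ (fun=> 1)) => [|x Ax]; last by rewrite /ind asboolT.
rewrite (@eq_int3 _ (D `\` A) _ (fun=> 0)) => [|x [_ nA]]; last by rewrite /ind asboolF.
by rewrite !int3_cst //; [rewrite mul1r mul0r addr0|exact: msetD].
Qed.

Lemma vol_packing (I : finType) (P : pred I) (F : I -> set E3) D :
  mset D -> finv D -> (forall i, mset (F i)) -> (forall i, P i -> F i `<=` D) ->
  (forall i j x, P i -> P j -> F i x -> F j x -> i = j) ->
  \sum_(i | P i) vol (F i) <= vol D.
Proof.
move=> mD fD mF FD dis.
pose G i := if P i then ind (F i) else fun=> 0.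
have nG i : nice D (G i).
  by rewrite /G; case: ifP => _; [exact: nice_ind|exact: nice_cst].
have -> : \sum_(i | P i) vol (F i) = int3 D (fun x => \sum_(i <- index_enum I) G i x).
  rewrite int3_sum // big_mkcond; apply: eq_bigr => i _; rewrite /G.
  by case: (boolP (P i)) => Pi; [rewrite int3_ind //; exact: FD|rewrite int3_cst // mul0r].
rewrite -[leRHS]mul1r; apply: int3_le_cst; first exact: nice_sum.
move=> x _; have [[i [Pi Fi]]|no] := pselect (exists i, P i /\ F i x).
  rewrite (bigD1 i) //= big1 => [|j ji]; first by rewrite /G Pi /ind asboolT // addr0.
  rewrite /G; case: (boolP (P j)) => // Pj; rewrite /ind asboolF // => Fj.
  by move: ji; rewrite (dis i j x) // eqxx.
rewrite big1 ?ler01 // => i _; rewrite /G; case: (boolP (P i)) => // Pi.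
by rewrite /ind asboolF // => Fi; apply: no; exists i.
Qed.

End Packing.

(** * The gradient on every element *)

Section GradBound.
Context (R : realType) (N : nat) (Omega : set 'rV[R]_3) (K : mesh R N) (rho h : R).
Local Notation E3 := 'rV[R]_3.

Section Count.
Hypothesis rm : regular_mesh Omega rho h K.

(** Disjoint interiors of volume at least [(rho h)^3] fit into a cube of half-side [M h]. *)
Lemma card_cells (A : pred 'I_N) (y : E3) (M : R) : 0 <= M ->
  (forall i, A i -> forall x, cell (K i) x -> `|x - y| <= M * h) ->
  #|A|%:R <= (2 * M / rho) ^+ 3.
Proof.
move=> M0 hA; have h0 := rm_h rm; have r0 := rm_rho rm.
have Mh : 0 <= M * h by rewrite mulr_ge0 // ltW.
have r3 : 0 < rho ^+ 3 by exact: exprn_gt0.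
have h3 : 0 < h ^+ 3 by exact: exprn_gt0.
rewrite expr_div_n ler_pdivlMr // -(ler_pM2r h3) -mulrA.
have -> : (2 * M) ^+ 3 * h ^+ 3 = (2 * (M * h)) ^+ 3 by ring.
rewrite -(vol_cbox y Mh).
apply: le_trans (_ : \sum_(i | A i) vol (cell (K i))° <= _).
  by rewrite mulr_natl -sumr_const; apply: ler_sum => i _; exact: (vol_icell_ge rm).
apply: vol_packing; [exact: mset_cbox|exact: finv_cbox|by move=> i; exact: mset_icell| |].
  by move=> i Ai x /interior_subset; exact: hA.
move=> i j x _ _ /interior_cell hi /interior_subset cj.
exact: int_cell_inj (rm_conf rm) _ _ _ hi cj.
Qed.

Definition meets i : pred 'I_N := fun j => `[< exists x, cell (K i) x /\ cell (K j) x >].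

Lemma meets_sym i j : meets i j = meets j i.
Proof. by apply/asboolP/asboolP => -[x [? ?]]; exists x. Qed.

Lemma card_meets i : #|meets i|%:R <= (4 / rho) ^+ 3.
Proof.
have -> : 4 / rho = 2 * 2 / rho by congr (_ / _); ring.
apply: (@card_cells _ (vert (K i) 0)) => // j /asboolP[w [wi wj]] x cx.
apply: le_trans (ler_distD w _ _) _.
have := rm_diam rm cx wj; have := rm_diam rm wi (vert_cell (K i) 0); lra.
Qed.

End Count.

Context (q : E3 -> R) (c : 'I_N -> R) (g : 'I_N -> E3) (S : R).
Hypothesis ts : tested Omega rho h K q c g S.
Let rm := ts_rm ts.
Let tet := rm_tet rm.
Let conf := rm_conf rm.
Let h0 := rm_h rm.
Let r0 := rm_rho rm.
Implicit Types (x y z p : E3) (i j : 'I_N) (a b k l : 'I_4).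
Local Notation inn := (edge_inside Omega K).
Local Notation tsum := (tsum Omega K g).
Local Notation isolated := (isolated Omega K).

Definition bad p i : bool := [exists k, `[< vert (K i) k = p >] && isolated i k].

Lemma isolated_uniq i a b : isolated i a -> isolated i b -> a = b.
Proof.
move=> ia ib; apply/eqP; apply: contraT => ab.
have [x [_ [xa xb _ _ _]]] := other_two a b.
have ibx : inn i b x by apply: (isolated_others ts ia); rewrite // 1?eq_sym.
by move/forallP: ib => /(_ x); rewrite xb /= ibx.
Qed.

(** A step starts only from a bad cell, so a path has bad cells except possibly its last one. *)
Definition step p : rel 'I_N := fun i j => bad p i && `[< adj Omega K p i j >].

Lemma adj_vert p i j k : adj Omega K p i j -> vert (K i) k = p -> exists k', vert (K j) k' = p.
Proof.
move=> [z [k0 [oz ci cj zp vk0]]] vp; rewrite -vp.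
apply: (common_vertex conf ci cj); apply: zp.
by apply/eqP => e; apply: vk0; rewrite -e.
Qed.

(** Induction from the good end. The face shared by [i] and [j] has two vertices besides [p], one of
    them not isolated in [j]. The derivative from [p] to this vertex is the same in both cells by
    [shared_dir], and [pair_bound] connects it to [m] inside [i]. *)
Lemma chain_bound p s i : path (step p) i s -> ~~ bad p (last i s) ->
  forall k m, vert (K i) k = p -> ~~ isolated i m ->
  `|dot (g i) (vert (K i) m - p)| <= \sum_(l <- i :: s) 3 * tsum l.
Proof.
elim: s i => [|j s IH] i /=.
  move=> _ nb k m vp im; rewrite big_seq1 -vp; apply: (pair_bound ts) => //.
  by apply: contra nb => ik; apply/existsP; exists k; rewrite asboolT.
move=> /andP[/andP[/existsP[k1 /andP[/asboolP vk1 ik1]] /asboolP ad] pth] nb k m vp im.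
have ek : k1 = k by apply: (@vert_inj _ (K i)); rewrite vk1 vp.
subst k1; have [z [k0 [oz ci cj zp vk0]]] := ad.
have kk0 : k != k0 by apply/eqP => e; apply: vk0; rewrite -e.
have [k' vk'] := adj_vert ad vp.
have [b [d [bk bk0 dk dk0 bd]]] := other_two k k0.
have [b' vb] := common_vertex conf ci cj (zp b bk0).
have [d' vd] := common_vertex conf ci cj (zp d dk0).
have [m0 [m' [m0k m0k0 vm im']]] : exists m0 m', [/\ m0 != k, m0 != k0, vert (K j) m' = vert (K i) m0 & ~~ isolated j m'].
  have [ib|nib] := boolP (isolated j b'); last by exists b, b'.
  exists d, d'; split=> //; apply/negP => id; have := isolated_uniq ib id => e.
  by move: bd; rewrite (vert_inj (_ : vert (K i) b = vert (K i) d)) ?eqxx // -vb -vd e.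
have im0 : ~~ isolated i m0 by apply: contra m0k => im0; rewrite (isolated_uniq im0 ik1).
have := IH j pth nb k' m' vk' im'; rewrite vm => hj.
have -> : vert (K i) m - p = (vert (K i) m - vert (K i) m0) + (vert (K i) m0 - vert (K i) k).
  by rewrite vp addrA subrK.
rewrite dotDr (shared_dir ts oz ci cj (zp m0 m0k0) (zp k kk0)) vp big_cons.
apply: le_trans (ler_normD _ _) _; apply: lerD => //.
exact: (pair_bound ts im0 im).
Qed.

Lemma path_star p s i k : path (step p) i s -> vert (K i) k = p ->
  forall j, j \in i :: s -> cell (K j) p.
Proof.
elim: s i k => [|j s IH] i k /=.
  by move=> _ <- l; rewrite inE => /eqP ->; exact: vert_cell.
move=> /andP[/andP[_ /asboolP ad] pth] vp l; rewrite inE => /orP[/eqP ->|].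
  by rewrite -vp; exact: vert_cell.
by have [k' vk'] := adj_vert ad vp; exact: IH pth vk' l.
Qed.

(** Otherwise points of an edge close to the vertex would be in [Omega], and by [omega_support] so
    would its midpoint. *)
Lemma isolated_vertex i k : isolated i k -> ~ Omega (vert (K i) k).
Proof.
move=> ik op; have [b [_ [bk _ _ _ _]]] := other_two k k.
have [e e0 he] := omega_near tet op; set p := vert (K i) k in op he *; set v := vert (K i) b.
have w1 : 0 < `|v - p| + 1 by rewrite ltr_wpDl.
pose s := Num.min 2^-1 (e / (2 * (`|v - p| + 1))).
have s0 : 0 < s by rewrite lt_min invr_gt0 ltr0n divr_gt0 // mulr_gt0.
have s1 : s <= 2^-1 by rewrite ge_min lexx.
have oz : Omega (p + s *: (v - p)).
  apply: he; rewrite opprD addNKr normrN normrZ gtr0_norm //.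
  have sE : s * (2 * (`|v - p| + 1)) <= e by rewrite -ler_pdivlMr ?mulr_gt0 // ge_min lexx orbT.
  by have := mulr_ge0 (ltW s0) (normr_ge0 (v - p)); nra.
have bz l : bary (K i) l (p + s *: (v - p)) = (1 - s) * (l == k)%:R + s * (l == b)%:R.
  by rewrite bary_conv !bary_vert.
have s2 : 0 < 1 - s by lra.
move/forallP: ik => /(_ b); rewrite bk /= => /negP; apply; apply/asboolP.
apply: (omega_support tet conf _ (mid_cell (K i) k b) _ oz).
  by apply/cellP => l; rewrite bz addr_ge0 // mulr_ge0 // ltW.
move=> l; rewrite bz mid_bary.
have [->|lk] := eqVneq l k.
  by rewrite eq_sym (negbTE bk) /= mulr1 mulr0 !addr0 mulr1 s2 invr_gt0 ltr0n.
have [_|lb] /= := eqVneq l b; last by rewrite !mulr0 addr0 mulr0.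
by rewrite !mulr0 !add0r !mulr1 s0 invr_gt0 ltr0n.
Qed.

(** If every cell reached from [i] were bad at the isolated vertex [p], then [star_neighbourhood]
    would place [p] in [Omega], against [isolated_vertex]. The chain is shortened to a simple path,
    so that its cells, all meeting [i] at [p], are summed without repetition. *)
Lemma all_pairs i a b :
  `|dot (g i) (vert (K i) b - vert (K i) a)| <= 6 * \sum_(l | meets i l) tsum l.
Proof.
have t0 := tsum_ge0 Omega K g.
have mi : meets i i by apply/asboolP; exists (vert (K i) 0); split; exact: vert_cell.
have tle : tsum i <= \sum_(l | meets i l) tsum l.
  by rewrite (bigD1 i) //= lerDl sumr_ge0.
have B0 : 0 <= \sum_(l | meets i l) tsum l by rewrite sumr_ge0.
have [[k ik]|no] := pselect (exists k, isolated i k); last first.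
  have ni k : ~~ isolated i k by apply/negP => ik; apply: no; exists k.
  by have := pair_bound ts (ni a) (ni b); have := t0 i; lra.
set p := vert (K i) k.
have [j cij nbj] : exists2 j, connect (step p) i j & ~~ bad p j.
  apply: contrapT => allbad; apply: (isolated_vertex ik).
  have ab j : connect (step p) i j -> bad p j.
    by move=> cij; apply: contraT => nb; case: allbad; exists j.
  apply: (star_neighbourhood ts (A := connect (step p) i) (i0 := i)); first exact: connect0.
    by move=> j /ab /existsP[k' /andP[/asboolP vk' ik']]; exists k'.
  move=> j l cij ad; apply: (connect_trans cij (connect1 _)).
  by rewrite /step ab //; apply/asboolP.
case/connectP: cij => s0 pth0 lst.
move: nbj; rewrite lst; case/shortenP: pth0 => s pth un _ nb {lst s0}.
have sumle : \sum_(l <- i :: s) 3 * tsum l <= 3 * \sum_(l | meets i l) tsum l.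
  rewrite mulr_sumr big_uniq //= big_mkcond [leRHS]big_mkcond; apply: ler_sum => l _.
  case: (boolP (l \in i :: s)) => ls; last by case: ifP => // _; rewrite mulr_ge0.
  rewrite ifT //; apply/asboolP; exists p; split; first exact: vert_cell.
  exact: path_star pth (erefl p) l ls.
have apex m : `|dot (g i) (vert (K i) m - p)| <= 3 * \sum_(l | meets i l) tsum l.
  have [->|mk] := eqVneq m k; first by rewrite subrr dot0r normr0 mulr_ge0.
  apply: le_trans sumle; apply: chain_bound pth nb _ _ (erefl p) _.
  by apply: contra mk => im; rewrite (isolated_uniq im ik).
have -> : vert (K i) b - vert (K i) a = (vert (K i) b - p) - (vert (K i) a - p) by rewrite opprB addrA subrK.
rewrite dotBr; apply: le_trans (ler_normB _ _) _.
by have := apex a; have := apex b; lra.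
Qed.

Lemma grad_le i : `|g i| <= 24 / (rho * h) * \sum_(l | meets i l) tsum l.
Proof.
have rh : 0 < rho * h by rewrite mulr_gt0.
have B0 : 0 <= \sum_(l | meets i l) tsum l by rewrite sumr_ge0 // => *; exact: tsum_ge0.
apply: norm_le => [|j]; first by rewrite mulr_ge0 // divr_ge0 // ltW.
rewrite -dot_delta (lbary_rec (K i) (delta_mx 0 j)).
have -> : \sum_k lbary (K i) k (delta_mx 0 j) *: vert (K i) k =
          \sum_k lbary (K i) k (delta_mx 0 j) *: (vert (K i) k - vert (K i) 0).
  under [RHS]eq_bigr do rewrite scalerBr.
  by rewrite sumrB -scaler_suml lbary_sum scale0r subr0.
rewrite dot_sumr; apply: le_trans (ler_norm_sum _ _ _) _.
apply: le_trans (_ : \sum_(k < 4) (rho * h)^-1 * (6 * \sum_(l | meets i l) tsum l) <= _).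
  apply: ler_sum => k _; rewrite dotZr normrM ler_pM //; last exact: all_pairs.
  by apply: le_trans (lbary_mesh rm _ _ _) _; rewrite norm_delta mul1r.
rewrite sum_ord4 le_eqVlt; apply/orP; left; apply/eqP; field.
by rewrite !gt_eqF.
Qed.

Definition Cg : R := (24 / rho) ^+ 2 * ((4 / rho) ^+ 3) ^+ 2 * (288 / rho ^+ 3) ^+ 2.

(** The packing factor occurs twice: in Cauchy-Schwarz over the cells meeting [i], and in exchanging
    the two sums. *)
Lemma grad_bound : h ^+ 5 * \sum_i `|g i| ^+ 2 <= Cg * S ^+ 2.
Proof.
have rh : 0 < rho * h by rewrite mulr_gt0.
set Cn := (4 / rho) ^+ 3; have Cn0 : 0 <= Cn by rewrite exprn_ge0 // divr_ge0 // ltW.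
have h5 : 0 <= h ^+ 5 by rewrite exprn_ge0 // ltW.
have s1 i : `|g i| ^+ 2 <= (24 / (rho * h)) ^+ 2 * (Cn * \sum_(l | meets i l) tsum l ^+ 2).
  apply: le_trans (_ : (24 / (rho * h) * \sum_(l | meets i l) tsum l) ^+ 2 <= _).
    rewrite lerXn2r ?nnegrE ?grad_le //.
    by rewrite mulr_ge0 ?divr_ge0 ?(ltW rh) // sumr_ge0 // => *; exact: tsum_ge0.
  rewrite exprMn ler_wpM2l ?sqr_ge0 //; apply: le_trans (cauchy_sum _ _) _.
  by rewrite ler_wpM2r ?(card_meets rm) // sumr_ge0 // => *; exact: sqr_ge0.
have s2 : \sum_i \sum_(l | meets i l) tsum l ^+ 2 <= Cn * \sum_l tsum l ^+ 2.
  rewrite mulr_sumr (exchange_big_dep xpredT) //=; apply: ler_sum => l _.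
  rewrite sumr_const -mulr_natl ler_wpM2r ?sqr_ge0 //.
  apply: le_trans (card_meets rm l); rewrite ler_nat; apply: subset_leq_card.
  apply/fintype.subsetP => i hi; have : meets i l by exact: hi.
  by rewrite meets_sym => hl; exact: hl.
apply: le_trans (_ : h ^+ 5 * ((24 / (rho * h)) ^+ 2 * (Cn * (Cn * \sum_l tsum l ^+ 2))) <= _).
  rewrite ler_wpM2l //; apply: le_trans (ler_sum _ (fun i _ => s1 i)) _.
  by rewrite -!mulr_sumr !ler_wpM2l ?sqr_ge0.
have -> : h ^+ 5 * ((24 / (rho * h)) ^+ 2 * (Cn * (Cn * \sum_l tsum l ^+ 2))) =
   (24 / rho) ^+ 2 * Cn ^+ 2 * (h ^+ 3 * \sum_l tsum l ^+ 2).
  by field; rewrite !gt_eqF.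
rewrite /Cg -/Cn -[leRHS]mulrA; apply: ler_wpM2l; first by rewrite mulr_ge0 ?sqr_ge0.
exact: (tang_bound ts).
Qed.

End GradBound.

(** * The pressure on a parallelepiped *)

Section Aux.
Context (R : realType).
Local Notation E3 := 'rV[R]_3.

(** The supremum of the [t] with [|f t - f 0| <= L t] satisfies this bound, and the local estimate
    excludes that it is below 1. *)
Lemma local_lipschitz (f : R -> R) (L : R) : 0 <= L ->
  (forall t, 0 <= t <= 1 -> exists2 e, 0 < e &
    forall s, 0 <= s <= 1 -> `|s - t| < e -> `|f s - f t| <= L * `|s - t|) ->
  `|f 1 - f 0| <= L.
Proof.
move=> L0 loc.
pose T := [set t : R | 0 <= t <= 1 /\ `|f t - f 0| <= L * t].
have T0 : T 0 by split; [rewrite lexx ler01|rewrite subrr normr0 mulr0].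
have hsT : has_sup T by split; [exists 0|exists 1 => t [/andP[]]].
set t := sup T.
have t0 : 0 <= t by apply: ub_le_sup T0; case: hsT.
have t1 : t <= 1 by apply: ge_sup; [exists 0|move=> s [/andP[]]].
have [e e0 he] := loc t ltac:(by rewrite t0 t1).
have [s [s01 hs] st] := sup_adherent e0 hsT; rewrite -/t in st.
have sle : s <= t by apply: ub_le_sup; case: hsT.
have ht : `|f t - f 0| <= L * t.
  have a : `|s - t| = t - s by rewrite distrC ger0_norm ?subr_ge0.
  have h1 : `|f s - f t| <= L * (t - s) by rewrite -a; apply: he => //; rewrite a; lra.
  by apply: le_trans (ler_distD (f s) _ _) _; rewrite (distrC (f t)); lra.
have [tlt|tge] := ltP t 1; last first.
  by have <- : t = 1 by [apply/eqP; rewrite eq_le t1]; apply: le_trans ht _; rewrite ler_piMr.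
exfalso; pose d := Num.min (e / 2) (1 - t).
have d0 : 0 < d by rewrite lt_min divr_gt0 ?subr_gt0.
have de : d <= e / 2 by rewrite ge_min lexx.
have d1 : d <= 1 - t by rewrite ge_min lexx orbT.
have s01' : 0 <= t + d <= 1 by apply/andP; split; lra.
have hd : `|f (t + d) - f t| <= L * d.
  have := he (t + d) s01'; rewrite addrAC subrr add0r gtr0_norm //; apply; lra.
have : t + d <= t.
  apply: ub_le_sup; first by case: hsT.
  split=> //; apply: le_trans (ler_distD (f t) _ _) _; lra.
by lra.
Qed.

Lemma int3_dct D (F : nat -> E3 -> R) f (L : R) : mset D -> finv D ->
  (forall m, mfn (F m)) -> mfn f -> (forall m x, D x -> `|F m x| <= L) ->
  (forall x, D x -> exists m0, forall m, (m0 <= m)%N -> F m x = f x) ->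
  forall e, 0 < e -> exists m0, forall m, (m0 <= m)%N -> `|int3 D (F m) - int3 D f| < e.
Proof.
move=> mD fD mF mf bF ev e e0.
have nF m : nice D (F m) by split=> //; exists L => x; exact: bF.
have nf : nice D f.
  split=> //; exists L => x Dx; have [m0 hm0] := ev x Dx.
  by rewrite -(hm0 m0 (leqnn _)); exact: bF.
have nL : nice D (fun=> L) by exact: nice_cst.
have mD' : measurable (@vec3 R @^-1` D) by [].
have cv : (\int[@leb3 R]_(p in @vec3 R @^-1` D) (F m (vec3 p))%:E @[m --> \oo] -->
          \int[@leb3 R]_(p in @vec3 R @^-1` D) (f (vec3 p))%:E)%E.
  apply: (@dominated_cvg _ _ R (@leb3 R) _ mD' _ _ (EFin \o ((fun=> L) \o @vec3 R))).
  - by move=> m; apply/measurable_EFinP; exact: measurable_funTS (mF m).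
  - move=> p Dp; have [m0 hm0] := ev _ Dp; apply: cvg_near_cst.
    by exists m0 => // m /= mm; rewrite hm0.
  - by [].
  - exact: nice_integrable nL.
  - by move=> m p Dp; rewrite /= lee_fin; exact: bF.
have fin := integrable_fin_num mD' (nice_integrable nf).
rewrite -(fineK fin) in cv.
have cv2 : (fun m => int3 D (F m)) @ \oo --> int3 D f by exact: fine_cvg cv.
have /(@cvgrPdist_lt R R^o)/(_ e e0)[m0 _ hm0] := cv2.
by exists m0 => m mm; rewrite distrC; exact: hm0.
Qed.

End Aux.

Section Pressure.
Context (R : realType) (N : nat) (Omega : set 'rV[R]_3) (K : mesh R N) (rho h : R).
Local Notation E3 := 'rV[R]_3.
Context (q : E3 -> R) (c : 'I_N -> R) (g : 'I_N -> E3) (S : R).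
Hypothesis ts : tested Omega rho h K q c g S.
Let rm := ts_rm ts.
Let tet := rm_tet rm.
Let conf := rm_conf rm.
Implicit Types (x y z w : E3) (i j : 'I_N).

(** The segment may cross many cells or run inside faces; around each of its points [q] is given by
    the affine formulas of the cells containing that point. *)
Lemma seg_lip x w (L : R) : 0 <= L -> (forall t, 0 <= t <= 1 -> Omega (x + t *: w)) ->
  (forall i t, 0 <= t <= 1 -> cell (K i) (x + t *: w) -> `|dot (g i) w| <= L) ->
  `|q (x + w) - q x| <= L.
Proof.
move=> L0 om hL.
have := @local_lipschitz R (fun t => q (x + t *: w)) L L0.
rewrite scale1r scale0r addr0; apply => t t01.
have [e e0 he] := near_cells K (x + t *: w).
have w1 : 0 < `|w| + 1 by rewrite ltr_wpDl.
exists (e / (`|w| + 1)); first exact: divr_gt0.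
move=> s s01; rewrite ltr_pdivlMr // => hs.
have [j cj] := omega_cell tet (om s s01).
have cj' : cell (K j) (x + t *: w).
  apply: (he (x + s *: w) _ j cj).
  rewrite opprD addrACA subrr add0r -scalerBl normrZ distrC.
  by apply: le_lt_trans hs; rewrite ler_wpM2l // lerDl.
rewrite !(ts_aff ts (i := j)) //; try exact: om.
rewrite opprD addrACA subrr add0r -dotBr opprD addrACA subrr add0r -scalerBl dotZr normrM mulrC.
by rewrite ler_wpM2r //; exact: hL cj'.
Qed.

(** Extension by zero gives the measurability on the whole space that [nice] demands. *)
Definition qext x : R := if `[< Omega x >] then q x else 0.

Lemma qinE x : Omega x -> qext x = q x.
Proof. by move=> ox; rewrite /qext asboolT. Qed.

Lemma mfn_qin : mfn qext.
Proof.
pose F i x := if `[< (own K i `&` Omega) x >] then c i + dot (g i) x else 0.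
apply: (@mfn_ext _ (fun x => \sum_(i <- index_enum _) F i x)).
  move=> x; rewrite /qext; case: asboolP => ox; last first.
    by apply: big1 => i _; rewrite /F asboolF // => -[].
  have [j0 cj0] := omega_cell tet ox; have [i oi] := own_ex cj0.
  rewrite (bigD1 i) //= big1 ?addr0 => [|j ji].
    by rewrite /F asboolT // -(ts_aff ts ox) //; case: oi.
  by rewrite /F asboolF // => -[oj _]; move: ji; rewrite (own_uniq oi oj) eqxx.
apply: mfn_sum => i; apply: mfn_if.
  by apply: msetI; [exact: mset_own|exact: mset_omega tet].
by apply: mfnD; [exact: mfn_cst|exact: mfn_dot].
Qed.

Lemma nice_qin : nice Omega qext.
Proof.
split; [exact: mset_omega tet|exact: finv_omega tet|exact: mfn_qin|].
exists (\sum_i (`|c i| + 3 * `|g i| * \sum_k `|vert (K i) k|)) => x ox.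
have [i ci] := omega_cell tet ox; rewrite qinE // (ts_aff ts ox ci).
apply: le_trans (ler_normD _ _) _; rewrite (bigD1 i) //=.
apply: le_trans (_ : `|c i| + 3 * `|g i| * \sum_k `|vert (K i) k| <= _); last first.
  rewrite lerDl; apply: sumr_ge0 => j _; rewrite addr_ge0 // mulr_ge0 ?mulr_ge0 //.
  exact: sumr_ge0.
rewrite lerD2l; apply: le_trans (dot_le _ _) _; rewrite ler_wpM2l ?mulr_ge0 //.
exact: cell_norm.
Qed.

End Pressure.

(** * Parallelepipeds and their coordinates *)

Section Boxes.
Context (R : realType).
Local Notation E3 := 'rV[R]_3.

Lemma mulmx_lip (A : 'M[R]_3) : exists2 L, 0 < L & forall v : E3, `|v *m A| <= L * `|v|.
Proof.
pose L := \sum_j \sum_k `|A k j| + 1; exists L.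
  by rewrite ltr_wpDl // sumr_ge0 // => j _; exact: sumr_ge0.
have L0 : 0 <= L by rewrite addr_ge0 // sumr_ge0 // => j _; exact: sumr_ge0.
move=> v; apply: norm_le => [|j]; first by rewrite mulr_ge0.
rewrite mxE; apply: le_trans (ler_norm_sum _ _ _) _.
apply: le_trans (_ : \sum_k `|A k j| * `|v| <= _).
  by apply: ler_sum => k _; rewrite normrM mulrC ler_wpM2l // norm_coord.
rewrite -mulr_suml ler_wpM2r // /L [X in X + 1](bigD1 j) //= -addrA lerDl addr_ge0 //.
by rewrite sumr_ge0 // => j' _; exact: sumr_ge0.
Qed.

Lemma index_enum_In (I : finType) (i : I) : List.In i (index_enum I).
Proof.
have := mem_index_enum i.
by elim: (index_enum I) => //= a s IH; rewrite inE => /orP[/eqP ->|/IH]; [left|right].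
Qed.

Lemma vol_cover (I : finType) (D : set E3) (F : I -> set E3) : mset D -> finv D ->
  (forall i, mset (F i)) -> (forall i, finv (F i)) -> (forall x, D x -> exists i, F i x) ->
  vol D <= \sum_i vol (F i).
Proof.
move=> mD fD mF fF cov; rewrite -[vol D]mul1r -int3_cst //.
apply: le_trans (int3_cover (s := index_enum I) mD mF (nice_cst 1 mD fD) _ _) _ => //.
  move=> x /cov[i Fi]; exists i => //; exact: index_enum_In.
apply: ler_sum => i _; rewrite int3_cst; last exact: msetI.
by rewrite mul1r; apply: volS; [exact: msetI|exact: mF|move=> x []|].
Qed.

Lemma step_index (M : nat) (s y : R) : 0 <= y -> y < M%:R * s ->
  exists2 m, (m < M)%N & m%:R * s <= y < m.+1%:R * s.
Proof.
move=> y0; elim: M => [|M IH] hy; first by move: hy; rewrite mul0r ltNge y0.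
have [/IH[m mM hm]|hM] := ltP y (M%:R * s); first by exists m => //; exact: ltnW.
by exists M => //; rewrite hM.
Qed.

Context (B : 'M[R]_3) (o : E3).
Hypothesis uB : B \in unitmx.
Implicit Types (x v a b c t : E3) (k l : 'I_3).

Definition tc x : E3 := (x - o) *m invmx B.
Definition pt t : E3 := o + t *m B.
Definition edgev l : E3 := row l B.

Lemma ptK t : tc (pt t) = t.
Proof. by rewrite /tc /pt addrC addKr mulmxK. Qed.

Lemma tcK x : pt (tc x) = x.
Proof. by rewrite /tc /pt mulmxKV // addrC subrK. Qed.

Lemma tcD x v : tc (x + v) = tc x + v *m invmx B.
Proof. by rewrite /tc addrAC mulmxDl. Qed.

Lemma tcB x y : tc x - tc y = (x - y) *m invmx B.
Proof. by rewrite -{1}(subrK y x) addrC (addrC _ y) tcD addKr. Qed.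

Lemma wvK l : edgev l *m invmx B = delta_mx 0 l.
Proof. by rewrite /edgev rowE mulmxK. Qed.

Lemma tc_shift x (s : R) l : tc (x + s *: edgev l) = tc x + s *: delta_mx 0 l.
Proof. by rewrite tcD -scalemxAl wvK. Qed.

Lemma ptB t t' : pt t - pt t' = (t - t') *m B.
Proof. by rewrite /pt opprD addrACA subrr add0r mulmxBl. Qed.

Lemma tc_conv x v k (s : R) : tc (x + s *: v) 0 k = (1 - s) * tc x 0 k + s * tc (x + v) 0 k.
Proof. by rewrite !tcD -scalemxAl !mxE; ring. Qed.

(** Half-open, so that translates tile without overlap. *)
Definition hbox a b : set E3 := [set x | forall l, a 0 l <= tc x 0 l < b 0 l].

Lemma mfn_tc l : mfn (fun x => tc x 0 l).
Proof.
apply: (@mfn_ext _ (fun x => \sum_(k <- index_enum _) invmx B k l * x 0 k + (- o *m invmx B) 0 l)).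
  by move=> x; rewrite /tc mulmxDl !mxE; congr (_ + _); apply: eq_bigr => k _; rewrite mulrC.
apply: mfnD; last exact: mfn_cst.
by apply: mfn_sum => k; apply: mfnM; [exact: mfn_cst|exact: mfn_coord].
Qed.

Lemma mset_hbox a b : mset (hbox a b).
Proof.
apply: mset_forall => l.
have -> : (fun x => is_true (a 0 l <= tc x 0 l < b 0 l)) =
   [set x | a 0 l <= tc x 0 l] `&` ~` [set x | b 0 l <= tc x 0 l].
  apply/seteqP; split=> x /=; first by move=> /andP[? h]; split=> //; apply/negP; rewrite -ltNge.
  by case=> ? /negP; rewrite -ltNge => h; apply/andP.
by apply: msetI; [|apply: msetC]; apply: mset_ge; exact: mfn_tc.
Qed.

Lemma finv_hbox a b : finv (hbox a b).
Proof.
have [L L0 hL] := mulmx_lip B.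
apply: (@finv_bounded _ _ (`|o| + L * (`|a| + `|b|))) (mset_hbox a b) _ => x hx.
rewrite -(tcK x) /pt; apply: le_trans (ler_normD _ _) _; rewrite lerD2l.
apply: le_trans (hL _) _; rewrite ler_wpM2l ?(ltW L0) //.
apply: norm_le => [|l]; first exact: addr_ge0.
have /andP[h1 h2] := hx l; have := norm_coord a l; have := norm_coord b l.
by rewrite !ler_norml => /andP[b1 b2] /andP[a1 a2]; apply/andP; split; have := normr_ge0 a; have := normr_ge0 b; lra.
Qed.

Lemma hbox_shift x a b c : hbox (a + c) (b + c) (x + c *m B) <-> hbox a b x.
Proof.
have e l : tc (x + c *m B) 0 l = tc x 0 l + c 0 l by rewrite tcD mulmxK // mxE.
have ea l : (a + c) 0 l = a 0 l + c 0 l by rewrite mxE.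
have eb l : (b + c) 0 l = b 0 l + c 0 l by rewrite mxE.
by split=> hx l; have := hx l; rewrite e ea eb => /andP[h1 h2]; apply/andP; split; lra.
Qed.

Lemma vol_hbox_shift a b c : vol (hbox (a + c) (b + c)) = vol (hbox a b).
Proof.
rewrite -(vol_mp3 (mp3_translate (c *m B)) (mset_hbox _ _)); congr vol.
by apply/seteqP; split=> x hx; [exact: (hbox_shift x a b c).1 hx|exact: (hbox_shift x a b c).2 hx].
Qed.

Definition thin l (s r : R) : E3 := \row_k (if k == l then s else r).

(** [M] translates of the slab tile the box, so translation invariance alone gives the ratio of the
    volumes. *)
Lemma vol_slab a l (r s : R) (M : nat) : 0 < s -> r = M%:R * s ->
  M%:R * vol (hbox a (a + thin l s r)) = vol (hbox a (a + const_mx r)).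
Proof.
move=> s0 rE; pose F (m : 'I_M) := hbox (a + m%:R *: (s *: delta_mx 0 l)) (a + thin l s r + m%:R *: (s *: delta_mx 0 l)).
have vF m : vol (F m) = vol (hbox a (a + thin l s r)) by exact: vol_hbox_shift.
have Fl m x k : F m x -> if k == l then a 0 l + m%:R * s <= tc x 0 l < a 0 l + m.+1%:R * s
    else a 0 k <= tc x 0 k < a 0 k + r.
  move=> /(_ k); rewrite !mxE eqxx /=; case: (eqVneq k l) => [->|kl] /=.
    by rewrite mulr1 -[m.+1%:R]natr1 => /andP[h1 h2]; apply/andP; split; lra.
  by rewrite !mulr0 !addr0.
have sumE : \sum_m vol (F m) = M%:R * vol (hbox a (a + thin l s r)).
  by rewrite (eq_bigr _ (fun m _ => vF m)) sumr_const card_ord mulr_natl.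
rewrite -sumE; apply/eqP; rewrite eq_le; apply/andP; split.
  apply: vol_packing; [exact: mset_hbox|exact: finv_hbox|by move=> m; exact: mset_hbox| |].
    move=> m _ x Fx k; have := Fl m x k Fx; rewrite !mxE; case: (eqVneq k l) => [->|kl] //.
    move=> /andP[h1 h2]; apply/andP; split.
      by apply: le_trans h1; rewrite lerDl mulr_ge0 // ltW.
    by apply: lt_le_trans h2 _; rewrite rE lerD2l ler_pM2r // ler_nat ltn_ord.
  move=> m m' x _ _ /(Fl _ _ l) + /(Fl _ _ l); rewrite eqxx => /andP[a1 a2] /andP[b1 b2].
  have le (p p' : nat) : a 0 l + p%:R * s <= tc x 0 l -> tc x 0 l < a 0 l + p'.+1%:R * s -> (p <= p')%N.
    move=> h1 h2; rewrite -ltnS -(ltr_nat R) -(ltr_pM2r s0) -(ltrD2l (a 0 l)).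
    exact: le_lt_trans h1 h2.
  by apply/val_inj/eqP; rewrite eqn_leq (le _ _ a1 b2) (le _ _ b1 a2).
apply: vol_cover; [exact: mset_hbox|exact: finv_hbox|by move=> m; exact: mset_hbox|by move=> m; exact: finv_hbox|].
move=> x hx; have /andP[x1] := hx l.
have ck k : (a + const_mx r) 0 k = a 0 k + r by rewrite !mxE.
rewrite ck => x2.
have [m mM /andP[h1 h2]] : exists2 m, (m < M)%N & m%:R * s <= tc x 0 l - a 0 l < m.+1%:R * s.
  by apply: step_index; [rewrite subr_ge0|rewrite -rE; lra].
exists (Ordinal mM) => k; have := hx k; rewrite ck.
have -> : (a + (Ordinal mM)%:R *: (s *: delta_mx 0 l)) 0 k = a 0 k + m%:R * (s * (k == l)%:R) by rewrite !mxE eqxx.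
have -> : (a + thin l s r + (Ordinal mM)%:R *: (s *: delta_mx 0 l)) 0 k =
  a 0 k + (if k == l then s else r) + m%:R * (s * (k == l)%:R) by rewrite !mxE eqxx.
case: (eqVneq k l) => [->|kl] /= => /andP[y1 y2].
  by move: h2; rewrite -[m.+1%:R]natr1 mulr1 => h2; apply/andP; split; lra.
by rewrite !mulr0 !addr0 y1.
Qed.

End Boxes.

Lemma natr_lt_le (R : realFieldType) (a b : nat) (y : R) : a%:R <= y -> y < b.+1%:R -> (a <= b)%N.
Proof. by move=> h1 h2; rewrite -ltnS -(ltr_nat R); exact: le_lt_trans h1 h2. Qed.

Lemma window_lt (x y : nat) : (x <= y + 8)%N -> (x + 8 - y < 17)%N.
Proof. lia. Qed.

Lemma window_inj (x y z : nat) : (z <= x + 8)%N -> (z <= y + 8)%N -> (x + 8 - z = y + 8 - z)%N -> x = y.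
Proof. lia. Qed.

Lemma cauchy_schwarz (R : rcfType) (I : finType) (P : pred I) (a b : I -> R) :
  \sum_(i | P i) a i * b i <=
  Num.sqrt (\sum_(i | P i) a i ^+ 2) * Num.sqrt (\sum_(i | P i) b i ^+ 2).
Proof.
set A := \sum_(i | P i) a i ^+ 2; set B := \sum_(i | P i) b i ^+ 2; set X := \sum_(i | P i) a i * b i.
have A0 : 0 <= A by apply: sumr_ge0 => *; exact: sqr_ge0.
have B0 : 0 <= B by apply: sumr_ge0 => *; exact: sqr_ge0.
have quad t : 0 <= A * t ^+ 2 - 2 * X * t + B.
  have -> : A * t ^+ 2 - 2 * X * t + B = \sum_(i | P i) (a i * t - b i) ^+ 2.
    rewrite /A /B /X mulr_suml -mulrA mulr_suml mulr_sumr -sumrB -big_split.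
    by apply: eq_bigr => i _ /=; ring.
  by apply: sumr_ge0 => *; exact: sqr_ge0.
have [X0|X0] := leP X 0; first by apply: le_trans X0 _; rewrite mulr_ge0 ?sqrtr_ge0.
have Xsq : X ^+ 2 <= A * B.
  have [A1|A1] := ltP 0 A.
    have := quad (X / A).
    have -> : A * (X / A) ^+ 2 - 2 * X * (X / A) + B = (A * B - X ^+ 2) / A.
      by field; rewrite gt_eqF.
    by rewrite pmulr_lge0 ?invr_gt0 // subr_ge0.
  have A2 : A = 0 by apply/eqP; rewrite eq_le A1.
  have := quad ((B + 1) / (2 * X)).
  have -> : A * ((B + 1) / (2 * X)) ^+ 2 - 2 * X * ((B + 1) / (2 * X)) + B = -1.
    by rewrite A2; field; rewrite gt_eqF.
  by rewrite lerNr oppr0 ler10.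
rewrite -sqrtrM // -[X](ger0_norm (ltW X0)) -sqrtr_sqr ler_sqrt //.
exact: mulr_ge0.
Qed.

(** * The lattice of a parallelepiped against the mesh *)

Section LatticeMesh.
Context (R : realType) (m : nat).
Local Notation n := m.+2.
Local Notation G := 'rV['I_n]_3.
Local Notation E3 := 'rV[R]_3.
Context (B : 'M[R]_3) (o : E3).
Hypothesis uB : B \in unitmx.
Local Notation tc := (tc B o).
Local Notation pt := (pt B o).
Implicit Types (al be ga : G) (x y : E3) (l j : 'I_3).

Let n0 : 0 < n%:R :> R. Proof. by rewrite ltr0n. Qed.

Definition lat al : E3 := \row_l (al 0 l)%:R.
Definition lcell al : set E3 := hbox B o (n%:R^-1 *: lat al) (n%:R^-1 *: lat al + const_mx n%:R^-1).

Lemma lcellP al x : lcell al x <-> forall l, (al 0 l)%:R <= n%:R * tc x 0 l < (al 0 l).+1%:R.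
Proof.
have e l : ((n%:R^-1 *: lat al) 0 l <= tc x 0 l < (n%:R^-1 *: lat al + const_mx n%:R^-1) 0 l) =
   ((al 0 l)%:R <= n%:R * tc x 0 l < (al 0 l).+1%:R).
  have -> : (n%:R^-1 *: lat al) 0 l = n%:R^-1 * (al 0 l)%:R by rewrite !mxE.
  have -> : (n%:R^-1 *: lat al + const_mx n%:R^-1) 0 l = n%:R^-1 * (al 0 l).+1%:R.
    by rewrite !mxE -[(al 0 l).+1%:R]natr1; field; rewrite gt_eqF.
  by rewrite ![n%:R^-1 * _]mulrC ler_pdivrMr // ltr_pdivlMr // ![tc x 0 l * _]mulrC.
by split=> h l; have := h l; rewrite e.
Qed.

Lemma lcell_uniq al be x : lcell al x -> lcell be x -> al = be.
Proof.
move=> /lcellP ha /lcellP hb; apply/rowP => l; apply/val_inj/eqP; rewrite eqn_leq.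
have /andP[a1 a2] := ha l; have /andP[b1 b2] := hb l.
by rewrite (natr_lt_le a1 b2) (natr_lt_le b1 a2).
Qed.

Lemma lcell_ex x : (forall l, 0 <= n%:R * tc x 0 l < n%:R) -> exists al, lcell al x.
Proof.
move=> h; have /choice[F FP] l : exists k : 'I_n, k%:R <= n%:R * tc x 0 l < k.+1%:R.
  have /andP[x0 x1] := h l.
  have [k kn] := @step_index _ n 1 _ x0 ltac:(by rewrite mulr1).
  by rewrite !mulr1 => hk; exists (Ordinal kn).
by exists (\row_l F l); apply/lcellP => l; rewrite mxE.
Qed.

Lemma mset_lcell al : mset (lcell al). Proof. exact: mset_hbox. Qed.
Lemma finv_lcell al : finv (lcell al). Proof. exact: finv_hbox. Qed.

Definition Vx (V : G -> R) x : R := \sum_al V al * ind (lcell al) x.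

Lemma Vx_in V al x : lcell al x -> Vx V x = V al.
Proof.
move=> ax; rewrite /Vx (bigD1 al) //= big1 ?addr0 => [|be ba]; first by rewrite /ind asboolT // mulr1.
by rewrite /ind asboolF ?mulr0 // => bx; move: ba; rewrite (lcell_uniq bx ax) eqxx.
Qed.

Lemma Vx_out V x : (forall al, ~ lcell al x) -> Vx V x = 0.
Proof. by move=> h; apply: big1 => al _; rewrite /ind asboolF ?mulr0. Qed.

Lemma mfn_Vx V : mfn (Vx V).
Proof.
apply: mfn_sum => al; apply: mfnM; first exact: mfn_cst.
exact: mfn_if (mset_lcell al) (mfn_cst 1).
Qed.

Lemma Vx_le V x : `|Vx V x| <= \sum_al `|V al|.
Proof.
apply: le_trans (ler_norm_sum _ _ _) _; apply: ler_sum => al _.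
by rewrite normrM /ind; case: ifP => _; rewrite ?normr1 ?mulr1 // normr0 mulr0.
Qed.

Context (N : nat) (Omega : set E3) (K : mesh R N) (rho h Lt Lb : R).
Hypothesis rm : regular_mesh Omega rho h K.
Hypothesis (Lt0 : 0 < Lt) (Lb0 : 0 < Lb).
Hypothesis hLt : forall v : E3, `|v *m invmx B| <= Lt * `|v|.
Hypothesis hLb : forall v : E3, `|v *m B| <= Lb * `|v|.
(** The lattice width is comparable to [h]: by [nh] an element extends over at most one lattice step
    in each coordinate, by [nl] a lattice step is at most [2 Lt h]. *)
Hypothesis nh : n%:R * (Lt * h) <= 1.
Hypothesis nl : 1 <= 2 * n%:R * (Lt * h).
Implicit Type i : 'I_N.
Let h0 := rm_h rm.

(** Three lattice steps leave room for neighbouring lattice cells and for the segments in [osc]. *)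
Definition near i al : bool :=
  `[< exists2 x, cell (K i) x & forall l, `|n%:R * tc x 0 l - (al 0 l)%:R| <= 3 >].

Lemma tc_cell i x y l : cell (K i) x -> cell (K i) y -> `|n%:R * tc x 0 l - n%:R * tc y 0 l| <= 1.
Proof.
move=> cx cy; rewrite -mulrBr normrM ger0_norm ?(ltW n0) //.
apply: le_trans nh; rewrite ler_pM2l //.
have -> : tc x 0 l - tc y 0 l = ((x - y) *m invmx B) 0 l by rewrite -(tcB B o); move: (tc x) (tc y) => t t'; rewrite !mxE.
apply: le_trans (norm_coord _ _) _; apply: le_trans (hLt _) _.
by rewrite ler_wpM2l ?(ltW Lt0) //; exact: rm_diam rm _ _ _ cx cy.
Qed.

Definition Mw : R := 1 + 6 * Lb * Lt.
Definition Kc : R := (2 * Mw / rho) ^+ 3.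
Definition Kl : R := 17 ^+ 3.

(** By [nl], three lattice steps are at most [6 Lb Lt h] in space, so these elements fit into a cube
    of half-side [Mw h]. *)
Lemma card_near_cells al : #|[pred i | near i al]|%:R <= Kc.
Proof.
have M0 : 0 <= Mw by rewrite addr_ge0 // !mulr_ge0 // ltW.
apply: (@card_cells R N Omega K rho h rm _ (pt (n%:R^-1 *: lat al)) Mw M0) => i /asboolP[x cx hx] y cy.
apply: le_trans (ler_distD x _ _) _; rewrite /Mw mulrDl mul1r; apply: lerD.
  exact: rm_diam rm _ _ _ cy cx.
rewrite -{1}(tcK o uB x) ptB; apply: le_trans (hLb _) _.
have -> : 6 * Lb * Lt * h = Lb * (6 * (Lt * h)) by ring.
rewrite ler_pM2l //; apply: norm_le => [|l]; first by rewrite !mulr_ge0 // ltW.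
have -> : (tc x - n%:R^-1 *: lat al) 0 l = n%:R^-1 * (n%:R * tc x 0 l - (al 0 l)%:R).
  have -> : (tc x - n%:R^-1 *: lat al) 0 l = tc x 0 l - n%:R^-1 * (al 0 l)%:R.
    by move: (tc x) => t; rewrite !mxE.
  by field; rewrite gt_eqF.
rewrite normrM ger0_norm ?invr_ge0 ?(ltW n0) // mulrC ler_pdivrMr //.
apply: le_trans (hx l) _.
have -> : 6 * (Lt * h) * n%:R = 3 * (2 * n%:R * (Lt * h)) by ring.
by rewrite -[leLHS]mulr1 ler_pM2l.
Qed.

(** Lattice points near the same element differ by at most 3 + 1 + 3 in each coordinate, so a window
    of 17 values contains them. *)
Lemma card_near_lat i : #|near i|%:R <= Kl.
Proof.
have [[a0 na0]|no] := pselect (exists a0, near i a0); last first.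
  rewrite eq_card0 ?exprn_ge0 // => al; apply/negbTE/negP => na; apply: no; by exists al.
have close al l : near i al -> (al 0%R l <= a0 0%R l + 8)%N /\ (a0 0%R l <= al 0%R l + 8)%N.
  move=> /asboolP[x cx hx]; move/asboolP: na0 => [y cy hy].
  have := hx l; have := hy l; have := tc_cell l cx cy; rewrite !ler_norml => /andP[x1 x2] /andP[y1 y2] /andP[z1 z2].
  by split; rewrite -(ler_nat R) natrD; lra.
pose F al : {ffun 'I_3 -> 'I_17} := [ffun l => inord (al 0%R l + 8 - a0 0%R l)%N].
have -> : Kl = #|{ffun 'I_3 -> 'I_17}|%:R by rewrite card_ffun !card_ord natrX.
rewrite ler_nat.
rewrite -(card_in_imset (f := F) (D := near i)); first exact: max_card.
move=> al be na nb /ffunP eF; apply/rowP => l; apply/val_inj.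
have [a1 a2] := close al l na; have [b1 b2] := close be l nb.
have := congr1 val (eF l); rewrite !ffunE /= !inordK ?window_lt //.
exact: window_inj.
Qed.

Section Variation.
Context (V : G -> R).
Hypothesis V0 : forall al, ~~ inner al -> V al = 0.

Definition vari i j : R := \sum_(ga | near i ga) `|fdiff (@unitv m) j V ga|.

Lemma fdiff_le_vari i j ga : near i ga -> `|V (ga + unitv m j) - V ga| <= vari i j.
Proof. by move=> nga; rewrite /vari (bigD1 ga) //= lerDl sumr_ge0. Qed.

Lemma vari_ge0 i j : 0 <= vari i j.
Proof. exact: sumr_ge0. Qed.

Lemma step_vari i j al be : (forall l, l != j -> al 0 l = be 0 l) ->
  (al 0%R j <= (be 0%R j).+1)%N -> (be 0%R j <= (al 0%R j).+1)%N -> near i al -> near i be ->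
  `|V be - V al| <= vari i j.
Proof.
move=> ne h1 h2 na nb.
have succ (a b : G) : (forall l, l != j -> a 0 l = b 0 l) -> (b 0%R j = (a 0%R j).+1 :> nat) -> b = a + unitv m j.
  move=> e eb; apply/rowP => l; apply: ord_inj.
  have am : (a 0%R j < m.+1)%N by rewrite -ltnS -eb ltn_ord.
  rewrite (unitv_addS am); case: eqP => [->|/eqP lj]; [exact: eb|by rewrite e].
case: (ltngtP (al 0%R j) (be 0%R j)) => hlt.
- have e : be = al + unitv m j by apply: succ => //; apply/eqP; rewrite eqn_leq h2.
  by rewrite e; exact: fdiff_le_vari.
- have e : al = be + unitv m j.
    by apply: succ => [l lj|]; [rewrite ne|apply/eqP; rewrite eqn_leq h1].
  by rewrite distrC e; exact: fdiff_le_vari.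
- have -> : al = be; last by rewrite subrr normr0 vari_ge0.
  by apply/rowP => l; have [->|lj] := eqVneq l j; [exact: val_inj|exact: ne].
Qed.

(** The lattice cells of [x] and [y] differ by at most one in each coordinate, and [g1], [g2] change
    the coordinates one at a time. As [al] is inner, [y] still lies in some lattice cell. *)
Lemma Vx_variation_in i x y al : cell (K i) x -> cell (K i) y -> lcell al x -> inner al ->
  `|Vx V x - Vx V y| <= \sum_j vari i j.
Proof.
move=> cx cy ax /forallP ia; move/lcellP: (ax) => hx.
have [be by_] : exists be, lcell be y.
  apply: lcell_ex => l; have /andP[x1 x2] := hx l; have /andP[i1 i2] := ia l.
  have := tc_cell l cx cy; rewrite ler_norml => /andP[z1 z2].
  have a1 : 1 <= (al 0 l)%:R :> R by rewrite ler1n.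
  have a2 : (al 0 l).+1%:R + 1 <= n%:R :> R by rewrite natr1 ler_nat !ltnS in i2 *.
  by apply/andP; split; lra.
move/lcellP: (by_) => hy; rewrite (Vx_in _ ax) (Vx_in _ by_).
have near_mix (ga : G) : (forall l, ga 0 l = al 0 l \/ ga 0 l = be 0 l) -> near i ga.
  move=> mix; apply/asboolP; exists x => // l.
  have /andP[x1 x2] := hx l; have /andP[y1 y2] := hy l.
  have := tc_cell l cx cy; rewrite ler_norml => /andP[z1 z2].
  move: x2 y2; rewrite -!natr1 => x2 y2.
  by case: (mix l) => ->; rewrite ler_norml; apply/andP; split; lra.
have cl l : (al 0%R l <= (be 0%R l).+1)%N /\ (be 0%R l <= (al 0%R l).+1)%N.
  have /andP[x1 x2] := hx l; have /andP[y1 y2] := hy l.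
  have := tc_cell l cx cy; rewrite ler_norml => /andP[z1 z2].
  by move: x2 y2; rewrite -!natr1 => x2 y2; split; rewrite -ltnS -(ltr_nat R) -!natr1; lra.
pose g1 : G := \row_l (if l == 0 then be 0 l else al 0 l).
pose g2 : G := \row_l (if l == 2 then al 0 l else be 0 l).
have n0' : near i al by apply: near_mix; left.
have n3 : near i be by apply: near_mix; right.
have n1 : near i g1 by apply: near_mix => l; rewrite mxE; case: ifP; [right|left].
have n2 : near i g2 by apply: near_mix => l; rewrite mxE; case: ifP; [left|right].
have s0 : `|V g1 - V al| <= vari i 0.
  by apply: step_vari => // [l l0||]; rewrite !mxE ?(negbTE l0) //=; case: (cl 0).
have s1 : `|V g2 - V g1| <= vari i 1.
  apply: step_vari => // [l l1||]; rewrite !mxE //=; do ? by case: (cl 1).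
  by move: l l1; apply: ord3P.
have s2 : `|V be - V g2| <= vari i 2.
  by apply: step_vari => // [l l2||]; rewrite !mxE ?(negbTE l2) //=; case: (cl 2).
rewrite sum_ord3 distrC; apply: le_trans (ler_distD (V g2) _ _) _; rewrite addrC; apply: lerD => //.
by apply: le_trans (ler_distD (V g1) _ _) _; rewrite addrC; apply: lerD.
Qed.

Lemma Vx_variation i x y : cell (K i) x -> cell (K i) y ->
  `|Vx V x - Vx V y| <= \sum_j vari i j.
Proof.
move=> cx cy.
have zero z : (forall al, lcell al z -> ~~ inner al) -> Vx V z = 0.
  move=> hz; have [[al az]|no] := pselect (exists al, lcell al z).
    by rewrite (Vx_in _ az) V0 // hz.
  by apply: Vx_out => al az; apply: no; exists al.
have [[al [ax ia]]|nx] := pselect (exists al, lcell al x /\ inner al); first exact: Vx_variation_in ax ia.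
have [[be [by_ ib]]|ny] := pselect (exists be, lcell be y /\ inner be).
  by rewrite distrC; exact: Vx_variation_in by_ ib.
rewrite (zero x) => [|al ax]; last by apply/negP => ia; apply: nx; exists al.
rewrite (zero y) => [|al ay]; last by apply/negP => ia; apply: ny; exists al.
by rewrite subrr normr0 sumr_ge0 // => j _; exact: vari_ge0.
Qed.

End Variation.

End LatticeMesh.

Lemma conv_between (R : realFieldType) (a b t lo hi : R) : 0 <= t <= 1 -> lo < a < hi -> lo < b < hi ->
  lo < (1 - t) * a + t * b < hi.
Proof.
move=> /andP[t0 t1] /andP[a1 a2] /andP[b1 b2].
have t1' : 0 <= 1 - t by rewrite subr_ge0.
pose e := Num.min (Num.min (a - lo) (b - lo)) (Num.min (hi - a) (hi - b)).
have e0 : 0 < e by rewrite !lt_min !subr_gt0 a1 b1 a2 b2.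
have /andP[/andP[e1 e2] /andP[e3 e4]] : ((e <= a - lo) && (e <= b - lo)) && ((e <= hi - a) && (e <= hi - b)).
  by rewrite -!le_min.
have := ler_wpM2l t1' e1; have := ler_wpM2l t0 e2; have := ler_wpM2l t1' e3; have := ler_wpM2l t0 e4.
by move=> h1 h2 h3 h4; apply/andP; split; lra.
Qed.

(** * Integration by parts against lattice functions *)

Section Parts.
Context (R : realType) (m : nat).
Local Notation n := m.+2.
Local Notation G := 'rV['I_n]_3.
Local Notation E3 := 'rV[R]_3.
Context (B : 'M[R]_3) (o : E3).
Hypothesis uB : B \in unitmx.
Local Notation tc := (tc B o).
Local Notation pt := (pt B o).
Local Notation wv := (edgev B).
Local Notation lat := (@lat R m).
Local Notation lcell := (@lcell R m B o).
Context (N : nat) (Omega : set E3) (K : mesh R N) (rho h Lt Lb : R).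
Hypothesis (Lt0 : 0 < Lt) (Lb0 : 0 < Lb).
Hypothesis hLt : forall v : E3, `|v *m invmx B| <= Lt * `|v|.
Hypothesis hLb : forall v : E3, `|v *m B| <= Lb * `|v|.
Context (q : E3 -> R) (c : 'I_N -> R) (g : 'I_N -> E3) (S : R).
Hypothesis ts : tested Omega rho h K q c g S.
Hypothesis hP : forall x, (forall l, 0 < tc x 0 l < 1) -> Omega x.
Let rm := ts_rm ts.
Let tet := rm_tet rm.
Let conf := rm_conf rm.
Local Notation near := (@near R m B o N K).
Local Notation qin := (qext Omega q).
Implicit Types (al be ga : G) (x y : E3) (l j k : 'I_3) (i : 'I_N).

Let n0 : 0 < n%:R :> R. Proof. by rewrite ltr0n. Qed.

Lemma in_P x : (forall l, 0 < n%:R * tc x 0 l < n%:R) -> Omega x.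
Proof.
move=> hx; apply: hP => l; have /andP[h1 h2] := hx l.
by rewrite -(pmulr_rgt0 _ n0) h1 -(ltr_pM2l n0) mulr1.
Qed.

(** The 18 is the 3 of [dot_le] times a distance of six lattice steps. Bounding the largest gradient
    by a root of a sum of squares prepares the summation over [al]. *)
Definition oscb al : R := 18 * Lb / n%:R * Num.sqrt (\sum_(i | near i al) `|g i| ^+ 2).

Lemma os_ge0 al : 0 <= oscb al.
Proof. by rewrite mulr_ge0 ?sqrtr_ge0 // divr_ge0 ?(ltW n0) // mulr_ge0 // ltW. Qed.

Lemma osc al x y : (forall t : R, 0 <= t <= 1 -> Omega (x + t *: (y - x))) ->
  (forall l, `|n%:R * tc x 0 l - (al 0 l)%:R| <= 3) ->
  (forall l, `|n%:R * tc y 0 l - (al 0 l)%:R| <= 3) -> `|q y - q x| <= oscb al.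
Proof.
move=> om hx hy; have {1}-> : y = x + (y - x) by rewrite addrC subrK.
apply: (seg_lip ts) (os_ge0 al) om _ => i t /andP[t0 t1] ci.
have ni : near i al.
  apply/asboolP; exists (x + t *: (y - x)) => // l; rewrite tc_conv addrCA subrr addr0.
  have -> : n%:R * ((1 - t) * tc x 0 l + t * tc y 0 l) - (al 0 l)%:R =
    (1 - t) * (n%:R * tc x 0 l - (al 0 l)%:R) + t * (n%:R * tc y 0 l - (al 0 l)%:R) by ring.
  apply: le_trans (ler_normD _ _) _; rewrite !normrM (ger0_norm t0) ger0_norm ?subr_ge0 //.
  have t1' : 0 <= 1 - t by rewrite subr_ge0.
  have p1 := ler_wpM2l t1' (hx l); have p2 := ler_wpM2l t0 (hy l); lra.
apply: le_trans (dot_le _ _) _.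
have yx : `|y - x| <= Lb * (6 / n%:R).
  rewrite -{1}(tcK o uB y) -{1}(tcK o uB x) ptB; apply: le_trans (hLb _) _; rewrite ler_pM2l //.
  apply: norm_le => [|l]; first by rewrite divr_ge0 // ltW.
  have -> : (tc y - tc x) 0 l = tc y 0 l - tc x 0 l by move: (tc y) (tc x) => a b; rewrite !mxE.
  rewrite ler_pdivlMr // -(ger0_norm (ltW n0)) -normrM mulrC mulrBr.
  have -> : n%:R * tc y 0 l - n%:R * tc x 0 l =
    (n%:R * tc y 0 l - (al 0 l)%:R) - (n%:R * tc x 0 l - (al 0 l)%:R) by ring.
  by apply: le_trans (ler_normB _ _) _; have := hx l; have := hy l; lra.
apply: le_trans (_ : 3 * `|g i| * (Lb * (6 / n%:R)) <= _); first by rewrite ler_wpM2l // mulr_ge0.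
have -> : 3 * `|g i| * (Lb * (6 / n%:R)) = 18 * Lb / n%:R * `|g i| by field; rewrite gt_eqF.
rewrite ler_wpM2l ?divr_ge0 ?(ltW n0) //; first by rewrite mulr_ge0 // ltW.
rewrite -[leLHS]ger0_norm // -sqrtr_sqr ler_sqrt; last by apply: sumr_ge0 => *; exact: sqr_ge0.
by rewrite (bigD1 i) //= lerDl sumr_ge0 // => *; exact: sqr_ge0.
Qed.

Definition ctr al : E3 := pt (n%:R^-1 *: (lat al + const_mx 2^-1)).
(** The lattice function to which [lattice_necas] is applied. *)
Definition center_value al : R := q (ctr al).

Lemma ctr_tc al l : n%:R * tc (ctr al) 0 l = (al 0 l)%:R + 2^-1.
Proof. by rewrite /ctr (ptK o uB) !mxE mulrA divff ?mul1r // gt_eqF. Qed.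

Lemma ord_le (a : 'I_n) : a.+1%:R <= n%:R :> R.
Proof. by rewrite ler_nat ltn_ord. Qed.

Lemma osc_cell al x : Omega x -> lcell al x -> `|q x - center_value al| <= oscb al.
Proof.
move=> ox /lcellP ax; rewrite distrC; apply: osc => [t /andP[t0 t1]|l|l].
(* [x] may lie on the boundary of the parallelepiped, where [hP] is silent; the rest of the segment
   is interior. *)
- move: t0; rewrite le_eqVlt => /orP[/eqP <-|t0]; first by rewrite scale0r addr0.
  apply: in_P => l; rewrite tc_conv [x + _]addrC subrK.
  have /andP[a1 a2] := ax l; have al0 : 0 <= (al 0 l)%:R :> R by [].
  have aln := ord_le (al 0 l); rewrite -natr1 in aln a2.
  have t1' : 0 <= 1 - t by rewrite subr_ge0.
  have -> : n%:R * ((1 - t) * tc x 0 l + t * tc (ctr al) 0 l) =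
    (1 - t) * (n%:R * tc x 0 l) + t * (n%:R * tc (ctr al) 0 l) by ring.
  rewrite ctr_tc.
  have p1 : 0 <= (1 - t) * (n%:R * tc x 0 l) by rewrite mulr_ge0 //; lra.
  have p2 : 0 < t * ((al 0 l)%:R + 2^-1) by rewrite mulr_gt0 //; lra.
  have p3 : 0 <= (1 - t) * (n%:R - n%:R * tc x 0 l) by rewrite mulr_ge0 // subr_ge0; lra.
  have p4 : 0 < t * (n%:R - ((al 0 l)%:R + 2^-1)) by rewrite mulr_gt0 // subr_gt0; lra.
  by apply/andP; split; lra.
- have /andP[a1 a2] := ax l; rewrite -natr1 in a2.
  by rewrite ler_norml; apply/andP; split; lra.
- by rewrite ctr_tc ler_norml; apply/andP; split; lra.
Qed.

Lemma osc_step al l : nowrap al -> `|fdiff (@unitv m) l center_value al| <= oscb al.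
Proof.
move=> /forallP nw; have sE k := unitv_addS (nw l) k.
have ctr_in be : forall k, 0 < n%:R * tc (ctr be) 0 k < n%:R.
  move=> k; rewrite ctr_tc; have := ord_le (be 0 k); rewrite -natr1 => b2.
  have b1 : 0 <= (be 0 k)%:R :> R by [].
  by apply/andP; split; lra.
apply: osc => [t /andP[t0 t1]|k|k].
- apply: in_P => k; rewrite tc_conv [ctr al + _]addrC subrK.
  have -> : n%:R * ((1 - t) * tc (ctr al) 0 k + t * tc (ctr (al + unitv m l)) 0 k) =
    (1 - t) * (n%:R * tc (ctr al) 0 k) + t * (n%:R * tc (ctr (al + unitv m l)) 0 k) by ring.
  by apply: conv_between; rewrite ?ctr_in // t0.
- by rewrite ctr_tc ler_norml; apply/andP; split; lra.
- rewrite ctr_tc sE; case: eqP => _; last by rewrite ler_norml; apply/andP; split; lra.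
  by rewrite -natr1 ler_norml; apply/andP; split; lra.
Qed.

Section Direction.
Context (l : 'I_3) (V : G -> R).
Hypothesis V0 : forall al, ~~ inner al -> V al = 0.
Local Notation e := (unitv m l).

(** Thin slabs stand in for the faces of the lattice cells: their integrals, divided by the
    thickness, replace surface integrals. *)
Definition slab al (s : R) : set E3 :=
  hbox B o (n%:R^-1 *: lat al) (n%:R^-1 *: lat al + thin l s n%:R^-1).

Lemma slabP al s x : slab al s x <-> forall k, (al 0 k)%:R <= n%:R * tc x 0 k <
  (al 0 k)%:R + (if k == l then n%:R * s else 1).
Proof.
have E k : ((n%:R^-1 *: lat al) 0 k <= tc x 0 k < (n%:R^-1 *: lat al + thin l s n%:R^-1) 0 k) =
   ((al 0 k)%:R <= n%:R * tc x 0 k < (al 0 k)%:R + (if k == l then n%:R * s else 1)).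
  have -> : (n%:R^-1 *: lat al) 0 k = n%:R^-1 * (al 0 k)%:R by rewrite !mxE.
  have -> : (n%:R^-1 *: lat al + thin l s n%:R^-1) 0 k =
      n%:R^-1 * ((al 0 k)%:R + (if k == l then n%:R * s else 1)).
    by rewrite !mxE; case: ifP => _; field; rewrite gt_eqF.
  by rewrite ![n%:R^-1 * _]mulrC ler_pdivrMr // ltr_pdivlMr // ![tc x 0 k * _]mulrC.
by split=> hx k; have := hx k; rewrite E.
Qed.

Lemma lcell_P be al x : inner be -> al = be \/ al = be + e -> lcell al x ->
  forall k, 0 < n%:R * tc x 0 k < n%:R.
Proof.
move=> /forallP ib ab /lcellP ax k; have /andP[a1 a2] := ax k.
have ak := ord_le (al 0 k).
have /andP[i1 _] := ib k; have /andP[_ il] := ib l.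
have p : 1 <= (al 0 k)%:R :> R.
  rewrite ler1n; case: ab => ->; first exact: i1.
  by rewrite (unitv_addS il); case: ifP.
by apply/andP; split; lra.
Qed.

Lemma slab_sub al s : n%:R * s <= 1 -> slab al s `<=` lcell al.
Proof.
move=> ns x /slabP hx; apply/lcellP => k; have /andP[h1 h2] := hx k.
by rewrite h1 -[(al 0 k).+1%:R]natr1 /=; apply: lt_le_trans h2 _; rewrite lerD2l; case: ifP.
Qed.

Lemma nice_sub D : mset D -> D `<=` Omega -> nice D qin.
Proof. by move=> mD DO; apply: niceS DO (nice_qin ts). Qed.

Definition Qs s al : R := int3 (slab al s) qin.

(** The shifted lattice cell loses its lower slab and gains the lower slab of the next one. *)
Lemma shift_int al s : inner al -> 0 < s -> n%:R * s < 1 ->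
  int3 (lcell al) (fun x => qin (x + s *: wv l)) = int3 (lcell al) qin + Qs s (al + e) - Qs s al.
Proof.
move=> ia s0 ns; have il : (al 0%R l < m.+1)%N by move/forallP: ia => /(_ l)/andP[].
have aE k := unitv_addS il k.
pose D := [set y | lcell al (y - s *: wv l)].
have tcm y : tc (y - s *: wv l) = tc y - s *: delta_mx 0 l by rewrite -scaleNr (tc_shift o uB) scaleNr.
have tck y k : n%:R * tc (y - s *: wv l) 0 k = n%:R * tc y 0 k - (if k == l then n%:R * s else 0).
  rewrite tcm; move: (tc y) => t; by rewrite !mxE eqxx /=; case: (k == l) => /=; ring.
have DE : D = (lcell al `\` slab al s) `|` slab (al + e) s.
  apply/seteqP; split=> y.
    move/lcellP => Dy; have /andP[d1 d2] := Dy l; rewrite tck eqxx in d1 d2.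
    have ok k : k != l -> (al 0 k)%:R <= n%:R * tc y 0 k < (al 0 k).+1%:R.
      by move=> kl; have := Dy k; rewrite tck (negbTE kl) subr0.
    have [lt|ge] := ltP (n%:R * tc y 0 l) ((al 0 l).+1%:R).
      left; split.
        apply/lcellP => k; have [->|/ok//] := eqVneq k l.
        by rewrite lt andbT; have := mulr_gt0 n0 s0; lra.
      by move=> /slabP/(_ l); rewrite eqxx => /andP[_]; lra.
    right; apply/slabP => k; rewrite aE; have [->|kl] := eqVneq k l.
      by rewrite ge /=; lra.
    by have /andP[h1 h2] := ok k kl; rewrite h1 /= natr1.
  have ns0 := mulr_gt0 n0 s0.
  case=> [[/lcellP ly nsl]|/slabP sy]; apply/lcellP => k; rewrite tck.
    have /andP[h1 h2] := ly k; have [->|kl] := eqVneq k l; last by rewrite subr0 h1.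
    have /andP[g1 g2] := ly l; rewrite -[(al 0 l).+1%:R]natr1 in g2 *.
    have ge : (al 0 l)%:R + n%:R * s <= n%:R * tc y 0 l.
      rewrite leNgt; apply/negP => lt; apply: nsl; apply/slabP => k'.
      have [->|kl'] := eqVneq k' l; first by rewrite g1.
      by rewrite natr1; exact: ly.
    by apply/andP; split; lra.
  have := sy k; rewrite aE; have [->|kl] := eqVneq k l => /andP[h1 h2].
    by rewrite -[(al 0 l).+1%:R]natr1 in h1 h2 *; apply/andP; split; lra.
  by rewrite subr0 h1 -[(al 0 k).+1%:R]natr1.
have ml : mset (lcell al) := mset_lcell _ _ _; have msl be : mset (slab be s) by exact: mset_hbox.
have sub1 : slab al s `<=` lcell al by apply: slab_sub; exact: ltW.
have sub2 : slab (al + e) s `<=` lcell (al + e) by apply: slab_sub; exact: ltW.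
have lO : lcell al `<=` Omega by move=> x /(lcell_P ia (or_introl (erefl _))); exact: in_P.
have lO2 : lcell (al + e) `<=` Omega by move=> x /(lcell_P ia (or_intror (erefl _))); exact: in_P.
have mD : mset D by rewrite DE; apply: msetU => //; exact: msetD.
have DO : D `<=` Omega.
  by rewrite DE => x [[/lO]|/sub2/lO2].
have nD : nice D qin by exact: nice_sub.
have pE : (fun x => x + s *: wv l) @^-1` D = lcell al.
  by apply/seteqP; split=> x; rewrite /D /= addrK.
transitivity (int3 D qin).
  by rewrite -[in LHS]pE; exact: (int3_mp3 (mp3_translate (s *: wv l)) nD).
rewrite [in LHS]DE int3U //; [|exact: msetD| |by rewrite -DE]; last first.
  apply/seteqP; split=> x // -[[/lcellP/(_ l) + _] /slabP/(_ l)].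
  by rewrite aE eqxx => /andP[_ h1] /andP[h2 _]; lra.
have -> : int3 (lcell al) qin = int3 ((lcell al `\` slab al s) `|` slab al s) qin by rewrite setUC setDUK.
rewrite int3U //; [by rewrite [RHS]addrAC addrK|exact: msetD|by apply/seteqP; split=> x // -[[_ h1] /h1]|].
by rewrite setUC setDUK //; exact: nice_sub.
Qed.

Definition vC : R := vol (hbox B o 0 (const_mx n%:R^-1)).

Lemma vol_lcell al : vol (lcell al) = vC.
Proof.
rewrite /vC -(vol_hbox_shift o uB 0 (const_mx n%:R^-1) (n%:R^-1 *: lat al)).
by rewrite add0r addrC.
Qed.

Lemma bdiff_P al : bdiff (@unitv m) l V al != 0 -> lcell al `<=` Omega.
Proof.
move=> nz x ax; apply: in_P.
have [ia|na] := boolP (inner al); first by apply: (lcell_P ia) ax; left.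
have [ib|nb] := boolP (inner (al - e)); first by apply: (lcell_P ib) ax; right; rewrite subrK.
by move: nz; rewrite /bdiff !V0 // subrr eqxx.
Qed.

Lemma slab_osc al s : 0 < s -> n%:R * s <= 1 -> bdiff (@unitv m) l V al != 0 ->
  `|Qs s al - center_value al * vol (slab al s)| <= oscb al * vol (slab al s).
Proof.
move=> s0 ns nz; have sub := slab_sub (al := al) ns; have lO := bdiff_P nz.
have msl : mset (slab al s) by exact: mset_hbox.
have fsl : finv (slab al s) by exact: finv_hbox.
have ns' : nice (slab al s) qin by apply: nice_sub => // x /sub/lO.
rewrite -int3_cst // /Qs -int3B //; last exact: nice_cst.
apply: int3_norm_le; first by apply: niceB => //; exact: nice_cst.
by move=> x sx; rewrite qinE; [apply: osc_cell; [apply: lO|]|apply: lO]; exact: sub.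
Qed.

(** A thickness for which [M + 2] slabs tile a lattice cell exactly, as [vol_slab] requires; the 2
    keeps [n sM] below 1. *)
Definition sM (M : nat) : R := (n%:R * M.+2%:R)^-1.

Lemma sM_gt0 M : 0 < sM M.
Proof. by rewrite invr_gt0 mulr_gt0 // ltr0n. Qed.

Lemma n_sM M : n%:R * sM M = M.+2%:R^-1.
Proof. by rewrite /sM invfM mulrA divff ?mul1r // gt_eqF. Qed.

Lemma n_sM_lt1 M : n%:R * sM M < 1.
Proof. by rewrite n_sM invf_lt1 ?ltr0n // ltr1n. Qed.

(** Summation by parts moves the difference of slab integrals onto [V]. Each slab integral is the
    centre value times the slab volume up to the oscillation, and slab volume over thickness is
    [n vC] for every [M]. *)
Lemma quotient_identity M :
  `|\sum_al V al * int3 (lcell al) (fun x => (qin (x + sM M *: wv l) - qin x) / sM M)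
    + n%:R * vC * \sum_al center_value al * bdiff (@unitv m) l V al|
  <= n%:R * vC * \sum_al `|bdiff (@unitv m) l V al| * oscb al.
Proof.
have s0 := sM_gt0 M; have ns := n_sM_lt1 M.
have quo al : V al * int3 (lcell al) (fun x => (qin (x + sM M *: wv l) - qin x) / sM M) =
    V al * ((Qs (sM M) (al + e) - Qs (sM M) al) / sM M).
  have [ia|na] := boolP (inner al); last by rewrite V0 // !mul0r.
  congr (_ * _).
  have lO : lcell al `<=` Omega by move=> x /(lcell_P ia (or_introl (erefl _))); exact: in_P.
  have nq : nice (lcell al) qin by apply: nice_sub => //; exact: mset_lcell.
  have nq' : nice (lcell al) (fun x => qin (x + sM M *: wv l)).
    have mp := mp3_translate (sM M *: wv l).
    split; [exact: mset_lcell|exact: finv_lcell| |].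
      have := mfn_qin ts; rewrite /mfn => mq; case: mp => mp _.
      rewrite (_ : _ \o _ = (qin \o @vec3 R) \o (@unvec R \o (fun x => x + sM M *: wv l) \o @vec3 R)).
        exact: measurableT_comp.
      by apply/funext => p /=; rewrite unvecK.
    have [_ _ _ [Mb hb]] := nice_qin ts; exists `|Mb| => x _; rewrite /qext.
    case: asboolP => ox; last by rewrite normr0.
    by have := hb _ ox; rewrite qinE // => /le_trans; apply; exact: ler_norm.
  rewrite (_ : (fun x => _) = fun x => (sM M)^-1 * (qin (x + sM M *: wv l) - qin x)); last first.
    by apply/funext => x; rewrite mulrC.
  rewrite int3Z; last exact: niceB.
  transitivity ((sM M)^-1 * (int3 (lcell al) (fun x => qin (x + sM M *: wv l)) - int3 (lcell al) qin)).
    by congr (_ * _); exact: int3B.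
  move: (shift_int ia s0 ns); set a := int3 _ _; set b := int3 _ _ => ->.
  move: (Qs _ _) (Qs _ _) b => x y z {a}.
  by rewrite mulrC; congr (_ / _); rewrite [LHS]addrC !addrA addNr add0r.
rewrite (eq_bigr _ (fun al _ => quo al)).
have -> : \sum_al V al * ((Qs (sM M) (al + e) - Qs (sM M) al) / sM M) =
   - \sum_al (Qs (sM M) al / sM M) * bdiff (@unitv m) l V al.
  by rewrite sum_by_parts opprK; apply: eq_bigr => al _; rewrite /fdiff mulrC mulrBl.
have vs al : vol (slab al (sM M)) / sM M = n%:R * vC.
  have := @vol_slab R B o uB (n%:R^-1 *: lat al) l n%:R^-1 (sM M) M.+2 s0.
  have nE : n%:R^-1 = M.+2%:R * sM M by rewrite /sM invfM mulrCA divff ?mulr1 // pnatr_eq0.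
  move=> /(_ nE).
  rewrite -/(slab al (sM M)) -/(lcell al) vol_lcell => <-.
  by rewrite /sM invrK mulrC -mulrA.
rewrite addrC !mulr_sumr -sumrB; apply: le_trans (ler_norm_sum _ _ _) _.
apply: ler_sum => al _; have [z|nz] := eqVneq (bdiff (@unitv m) l V al) 0.
  by rewrite z !mulr0 subr0 !normr0 mul0r mulr0.
have -> : n%:R * vC * (center_value al * bdiff (@unitv m) l V al) - Qs (sM M) al / sM M * bdiff (@unitv m) l V al =
   - bdiff (@unitv m) l V al * ((Qs (sM M) al - center_value al * vol (slab al (sM M))) / sM M).
  by rewrite -(vs al); field; rewrite gt_eqF.
rewrite normrM normrN mulrCA ler_wpM2l // normrM [X in _ * X]ger0_norm ?invr_ge0 ?(ltW s0) //.
rewrite -(vs al) ler_pdivrMr // mulrAC divfK ?gt_eqF // [leRHS]mulrC.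
by apply: slab_osc => //; exact: ltW.
Qed.

End Direction.
End Parts.

Section Aux.
Context (R : realType).
Local Notation E3 := 'rV[R]_3.

Lemma int3_indI (D A : set E3) : mset D -> finv D -> mset A -> int3 D (ind A) = vol (D `&` A).
Proof.
move=> mD fD mA; have mDA : mset (D `&` A) by exact: msetI.
rewrite -(int3_ind mD fD mDA) ?subIsetl //; apply: eq_int3 => x Dx; rewrite /ind.
by congr (if _ then _ else _); apply: asbool_equiv_eq; split=> [?|[]].
Qed.

End Aux.

(** * Lattice fields as test velocities *)

Section Key.
Context (R : realType) (m : nat).
Local Notation n := m.+2.
Local Notation G := 'rV['I_n]_3.
Local Notation E3 := 'rV[R]_3.
Context (B : 'M[R]_3) (o : E3).
Hypothesis uB : B \in unitmx.
Local Notation tc := (tc B o).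
Local Notation wv := (edgev B).
Local Notation lcell := (@lcell R m B o).
Context (N : nat) (Omega : set E3) (K : mesh R N) (rho h Lt Lb : R).
Hypothesis (Lt0 : 0 < Lt) (Lb0 : 0 < Lb).
Hypothesis hLt : forall v : E3, `|v *m invmx B| <= Lt * `|v|.
Hypothesis hLb : forall v : E3, `|v *m B| <= Lb * `|v|.
Hypothesis nh : n%:R * (Lt * h) <= 1.
Context (q : E3 -> R) (c : 'I_N -> R) (g : 'I_N -> E3) (S : R).
Hypothesis ts : tested Omega rho h K q c g S.
Hypothesis hP : forall x, (forall l, 0 < tc x 0 l < 1) -> Omega x.
Let rm := ts_rm ts.
Let tet := rm_tet rm.
Let conf := rm_conf rm.
Local Notation near := (@near R m B o N K).
Local Notation qin := (qext Omega q).
Local Notation os := (@oscb R m B o N K Lb g).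
Local Notation u := (@center_value R m B o q).
Local Notation vC := (@vC R m B o).
Local Notation sM := (@sM R m).
Local Notation bd l V := (bdiff (@unitv m) l V).
Implicit Types (al be ga : G) (x y : E3) (l j k : 'I_3) (i : 'I_N).

Let n0 : 0 < n%:R :> R. Proof. by rewrite ltr0n. Qed.

(** The elementwise derivative of [q] along row [l] of [B], set to zero on element faces. *)
Definition gw l x : R := \sum_i dot (g i) (wv l) * ind (cell (K i))° x.

Definition quo l (M : nat) x : R := (qin (x + sM M *: wv l) - qin x) / sM M.

Lemma mfn_quo l M : mfn (quo l M).
Proof.
have mq := mfn_qin ts.
have mt : mfn (fun x => qin (x + sM M *: wv l)).
  have [mp _] := mp3_translate (sM M *: wv l); rewrite /mfn.
  rewrite (_ : _ \o _ = (qin \o @vec3 R) \o (@unvec R \o (fun x => x + sM M *: wv l) \o @vec3 R)).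
    exact: measurableT_comp.
  by apply/funext => p /=; rewrite unvecK.
apply: mfnM; last exact: mfn_cst.
apply: mfnD => //; apply: (@mfn_ext _ (fun x => -1 * qin x)); first by move=> x; rewrite mulN1r.
by apply: mfnM => //; exact: mfn_cst.
Qed.

Lemma seg_in l al x M (t : R) : inner al -> lcell al x -> 0 <= t <= 1 -> Omega (x + t *: (sM M *: wv l)).
Proof.
move=> /forallP ia /lcellP ax /andP[t0 t1]; apply: (in_P (m := m) hP) => k.
have /andP[a1 a2] := ax k; have /andP[i1 i2] := ia k.
have b1 : 1 <= (al 0 k)%:R :> R by rewrite ler1n.
have b2 : (al 0 k).+1%:R + 1 <= n%:R :> R by rewrite natr1 ler_nat !ltnS in i2 *.
rewrite scalerA (tc_shift o uB).
have -> : (tc x + (t * sM M) *: delta_mx 0 l) 0 k = tc x 0 k + (if k == l then t * sM M else 0).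
  by move: (tc x) => v; rewrite !mxE eqxx /=; case: (k == l); rewrite /= ?mulr1 ?mulr0.
have ns := n_sM_lt1 R m M; have s0 := sM_gt0 R m M.
have ns0 : 0 < n%:R * sM M by rewrite mulr_gt0.
have p1 : 0 <= t * (n%:R * sM M) by rewrite mulr_ge0 // ltW.
have p2 : t * (n%:R * sM M) <= 1 by rewrite mulr_ile1 // ltW.
rewrite mulrDr; case: (k == l); rewrite ?mulr0 ?addr0.
  by rewrite (mulrCA _ t); apply/andP; split; lra.
by apply/andP; split; lra.
Qed.

Lemma quo_le l al x M : inner al -> lcell al x -> `|quo l M x| <= \sum_i `|dot (g i) (wv l)|.
Proof.
move=> ia ax; have s0 := sM_gt0 R m M.
have ox : Omega x by have := seg_in l M (t := 0) ia ax; rewrite scale0r addr0; apply; rewrite lexx ler01.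
have ox' : Omega (x + sM M *: wv l).
  by have := seg_in l M (t := 1) ia ax; rewrite scale1r; apply; rewrite lexx ler01.
rewrite /quo !qinE // normrM [X in _ * X]gtr0_norm ?invr_gt0 // ler_pdivrMr //.
apply: (seg_lip ts) => [|t t01|i t t01 ci].
- by rewrite mulr_ge0 ?(ltW s0) // sumr_ge0.
- exact: seg_in ia ax t01.
- rewrite dotZr normrM gtr0_norm // mulrC ler_pM2r // (bigD1 i) //= lerDl.
  exact: sumr_ge0.
Qed.

Lemma ind_cell i x : (forall k : 'I_4, 0 < bary (K i) k x) -> gw ^~ x =1 (fun l => dot (g i) (wv l)).
Proof.
move=> hx l; rewrite /gw (bigD1 i) //= big1 ?addr0 => [|j ji].
  by rewrite /ind asboolT ?mulr1 //; apply/interior_cell.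
rewrite /ind asboolF ?mulr0 // => /interior_subset cj.
by move: ji; rewrite (int_cell_inj conf hx cj) eqxx.
Qed.

Lemma mfn_gw l : mfn (gw l).
Proof.
apply: mfn_sum => i; apply: mfnM; first exact: mfn_cst.
exact: mfn_if (mset_icell (K i)) (mfn_cst 1).
Qed.

Lemma gw_le l x : `|gw l x| <= \sum_i `|dot (g i) (wv l)|.
Proof.
apply: le_trans (ler_norm_sum _ _ _) _; apply: ler_sum => i _.
by rewrite normrM /ind; case: ifP => _; rewrite ?normr1 ?mulr1 // normr0 mulr0.
Qed.

(** Off the planes of the element faces, a point and its small shifts lie in one open element, so
    the quotients eventually equal [gw]. The bound for dominated convergence is [quo_le]. *)
Lemma dct_cell l al (e : R) : inner al -> 0 < e -> exists M0, forall M, (M0 <= M)%N ->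
  `|int3 (lcell al) (quo l M) - int3 (lcell al) (gw l)| < e.
Proof.
move=> ia e0.
pose Z := [set x | exists ik : 'I_N * 'I_4, plane (gb (K ik.1) ik.2) (- bary (K ik.1) ik.2 0) x].
have mZ : mset Z by apply: mset_exists => ik; exact: mset_plane.
have lZ : @leb3 R (@vec3 R @^-1` Z) = 0%E.
  apply: vol_null_union => ik; [exact: mset_plane|exact: leb3_plane (gb_neq0 _ _)].
have vZ : vol Z = 0 by rewrite /vol lZ.
have fZ : finv Z by rewrite /finv lZ ltry.
have ml := @mset_lcell R m B o al; have fl := @finv_lcell R m B o uB al.
set L := \sum_i `|dot (g i) (wv l)|.
have nq M : nice (lcell al) (quo l M).
  by split=> //; [exact: mfn_quo|exists L => x ax; exact: quo_le ia ax].
have ng : nice (lcell al) (gw l) by split=> //; [exact: mfn_gw|exists L => x _; exact: gw_le].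
have mD : mset (lcell al `\` Z) by exact: msetD.
have fD : finv (lcell al `\` Z) by apply: finvS fl => //; exact: subDsetl.
have ev x : (lcell al `\` Z) x -> exists M0, forall M, (M0 <= M)%N -> quo l M x = gw l x.
  move=> [ax nZ].
  have ox : Omega x by have := seg_in l 0 (t := 0) ia ax; rewrite scale0r addr0; apply; rewrite lexx ler01.
  have [i ci] := omega_cell tet ox.
  have hx (k : 'I_4) : 0 < bary (K i) k x.
    rewrite lt_neqAle; apply/andP; split; last by move/cellP: ci.
    apply/eqP => b0; apply: nZ; exists (i, k); rewrite /plane /=.
    by move: b0; rewrite (bary_dot (K i) k x) => b0; lra.
  have [d d0 hd] := icell_near hx.
  have wd : 0 <= `|wv l| / d by rewrite divr_ge0 // ltW.
  exists (Num.bound (`|wv l| / d)) => M MM.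
  have s0 := sM_gt0 R m M.
  have hx' (k : 'I_4) : 0 < bary (K i) k (x + sM M *: wv l).
    apply: hd; rewrite opprD addNKr normrN normrZ gtr0_norm //.
    have sle : sM M <= M.+2%:R^-1 by rewrite -(n_sM R m M) ler_peMl ?(ltW s0) // ler1n.
    apply: le_lt_trans (ler_wpM2r (normr_ge0 _) sle) _.
    rewrite mulrC ltr_pdivrMr ?ltr0n // mulrC -ltr_pdivrMr //.
    apply: lt_le_trans (archi_boundP wd) _; rewrite ler_nat.
    by apply: leq_trans MM _; do 2! apply: leqW.
  rewrite (ind_cell hx) /quo.
  have ox' : Omega (x + sM M *: wv l) by apply: (int_cell_omega tet (i := i)) hx'.
  have ci' : cell (K i) (x + sM M *: wv l) by apply/cellP => k; exact: ltW.
  rewrite !qinE // (ts_aff ts ox' ci') (ts_aff ts ox ci) dotDr dotZr opprD addrACA subrr add0r.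
  by rewrite addrAC subrr add0r mulrAC divff ?mul1r // gt_eqF.
have [M0 hM0] := int3_dct mD fD (mfn_quo l) (mfn_gw l) (L := L)
  (fun M x h => quo_le l M ia h.1) ev e0.
exists M0 => M MM; rewrite (int3_null mZ vZ fZ (nq M)) (int3_null mZ vZ fZ ng).
exact: hM0.
Qed.

(** The bound of [quotient_identity] is uniform in [M], and one large [M] serves all the finitely
    many inner lattice points. *)
Lemma limit_identity l V : (forall al, ~~ inner al -> V al = 0) ->
  `|\sum_al V al * int3 (lcell al) (gw l) + n%:R * vC * \sum_al u al * bd l V al|
  <= n%:R * vC * \sum_al `|bd l V al| * os al.
Proof.
move=> V0; apply/ler_addgt0Pl => e e0.
set W := \sum_al `|V al|; have W0 : 0 < W + 1 by rewrite ltr_wpDl // sumr_ge0.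
have e1 : 0 < e / (W + 1) by rewrite divr_gt0.
have /choice[F FP] al : exists M0, inner al -> forall M, (M0 <= M)%N ->
    `|int3 (lcell al) (quo l M) - int3 (lcell al) (gw l)| < e / (W + 1).
  have [ia|na] := boolP (inner al); last by exists 0%N.
  by have [M0 hM0] := dct_cell l ia e1; exists M0.
pose M := \max_al F al.
have dif : `|\sum_al V al * int3 (lcell al) (gw l) - \sum_al V al * int3 (lcell al) (quo l M)| <= e.
  rewrite -sumrB; apply: le_trans (ler_norm_sum _ _ _) _.
  apply: le_trans (_ : \sum_al `|V al| * (e / (W + 1)) <= _); last first.
    by rewrite -mulr_suml -/W mulrA ler_pdivrMr // mulrC ler_pM2l // lerDl.
  apply: ler_sum => al _; rewrite -mulrBr normrM.
  have [ia|na] := boolP (inner al); last by rewrite V0 // normr0 !mul0r.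
  by rewrite ler_wpM2l // distrC ltW //; apply: FP => //; exact: leq_bigmax.
have qi := @quotient_identity R m B o uB N Omega K rho h Lb Lb0 hLb q c g S ts hP l V V0 M.
move: dif qi; rewrite /quo; set a := \sum_al V al * int3 _ (gw l); set b := \sum_al V al * int3 _ _.
set x := n%:R * vC * _; set y := n%:R * vC * _ => dif qi.
have -> : a + x = (a - b) + (b + x) by rewrite addrA subrK.
by apply: le_trans (ler_normD _ _) _; exact: lerD.
Qed.

Section VectorTest.
Context (V : 'I_3 -> G -> R).
Hypothesis V0 : forall l al, ~~ inner al -> V l al = 0.

(** A discontinuous field, constant on lattice cells. The discrete velocity samples it at the edge
    midpoints, so only its variation on each element counts. *)
Definition tf x : E3 := \sum_l Vx B o (V l) x *: wv l.

Definition dd i : R := Lb * \sum_l \sum_j vari B o K (V l) i j.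

Lemma norm_wv l : `|wv l| <= Lb.
Proof. by rewrite /edgev rowE; apply: le_trans (hLb _) _; rewrite norm_delta mulr1. Qed.

Lemma tf_var i x y : cell (K i) x -> cell (K i) y -> `|tf x - tf y| <= dd i.
Proof.
move=> cx cy; rewrite /tf -sumrB; apply: le_trans (ler_norm_sum _ _ _) _.
rewrite /dd mulr_sumr; apply: ler_sum => l _; rewrite -scalerBl normrZ mulrC ler_pM ?norm_wv //.
exact: (Vx_variation o rm Lt0 hLt nh (@V0 l) cx cy).
Qed.

Lemma tf_spread : spread K tf dd.
Proof. by move=> i e e' ee ee'; apply: tf_var; exact: midpoint_cell. Qed.

(** Inner lattice cells lie in [Omega], boundary midpoints do not. *)
Lemma tf_vanishing : vanishing Omega K tf.
Proof.
move=> i e ee be; set p := midpoint _ _.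
have fm : face (K i) e p.
  apply/faceP; split=> k; rewrite midpoint_bary //; first by case: ifP.
  by move/negbTE => ->.
have np : ~ Omega p by apply/(bd_cell tet (midpoint_cell (K i) ee)); exact: be.
apply: big1 => l _; rewrite [Vx _ _ _ _](_ : _ = 0) ?scale0r //.
have [[al ap]|no] := pselect (exists al, lcell al p).
  rewrite (Vx_in _ ap) V0 //; apply/negP => ia; apply: np.
  by apply: (in_P (m := m) hP) => k; have := @lcell_P R m B o l al al p ia (or_introl (erefl al)) ap k.
by apply: Vx_out => al ap; apply: no; exists al.
Qed.

Lemma nice_Vx i l : nice (cell (K i))° (Vx B o (V l)).
Proof.
split; [exact: mset_icell|exact: finv_icell|exact: mfn_Vx|].
by exists (\sum_al `|V l al|) => x _; exact: Vx_le.
Qed.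

Lemma int_tf i : int3 (cell (K i))° (fun x => dot (tf x) (g i)) =
  \sum_l \sum_al V l al * (dot (g i) (wv l) * vol (lcell al `&` (cell (K i))°)).
Proof.
have mc := mset_icell (K i); have fc := finv_icell (K i).
rewrite (_ : (fun x => _) = fun x => \sum_(l <- index_enum _) dot (g i) (wv l) * Vx B o (V l) x); last first.
  by apply/funext => x; rewrite dotC /tf dot_sumr; apply: eq_bigr => l _; rewrite dotZr mulrC.
rewrite int3_sum //; last by move=> l; apply: niceZ; exact: nice_Vx.
apply: eq_bigr => l _; rewrite int3Z; last exact: nice_Vx.
have ml al := @mset_lcell R m B o al.
rewrite /Vx int3_sum //; last by move=> al; apply: niceZ; exact: nice_ind.
rewrite mulr_sumr; apply: eq_bigr => al _.
rewrite int3Z; last exact: nice_ind.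
by rewrite int3_indI // setIC mulrCA.
Qed.

Lemma sum_gw : \sum_l \sum_al V l al * int3 (lcell al) (gw l) =
  \sum_i int3 (cell (K i))° (fun x => dot (tf x) (g i)).
Proof.
rewrite [RHS](eq_bigr _ (fun i _ => int_tf i)) [RHS]exchange_big /=; apply: eq_bigr => l _.
rewrite [RHS]exchange_big /=; apply: eq_bigr => al _; rewrite -mulr_sumr; congr (_ * _).
have ml := @mset_lcell R m B o al; have fl := @finv_lcell R m B o uB al.
have mc i := mset_icell (K i).
rewrite /gw int3_sum //; last by move=> i; apply: niceZ; exact: nice_ind.
apply: eq_bigr => i _; rewrite int3Z; last exact: nice_ind.
by rewrite int3_indI.
Qed.

(** Midpoint rule and integral are both averages of [tf] times the volume, so they differ by no more
    than its variation allows. *)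
Lemma quadrature i : `|vol (cell (K i))° / 6 * \sum_(e | is_edge e) dot (tf (midpoint (K i) e)) (g i)
   - int3 (cell (K i))° (fun x => dot (tf x) (g i))| <= 24 * h ^+ 3 * (`|g i| * dd i).
Proof.
have mc := mset_icell (K i); have fc := finv_icell (K i).
set A := \sum_(e | is_edge e) dot (tf (midpoint (K i) e)) (g i).
have nt : nice (cell (K i))° (fun x => dot (tf x) (g i)).
  rewrite (_ : (fun x => _) = fun x => \sum_(l <- index_enum _) dot (g i) (wv l) * Vx B o (V l) x); last first.
    by apply/funext => x; rewrite dotC /tf dot_sumr; apply: eq_bigr => l _; rewrite dotZr mulrC.
  by apply: nice_sum => // l; apply: niceZ; exact: nice_Vx.
have -> : vol (cell (K i))° / 6 * A = int3 (cell (K i))° (fun=> A / 6).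
  by rewrite int3_cst // [RHS]mulrC (mulrC A) mulrA.
have nc : nice (cell (K i))° (fun=> A / 6) by exact: nice_cst.
rewrite -int3B //.
have d0 : 0 <= dd i.
  by apply: le_trans (tf_var (vert_cell (K i) 0) (vert_cell (K i) 0)).
apply: le_trans (_ : 3 * (`|g i| * dd i) * vol (cell (K i))° <= _); last first.
  have -> : 24 * h ^+ 3 * (`|g i| * dd i) = 3 * (`|g i| * dd i) * (8 * h ^+ 3) by ring.
  by apply: ler_wpM2l; [apply: mulr_ge0 => //; exact: mulr_ge0|exact: (vol_icell_le rm i)].
apply: int3_norm_le; first exact: niceB.
move=> x /interior_subset cx.
have -> : A / 6 - dot (tf x) (g i) = 6^-1 * \sum_(e : {set 'I_4} | is_edge e) dot (tf (midpoint (K i) e) - tf x) (g i).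
  rewrite (eq_bigr (fun e => dot (tf (midpoint (K i) e)) (g i) - dot (tf x) (g i))); last first.
    by move=> e _; rewrite dotBl.
  rewrite sumrB -/A mulrBr mulrC; congr (_ - _).
  by rewrite (sum_edges (fun=> dot (tf x) (g i))); move: (dot _ _) => z; field.
rewrite normrM ger0_norm ?invr_ge0 // mulrC ler_pdivrMr //.
apply: le_trans (ler_norm_sum _ _ _) _.
apply: le_trans (_ : \sum_(e : {set 'I_4} | is_edge e) 3 * (`|g i| * dd i) <= _); last first.
  by rewrite (sum_edges (fun=> 3 * (`|g i| * dd i))); move: (_ * dd i) => z; lra.
apply: ler_sum => e ee; apply: le_trans (dot_le _ _) _.
rewrite -mulrA ler_pM2l // [leLHS]mulrC ler_wpM2l //.
by apply: tf_var => //; exact: midpoint_cell.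
Qed.

(** [ts_test] for [tf], corrected by the errors of [quadrature] and [limit_identity]. Both
    corrections carry the gradient of [q]. *)
Lemma key_inequality :
  n%:R * vC * \sum_l \sum_al u al * bd l (V l) al <=
  S * Num.sqrt (h * \sum_i dd i ^+ 2) + 24 * h ^+ 3 * \sum_i `|g i| * dd i
  + n%:R * vC * \sum_l \sum_al `|bd l (V l) al| * os al.
Proof.
have t1 := ts_test ts tf_vanishing tf_spread.
have t2 : - \sum_i int3 (cell (K i))° (fun x => dot (tf x) (g i)) <=
   S * Num.sqrt (h * \sum_i dd i ^+ 2) + 24 * h ^+ 3 * \sum_i `|g i| * dd i.
  have e : 24 * h ^+ 3 * \sum_i `|g i| * dd i = \sum_i 24 * h ^+ 3 * (`|g i| * dd i) by rewrite mulr_sumr.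
  rewrite -sumrN in t1; rewrite -sumrN e -lerBlDr -sumrB.
  apply: le_trans t1; apply: ler_sum => i _.
  by have := quadrature i; rewrite ler_norml => /andP[]; set a := _ / 6 * _; set b := int3 _ _; lra.
have t3 l : n%:R * vC * \sum_al u al * bd l (V l) al <=
   - \sum_al V l al * int3 (lcell al) (gw l) + n%:R * vC * \sum_al `|bd l (V l) al| * os al.
  have := limit_identity l (@V0 l); rewrite ler_norml => /andP[_].
  set a := \sum_al V l al * _; set b := n%:R * _ * _; set d := n%:R * _ * _; lra.
rewrite -sum_gw -sumrN in t2.
have t4 := ler_sum (index_enum 'I_3) (P := xpredT) (fun l _ => t3 l).
rewrite big_split /= -!mulr_sumr in t4.
by apply: le_trans t4 _; rewrite lerD2r.
Qed.

End VectorTest.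
End Key.

Section Aux.
Context (R : realType).
Local Notation E3 := 'rV[R]_3.

Lemma int3_set0 (f : E3 -> R) (D : set E3) : D = set0 -> int3 D f = 0.
Proof.
move=> ->; rewrite (@eq_int3 _ set0 _ (fun=> 0)) // int3_cst ?mul0r //.
by rewrite /mset preimage_set0.
Qed.

Lemma cauchy3 (a : 'I_3 -> R) : (\sum_l a l) ^+ 2 <= 3 * \sum_l a l ^+ 2.
Proof. by have := cauchy_sum predT a; rewrite card_ord. Qed.

Lemma le_sqrt_mul (a b s : R) : 0 <= s -> 0 <= b -> a <= b * s ^+ 2 -> Num.sqrt a <= Num.sqrt b * s.
Proof.
move=> s0 b0 hab; rewrite -[s]ger0_norm // -sqrtr_sqr -sqrtrM // ler_sqrt //.
by rewrite mulr_ge0 // sqr_ge0.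
Qed.

End Aux.

(** * One octant, for meshes that are fine relative to it *)

Section Fine.
Context (R : realType) (m : nat).
Local Notation n := m.+2.
Local Notation G := 'rV['I_n]_3.
Local Notation E3 := 'rV[R]_3.
Context (B : 'M[R]_3) (o : E3).
Hypothesis uB : B \in unitmx.
Local Notation tc := (tc B o).
Local Notation pt := (pt B o).
Local Notation lcell := (@lcell R m B o).
Context (N : nat) (Omega : set E3) (K : mesh R N) (rho h Lt Lb : R).
Hypothesis (Lt0 : 0 < Lt) (Lb0 : 0 < Lb).
Hypothesis hLt : forall v : E3, `|v *m invmx B| <= Lt * `|v|.
Hypothesis hLb : forall v : E3, `|v *m B| <= Lb * `|v|.
Hypothesis nh : n%:R * (Lt * h) <= 1.
Hypothesis nl : 1 <= 2 * n%:R * (Lt * h).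
Context (q : E3 -> R) (c : 'I_N -> R) (g : 'I_N -> E3) (S : R).
Hypothesis ts : tested Omega rho h K q c g S.
Hypothesis hP : forall x, (forall l, 0 < tc x 0 l < 1) -> Omega x.
Let rm := ts_rm ts.
Let h0 := rm_h rm.
Local Notation near := (@near R m B o N K).
Local Notation os := (@oscb R m B o N K Lb g).
Local Notation u := (@center_value R m B o q).
Local Notation vC := (@vC R m B o).
Local Notation fd l V := (fdiff (@unitv m) l V).
Local Notation bd l V := (bdiff (@unitv m) l V).
Local Notation Kl := (Kl R).
Local Notation Kc := (Kc rho Lt Lb).
Local Notation Cg := (Cg rho).
Implicit Types (al be ga : G) (x y : E3) (l j k : 'I_3) (i : 'I_N) (V : 'I_3 -> G -> R).

Let n0 : 0 < n%:R :> R. Proof. by rewrite ltr0n. Qed.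
Let S0 := ts_S ts.
Let Kl0 : 0 <= Kl. Proof. exact: exprn_ge0. Qed.
Let Kc0 : 0 <= Kc. Proof. exact: (le_trans (ler0n _ _) (card_near_cells o uB rm Lt0 Lb0 hLb nl (0 : G))). Qed.
Let Cg0 : 0 <= Cg.
Proof. by apply: mulr_ge0; [apply: mulr_ge0|]; exact: sqr_ge0. Qed.

Lemma n_inv_le : n%:R^-1 <= 2 * (Lt * h).
Proof. by rewrite -[leLHS]mul1r ler_pdivrMr // mulrAC. Qed.

Lemma n_inv_ge : Lt * h <= n%:R^-1.
Proof. by rewrite -[leRHS]mul1r ler_pdivlMr // mulrC. Qed.

Definition energy (V : 'I_3 -> G -> R) : R := \sum_l \sum_j sqsum (fd j (V l)).

Lemma energy_ge0 V : 0 <= energy V.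
Proof. by do 3! apply: sumr_ge0 => ? _; exact: sqr_ge0. Qed.

Definition K1 : R := 9 * Lb ^+ 2 * Kl * Kc.

Let K10 : 0 <= K1.
Proof. by do 2! (apply: mulr_ge0 => //); apply: mulr_ge0 => //; exact: sqr_ge0. Qed.

(** Cauchy-Schwarz on each variation, then both counting bounds: an element is near at most [Kl]
    lattice points, a lattice point near at most [Kc] elements. *)
Lemma dd_energy V : \sum_i dd B o K Lb V i ^+ 2 <= K1 * energy V.
Proof.
have one i : dd B o K Lb V i ^+ 2 <= Lb ^+ 2 * (9 * Kl * \sum_l \sum_j \sum_(ga | near i ga) fd j (V l) ga ^+ 2).
  rewrite /dd exprMn ler_wpM2l ?sqr_ge0 //; apply: le_trans (cauchy3 _) _.
  have -> : 9 * Kl * \sum_l \sum_j \sum_(ga | near i ga) fd j (V l) ga ^+ 2 =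
    3 * \sum_l 3 * \sum_j Kl * \sum_(ga | near i ga) fd j (V l) ga ^+ 2.
    by rewrite -mulr_sumr mulrA; under [in RHS]eq_bigr do rewrite -mulr_sumr; rewrite -mulr_sumr; ring.
  rewrite ler_pM2l //; apply: ler_sum => l _; apply: le_trans (cauchy3 _) _.
  rewrite ler_pM2l //; apply: ler_sum => j _; rewrite /vari; apply: le_trans (cauchy_sum _ _) _.
  under eq_bigr do rewrite real_normK ?num_real //.
  rewrite ler_wpM2r //; first by apply: sumr_ge0 => *; exact: sqr_ge0.
  exact: (card_near_lat o rm Lt0 hLt nh i).
apply: le_trans (ler_sum _ (fun i _ => one i)) _; rewrite -!mulr_sumr.
have -> : K1 * energy V = Lb ^+ 2 * (9 * Kl * (Kc * energy V)) by rewrite /K1; ring.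
rewrite ler_wpM2l ?sqr_ge0 // ler_wpM2l ?mulr_ge0 // /energy mulr_sumr exchange_big /=.
apply: ler_sum => l _; rewrite exchange_big mulr_sumr /=; apply: ler_sum => j _.
rewrite /sqsum mulr_sumr (exchange_big_dep xpredT) //=; apply: ler_sum => ga _.
rewrite sumr_const -[leLHS]mulr_natl ler_wpM2r ?sqr_ge0 //.
exact: (card_near_cells o uB rm Lt0 Lb0 hLb nl ga).
Qed.

Lemma grad_dd V : h ^+ 3 * \sum_i `|g i| * dd B o K Lb V i <=
  Num.sqrt Cg * S * Num.sqrt (h * \sum_i dd B o K Lb V i ^+ 2).
Proof.
have h5 : 0 <= h ^+ 5 by rewrite exprn_ge0 // ltW.
(* The first root goes with the gradients, as in [grad_bound], the second with the variations, as in
   [ts_test]. *)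
have -> : h ^+ 3 = Num.sqrt (h ^+ 5) * Num.sqrt h.
  rewrite -sqrtrM // -exprSr (_ : h ^+ 6 = (h ^+ 3) ^+ 2); last by rewrite -exprM.
  by rewrite sqrtr_sqr ger0_norm // exprn_ge0 // ltW.
apply: le_trans (ler_wpM2l _ (cauchy_schwarz _ _ _)) _; first by rewrite mulr_ge0 ?sqrtr_ge0.
rewrite mulrACA -(sqrtrM _ h5) -(sqrtrM _ (ltW h0)) ler_wpM2r ?sqrtr_ge0 //.
apply: le_sqrt_mul => //; exact: (grad_bound ts).
Qed.

Definition Co : R := (36 * Lb * Lt) ^+ 2 * Kl * Cg.

Let Co0 : 0 <= Co. Proof. by rewrite mulr_ge0 // mulr_ge0 // sqr_ge0. Qed.

Lemma os_sum : h ^+ 3 * \sum_al os al ^+ 2 <= Co * S ^+ 2.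
Proof.
have h3 : 0 <= h ^+ 3 by rewrite exprn_ge0 // ltW.
have e al : os al ^+ 2 = (18 * Lb / n%:R) ^+ 2 * \sum_(i | near i al) `|g i| ^+ 2.
  by rewrite /oscb exprMn sqr_sqrtr // sumr_ge0 // => *; exact: sqr_ge0.
rewrite (eq_bigr _ (fun al _ => e al)) -mulr_sumr.
have s1 : \sum_al \sum_(i | near i al) `|g i| ^+ 2 <= Kl * \sum_i `|g i| ^+ 2.
  rewrite (exchange_big_dep xpredT) //= mulr_sumr; apply: ler_sum => i _.
  rewrite sumr_const -[leLHS]mulr_natl ler_wpM2r ?sqr_ge0 //.
  apply: le_trans (card_near_lat o rm Lt0 hLt nh i).
  by rewrite ler_nat; apply: subset_leq_card; apply/fintype.subsetP.
have s2 : (18 * Lb / n%:R) ^+ 2 <= (36 * Lb * Lt * h) ^+ 2.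
  have a0 : 0 <= 18 * Lb by rewrite mulr_ge0 // ltW.
  rewrite lerXn2r ?nnegrE ?divr_ge0 ?(ltW n0) // ?mulr_ge0 ?(ltW Lb0) ?(ltW Lt0) ?(ltW h0) //.
  have -> : 36 * Lb * Lt * h = 18 * Lb * (2 * (Lt * h)) by ring.
  by rewrite ler_wpM2l // n_inv_le.
have G0 : 0 <= \sum_i `|g i| ^+ 2 by apply: sumr_ge0 => *; exact: sqr_ge0.
apply: le_trans (_ : h ^+ 3 * ((36 * Lb * Lt * h) ^+ 2 * (Kl * \sum_i `|g i| ^+ 2)) <= _).
  rewrite ler_wpM2l //; apply: ler_pM => //; first exact: sqr_ge0.
  by do 2! apply: sumr_ge0 => ? _; exact: sqr_ge0.
have -> : h ^+ 3 * ((36 * Lb * Lt * h) ^+ 2 * (Kl * \sum_i `|g i| ^+ 2)) =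
   (36 * Lb * Lt) ^+ 2 * Kl * (h ^+ 5 * \sum_i `|g i| ^+ 2).
  by move: (\sum_i _) => z; ring.
rewrite /Co -[leRHS]mulrA; apply: ler_wpM2l; first by rewrite mulr_ge0 // sqr_ge0.
exact: (grad_bound ts).
Qed.

Lemma vC_ge : (2 * (4 * n%:R * Lt)^-1) ^+ 3 <= vC.
Proof.
have nL : 0 < 4 * n%:R * Lt by rewrite !mulr_gt0.
apply: (@vol_gt0 _ _ (pt (const_mx (2 * n%:R)^-1))); [exact: mset_hbox|exact: finv_hbox|by rewrite invr_gt0|].
move=> x hx l.
have : `|tc x 0 l - (2 * n%:R)^-1| <= (4 * n%:R)^-1.
  have -> : tc x 0 l - (2 * n%:R)^-1 = ((x - pt (const_mx (2 * n%:R)^-1)) *m invmx B) 0 l.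
    by rewrite -(tcB B o) (ptK o uB); move: (tc x) => t; rewrite !mxE.
  apply: le_trans (norm_coord _ _) _; apply: le_trans (hLt _) _.
  apply: le_trans (ler_wpM2l (ltW Lt0) hx) _.
  by rewrite invfM mulrCA divff ?mulr1 // gt_eqF.
have nE : n%:R^-1 = 4 * (4 * n%:R)^-1 :> R by rewrite invfM mulrA divff ?mul1r.
have nE2 : (2 * n%:R)^-1 = 2 * (4 * n%:R)^-1 :> R.
  by rewrite !invfM mulrA; congr (_ * _); field.
rewrite ![(0 : E3) 0 l]mxE [(const_mx _ : E3) 0 l]mxE nE nE2.
have : 0 < (4 * n%:R)^-1 :> R by rewrite invr_gt0 mulr_gt0.
rewrite ler_norml => p /andP[]; move: ((4 * n%:R)^-1) (tc x 0 l) p => e t p a b; apply/andP; split; lra.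
Qed.

Lemma vC_le : vC <= (4 * Lb * Lt) ^+ 3 * h ^+ 3.
Proof.
rewrite -exprMn; have -> : 4 * Lb * Lt * h = 2 * (Lb * (2 * (Lt * h))) by ring.
apply: (@vol_small _ _ (pt 0)); first exact: mset_hbox.
  by rewrite !mulr_ge0 // ltW.
move=> x hx; rewrite -{1}(tcK o uB x) ptB subr0; apply: le_trans (hLb _) _.
rewrite ler_pM2l //; apply: norm_le => [|l]; first by rewrite !mulr_ge0 // ltW.
have /andP[] := hx l; rewrite ![(0 : E3) 0 l]mxE [(const_mx _ : E3) 0 l]mxE => a b.
by rewrite ger0_norm //; apply: le_trans (ltW b) n_inv_le.
Qed.

Lemma beta_ge : h ^+ 2 / (8 * Lt) <= n%:R * vC.
Proof.
apply: le_trans (_ : n%:R * (2 * (4 * n%:R * Lt)^-1) ^+ 3 <= _); last by rewrite ler_pM2l // vC_ge.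
have -> : n%:R * (2 * (4 * n%:R * Lt)^-1) ^+ 3 = (n%:R^-1) ^+ 2 / (8 * Lt ^+ 3).
  by move: (n%:R) n0 => a a0; field; rewrite !gt_eqF.
have -> : h ^+ 2 / (8 * Lt) = (Lt * h) ^+ 2 / (8 * Lt ^+ 3) by field; rewrite !gt_eqF.
rewrite ler_pM2r ?invr_gt0 ?mulr_gt0 ?exprn_gt0 //.
by rewrite lerXn2r ?nnegrE ?n_inv_ge ?invr_ge0 ?(ltW n0) // mulr_ge0 ?(ltW Lt0) ?(ltW h0).
Qed.

Definition Cs : R := 8 * Lt * ((1 + 24 * Num.sqrt Cg) * Num.sqrt K1) + 3 * Num.sqrt Co.

(** Lattice sums carry no volume factor, so [S / r] measures [S] in the lattice norm. *)
Let r := Num.sqrt (h ^+ 3).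
Let h3 : 0 < h ^+ 3. Proof. by rewrite exprn_gt0. Qed.
Let r0 : 0 < r. Proof. by rewrite sqrtr_gt0. Qed.

Lemma os_sqrt : Num.sqrt (\sum_al os al ^+ 2) <= Num.sqrt Co * (S / r).
Proof.
apply: le_sqrt_mul => //; first by rewrite divr_ge0 // ltW.
by rewrite expr_div_n sqr_sqrtr ?(ltW h3) // mulrA ler_pdivlMr // mulrC os_sum.
Qed.

Lemma bd_os V : \sum_l \sum_al `|bd l (V l) al| * os al <= 3 * (Num.sqrt (energy V) * (Num.sqrt Co * (S / r))).
Proof.
have one l : \sum_al `|bd l (V l) al| * os al <= Num.sqrt (energy V) * (Num.sqrt Co * (S / r)).
  apply: le_trans (cauchy_schwarz _ _ _) _; apply: ler_pM; rewrite ?sqrtr_ge0 ?os_sqrt //.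
  rewrite ler_sqrt ?energy_ge0 //; under eq_bigr do rewrite real_normK ?num_real //.
  have -> : \sum_al bd l (V l) al ^+ 2 = sqsum (fd l (V l)).
    rewrite /sqsum -(sum_shift _ (unitv m l)); apply: eq_bigr => al _.
    by rewrite /bdiff /fdiff addrK.
  rewrite /energy (bigD1 l) //= (bigD1 l) //= -addrA lerDl addr_ge0 //.
    by do 2! apply: sumr_ge0 => ? _; exact: sqr_ge0.
  by do 3! apply: sumr_ge0 => ? _; exact: sqr_ge0.
apply: le_trans (ler_sum _ (fun l _ => one l)) _.
by rewrite sum_ord3; lra.
Qed.

(** [key_inequality] is divided by [n vC], which is at least a multiple of [h^2]; with the factor
    [sqrt h] of the energy this leaves [S / r]. *)
Lemma necas_test V : (forall l al, ~~ inner al -> V l al = 0) ->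
  \sum_l \sum_al u al * bd l (V l) al <= Cs * (S / r) * Num.sqrt (energy V).
Proof.
move=> V0; set E := Num.sqrt (energy V); have E0 : 0 <= E := sqrtr_ge0 _.
set X := \sum_l _; set b := n%:R * vC.
have b0 : 0 < b.
  by apply: lt_le_trans beta_ge; rewrite divr_gt0 ?exprn_gt0 // mulr_gt0.
have Sr0 : 0 <= S / r by rewrite divr_ge0 // ltW.
have key := @key_inequality R m B o uB N Omega K rho h Lt Lb Lt0 Lb0 hLt hLb nh q c g S ts hP V V0.
rewrite -/X -/b in key.
have hd : Num.sqrt (h * \sum_i dd B o K Lb V i ^+ 2) <= Num.sqrt h * (Num.sqrt K1 * E).
  rewrite sqrtrM ?(ltW h0) // ler_wpM2l ?sqrtr_ge0 // -sqrtrM //.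
  by rewrite ler_sqrt ?dd_energy // mulr_ge0 ?energy_ge0.
set A := Num.sqrt (h * _) in key hd.
have g1 := grad_dd V; rewrite -/A in g1.
have b1 := bd_os V; rewrite -/E in b1.
have sC0 : 0 <= Num.sqrt Cg := sqrtr_ge0 _.
have hr : Num.sqrt h * r = h ^+ 2.
  by rewrite /r -sqrtrM ?(ltW h0) // -exprS (_ : h ^+ 4 = (h ^+ 2) ^+ 2) ?sqrtr_sqr ?ger0_norm ?sqr_ge0 // -exprM.
have hb : Num.sqrt h <= b * (8 * Lt / r).
  have b2 := beta_ge; rewrite -/b in b2.
  have -> : Num.sqrt h = h ^+ 2 / (8 * Lt) * (8 * Lt / r).
    by rewrite -hr; move: (Num.sqrt h) => z; field; rewrite !gt_eqF.
  by rewrite ler_wpM2r // divr_ge0 ?(ltW r0) // mulr_ge0 // ltW.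
rewrite -(ler_pM2l b0); apply: le_trans key _.
apply: le_trans (_ : (1 + 24 * Num.sqrt Cg) * S * A + b * (3 * (E * (Num.sqrt Co * (S / r)))) <= _).
  rewrite lerD // ?ler_pM2l //.
  have -> : (1 + 24 * Num.sqrt Cg) * S * A = S * A + 24 * (Num.sqrt Cg * S * A) by ring.
  by rewrite lerD2l -mulrA ler_pM2l.
have c0 : 0 <= (1 + 24 * Num.sqrt Cg) * S by rewrite mulr_ge0 // addr_ge0 // mulr_ge0.
have K0 : 0 <= Num.sqrt K1 * E by rewrite mulr_ge0 // sqrtr_ge0.
have A1 : (1 + 24 * Num.sqrt Cg) * S * A <= (1 + 24 * Num.sqrt Cg) * S * (b * (8 * Lt / r) * (Num.sqrt K1 * E)).
  rewrite ler_wpM2l //; apply: le_trans hd _; exact: ler_wpM2r.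
apply: le_trans (lerD A1 (lexx _)) _.
rewrite le_eqVlt; apply/orP; left; apply/eqP; rewrite /Cs.
have idn (b' E' x1 x2 x3 L s' z : R) : (1 + 24 * x1) * s' * (b' * (8 * L * z) * (x2 * E')) + b' * (3 * (E' * (x3 * (s' * z)))) =
  b' * ((8 * L * ((1 + 24 * x1) * x2) + 3 * x3) * (s' * z) * E') by ring.
exact: idn.
Qed.

Lemma necas_diff : \sum_l \sum_(al | nowrap al) fd l u al ^+ 2 <= 3 * (Co * (S / r) ^+ 2).
Proof.
have os2 : \sum_al os al ^+ 2 <= Co * (S / r) ^+ 2.
  by rewrite expr_div_n sqr_sqrtr ?(ltW h3) // mulrA ler_pdivlMr // mulrC os_sum.
have one l : \sum_(al | nowrap al) fd l u al ^+ 2 <= Co * (S / r) ^+ 2.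
  apply: le_trans os2; rewrite big_mkcond; apply: ler_sum => al _.
  case: ifP => nw; last exact: sqr_ge0.
  rewrite -real_normK ?num_real // lerXn2r ?nnegrE ?os_ge0 //.
  exact: (osc_step uB Lb0 hLb ts hP l nw).
apply: le_trans (ler_sum _ (fun l _ => one l)) _.
by rewrite sum_ord3; lra.
Qed.

Definition Cf : R := (4 * Lb * Lt) ^+ 3 * (2 * (10 ^+ 11 * (Cs ^+ 2 + 3 * Co) + Co)).

(** The part of the parallelepiped that [lattice_necas] controls: closed, and containing pieces of
    three of its faces. *)
Definition octant : set E3 := [set x | forall l, 0 <= tc x 0 l <= 2^-1].

Lemma mset_octant : mset octant.
Proof.
apply: mset_forall => l.
have -> : (fun x => is_true (0 <= tc x 0 l <= 2^-1)) =
   [set x | 0 <= tc x 0 l] `&` ~` [set x | 2^-1 < tc x 0 l].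
  apply/seteqP; split=> x /=; first by move=> /andP[? h1]; split=> //; apply/negP; rewrite -leNgt.
  by case=> ? /negP; rewrite -leNgt => h1; apply/andP.
apply: msetI; first by apply: mset_ge; exact: mfn_tc.
by apply: msetC; apply: mset_gt; exact: mfn_tc.
Qed.

(** On a lattice cell [q] deviates from its centre value by at most [os]; [lattice_necas] handles
    the centre values, and the volume [vC], of order [h^3], cancels [r^2]. *)
Lemma fine_box (J : nat) : n = (4 * J)%N -> (2 <= J)%N ->
  exists c0, int3 (octant `&` Omega) (fun x => (q x - c0) ^+ 2) <= Cf * S ^+ 2.
Proof.
move=> nJ J2.
have Sr0 : 0 <= S / r by rewrite divr_ge0 // ltW.
have Cs0 : 0 <= Cs.
  rewrite /Cs addr_ge0 // !mulr_ge0 ?sqrtr_ge0 ?(ltW Lt0) // addr_ge0 // mulr_ge0 // sqrtr_ge0.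
have [c0 hc0] := lattice_necas nJ J2 (mulr_ge0 Cs0 Sr0) necas_test necas_diff.
exists c0; set D := octant `&` Omega.
have mO := mset_octant; have tet := rm_tet rm.
have mD : mset D by apply: msetI => //; exact: mset_omega tet.
have nq : nice D (fun x => (qext Omega q x - c0) ^+ 2).
  have nqi : nice D (qext Omega q) by apply: niceS (nice_qin ts) => //; exact: subIsetr.
  by apply: nice_sq; apply: niceB => //; apply: nice_cst => //; case: nqi.
rewrite (@eq_int3 _ _ _ (fun x => (qext Omega q x - c0) ^+ 2)); last by move=> x [_ ox]; rewrite qinE.
pose oct al := [forall l, (al 0%R l <= 2 * J)%N].
pose P al := if oct al then lcell al else set0.
have mP al : mset (P al).
  by rewrite /P; case: ifP => _; [exact: mset_lcell|rewrite /mset preimage_set0].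
apply: le_trans (int3_cover (s := index_enum _) mD mP nq _ _) _.
- by move=> x _; exact: sqr_ge0.
- move=> x [ox _].
  have nR : n%:R = 4 * J%:R :> R by rewrite nJ natrM.
  have [al ax] : exists al, lcell al x.
    apply: lcell_ex => l; have /andP[a b] := ox l; rewrite mulr_ge0 ?(ltW n0) //=.
    have : n%:R * tc x 0 l <= n%:R * 2^-1 by rewrite ler_pM2l.
    by have := n0; lra.
  exists al; first exact: index_enum_In.
  rewrite /P ifT //; apply/forallP => l; move/lcellP: ax => /(_ l)/andP[a1 _]; have /andP[_ b] := ox l.
  rewrite -(ler_nat R) natrM; apply: le_trans a1 _.
  apply: le_trans (_ : n%:R * 2^-1 <= _); first by rewrite ler_pM2l.
  by rewrite nR; lra.
have vb al : int3 (D `&` P al) (fun x => (qext Omega q x - c0) ^+ 2) <=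
   (if oct al then 2 * ((u al - c0) ^+ 2 + os al ^+ 2) else 0) * vC.
  rewrite /P; case: ifP => oa; last by rewrite setI0 int3_set0 // mul0r.
  have ml := @mset_lcell R m B o al; have mDl : mset (D `&` lcell al) by exact: msetI.
  have z0 : 0 <= 2 * ((u al - c0) ^+ 2 + os al ^+ 2) by rewrite mulr_ge0 // addr_ge0 // sqr_ge0.
  apply: le_trans (int3_le_cst (c := 2 * ((u al - c0) ^+ 2 + os al ^+ 2)) _ _) _.
  - by apply: niceS nq => //; exact: subIsetl.
  - move=> x [[_ ox] ax]; rewrite qinE //.
    have := osc_cell uB Lb0 hLb ts hP ox ax; set uu := center_value _ _ _ _ => hx.
    have -> : q x - c0 = (q x - uu) + (uu - c0) by rewrite addrA subrK.
    have h2 : (q x - uu) ^+ 2 <= os al ^+ 2.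
      by rewrite -real_normK ?num_real // lerXn2r ?nnegrE ?os_ge0.
    move: (q x - uu) (uu - c0) h2 => a b h2.
    by have := sqr_ge0 (a - b); rewrite !sqrrD sqrrN mulrN; lra.
  rewrite ler_wpM2l // -(vol_lcell o uB al).
  by apply: volS => //; first [exact: subIsetr|exact: finv_lcell].
apply: le_trans (ler_sum _ (fun al _ => vb al)) _; rewrite -mulr_suml -big_mkcond /= -mulr_sumr big_split /=.
have os2 : \sum_(al | oct al) os al ^+ 2 <= Co * (S / r) ^+ 2.
  apply: le_trans (_ : \sum_al os al ^+ 2 <= _).
    by rewrite big_mkcond; apply: ler_sum => al _; case: ifP => // _; exact: sqr_ge0.
  by rewrite expr_div_n sqr_sqrtr ?(ltW h3) // mulrA ler_pdivlMr // mulrC os_sum.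
have vC0 : 0 <= vC by exact: vol_ge0.
apply: le_trans (ler_pM _ vC0 (ler_wpM2l (ler0n R 2) (lerD hc0 os2)) vC_le) _.
  by rewrite mulr_ge0 // addr_ge0 //; apply: sumr_ge0 => *; exact: sqr_ge0.
rewrite le_eqVlt; apply/orP; left; apply/eqP; rewrite /Cf exprMn expr_div_n sqr_sqrtr ?(ltW h3) //.
move: Cs Co (10 ^+ 11) => a b d.
by move: (h ^+ 3) h3 => z z0; field; rewrite gt_eqF.
Qed.

End Fine.

(** * Patching the parallelepipeds together *)

Lemma quad_pred (J : nat) : (2 <= J)%N -> ((4 * J - 2).+2 = 4 * J)%N.
Proof. lia. Qed.

Section Control.
Context (R : realType) (Omega : set 'rV[R]_3) (rho : R).
Local Notation E3 := 'rV[R]_3.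

(** [C] is chosen before the mesh and depends on [A], [Omega] and [rho] only; [c0] may depend on
    everything. *)
Definition controlled (A : set E3) : Prop := exists2 C, 0 <= C &
  forall (h : R) (N : nat) (K : mesh R N) q c g S, tested Omega rho h K q c g S ->
  exists c0, int3 (A `&` Omega) (fun x => (q x - c0) ^+ 2) <= C * S ^+ 2.

Lemma nice_dev (h : R) (N : nat) (K : mesh R N) q c g S A (c0 : R) : tested Omega rho h K q c g S ->
  mset A -> A `<=` Omega -> nice A (fun x => (qext Omega q x - c0) ^+ 2).
Proof.
move=> ts mA AO; have nq : nice A (qext Omega q) by apply: niceS AO (nice_qin ts).
by apply: nice_sq; apply: niceB => //; apply: nice_cst => //; case: nq.
Qed.

Lemma int3_dev (A : set E3) q (c0 : R) : A `<=` Omega ->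
  int3 A (fun x => (q x - c0) ^+ 2) = int3 A (fun x => (qext Omega q x - c0) ^+ 2).
Proof. by move=> AO; apply: eq_int3 => x /AO ox; rewrite qinE. Qed.

Lemma controlledS (A A' : set E3) : mset A -> mset A' -> A `<=` A' -> controlled A' -> controlled A.
Proof.
move=> mA mA' AA' [C C0 hC]; exists C => // h N K q c g S ts.
have [c0 hc0] := hC _ _ _ _ _ _ _ ts; exists c0; apply: le_trans hc0.
have mO := mset_omega (rm_tet (ts_rm ts)).
rewrite [leLHS]int3_dev; last exact: subIsetr.
rewrite [leRHS]int3_dev; last exact: subIsetr.
apply: int3S; [exact: msetI|exact: setSI| |by move=> x _; exact: sqr_ge0].
by apply: nice_dev ts _ _; [exact: msetI|exact: subIsetr].
Qed.

Lemma sqr_tri (a b : R) : (a + b) ^+ 2 <= 2 * a ^+ 2 + 2 * b ^+ 2.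
Proof. by have := sqr_ge0 (a - b); rewrite !sqrrD sqrrN mulrN; lra. Qed.

(** Both constants approximate [q] on the common cube, so they differ by at most a multiple of
    [S]. *)
Lemma controlledU (A A' : set E3) z (r : R) : mset A -> mset A' -> 0 < r ->
  cbox z r `<=` A `&` A' `&` Omega -> controlled A -> controlled A' -> controlled (A `|` A').
Proof.
move=> mA mA' r0 sub [C C0 hC] [C' C0' hC'].
pose v := vol (cbox z r); have v0 : 0 < v by rewrite /v vol_cbox ?(ltW r0) // exprn_gt0 // mulr_gt0.
have V0 := vol_ge0 Omega.
exists (C + 2 * C' + 2 * (2 * (C + C') / v) * vol Omega).
  by rewrite !addr_ge0 ?mulr_ge0 ?addr_ge0 ?mulr_ge0 ?invr_ge0 ?(ltW v0) ?addr_ge0.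
move=> h N K q c g S ts.
have [c1 h1] := hC _ _ _ _ _ _ _ ts; have [c2 h2] := hC' _ _ _ _ _ _ _ ts; exists c1.
have tet := rm_tet (ts_rm ts); have mO := mset_omega tet; have fO := finv_omega tet.
have sA : A `&` Omega `<=` Omega by exact: subIsetr.
have sA' : A' `&` Omega `<=` Omega by exact: subIsetr.
have mAO : mset (A `&` Omega) by exact: msetI.
have mAO' : mset (A' `&` Omega) by exact: msetI.
rewrite int3_dev // in h1; rewrite int3_dev // in h2.
have mB := mset_cbox z (ltW r0); have fB := finv_cbox z (ltW r0).
have BO : cbox z r `<=` Omega by move=> x /sub[].
have nB c' := nice_dev c' ts mB BO.
have d1 : int3 (cbox z r) (fun x => (qext Omega q x - c1) ^+ 2) <= C * S ^+ 2.
  apply: le_trans h1; apply: int3S => // [x /sub[[Ax _] ox]||x _]; [by []|exact: nice_dev ts _ _|exact: sqr_ge0].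
have d2 : int3 (cbox z r) (fun x => (qext Omega q x - c2) ^+ 2) <= C' * S ^+ 2.
  apply: le_trans h2; apply: int3S => // [x /sub[[_ Ax] ox]||x _]; [by []|exact: nice_dev ts _ _|exact: sqr_ge0].
have dc : (c1 - c2) ^+ 2 <= 2 * (C + C') / v * S ^+ 2.
  rewrite mulrAC ler_pdivlMr // -/v -int3_cst //.
  apply: le_trans (int3_le (g := fun x => 2 * (qext Omega q x - c1) ^+ 2 + 2 * (qext Omega q x - c2) ^+ 2) _ _ _) _.
  - exact: nice_cst.
  - by apply: niceD; exact: niceZ.
  - move=> x _; have -> : c1 - c2 = (qext Omega q x - c2) - (qext Omega q x - c1) by ring.
    by apply: le_trans (sqr_tri _ _) _; rewrite sqrrN addrC.
  rewrite int3D; [|exact: niceZ|exact: niceZ]; rewrite !int3Z //.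
  by move: d1 d2; set a := int3 _ _; set b := int3 _ _; lra.
have cov : int3 ((A `|` A') `&` Omega) (fun x => (q x - c1) ^+ 2) <=
   int3 (A `&` Omega) (fun x => (qext Omega q x - c1) ^+ 2) + int3 (A' `&` Omega) (fun x => (qext Omega q x - c1) ^+ 2).
  rewrite int3_dev; last exact: subIsetr.
  have mU : mset ((A `|` A') `&` Omega) by apply: msetI => //; exact: msetU.
  have nU := nice_dev c1 ts mU (@subIsetr _ _ _).
  pose P (b : bool) := if b then A else A'.
  have mP b : mset (P b) by case: b.
  apply: le_trans (int3_cover (s := [:: true; false]) mU mP nU _ _) _.
  - by move=> x _; exact: sqr_ge0.
  - by move=> x [[Ax|Ax] _]; [exists true; [left|]|exists false; [right; left|]].
  rewrite !big_cons big_nil addr0 /P.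
  have -> : (A `|` A') `&` Omega `&` A = A `&` Omega.
    by apply/seteqP; split=> x; [move=> [[_ ?] ?]|move=> [? ?]; do ! split => //; left].
  have -> // : (A `|` A') `&` Omega `&` A' = A' `&` Omega.
  by apply/seteqP; split=> x; [move=> [[_ ?] ?]|move=> [? ?]; do ! split => //; right].
apply: le_trans cov _.
have fAO' : finv (A' `&` Omega) by apply: finvS fO.
have d3 : int3 (A' `&` Omega) (fun x => (qext Omega q x - c1) ^+ 2) <=
    2 * (C' * S ^+ 2) + 2 * (c1 - c2) ^+ 2 * vol Omega.
  have n2 := nice_dev c2 ts mAO' sA'.
  apply: le_trans (int3_le (g := fun x => 2 * (qext Omega q x - c2) ^+ 2 + 2 * (c1 - c2) ^+ 2) _ _ _) _.
  - exact: nice_dev ts mAO' sA'.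
  - by apply: niceD; [exact: niceZ|exact: nice_cst].
  - move=> x _; have -> : qext Omega q x - c1 = (qext Omega q x - c2) - (c1 - c2) by ring.
    by apply: le_trans (sqr_tri _ _) _; rewrite sqrrN.
  rewrite int3D; [|exact: niceZ|exact: nice_cst]; rewrite int3Z // int3_cst //; apply: lerD.
    by rewrite ler_pM2l.
  by apply: ler_wpM2l; [rewrite mulr_ge0 // sqr_ge0|exact: volS].
have d4 : 2 * (c1 - c2) ^+ 2 * vol Omega <= 2 * (2 * (C + C') / v * S ^+ 2) * vol Omega.
  by rewrite ler_wpM2r // ler_pM2l.
move: h1 d3 d4; set a := int3 _ _; set b := int3 _ _; set y := vol Omega; set e := (c1 - c2) ^+ 2.
move: (C + C') (v^-1) a b y e => *; lra.
Qed.

(** A small move towards the centre of the octant makes all its inequalities strict. *)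
Lemma octant_near (B : 'M[R]_3) (o z : E3) (e : R) : B \in unitmx -> octant B o z -> 0 < e ->
  exists y r, [/\ 0 < r, `|y - z| < e & cbox y r `<=` octant B o].
Proof.
move=> uB oz e0; have [Lt Lt0 hLt] := mulmx_lip (invmx B); have [Lb Lb0 hLb] := mulmx_lip B.
pose t := Num.min 1 (e / (2 * Lb)).
have t0 : 0 < t by rewrite lt_min ltr01 divr_gt0 // mulr_gt0.
have t1 : t <= 1 by rewrite ge_min lexx.
have te : t * (2 * Lb) <= e by rewrite -ler_pdivlMr ?mulr_gt0 // ge_min lexx orbT.
pose w := pt B o (const_mx 4^-1) - z; pose y := z + t *: w.
have tcy l : tc B o y 0 l = (1 - t) * tc B o z 0 l + t * 4^-1.
  rewrite /y tc_conv /w [z + _]addrC subrK (ptK o uB).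
  by move: (tc B o z) => a; rewrite mxE.
exists y, (t / (4 * Lt)); split; first by rewrite divr_gt0 // mulr_gt0.
  rewrite /y addrC addKr normrZ gtr0_norm //.
  have : `|w| <= Lb.
    rewrite /w -{1}(tcK o uB z) ptB; apply: le_trans (hLb _) _; rewrite -[leRHS]mulr1 ler_pM2l //.
    apply: norm_le => // l.
    have -> : (const_mx 4^-1 - tc B o z) 0 l = 4^-1 - tc B o z 0 l by move: (tc B o z) => a; rewrite !mxE.
    by have /andP[a b] := oz l; rewrite ler_norml; apply/andP; split; lra.
  move=> wL; have : t * `|w| <= t * Lb by rewrite ler_pM2l.
  by have := mulr_gt0 t0 Lb0; lra.
move=> x xy l.
have dx : `|tc B o x 0 l - tc B o y 0 l| <= t / 4.
  have -> : tc B o x 0 l - tc B o y 0 l = ((x - y) *m invmx B) 0 l.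
    by rewrite -(tcB B o); move: (tc B o x) (tc B o y) => a b; rewrite !mxE.
  apply: le_trans (norm_coord _ _) _; apply: le_trans (hLt _) _.
  apply: le_trans (ler_wpM2l (ltW Lt0) xy) _.
  by rewrite le_eqVlt; apply/orP; left; apply/eqP; field; rewrite gt_eqF.
move: dx; rewrite tcy ler_norml => /andP[d1 d2]; have /andP[z1 z2] := oz l.
have t1' : 0 <= 1 - t by rewrite subr_ge0.
have p1 := mulr_ge0 t1' z1; have p2 := ler_wpM2l t1' z2.
by apply/andP; split; lra.
Qed.

Lemma octant_far (B : 'M[R]_3) (o x : E3) : ~ octant B o x ->
  exists2 e, 0 < e & forall y, `|x - y| < e -> ~ octant B o y.
Proof.
move=> nx; have [Lt Lt0 hLt] := mulmx_lip (invmx B).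
have dl y l : `|tc B o x 0 l - tc B o y 0 l| <= Lt * `|x - y|.
  have -> : tc B o x 0 l - tc B o y 0 l = ((x - y) *m invmx B) 0 l.
    by rewrite -(tcB B o); move: (tc B o x) (tc B o y) => a b; rewrite !mxE.
  exact: le_trans (norm_coord _ _) (hLt _).
have [l hl] : exists l, ~ (0 <= tc B o x 0 l <= 2^-1).
  by apply: contrapT => no; apply: nx => l; apply: contrapT => nl; apply: no; exists l.
have key (e : R) : 0 < e -> (forall t, `|tc B o x 0 l - t| < e -> ~ (0 <= t <= 2^-1)) ->
   exists2 e, 0 < e & forall y, `|x - y| < e -> ~ octant B o y.
  move=> e0 he; exists (e / Lt); first exact: divr_gt0.
  move=> y; rewrite ltr_pdivlMr // mulrC => xy /(_ l); apply: he.
  exact: le_lt_trans (dl y l) xy.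
have [neg|pos] := ltP (tc B o x 0 l) 0.
  apply: (key (- tc B o x 0 l)); first by rewrite oppr_gt0.
  by move=> t; rewrite ltr_norml => /andP[a b] /andP[c d]; lra.
have big : 2^-1 < tc B o x 0 l by rewrite ltNge; apply/negP => le; apply: hl; rewrite pos le.
apply: (key (tc B o x 0 l - 2^-1)); first by rewrite subr_gt0.
by move=> t; rewrite ltr_norml => /andP[a b] /andP[c d]; lra.
Qed.

Lemma vol_octant (B : 'M[R]_3) (o : E3) : B \in unitmx -> finv (octant B o).
Proof.
move=> uB; have [Lb Lb0 hLb] := mulmx_lip B.
apply: (@finv_bounded _ _ (`|o| + Lb)) (mset_octant B o) _ => x ox.
rewrite -(tcK o uB x) /pt; apply: le_trans (ler_normD _ _) _; rewrite lerD2l.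
apply: le_trans (hLb _) _; rewrite -[leRHS]mulr1 ler_pM2l //; apply: norm_le => // l.
by have /andP[a b] := ox l; rewrite ger0_norm //; lra.
Qed.

(** For small [h] a lattice with [n = 4 J] suits [fine_box]. For [h] above [1 / (8 Lt)] the powers
    of [h] in [grad_bound] are bounded below, so the gradient itself is at most a multiple of [S]
    and [seg_lip] suffices. *)
Lemma box_controlled (B : 'M[R]_3) (o : E3) : B \in unitmx ->
  (forall x, (forall l, 0 < tc B o x 0 l < 1) -> Omega x) -> controlled (octant B o).
Proof.
move=> uB hP; have [Lt Lt0 hLt] := mulmx_lip (invmx B); have [Lb Lb0 hLb] := mulmx_lip B.
pose C2 := (3 * Lb) ^+ 2 * (Cg rho * (8 * Lt) ^+ 5) * vol (octant B o).
have Cg0 : 0 <= Cg rho by apply: mulr_ge0; [apply: mulr_ge0|]; exact: sqr_ge0.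
have C20 : 0 <= C2.
  apply: mulr_ge0; last exact: vol_ge0; apply: mulr_ge0; first exact: sqr_ge0.
  by apply: mulr_ge0 => //; rewrite exprn_ge0 // mulr_ge0 // ltW.
exists (`|Cf rho Lt Lb| + C2); first exact: addr_ge0.
move=> h N K q c g S ts; have h0 := rm_h (ts_rm ts).
have S20 : 0 <= S ^+ 2 := sqr_ge0 S.
have LH : 0 < Lt * h by rewrite mulr_gt0.
have [hs|hl] := leP h (8 * Lt)^-1.
  have LH8 : 8 * (Lt * h) <= 1.
    by move: hs; rewrite -[X in _ <= X]mul1r ler_pdivlMr ?mulr_gt0 //; lra.
  have y0 : 0 <= (4 * (Lt * h))^-1 by rewrite invr_ge0 mulr_ge0 // ltW.
  (* [J] is the integer part of [1 / (4 Lt h)], and the threshold for [h] makes it at least 2. *)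
  have [J _ /andP[J1 J2]] := @step_index R _ 1 _ y0 ltac:(rewrite mulr1; exact: archi_boundP y0).
  rewrite !mulr1 in J1 J2.
  have LH4 : 0 < 4 * (Lt * h) by rewrite mulr_gt0.
  have J1' : J%:R * (4 * (Lt * h)) <= 1 by rewrite -ler_pdivlMr // mul1r.
  have J2' : 1 < J.+1%:R * (4 * (Lt * h)) by rewrite -ltr_pdivrMr // mul1r.
  have J2n : (2 <= J)%N.
    rewrite -ltnS -(ltr_nat R) -(ltr_pM2r LH4); apply: le_lt_trans J2'.
    by lra.
  have nE := quad_pred J2n.
  have nR : (4 * J - 2).+2%:R = 4 * J%:R :> R by rewrite nE natrM.
  have nh : (4 * J - 2).+2%:R * (Lt * h) <= 1 by rewrite nR; lra.
  have nl : 1 <= 2 * (4 * J - 2).+2%:R * (Lt * h).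
    by rewrite nR; move: J2'; rewrite -natr1; lra.
  have [c0 hc0] := @fine_box R (4 * J - 2)%N B o uB N Omega K rho h Lt Lb Lt0 Lb0 hLt hLb nh nl q c g S ts hP J nE J2n.
  exists c0; apply: le_trans hc0 _; rewrite ler_wpM2r //.
  by apply: le_trans (ler_norm _) _; rewrite lerDl.
pose y := pt B o (const_mx 4^-1); exists (q y).
have tet := rm_tet (ts_rm ts).
have tcy l : tc B o y 0 l = 4^-1 by rewrite /y (ptK o uB) mxE.
have mO := mset_octant B o; have mOO : mset (octant B o `&` Omega) by apply: msetI => //; exact: mset_omega tet.
have gle i : `|g i| ^+ 2 <= Cg rho * (8 * Lt) ^+ 5 * S ^+ 2.
  have h5 : 0 < h ^+ 5 by rewrite exprn_gt0.
  have gb : h ^+ 5 * `|g i| ^+ 2 <= Cg rho * S ^+ 2.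
    apply: le_trans (grad_bound ts); rewrite ler_pM2l // (bigD1 i) //= lerDl.
    by apply: sumr_ge0 => *; exact: sqr_ge0.
  apply: le_trans (_ : ((8 * Lt) ^+ 5 * h ^+ 5) * `|g i| ^+ 2 <= _).
    rewrite ler_peMl ?sqr_ge0 // -exprMn exprn_ege1 //.
    by move: (ltW hl); rewrite -[X in X <= _]mul1r ler_pdivrMr ?mulr_gt0 // mulrC.
  have -> : Cg rho * (8 * Lt) ^+ 5 * S ^+ 2 = (8 * Lt) ^+ 5 * (Cg rho * S ^+ 2) by rewrite mulrAC mulrC.
  by rewrite -mulrA ler_wpM2l // exprn_ge0 // mulr_ge0 // ltW.
pose L := 3 * Lb * Num.sqrt (Cg rho * (8 * Lt) ^+ 5 * S ^+ 2).
have L0 : 0 <= L by rewrite mulr_ge0 ?sqrtr_ge0 // mulr_ge0 // ltW.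
have dev x : octant B o x -> Omega x -> `|q x - q y| <= L.
  move=> ox omx; have -> : x = y + (x - y) by rewrite addrC subrK.
  apply: (seg_lip ts) => [//|t /andP[t0 t1]|i t _ _].
    move: t1; rewrite le_eqVlt => /orP[/eqP ->|t1]; first by rewrite scale1r addrC subrK.
    apply: hP => l; rewrite tc_conv [y + _]addrC subrK tcy; have /andP[a b] := ox l.
    have t1' : 0 < 1 - t by rewrite subr_gt0.
    have p1 := mulr_ge0 t0 a; have p2 := ler_wpM2l t0 b.
    by apply/andP; split; lra.
  apply: le_trans (dot_le _ _) _.
  have xy : `|x - y| <= Lb.
    rewrite -{1}(tcK o uB x) /y ptB; apply: le_trans (hLb _) _; rewrite -[leRHS]mulr1 ler_pM2l //.
    apply: norm_le => // l.
    have -> : (tc B o x - const_mx 4^-1) 0 l = tc B o x 0 l - 4^-1 by move: (tc B o x) => a; rewrite !mxE.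
    by have /andP[a b] := ox l; rewrite ler_norml; apply/andP; split; lra.
  have gs : `|g i| <= Num.sqrt (Cg rho * (8 * Lt) ^+ 5 * S ^+ 2).
    by have := ler_wsqrtr (gle i); rewrite sqrtr_sqr ger0_norm.
  have := ler_pM (normr_ge0 _) (normr_ge0 _) gs xy; rewrite /L.
  by move: `|g i| `|x - y| (Num.sqrt _) => a b d; lra.
have mu : nice (octant B o `&` Omega) (fun x => (qext Omega q x - q y) ^+ 2).
  by apply: nice_dev ts _ _ => //; exact: subIsetr.
rewrite int3_dev; last exact: subIsetr.
apply: le_trans (int3_le_cst (c := L ^+ 2) mu _) _.
  move=> x [ox omx]; rewrite qinE // -real_normK ?num_real // lerXn2r ?nnegrE //.
  exact: dev.
have LE : L ^+ 2 = (3 * Lb) ^+ 2 * (Cg rho * (8 * Lt) ^+ 5) * S ^+ 2.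
  have X0 : 0 <= Cg rho * (8 * Lt) ^+ 5 * S ^+ 2.
    by do 2! (apply: mulr_ge0 => //); rewrite exprn_ge0 // mulr_ge0 // ltW.
  by rewrite /L exprMn (sqr_sqrtr X0) mulrA.
apply: le_trans (_ : L ^+ 2 * vol (octant B o) <= _).
  by rewrite ler_wpM2l ?sqr_ge0 //; apply: volS => //; first [exact: subIsetl|exact: vol_octant].
have -> : L ^+ 2 * vol (octant B o) = C2 * S ^+ 2 by rewrite LE mulrAC.
by rewrite ler_wpM2r // lerDr.
Qed.

End Control.

(** * Covering the domain by octants *)

Section Cover.
Context (R : realType) (Omega : set 'rV[R]_3) (rho : R).
Local Notation E3 := 'rV[R]_3.
Local Notation controlled := (controlled Omega rho).

Section CornerBox.
Context (T : elem R) (k : 'I_4).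
Implicit Types (a : {ffun 'I_3 -> 'I_24}) (l : 'I_3) (x : E3).

(** In barycentric coordinates a parallelepiped has side 1/12 and its octant side 1/24. As
    [18 / 24 + 3 / 12 = 1], index sums up to 18 keep the parallelepiped inside the element, and
    their octants cover the points where [bary T k] is at least 1/4. *)
Definition cornerB : 'M[R]_3 := \matrix_(l < 3) (12^-1 *: (vert T (lift k l) - vert T k)).

Lemma corner_bary (v : E3) l : bary T (lift k l) (vert T k + v *m cornerB) = v 0 l / 12.
Proof.
rewrite baryD bary_vert eq_sym (negbTE (neq_lift _ _)) add0r lbary_dot mulmx_sum_row dot_sumr.
rewrite (bigD1 l) //= big1 ?addr0 => [|j jl].
  by rewrite dotZr rowK dotZr -lbary_dot lbaryB !bary_vert eqxx eq_sym (negbTE (neq_lift _ _)) subr0 mulr1.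
rewrite dotZr rowK dotZr -lbary_dot lbaryB !bary_vert (inj_eq lift_inj) eq_sym (negbTE jl).
by rewrite eq_sym (negbTE (neq_lift _ _)) subrr !mulr0.
Qed.

Lemma corner_unit : cornerB \in unitmx.
Proof.
pose A : 'M[R]_3 := \matrix_(j, l) (12 * gb T (lift k l) 0 j).
suff /mulmx1_unit[] : cornerB *m A = 1%:M by [].
apply/matrixP => l j.
have -> : (cornerB *m A) l j = 12 * dot (gb T (lift k j)) (row l cornerB).
  by rewrite mxE /dot mulr_sumr; apply: eq_bigr => i _; rewrite [A i j]mxE [row l _ 0 i]mxE mulrCA [cornerB l i * _]mulrC.
have e1 : (lift k j == k) = false by rewrite eq_sym (negbTE (neq_lift _ _)).
rewrite rowK dotZr -lbary_dot lbaryB !bary_vert (inj_eq lift_inj) e1 subr0 mulrA divff ?pnatr_eq0 // mul1r.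
by rewrite mxE eq_sym.
Qed.

Definition corner_o (a : {ffun 'I_3 -> 'I_24}) : E3 := vert T k + (\row_l ((a l)%:R / 2)) *m cornerB.

Lemma corner_coord a x l : bary T (lift k l) x = (a l)%:R / 24 + tc cornerB (corner_o a) x 0 l / 12.
Proof.
rewrite -{1}(tcK (corner_o a) corner_unit x) /pt /corner_o -addrA -mulmxDl corner_bary.
by rewrite [(_ + tc _ _ _) 0 l]mxE [(\row_l _) 0 l]mxE; field.
Qed.

Definition admissible (a : {ffun 'I_3 -> 'I_24}) : bool := (a 0%R + a 1%R + a 2%R <= 18)%N.

Lemma bary_lift_sum x : bary T k x = 1 - \sum_(l < 3) bary T (lift k l) x.
Proof.
by have := bary_sum T x; rewrite (bigD1_ord k) //= => <-; rewrite addrK.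
Qed.

Lemma corner_in a x : admissible a -> (forall l, 0 < tc cornerB (corner_o a) x 0 l < 1) ->
  forall j, 0 < bary T j x.
Proof.
rewrite /admissible -(ler_nat R) !natrD => ad hx j.
case: (unliftP k j) => [l ->|->].
  rewrite (corner_coord a); have /andP[h1 _] := hx l.
  by rewrite ltr_wpDl ?divr_ge0 // divr_gt0.
rewrite bary_lift_sum sum_ord3 !(corner_coord a).
have /andP[_ h0] := hx 0; have /andP[_ h1] := hx 1; have /andP[_ h2] := hx 2.
by lra.
Qed.

Lemma corner_cover x : cell T x -> 4^-1 <= bary T k x ->
  exists2 a, admissible a & octant cornerB (corner_o a) x.
Proof.
move=> cx bk; have b0 j : 0 <= bary T j x by move/cellP: cx.
have := bary_lift_sum x; rewrite sum_ord3 => bE.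
have b1 l : bary T (lift k l) x < 1.
  by move: l; apply: ord3P; have := b0 (lift k 0); have := b0 (lift k 1); have := b0 (lift k 2); lra.
have /choice[f fP] l : exists m : 'I_24, m%:R * 24^-1 <= bary T (lift k l) x < m.+1%:R * 24^-1.
  have [m m24 hm] := @step_index R 24 24^-1 _ (b0 (lift k l)) ltac:(by rewrite divff ?pnatr_eq0).
  by exists (Ordinal m24).
exists [ffun l => f l].
  rewrite /admissible !ffunE -(ler_nat R) !natrD.
  have /andP[h0 _] := fP 0; have /andP[h1 _] := fP 1; have /andP[h2 _] := fP 2; lra.
move=> l; have := corner_coord [ffun l => f l] x l; rewrite ffunE => e.
by have /andP[] := fP l; rewrite -[(f l).+1%:R]natr1 e => h1 h2; apply/andP; split; lra.
Qed.

End CornerBox.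

Lemma controlled0 : controlled set0.
Proof. by exists 0 => // *; exists 0; rewrite int3_set0 ?set0I // mul0r. Qed.

(* A cube around [z] inside [Omega] links two controlled sets that both contain [z]. *)
Lemma link_cube z : open Omega -> Omega z -> exists2 e, 0 < e & exists Q, [/\ mset Q, controlled Q
  & forall x, `|z - x| < e -> Q x /\ Omega x].
Proof.
move=> oO oz; have [e e0 he] := openE3 oO oz.
pose s := e / 2; have s0 : 0 < s by rewrite divr_gt0.
have uB : (s%:M : 'M[R]_3) \in unitmx by rewrite unitmxE det_scalar unitfE expf_neq0 // gt_eqF.
pose o := z - const_mx (s / 4).
have tcE x l : tc s%:M o x 0 l = (x 0 l - z 0 l) / s + 4^-1.
  rewrite /tc invmx_scalar mul_mx_scalar /o !mxE; field; by rewrite gt_eqF.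
exists (s / 4); first exact: divr_gt0.
exists (octant s%:M o); split.
- exact: mset_octant.
- apply: box_controlled => // x hx; apply: he; apply: le_lt_trans (_ : s < _); last by rewrite /s; lra.
  rewrite distrC; apply: norm_le => [|l]; first exact: ltW.
  rewrite [(x - z) 0 l]mxE [(- z) 0 l]mxE; have := hx l; rewrite tcE => /andP[h1 h2].
  have -> : x 0 l - z 0 l = ((x 0 l - z 0 l) / s) * s by rewrite divfK // gt_eqF.
  by rewrite normrM (gtr0_norm s0) ler_piMl ?(ltW s0) // ler_norml; apply/andP; split; lra.
- move=> x zx; split; last by apply: he; rewrite /s in zx; lra.
  move=> l; rewrite tcE; have := norm_coord (x - z) l.
  rewrite [(x - z) 0 l]mxE [(- z) 0 l]mxE distrC in zx * => hc.
  have : `|(x 0 l - z 0 l) / s| <= 4^-1.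
    rewrite normrM normfV (gtr0_norm s0) ler_pdivrMr //; apply: le_trans hc _; lra.
  by rewrite ler_norml => /andP[h1 h2]; apply/andP; split; lra.
Qed.

(** Pieces are added one at a time, linked by cubes. When no further piece meets the family inside
    [Omega], the part of [Omega] that it covers is open and closed in [Omega], hence all of it. *)
Lemma connected_control (I : finType) (O : I -> set E3) :
  (forall p, mset (O p)) -> (forall p, controlled (O p)) ->
  (forall p x, ~ O p x -> exists2 e, 0 < e & forall y, `|x - y| < e -> ~ O p y) ->
  (forall p z e, O p z -> 0 < e -> exists y r, [/\ 0 < r, `|y - z| < e & cbox y r `<=` O p]) ->
  (forall x, Omega x -> exists p, O p x) ->
  open Omega -> connected Omega -> Omega !=set0 -> controlled Omega.
Proof.
move=> mO cO far inn cov oO con [x0 ox0].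
pose U (F : {set I}) : set E3 := [set x | exists p, p \in F /\ O p x].
have mU F : mset (U F).
  apply: mset_exists => p; case: (boolP (p \in F)) => pF.
    by rewrite (_ : (fun x => _) = O p) //; apply/seteqP; split=> x; [case|split].
  by rewrite (_ : (fun x => _) = set0) ?/mset ?preimage_set0 //; apply/seteqP; split=> x // -[].
have openU F : open (~` U F).
  rewrite openE => x nx; apply/nbhs_ballP.
  have /choice[f fP] p : exists e, 0 < e /\ (p \in F -> forall y, `|x - y| < e -> ~ O p y).
    have [pF|_] := boolP (p \in F); last by exists 1.
    have [|e e0 he] := far p x; last by exists e.
    by move=> Opx; apply: nx; exists p.
  have [d d0 hd] := finite_min_pos (fun p => (fP p).1).
  exists d => //= y /ballE3 xy [p [pF Opy]].
  exact: ((fP p).2 pF y (lt_le_trans xy (hd p)) Opy).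
(* [z] may be on the boundary of [O p]; [inn] supplies a nearby cube inside [O p] to serve as the
   overlap in [controlledU]. *)
have glue A A' p z e : mset A -> mset A' -> controlled A -> controlled A' -> O p z -> O p `<=` A' ->
   0 < e -> (forall x, `|z - x| < e -> A x /\ Omega x) -> controlled (A `|` A').
  move=> mA mA' cA cA' Opz pA' e0 he.
  have e2 : 0 < e / 2 by rewrite divr_gt0.
  have [y [r [r0 yz sub]]] := inn p z _ Opz e2.
  pose t := Num.min r (e / 4).
  have t0 : 0 < t by rewrite lt_min r0 divr_gt0.
  apply: (@controlledU _ _ _ A A' y t) => // x yx.
  have xr : cbox y r x by rewrite /cbox /=; apply: le_trans yx _; rewrite ge_min lexx.
  have [Ax ox] : A x /\ Omega x.
    apply: he; apply: le_lt_trans (ler_distD y _ _) _; rewrite (distrC z) (distrC y x).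
    have : t <= e / 4 by rewrite ge_min lexx orbT.
    by rewrite /cbox /= in yx; lra.
  by do 2! split => //; apply: pA'; exact: sub.
have main n F : (#|~: F| <= n)%N -> (exists2 x, Omega x & U F x) -> controlled (U F) -> controlled Omega.
  elim: n F => [|n IH] F cF [x ox Ux] cU.
    apply: controlledS cU => // [|y /cov[p Opy]]; first exact: mset_open.
    exists p; split=> //; have : p \notin ~: F by move: cF; rewrite leqn0 cards_eq0 => /eqP ->; rewrite finset.inE.
    by rewrite finset.inE negbK.
  have [[z [p [p' [oz pF Opz p'F Op'z]]]]|no] := pselect (exists z p p',
      [/\ Omega z, p \in F, O p z, p' \notin F & O p' z]).
    apply: (IH (p' |: F)%SET).
    - have : (#|~: (p' |: F)%SET| < #|~: F|)%N.
        apply: proper_card; apply/properP; split.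
          by apply/fintype.subsetP => a; rewrite !finset.inE negb_or => /andP[].
        by exists p'; rewrite !finset.inE ?eqxx.
      by move=> lt; rewrite -ltnS; exact: leq_trans lt cF.
    - by exists x => //; have [a [aF Oa]] := Ux; exists a; rewrite !finset.inE aF orbT.
    have [e e0 [Q [mQ cQ hQ]]] := link_cube oO oz.
    have c1 : controlled (Q `|` U F).
      by apply: (glue Q (U F) p z e) => // y Opy; exists p.
    have mQU : mset (Q `|` U F) by exact: msetU.
    have c2 : controlled ((Q `|` U F) `|` O p').
      apply: (glue _ _ p' z e) => // y /hQ[Qy oy]; split=> //; by left.
    apply: controlledS c2 => //; first exact: msetU.
    move=> y [a []]; rewrite !finset.inE => /orP[/eqP ->|aF] Oa; first by right.
    by left; right; exists a.
  suff e : Omega `&` U F = Omega by apply: controlledS cU => //; [exact: mset_open|rewrite -e; exact: subIsetr].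
  apply: con; first by exists x.
    exists (~` U (~: F)); first exact: openU.
    apply/seteqP; split=> y [oy].
      move=> [p [pF Opy]]; split=> // -[p' [p'F Op'y]]; apply: no; exists y, p, p'; split=> //.
      by move: p'F; rewrite finset.inE.
    move=> nU; split=> //; have [p Opy] := cov y oy; exists p; split=> //.
    by apply: contraT => pF; case: nU; exists p; rewrite finset.inE.
  by exists (U F) => //; rewrite -[U F]setCK; apply: open_closedC; exact: openU.
have [p Opx] := cov x0 ox0.
apply: (main _ [set p]%SET (leqnn _)).
  by exists x0 => //; exists p; rewrite finset.inE.
apply: controlledS (cO p) => // y [a []]; by rewrite finset.inE => /eqP ->.
Qed.

(** This mesh only supplies the pieces; the constant then holds for every tested mesh of [Omega]
    with the same [rho]. *)
Lemma omega_controlled (N : nat) (K : mesh R N) : tetrahedrization Omega K ->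
  connected Omega -> Omega !=set0 -> controlled Omega.
Proof.
move=> tet con ne.
pose O (p : 'I_N * 'I_4 * {ffun 'I_3 -> 'I_24}) : set E3 :=
  if admissible p.2 then octant (cornerB (K p.1.1) p.1.2) (corner_o (K p.1.1) p.1.2 p.2) else set0.
apply: (@connected_control _ O) => //.
- by move=> p; rewrite /O; case: ifP => _; [exact: mset_octant|rewrite /mset preimage_set0].
- move=> p; rewrite /O; case: ifP => ad; last exact: controlled0.
  apply: box_controlled => [|x hx]; first exact: corner_unit.
  by apply: (int_cell_omega tet (i := p.1.1)); exact: corner_in ad hx.
- move=> p x; rewrite /O; case: ifP => _; first exact: octant_far.
  by move=> _; exists 1 => // y _ [].
- move=> p z e; rewrite /O; case: ifP => _ // oz e0; apply: octant_near => //; exact: corner_unit.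
- move=> x ox; have [i ci] := omega_cell tet ox.
  have [k bk] : exists k, 4^-1 <= bary (K i) k x.
    apply: contrapT => no; have lt k : bary (K i) k x < 4^-1.
      by rewrite ltNge; apply/negP => ge; apply: no; exists k.
    by have := bary_sum (K i) x; rewrite sum_ord4; have := lt 0; have := lt 1; have := lt 2; have := lt 3; lra.
  have [a ad oa] := corner_cover ci bk.
  by exists (i, k, a); rewrite /O /= ad.
- exact: omega_open tet.
Qed.

End Cover.

(** * The inf-sup inequality *)

Section Final.
Context (R : realType) (Omega : set 'rV[R]_3) (N : nat) (K : mesh R N) (rho h : R).
Local Notation E3 := 'rV[R]_3.
Hypothesis rm : regular_mesh Omega rho h K.
Hypothesis ne : Omega !=set0.
Context (q : E3 -> R).
Hypothesis Hq : Qh Omega K q.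
Context (S : R).
Hypothesis HS : forall v, Wh_nz Omega K v -> bh K v q / norm_ah K v <= S.

Lemma Qh_tested : exists c g, tested Omega rho h K q c g (S * Num.sqrt (Ca rho)) /\
  (forall i x, (cell (K i))° x -> q x = c i + dot (g i) x).
Proof.
have [cq _ _ aff] := Hq.
have /choice[c cP] i : exists c, exists g, forall x, (cell (K i))° x -> q x = c + dot g x := aff i.
have /choice[g gP] := cP; exists c, g; split=> //.
have S0 : 0 <= S := S_ge0 rm gP ne HS.
split=> //.
(* Continuity of [q] in [Omega] extends the affine formula from the open cell to the part of its
   faces in [Omega]. *)
- move=> i x ox cx; apply/eqP; rewrite -subr_eq0 -normr_le0; apply/ler_addgt0Pl => e e0; rewrite addr0.
  have e2 : 0 < e / 2 by rewrite divr_gt0.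
  have /continuousP3/(_ _ e2)[d1 d10 h1] := cq x ox.
  have w1 : 0 < 6 * `|g i| + 1 by rewrite ltr_wpDl // mulr_ge0.
  have d20 : 0 < e / (6 * `|g i| + 1) by rewrite divr_gt0.
  have d0 : 0 < Num.min d1 (e / (6 * `|g i| + 1)) by rewrite lt_min d10.
  have [y] := cell_approx cx d0; rewrite lt_min => /andP[y1 y2] /interior_cell iy.
  have qy := gP i y iy; have := h1 y y1; rewrite qy => h2.
  have -> : q x - (c i + dot (g i) x) = (q x - (c i + dot (g i) y)) - dot (g i) (x - y).
    by rewrite dotBr; ring.
  apply: le_trans (ler_normB _ _) _; have := dot_le (g i) (x - y).
  have : `|x - y| * (6 * `|g i| + 1) <= e by rewrite -ler_pdivlMr // ltW.
  have := mulr_ge0 (normr_ge0 (g i)) (normr_ge0 (x - y)); have := normr_ge0 (x - y).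
  by move: `|g i| `|x - y| => a b *; lra.
- by rewrite mulr_ge0 // sqrtr_ge0.
- move=> nu d vn sp; have := test_bound rm gP ne HS vn sp.
  rewrite (bhE rm gP) sqrtrM ?mulrA //; exact: ltW (Ca_gt0 rm).
Qed.

End Final.

Theorem lemma3p4 (R : realType) (Omega : set 'rV[R]_3) (h0 sigma kappa : R)
    (dOmega : domain Omega) (h0_gt0 : 0 < h0) :
  exists C : R, 0 < C /\
    forall (h : R) (N : nat) (K : mesh R N),
      0 < h <= h0 ->
      tetrahedrization Omega K ->
      conforming K ->
      shape_regular sigma K ->
      mesh_parameter kappa h K ->
      (forall i, (3 <= internal_edges Omega (K i))%N) ->
      forall q : 'rV[R]_3 -> R, Qh Omega K q ->
        ((normL2 Omega q + h * normL2_grad K q)%:E <=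
         C%:E * ereal_sup [set (bh K v q / norm_ah K v)%:E
                          | v in [set v | Wh_nz Omega K v]])%E.
Proof.
have [_ con ne] := dOmega.
(* The covering mesh is fixed before the constant; without any mesh of [Omega] the claim is
   empty. *)
have [[N0 [K0 tet0]]|no] := pselect (exists N (K : mesh R N), tetrahedrization Omega K); last first.
  by exists 1; split=> // h N K _ tet; case: no; exists N, K.
pose rho := (8 * (kappa * sigma))^-1.
have [C1 C10 ctl] := omega_controlled rho tet0 con ne.
pose C := (Num.sqrt C1 + Num.sqrt (24 * Cg rho)) * Num.sqrt (Ca rho) + 1.
have C0 : 0 < C by rewrite ltr_wpDl // mulr_ge0 ?sqrtr_ge0 // addr_ge0 ?sqrtr_ge0.
exists C; split=> // h N K /andP[hh _] tet conf sr mp edges q Hq.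
have [x0 ox0] := ne; have [i0 _] := omega_cell tet ox0.
have ms i := mesh_size hh sr mp i.
have ks : 0 < kappa * sigma by case: (ms i0).
have rm : regular_mesh Omega rho h K.
  split=> //; first by rewrite invr_gt0 mulr_gt0.
    by move=> i; case: (ms i).
  by move=> i; have [_ _ [c hc]] := ms i; exists c => x; rewrite mulrC; exact: hc.
set A := [set _ | _ in _].
have [nu [vn sp [i [e [e' [ee ee' ne']]]]]] := bump_ex rm ne.
have Anu : A (bh K (nodv K nu) q / norm_ah K (nodv K nu))%:E.
  by exists (nodv K nu) => //; exact: (Wh_nz_nodv rm vn ee ee' ne').
(* An infinite supremum makes the bound trivial, and minus infinity is excluded by the bump. *)
case E : (ereal_sup A) => [S| |]; last 2 first.
- by rewrite gt0_muley ?lte_fin // leey.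
- by have := ereal_sup_ubound Anu; rewrite E leeNy_eq.
have HS v : Wh_nz Omega K v -> bh K v q / norm_ah K v <= S.
  by move=> nv; rewrite -lee_fin -E; apply: ereal_sup_ubound; exists v.
have [c [g [ts gP]]] := Qh_tested rm ne Hq HS.
rewrite -EFinM lee_fin.
have S0 : 0 <= S := S_ge0 rm gP ne HS.
set S' := S * Num.sqrt (Ca rho) in ts; have S0' : 0 <= S' := ts_S ts.
have Cg0 : 0 <= Cg rho by apply: mulr_ge0; [apply: mulr_ge0|]; exact: sqr_ge0.
have g1 : h * normL2_grad K q <= Num.sqrt (24 * Cg rho) * S'.
  have -> : h * normL2_grad K q = Num.sqrt (h ^+ 2 * \sum_i int3 (cell (K i))° (fun x => dot (grad q x) (grad q x))).
    by rewrite sqrtrM ?sqr_ge0 // sqrtr_sqr gtr0_norm.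
  apply: le_sqrt_mul => //; first exact: mulr_ge0.
  apply: le_trans (_ : h ^+ 2 * \sum_i (24 * h ^+ 3 * `|g i| ^+ 2) <= _); last first.
    rewrite -mulr_sumr.
    have -> : h ^+ 2 * (24 * h ^+ 3 * \sum_i `|g i| ^+ 2) = 24 * (h ^+ 5 * \sum_i `|g i| ^+ 2).
      by move: (\sum_i _) => z; ring.
    by rewrite -mulrA ler_pM2l //; exact: grad_bound ts.
  rewrite ler_pM2l ?exprn_gt0 //; apply: ler_sum => i1 _.
  rewrite (@eq_int3 _ _ _ (fun=> dot (g i1) (g i1))); last by move=> x ix; rewrite (grad_q gP ix).
  rewrite int3_cst; last exact: mset_icell.
  have d3 : dot (g i1) (g i1) <= 3 * `|g i1| ^+ 2.
    by apply: le_trans (ler_norm _) _; apply: le_trans (dot_le _ _) _; rewrite -mulrA -expr2.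
  have -> : 24 * h ^+ 3 * `|g i1| ^+ 2 = 3 * `|g i1| ^+ 2 * (8 * h ^+ 3) by ring.
  by apply: ler_pM => //; [exact: dot_ge0|exact: vol_ge0|exact: (vol_icell_le rm)].
(* The mean of [q] vanishes, so replacing [q] by [q - c0] can only increase the integral of the
   square. *)
have g2 : normL2 Omega q <= Num.sqrt C1 * S'.
  apply: le_sqrt_mul => //; have [c0] := ctl _ _ _ _ _ _ _ ts; rewrite setIid => hc0.
  apply: le_trans hc0; have [_ _ q0 _] := Hq.
  have mO := mset_omega tet; have fO := finv_omega tet; have nq := nice_qin ts.
  have q0' : int3 Omega (qext Omega q) = 0 by rewrite -q0; apply: eq_int3 => x ox; rewrite qinE.
  rewrite (@eq_int3 _ _ (fun x => q x ^+ 2) (fun x => qext Omega q x ^+ 2)); last by move=> x ox; rewrite qinE.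
  rewrite (@eq_int3 _ _ (fun x => (q x - c0) ^+ 2)
    (fun x => qext Omega q x ^+ 2 + ((- 2 * c0) * qext Omega q x + c0 ^+ 2))); last first.
    by move=> x ox; rewrite qinE //; ring.
  have n1 := niceZ (-2 * c0) nq; have n2 := nice_cst (c0 ^+ 2) mO fO.
  rewrite int3D; [|exact: nice_sq|exact: niceD].
  rewrite int3D // int3Z // q0' mulr0 add0r int3_cst // lerDl.
  by rewrite mulr_ge0 ?sqr_ge0 // vol_ge0.
apply: le_trans (lerD g2 g1) _; rewrite -mulrDl /S' /C.
have -> : (Num.sqrt C1 + Num.sqrt (24 * Cg rho)) * (S * Num.sqrt (Ca rho)) =
  (Num.sqrt C1 + Num.sqrt (24 * Cg rho)) * Num.sqrt (Ca rho) * S by rewrite mulrA mulrAC.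
by rewrite ler_wpM2r // lerDl.
Qed.
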